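(* Let $\varphi: \Gamma_1 \to \Gamma_2$ be a group morphism between virtually polycyclic groups $\Gamma_1, \Gamma_2$, and let $\rho_i: \Gamma_i \to \mathrm{Aff}(N_i)$, $i\in\{1,2\}$, be NIL-affine crystallographic actions, where $N_1,N_2$ are connected and simply connected nilpotent Lie groups. Then there exists a polynomial map $p: N_1 \to N_2$ such that $$\rho_2(\varphi(\gamma)) \circ p = p \circ \rho_1(\gamma)$$ for all $\gamma \in \Gamma_1$.
   Context: A group $\Gamma$ is virtually polycyclic if it has a subnormal series $1=\Gamma_0 \triangleleft \Gamma_1 \triangleleft \dots \triangleleft \Gamma_k=\Gamma$ in which every quotient $\Gamma_{i+1}/\Gamma_i$ is finite or infinite cyclic. For a connected and simply connected nilpotent Lie group $N$, $\mathrm{Aff}(N) = N \rtimes \mathrm{Aut}(N)$ acts on $N$ by $(x,\delta)\cdot n = x\,\delta(n)$. A NIL-affine action of $\Gamma$ is a group morphism $\rho:\Gamma \to \mathrm{Aff}(N)$. An action of a (discrete) group is crystallographic if it is properly discontinuous and cocompact. A map $p:N_1\to N_2$ is polynomial if it is expressed by polynomials in the coordinates given by one (hence any) Mal'cev basis of $N_1$ and of $N_2$ (equivalently, in the coordinates on the Lie algebras via the exponential maps). *)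

(* Defs.v *)
From HB Require Import structures.
From mathcomp Require Import all_boot all_order all_algebra generic_quotient.
From mathcomp Require Import all_classical all_reals all_analysis.
From mathcomp Require mpoly.

Set Implicit Arguments.
Unset Strict Implicit.
Unset Printing Implicit Defensive.

Import Order.TTheory GRing.Theory Num.Theory.
Import numFieldNormedType.Exports.

Local Open Scope classical_set_scope.
Local Open Scope ring_scope.
Local Open Scope group_scope.

Section GroupTheory.
Context {G : groupType}.
Implicit Types (H K A : set G) (x t : G).

Definition is_subgroup H :=
  H 1 /\ (forall x y, H x -> H y -> H (x * y)) /\ (forall x, H x -> H x^-1).

Definition is_normal_in H K :=
  [/\ is_subgroup H, is_subgroup K, H `<=` K
    & forall x y, H x -> K y -> H (x ^ y)].

Definition left_coset H x : set G := [set x * h | h in H].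

Definition cosets H K : set (set G) := [set left_coset H x | x in K].

Definition expgz x (z : int) : G :=
  match z with Posz n => x ^+ n | Negz n => x ^- n.+1 end.

Definition finite_quotient H K := finite_set (cosets H K).

(* [K / H] is infinite cyclic: [z |-> t^z H] is a bijection from the integers
   onto it, for some [t] in [K]. *)
Definition infinite_cyclic_quotient H K :=
  exists2 t, K t &
    set_bij [set: int] (cosets H K) (fun z => left_coset H (expgz t z)).

Definition subgroup_generated A : set G := smallest is_subgroup A.

Fixpoint lower_central_series (k : nat) : set G :=
  match k with
  | 0%N => [set: G]
  | k'.+1 => subgroup_generated
      [set [~ u.1, u.2] | u in lower_central_series k' `*` [set: G]]
  end.

End GroupTheory.

Definition virtually_polycyclic (G : groupType) :=
  exists (k : nat) (S : nat -> set G),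
    [/\ S 0%N = [set 1], S k = [set: G] &
        forall i, (i < k)%N ->
          is_normal_in (S i) (S i.+1) /\
          (finite_quotient (S i) (S i.+1) \/
           infinite_cyclic_quotient (S i) (S i.+1))].

Definition nilpotent_group (G : groupType) :=
  exists k : nat, lower_central_series k = [set (1 : G)].

(* Only the triviality of the fundamental groups: (path-)connectedness is
   a separate condition. *)
Definition simply_connected (R : realType) (T : topologicalType) :=
  let I := `[0%R, 1%R]%classic : set R in
  forall f : R -> T, {within I, continuous f} -> f 0%R = f 1%R ->
  exists H : R * R -> T,
    [/\ {within I `*` I, continuous H},
        forall t, I t -> H (0%R, t) = f t,
        forall t, I t -> H (1%R, t) = f 0%R,
        forall s, I s -> H (s, 0%R) = f 0%R
      & forall s, I s -> H (s, 1%R) = f 0%R].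

Section SmoothManifold.
Context {R : realType}.

(* [C^k] on an open subset [U] of R^n: all iterated partial derivatives up to
   order [k] exist and are continuous on [U]. *)
Fixpoint Ck (k n m : nat) (U : set 'rV[R]_n) (f : 'rV[R]_n -> 'rV[R]_m) : Prop :=
  {within U, continuous f} /\
  match k with
  | 0%N => True
  | k'.+1 => forall i : 'I_n,
      (forall x, U x -> derivable f x (delta_mx 0 i)) /\
      Ck k' U ('D_(delta_mx 0 i) f)
  end.

Definition smooth_on n m (U : set 'rV[R]_n) (f : 'rV[R]_n -> 'rV[R]_m) :=
  forall k, Ck k U f.

(* [chart_map] and [chart_inv] are only meaningful on [chart_dom] and on its
   image respectively. *)
Record chart (T : topologicalType) (n : nat) := Chart {
  chart_dom : set T;
  chart_map : T -> 'rV[R]_n;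
  chart_inv : 'rV[R]_n -> T }.

Definition is_chart (T : topologicalType) n (c : chart T n) :=
  [/\ open (chart_dom c),
      open (chart_map c @` chart_dom c),
      {within chart_dom c, continuous (chart_map c)},
      {within chart_map c @` chart_dom c, continuous (chart_inv c)}
    & forall x, chart_dom c x -> chart_inv c (chart_map c x) = x].

Definition smooth_atlas (T : topologicalType) n (A : set (chart T n)) :=
  [/\ forall c, A c -> is_chart c,
      forall x, exists2 c, A c & chart_dom c x
    & forall c d, A c -> A d ->
        smooth_on (chart_map c @` (chart_dom c `&` chart_dom d))
                  (chart_map d \o chart_inv c)].

Definition smooth_map (T T' : topologicalType) n n'
    (A : set (chart T n)) (A' : set (chart T' n')) (f : T -> T') :=
  continuous f /\
  forall c d, A c -> A' d ->
    smooth_on (chart_map c @` (chart_dom c `&` f @^-1` chart_dom d))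
              (chart_map d \o f \o chart_inv c).

Definition prod_chart (T T' : topologicalType) n n'
    (c : chart T n) (d : chart T' n') : chart (T * T')%type (n + n')%N :=
  Chart (chart_dom c `*` chart_dom d)
        (fun p => row_mx (chart_map c p.1) (chart_map d p.2))
        (fun v => (chart_inv c (lsubmx v), chart_inv d (rsubmx v))).

Definition prod_atlas (T T' : topologicalType) n n'
    (A : set (chart T n)) (A' : set (chart T' n')) :
    set (chart (T * T')%type (n + n')%N) :=
  [set prod_chart u.1 u.2 | u in A `*` A'].

End SmoothManifold.
Arguments chart : clear implicits.

HB.mixin Record isLieGroup (R : realType) G of Group G & Topological G := {
  lie_dim : nat;
  lie_atlas : set (chart R G lie_dim);
  lie_hausdorff : hausdorff_space G;
  lie_second_countable : @second_countable G;
  lie_smooth_atlas : smooth_atlas lie_atlas;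
  lie_mul_smooth :
    smooth_map (prod_atlas lie_atlas lie_atlas) lie_atlas
      (fun u : G * G => u.1 * u.2);
  lie_inv_smooth : smooth_map lie_atlas lie_atlas (fun x : G => x^-1)
}.

#[short(type="lieGroupType")]
HB.structure Definition LieGroup (R : realType) :=
  {G of Group G & Topological G & isLieGroup R G}.

Section NilAffine.
Context {R : realType} (N : lieGroupType R).

Definition lie_automorphism (d : N -> N) :=
  {morph d : x y / x * y} /\
  exists d' : N -> N,
    [/\ cancel d d', cancel d' d,
        smooth_map (@lie_atlas R N) (@lie_atlas R N) d
      & smooth_map (@lie_atlas R N) (@lie_atlas R N) d'].

(* Aff(N): the pairs [(x, d)] with [d] in Aut(N), under the law of the
   semidirect product. *)
Definition Aff : set (N * (N -> N)) := [set a | lie_automorphism a.2].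

Definition aff_mul (a b : N * (N -> N)) : N * (N -> N) :=
  (a.1 * a.2 b.1, a.2 \o b.2).

Definition aff_act (a : N * (N -> N)) (n : N) : N := a.1 * a.2 n.

Definition nil_affine_action (G : groupType) (rho : G -> N * (N -> N)) :=
  (forall g, Aff (rho g)) /\
  (forall g h, rho (g * h) = aff_mul (rho g) (rho h)).

(* One-parameter subgroups [t |-> exp (t X)] stand for the elements [X] of the
   Lie algebra. *)
Definition one_parameter_subgroup (X : R -> N) :=
  continuous X /\ forall s t, X (s + t)%R = X s * X t.

Definition malcev_coord n (X : 'I_n -> R -> N) (t : 'rV[R]_n) : N :=
  \prod_(i < n) X i (t 0 i).

(* [X_0, ..., X_(n-1)] is a Mal'cev basis: each element of [N] is uniquely
   [exp (t_0 X_0) * ... * exp (t_(n-1) X_(n-1))], and for each [k] the products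
   of the factors of index at least [k] form a normal subgroup, i.e. the span
   of [X_k, ..., X_(n-1)] is an ideal of the Lie algebra. *)
Definition malcev_basis n (X : 'I_n -> R -> N) :=
  [/\ forall i, one_parameter_subgroup (X i),
      forall g, exists! t, malcev_coord X t = g
    & forall k : nat,
        is_normal_in
          [set malcev_coord X t | t in
             [set t : 'rV[R]_n | forall i : 'I_n, (i < k)%N -> t 0 i = 0%R]]
          [set: N]].

End NilAffine.

Section Crystallographic.
Context {G : groupType} {T : topologicalType} (act : G -> T -> T).

Definition act_orbit (x : T) : set T := [set act g x | g in [set: G]].

Definition same_orbit (x y : T) : bool := `[< act_orbit x = act_orbit y >].

Lemma same_orbit_refl : reflexive same_orbit.
Proof. by move=> x; apply/asboolP. Qed.

Lemma same_orbit_sym : symmetric same_orbit.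
Proof. by move=> x y; apply/asboolP/asboolP. Qed.

Lemma same_orbit_trans : transitive same_orbit.
Proof. by move=> y x z /asboolP xy /asboolP yz; apply/asboolP; rewrite xy. Qed.

Canonical same_orbit_equiv :=
  EquivRel same_orbit same_orbit_refl same_orbit_sym same_orbit_trans.

Definition orbit_space := quotient_topology {eq_quot same_orbit_equiv}%qT.

Definition cocompact := compact [set: orbit_space].

Definition properly_discontinuous :=
  forall K : set T, compact K -> finite_set [set g | act g @` K `&` K !=set0].

Definition crystallographic := properly_discontinuous /\ cocompact.

End Crystallographic.

(* [p] is given by polynomials in Mal'cev coordinates of [N1] and [N2]. *)
Definition polynomial_map (R : realType) (N1 N2 : lieGroupType R)
    (p : N1 -> N2) :=
  exists n1 n2 (X1 : 'I_n1 -> R -> N1) (X2 : 'I_n2 -> R -> N2)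
         (P : 'I_n2 -> mpoly.mpoly n1 R),
    [/\ malcev_basis X1, malcev_basis X2 &
        forall t : 'rV[R]_n1,
          p (malcev_coord X1 t) =
          malcev_coord X2 (\row_j mpoly.meval (fun i => t 0 i) (P j))].

(* Main.v *)
(** The actions are transported to sequences of reals, where they become
polynomial and triangular.

A nilpotent, connected and simply connected Lie group [N] has a descending
series of normal subgroups [T 0 = N, ..., T n = 1] with quotients R, which are
split by one-parameter subgroups and refine a series of characteristic
subgroups.  The exponential map comes from the iterated squares in a chart,
[exp v = lim (v / 2^k)^(2^k)].  A non-trivial member [S] of a characteristic
series has a non-zero continuous homomorphism to R: if the adjoint action of
[S] is non-trivial it is a matrix coefficient of this unipotent action, and
otherwise [S] is abelian, and [exp] is injective on its Lie algebra because [N]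
is simply connected.  In the resulting coordinates translations have bounded
polynomial degree, and a continuous function of bounded degree is a polynomial
(Frechet), so affine maps are polynomial and triangular.

On the algebraic side, a virtually polycyclic group has a poly-Z subgroup [H] of
finite index, which acts on some R^h polynomially, the generators of the series
acting as unit translations in the successive coordinates.  On this model the
first cohomology of [H] with coefficients in polynomial functions with values in
any finite-dimensional representation vanishes, as a difference equation in one
variable has polynomial solutions.  Obstructions to equivariant maps to a
triangular action are such cocycles, so there is a polynomial equivariant map
[p1] from the model to [N1], and likewise, with partitions of unity, there are
Lipschitz equivariant maps from [N1] to the model and homotopies from the
composites to the identities.  By the theorem of Poincare-Miranda the composites
have dense image.  Hence [h <= n1] and the coordinates of [p1] are
algebraically independent, so the coordinates of the model are algebraic over
the functions [f o p1], [f] polynomial; as every non-zero stable space of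
polynomials contains the constants, relations of minimal degree show that they
are of that form.  So [p1] has a polynomial left inverse, the cohomology of
[H] on [N1] vanishes too, also for the whole group by averaging, and the map
to [N2] exists by the same obstruction theory. *)

Require Import Defs.
From HB Require Import structures.
From mathcomp Require Import all_boot all_order all_algebra ring lra zify qpoly generic_quotient.
From mathcomp Require Import all_classical all_reals all_analysis.
From mathcomp Require mpoly.

Set Implicit Arguments.
Unset Strict Implicit.
Unset Printing Implicit Defensive.
Import Order.TTheory GRing.Theory Num.Theory.
Import numFieldNormedType.Exports.
Local Open Scope classical_set_scope.
Local Open Scope ring_scope.

(** * Polynomial functions on sequences *)

(** One obstruction theory, [equivariant_map], is run over two algebras of functions. Locally
    Lipschitz cocycles are trivialised by weighted averages over the group. Polynomials admit no
    such averages, so on [N1] their cohomology has to be computed elsewhere: on the model it reduces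
    to difference equations, and the Lipschitz maps are only used to compare dimensions and to show
    that a polynomial vanishing on the image of [p1] is zero. Automorphisms act on the abelian
    quotients of the characteristic series by arbitrary linear maps and need not preserve a full
    flag. Triangularity is therefore by blocks, and the linear part of an action is a representation
    that need not be unipotent; this is why cohomology is taken with coefficients in all
    finite-dimensional representations. Points are sequences [nat -> R] of which the first [n] terms
    matter. Spaces of all dimensions thus live in one type, and a further coordinate is at hand as
    the time of a homotopy. *)

Section PolynomialFunctions.
Context {R : realType}.
Local Notation S := (nat -> R).
Implicit Types (P Q : pred nat) (f g : S -> R) (x y : S).

(** [P] is the set of variables that may occur. A predicate on functions suffices since over an
    infinite field a polynomial is determined by its values. *)
Inductive polyfun P : (S -> R) -> Prop :=
| polyfun_cst c : polyfun P (fun=> c)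
| polyfun_var i : P i -> polyfun P (fun x => x i)
| polyfun_add f g : polyfun P f -> polyfun P g -> polyfun P (fun x => f x + g x)
| polyfun_mul f g : polyfun P f -> polyfun P g -> polyfun P (fun x => f x * g x).

Lemma polyfun_ext P f g : f =1 g -> polyfun P f -> polyfun P g.
Proof. by move=> /funext ->. Qed.

Lemma polyfunW P Q f : (forall i, P i -> Q i) -> polyfun P f -> polyfun Q f.
Proof.
move=> PQ; elim=> *; [exact: polyfun_cst|exact/polyfun_var/PQ|
  exact: polyfun_add|exact: polyfun_mul].
Qed.

Lemma polyfun_scale P c f : polyfun P f -> polyfun P (fun x => c * f x).
Proof. by move=> pf; apply: polyfun_mul => //; apply: polyfun_cst. Qed.

Lemma polyfun_opp P f : polyfun P f -> polyfun P (fun x => - f x).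
Proof.
by move=> /(polyfun_scale (-1)); apply: polyfun_ext => x; rewrite mulN1r.
Qed.

Lemma polyfun_sub P f g : polyfun P f -> polyfun P g ->
  polyfun P (fun x => f x - g x).
Proof. by move=> pf pg; apply: polyfun_add => //; apply: polyfun_opp. Qed.

Lemma polyfun_sum P (I : Type) (r : seq I) (C : pred I) (F : I -> S -> R) :
  (forall i, C i -> polyfun P (F i)) ->
  polyfun P (fun x => \sum_(i <- r | C i) F i x).
Proof.
move=> pF; elim: r => [|i r IH].
  by apply: (polyfun_ext _ (polyfun_cst _ 0)) => x; rewrite big_nil.
case: (boolP (C i)) => Ci.
  apply: (polyfun_ext _ (polyfun_add (pF _ Ci) IH)) => x.
  by rewrite big_cons Ci.
by apply: (polyfun_ext _ IH) => x; rewrite big_cons (negbTE Ci).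
Qed.

Lemma polyfun_exp P f k : polyfun P f -> polyfun P (fun x => f x ^+ k).
Proof.
move=> pf; elim: k => [|k IH].
  by apply: (polyfun_ext _ (polyfun_cst _ 1)) => x; rewrite expr0.
by apply: (polyfun_ext _ (polyfun_mul pf IH)) => x; rewrite exprS.
Qed.

Lemma polyfun_prod P (I : Type) (r : seq I) (F : I -> S -> R) :
  (forall i, polyfun P (F i)) ->
  polyfun P (fun x => \prod_(i <- r) F i x).
Proof.
move=> pF; elim: r => [|i r IH].
  by apply: (polyfun_ext _ (polyfun_cst _ 1)) => x; rewrite big_nil.
apply: (polyfun_ext _ (polyfun_mul (pF i) IH)) => x.
by rewrite big_cons.
Qed.

Lemma polyfun_comp P Q f (F : S -> S) : polyfun P f ->
  (forall i, P i -> polyfun Q (fun x => F x i)) -> polyfun Q (fun x => f (F x)).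
Proof.
move=> pf pF; elim: pf => [c|i Pi|g h _ pg _ ph|g h _ pg _ ph].
- exact: polyfun_cst.
- exact: pF.
- exact: polyfun_add.
- exact: polyfun_mul.
Qed.

Lemma polyfun_dep P f x y : polyfun P f ->
  (forall i, P i -> x i = y i) -> f x = f y.
Proof.
move=> pf xy; elim: pf => [//|i Pi|g h _ pg _ ph|g h _ pg _ ph].
- exact: xy.
- by rewrite pg ph.
- by rewrite pg ph.
Qed.

Definition upd x i s : S := fun j => if j == i then s else x j.

Lemma upd_same x i s : upd x i s i = s.
Proof. by rewrite /upd eqxx. Qed.

Lemma upd_other x i s j : j != i -> upd x i s j = x j.
Proof. by rewrite /upd => /negbTE ->. Qed.

Lemma upd_id x i : upd x i (x i) = x.
Proof. by apply/funext => j; rewrite /upd; case: eqP => // ->. Qed.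

(** Setting the variables outside [Q] to zero changes no value of [f], and it removes them from any
    expression. *)
Lemma polyfun_restrict P Q f : polyfun P f ->
  (forall x y, (forall i, Q i -> x i = y i) -> f x = f y) ->
  polyfun (fun i => P i && Q i) f.
Proof.
move=> pf dep.
pose z x : S := fun i => if Q i then x i else 0.
apply: (@polyfun_ext _ (fun x => f (z x))).
  by move=> x; apply: dep => i; rewrite /z => ->.
apply: polyfun_comp pf _ => i Pi; rewrite /z.
case: (boolP (Q i)) => Qi; last exact: polyfun_cst.
by apply: polyfun_var; rewrite Pi.
Qed.

Lemma polyfun_expand P i f : polyfun P f -> exists d (c : nat -> S -> R),
  (forall k, polyfun (fun j => P j && (j != i)) (c k)) /\
  (forall x, f x = \sum_(k < d) x i ^+ k * c k x).
Proof.
elim=> [a|j Pj|g h _ [d [c [pc gE]]] _ [e [b [pb hE]]]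
        |g h _ [d [c [pc gE]]] _ [e [b [pb hE]]]].
- exists 1%N, (fun=> fun=> a); split=> [k|x]; first exact: polyfun_cst.
  by rewrite big_ord1 expr0 mul1r.
- case: (eqVneq j i) => [->|ji].
    exists 2%N, (fun k => fun=> (k == 1%N)%:R); split=> [k|x].
      exact: polyfun_cst.
    by rewrite big_ord_recr big_ord1 /= mulr0 add0r expr1 mulr1.
  exists 1%N, (fun=> fun x => x j); split=> [k|x].
    by apply: polyfun_var; rewrite Pj.
  by rewrite big_ord1 expr0 mul1r.
- exists (maxn d e), (fun k x => (if (k < d)%N then c k x else 0) +
                               (if (k < e)%N then b k x else 0)).
  split=> [k|x].
    by apply: polyfun_add; [case: (ltnP k d)|case: (ltnP k e)] => _ //;
       exact: polyfun_cst.
  rewrite gE hE.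
  have ext d' (F : nat -> R) : (d' <= maxn d e)%N ->
      \sum_(k < d') F k = \sum_(k < maxn d e) (if (k < d')%N then F k else 0).
    by move=> le; rewrite (big_ord_widen _ F le) big_mkcond.
  rewrite (ext d (fun k => x i ^+ k * c k x) (leq_maxl _ _)).
  rewrite (ext e (fun k => x i ^+ k * b k x) (leq_maxr _ _)).
  rewrite -big_split; apply: eq_bigr => k _ /=.
  by rewrite mulrDr; congr (_ + _); case: ifP => //; rewrite mulr0.
- exists (d + e)%N, (fun k x => \sum_(a < d) \sum_(l < e | (a + l)%N == k)
      c a x * b l x).
  split=> [k|x].
    by apply: polyfun_sum => a _; apply: polyfun_sum => l _; apply: polyfun_mul.
  rewrite gE hE big_distrlr /=.
  under [RHS]eq_bigr => k _ do rewrite big_distrr /=.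
  rewrite [RHS]exchange_big /=; apply: eq_bigr => a _.
  under [RHS]eq_bigr => k _ do rewrite big_distrr /= big_mkcond /=.
  rewrite [RHS]exchange_big /=; apply: eq_bigr => l _.
  have ale : (a + l < d + e)%N.
    by rewrite -addnS leq_add// ltnW.
  rewrite -big_mkcond (big_pred1 (Ordinal ale)) /=; last first.
    by move=> k; rewrite eq_sym.
  by rewrite exprD; ring.
Qed.

Lemma poly_nat_zero (d : nat) (c : nat -> R) (a : R) :
  (forall n : nat, \sum_(k < d) (a + n%:R) ^+ k * c k = 0) ->
  forall k, (k < d)%N -> c k = 0.
Proof.
move=> vanish; pose p := \poly_(k < d) c k.
have p0 : p = 0.
  apply: (@roots_geq_poly_eq0 _ _ [seq a + n%:R | n <- iota 0 d]).
  - apply/allP => _ /mapP [n _ ->]; apply/rootP.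
    rewrite horner_poly -[RHS](vanish n); apply: eq_bigr => k _.
    by rewrite mulrC.
  - rewrite map_inj_uniq ?iota_uniq// => m n /addrI /eqP.
    by rewrite eqr_nat => /eqP.
  - by rewrite size_map size_iota size_poly.
by move=> k kd; have := coef_poly d c k; rewrite kd -/p p0 coef0.
Qed.

(** In the variable [i] the polynomial takes one value at infinitely many points, so it is constant
    in that variable. *)
Lemma polyfun_periodic P i f a : polyfun P f -> a != 0 ->
  (forall x, f (upd x i (x i + a)) = f x) ->
  polyfun (fun j => P j && (j != i)) f.
Proof.
move=> pf a0 per; have [d [c [pc fE]]] := polyfun_expand i pf.
have cst x s : f (upd x i s) = f (upd x i 0).
  have pern (n : nat) s' : f (upd x i (s' + n%:R * a)) = f (upd x i s').
    elim: n => [|n IH]; first by rewrite mul0r addr0.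
    rewrite -IH -[in RHS]per upd_same; congr (f _).
    apply/funext => j; rewrite /upd; case: ifP => // _.
    by rewrite -addn1 natrD mulrDl mul1r addrA.
  pose e k := a ^+ k * c k x.
  have cx k s' : c k (upd x i s') = c k x.
    by apply: polyfun_dep (pc k) _ => j /andP [_ ji]; rewrite upd_other.
  have fx s' : f (upd x i s') = \sum_(k < d) (s' / a) ^+ k * e k.
    rewrite fE; apply: eq_bigr => k _.
    rewrite upd_same cx /e mulrA -exprMn mulfVK//.
  (* Subtracting the common value from the constant coefficient leaves a polynomial with a root at
     every natural number. *)
  pose e' k := if k == 0%N then e 0%N - f (upd x i 0) else e k.
  have [d0|d_gt0] := posnP d.
    by rewrite !fE d0 !big_ord0.
  have e'0 : forall k, (k < d)%N -> e' k = 0.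
    apply: (@poly_nat_zero d e' 0) => n; rewrite add0r.
    have := pern n 0; rewrite add0r fx mulfK//.
    case: (d) d_gt0 => // d' _.
    rewrite !big_ord_recl /= /e' /= expr0 !mul1r => <-.
    by rewrite opprD addNKr addNr.
  have full s' : f (upd x i s') = f (upd x i 0).
    rewrite fx; case: (d) d_gt0 e'0 => // d' _ e'0.
    rewrite big_ord_recl /= expr0 mul1r.
    have := e'0 0%N isT; rewrite /e' /= => /eqP; rewrite subr_eq0 => /eqP ->.
    rewrite big1 ?addr0// => k _.
    by have := e'0 (lift ord0 k) (ltn_ord _); rewrite /e' /= => ->; rewrite mulr0.
  exact: full.
apply: (@polyfun_restrict P (fun j => j != i)) pf _ => x y xy.
rewrite -(upd_id x i) -(upd_id y i) (cst x) (cst y); congr (f _).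
by apply/funext => j; rewrite /upd; case: ifPn => // /xy.
Qed.

Lemma interpolation (d : nat) : (0 < d)%N -> exists L : nat -> {poly R},
  forall p : {poly R}, (size p <= d)%N ->
    forall s, p.[s] = \sum_(n < d) p.[n%:R] * (L n).[s].
Proof.
move=> d0; have inj : injective (fun n : nat => n%:R : R).
  by move=> m n /eqP; rewrite eqr_nat => /eqP.
exists (fun n => if insub n is Some k
  then (lagrange d (fun n : nat => n%:R : R))`_(k : 'I_d) : {poly R} else 0) => p pd s.
rewrite {1}(lagrange_gen d0 inj pd) horner_sum; apply: eq_bigr => n _.
by rewrite hornerM hornerC valK nth_lagrange.
Qed.

(** A degree attached to the function and not to an expression, so that one bound can be stated for
    all elements of an infinite group. *)
Definition deg_lt d i (f : S -> R) := forall x, exists2 p : {poly R},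
  (size p <= d)%N & forall s, f (upd x i s) = p.[s].

Lemma deg_ltW d e i f : (d <= e)%N -> deg_lt d i f -> deg_lt e i f.
Proof. by move=> de df x; have [p pd pE] := df x; exists p => //; apply: leq_trans de. Qed.

Lemma deg_lt_add d i f g : deg_lt d i f -> deg_lt d i g ->
  deg_lt d i (fun x => f x + g x).
Proof.
move=> df dg x; have [p pd pE] := df x; have [q qd qE] := dg x.
exists (p + q) => [|s]; last by rewrite pE qE hornerD.
by rewrite (leq_trans (size_polyD _ _))// geq_max pd.
Qed.

Lemma deg_lt_scale d i c f : deg_lt d i f -> deg_lt d i (fun x => c * f x).
Proof.
move=> df x; have [p pd pE] := df x; exists (c *: p) => [|s]; last by rewrite pE hornerZ.
exact: leq_trans (size_scale_leq _ _) pd.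
Qed.

Lemma deg_lt_sum d i I (r : seq I) (F : I -> S -> R) :
  (forall j, deg_lt d i (F j)) -> deg_lt d i (fun x => \sum_(j <- r) F j x).
Proof.
move=> dF; elim: r => [|j r IH] x.
  by exists 0 => [|s]; rewrite ?size_poly0// big_nil horner0.
have [p pd pE] := deg_lt_add (dF j) IH x; exists p => // s.
by rewrite big_cons pE.
Qed.

Lemma polyfun_deg_lt P i f : polyfun P f -> exists d, deg_lt d i f.
Proof.
move=> /(polyfun_expand i) [d [c [pc E]]]; exists d => x.
exists (\poly_(k < d) c k x) => [|s]; first exact: size_poly.
rewrite E horner_poly; apply: eq_bigr => k _; rewrite upd_same mulrC.
by congr (_ * _); apply: polyfun_dep (pc k) _ => j /andP [_ /upd_other ->].
Qed.

End PolynomialFunctions.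

(** * Cohomology and equivariant maps *)

Section Subgroups.
Context {G : groupType}.
Implicit Types (H : set G).

Lemma subgroup1 H : is_subgroup H -> H 1%g. Proof. by case. Qed.
Lemma subgroupM H x y : is_subgroup H -> H x -> H y -> H (x * y)%g.
Proof. by case=> _ [HM _]; apply: HM. Qed.
Lemma subgroupV H x : is_subgroup H -> H x -> H x^-1%g.
Proof. by case=> _ [_]; apply. Qed.

End Subgroups.

Section Actions.
Context {R : realType} {G : groupType}.
Local Notation S := (nat -> R).

(** The values of [act] outside [Gam] are arbitrary, so that a group and its subgroups share one
    type. *)
Definition acts (Z : Type) (Gam : set G) (act : G -> Z -> Z) :=
  (forall z, act 1%g z = z) /\
  (forall g h, Gam g -> Gam h -> forall z, act (g * h)%g z = act g (act h z)).

Lemma actsK (Z : Type) (Gam : set G) (act : G -> Z -> Z) g z :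
  is_subgroup Gam -> acts Gam act -> Gam g -> act g (act g^-1%g z) = z.
Proof.
move=> sG [a1 aM] Gg; rewrite -aM//; last exact: subgroupV.
by rewrite mulgV a1.
Qed.

Lemma actsKV (Z : Type) (Gam : set G) (act : G -> Z -> Z) g z :
  is_subgroup Gam -> acts Gam act -> Gam g -> act g^-1%g (act g z) = z.
Proof.
move=> sG [a1 aM] Gg; rewrite -aM//; last exact: subgroupV.
by rewrite mulVg a1.
Qed.

Definition funalg (Z : Type) (A : (Z -> R) -> Prop) :=
  [/\ forall c, A (fun=> c),
      forall f g, A f -> A g -> A (fun z => f z + g z)
    & forall f g, A f -> A g -> A (fun z => f z * g z)].

Lemma funalg_polyfun (Z : Type) (A : (Z -> R) -> Prop) P f (F : Z -> S) :
  funalg A -> polyfun P f -> (forall i, P i -> A (fun z => F z i)) ->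
  A (fun z => f (F z)).
Proof.
move=> [Ac Aadd Amul] pf AF; elim: pf => [c|i Pi|g h _ pg _ ph|g h _ pg _ ph].
- exact: Ac.
- exact: AF.
- exact: Aadd.
- exact: Amul.
Qed.

Lemma polyfun_funalg P : funalg (@polyfun R P).
Proof.
split=> *; [exact: polyfun_cst|exact: polyfun_add|exact: polyfun_mul].
Qed.

Definition rep_on (Gam : set G) r (M : G -> 'M[R]_r) :=
  M 1%g = 1%:M /\ (forall g h, Gam g -> Gam h -> M (g * h)%g = M g *m M h).

(** Vector-valued functions form a module under [(g u)(z) = M g *m u (g^-1 z)]; this is the cocycle
    identity for it. *)
Definition cocycle (Z : Type) (Gam : set G) (act : G -> Z -> Z) r
    (M : G -> 'M[R]_r) (c : G -> Z -> 'cV[R]_r) :=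
  forall g h, Gam g -> Gam h -> forall z,
    c (g * h)%g z = c g z + M g *m c h (act g^-1%g z).

(* [H^1(Gam, A (x) V) = 0] for every finite-dimensional representation [V];
   the primitive [u] is required to vanish at the points of [Z0] where the
   whole cocycle does. *)
Definition H1_trivial (Z : Type) (Gam : set G) (act : G -> Z -> Z)
    (A : (Z -> R) -> Prop) (Z0 : set Z) :=
  forall r (M : G -> 'M[R]_r) (c : G -> Z -> 'cV[R]_r),
    rep_on Gam M ->
    (forall g, Gam g -> forall i, A (fun z => c g z i 0)) ->
    cocycle Gam act M c ->
    exists u : Z -> 'cV[R]_r,
      [/\ forall i, A (fun z => u z i 0),
          forall g, Gam g -> forall z, c g z = u z - M g *m u (act g^-1%g z)
        & forall z, Z0 z -> (forall g, Gam g -> c g z = 0) -> u z = 0].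

(* The coordinates [l] of smaller rank [rk l] are the ones of the base. *)
Definition triangular (Gam : set G) n (rk : nat -> nat) (act : G -> S -> S) :=
  forall g, Gam g ->
    (forall x i, (n <= i)%N -> act g x i = x i) /\
    forall i, (i < n)%N -> exists (m : nat -> R) (c : S -> R),
      polyfun (fun l => (l < n)%N && (rk l < rk i)%N) c /\
      forall x, act g x i = \sum_(l < n | rk l == rk i) m l * x l + c x.

Section TriangularAction.
Variables (Gam : set G) (n : nat) (rk : nat -> nat) (act : G -> S -> S).
Hypotheses (sG : is_subgroup Gam) (aG : acts Gam act)
  (tG : triangular Gam n rk act).

Lemma triangular_polyfun g i : Gam g -> (i < n)%N ->
  polyfun (fun l => (l < n)%N && (rk l <= rk i)%N) (fun x => act g x i).
Proof.
move=> /tG [_ +] ni => /(_ _ ni) [m [c [pc E]]].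
apply: (@polyfun_ext _ _ _ _ (fun x => esym (E x))); apply: polyfun_add.
  apply: polyfun_sum => l /eqP rl; apply: polyfun_scale; apply: polyfun_var.
  by rewrite ltn_ord rl /=.
by apply: polyfunW pc => l /andP [-> /ltnW].
Qed.

Lemma triangular_dep g i x y : Gam g -> (i < n)%N ->
  (forall l, (l < n)%N -> (rk l <= rk i)%N -> x l = y l) ->
  act g x i = act g y i.
Proof.
move=> Gg ni xy; apply: (polyfun_dep (triangular_polyfun Gg ni)).
by move=> l /andP [ln le]; apply: xy.
Qed.

Definition unitpt (l : nat) : S := fun j => (j == l)%:R.

(** The coefficients of a triangular map are only known to exist; values at unit points recover them
    as a function of [g]. *)
Definition linear_part (g : G) : 'M[R]_n :=
  \matrix_(i, l) if rk l == rk i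
    then act g (unitpt l) i - act g (fun=> 0) i else 0.

Lemma linear_partE g (i : 'I_n) x y : Gam g ->
  (forall l, (l < n)%N -> (rk l < rk i)%N -> x l = y l) ->
  act g x i - act g y i = \sum_(l < n) linear_part g i l * (x l - y l).
Proof.
move=> Gg xy; have [_ /(_ _ (ltn_ord i)) [m [c [pc E]]]] := tG Gg.
have cxy : c x = c y by apply: polyfun_dep pc _ => l /andP [ln rl]; apply: xy.
rewrite !E cxy opprD addrACA subrr addr0 -sumrB big_mkcond /=.
apply: eq_bigr => l _; rewrite mxE; case: ifP => [/eqP rl|_]; last first.
  by rewrite mul0r.
rewrite -mulrBr; congr (_ * _); rewrite !E.
have -> : c (unitpt l) = c (fun=> 0).
  apply: polyfun_dep pc _ => k /andP [_ rk']; rewrite /unitpt.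
  by case: eqP rk' => // ->; rewrite rl ltnn.
rewrite opprD addrACA subrr addr0 -sumrB (bigD1 l) ?rl//=.
rewrite big1 => [|k /andP [_ kl]]; first by rewrite /unitpt eqxx mulr1 mulr0 subr0 addr0.
by rewrite /unitpt -val_eqE in kl *; rewrite (negbTE kl) mulr0 subr0.
Qed.

(** Coordinates of rank below [rk l] do not distinguish [unitpt l] from the origin, so the images of
    these two points under [h] satisfy the hypothesis of [linear_partE]. *)
Lemma linear_part_rep : rep_on Gam linear_part.
Proof.
split.
  apply/matrixP => i l; rewrite !mxE !(proj1 aG) subr0 /unitpt.
  rewrite -val_eqE; case: (eqVneq (i : nat) l) => [->|]; first by rewrite eqxx.
  by move=> _; rewrite if_same.
move=> g h Gg Gh; apply/matrixP => i l; rewrite !mxE.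
case: ifP => [/eqP rl|/negbT rl]; last first.
  rewrite big1 // => j _; rewrite !mxE.
  case: ifP => [/eqP rj|_]; last by rewrite mul0r.
  case: ifP => [/eqP rl'|_]; last by rewrite mulr0.
  by rewrite rl' rj eqxx in rl.
rewrite !(proj2 aG)// linear_partE// => [|k kn rki]; last first.
  apply: triangular_dep => // j jn rj; rewrite /unitpt; case: eqP => // jl.
  by move: (leq_ltn_trans rj rki); rewrite jl rl ltnn.
apply: eq_bigr => j _; rewrite [in LHS]mxE [in RHS]mxE; case: ifP => [/eqP rj|_].
  by rewrite !mxE rl rj eqxx.
by rewrite !mul0r.
Qed.

End TriangularAction.

Section EquivariantMap.
Variables (Z : Type) (Gam : set G) (actZ : G -> Z -> Z) (A : (Z -> R) -> Prop)
  (Z0 : set Z) (n : nat) (rk : nat -> nat) (act : G -> S -> S).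
Hypotheses (sG : is_subgroup Gam) (aZ : acts Gam actZ) (aG : acts Gam act)
  (tG : triangular Gam n rk act) (algA : funalg A)
  (stA : forall g f, Gam g -> A f -> A (fun z => f (actZ g z)))
  (stZ0 : forall g z, Gam g -> Z0 z -> Z0 (actZ g z))
  (h1 : H1_trivial Gam actZ A Z0).

Let partial (F0 : Z -> S) (K : nat) (F : Z -> S) :=
  [/\ forall i, (i < n)%N -> A (fun z => F z i),
      forall z i, (n <= i)%N -> F z i = 0,
      forall g, Gam g -> forall z i, (i < n)%N -> (rk i < K)%N ->
        act g (F (actZ g^-1%g z)) i = F z i
    & forall z, Z0 z -> F z = F0 z].

(* The obstruction to extending the equivariance to the coordinates of rank
   [K] is a cocycle with values in the linear part of the action. *)
Let partial_step (F0 : Z -> S) (K : nat) (F : Z -> S) :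
  (forall g z, Gam g -> Z0 z -> F0 (actZ g z) = act g (F0 z)) ->
  partial F0 K F -> exists F', partial F0 K.+1 F'.
Proof.
move=> eqF0 [AF F0n eqF FF0].
pose M := linear_part n rk act.
pose c g z : 'cV[R]_n :=
  \col_i if rk i == K then act g (F (actZ g^-1%g z)) i - F z i else 0.
have [||u [Au cu u0]] := @h1 n M c (linear_part_rep aG tG).
- case: algA => Ac Aadd Amul g Gg i.
  have [rK|rK] := eqVneq (rk i) K; last first.
    have -> : (fun z => c g z i 0) = fun=> 0.
      by apply/funext => z; rewrite mxE (negbTE rK).
    exact: Ac.
  have -> : (fun z => c g z i 0) =
      fun z => act g (F (actZ g^-1%g z)) i + -1 * F z i.
    by apply/funext => z; rewrite mxE rK eqxx mulN1r.
  apply: Aadd; last by apply: Amul; [exact: Ac|exact: AF].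
  apply: (funalg_polyfun (P := fun l => (l < n)%N && (rk l <= rk i)%N)
            (f := fun y => act g y i) (F := fun z => F (actZ g^-1%g z))) => //.
    exact: (triangular_polyfun tG Gg (ltn_ord i)).
  move=> l /andP [ln _].
  by apply: (stA (f := fun z => F z l)); [exact: subgroupV|exact: AF].
- move=> g h Gg Gh z; apply/colP => i; rewrite !mxE.
  case: ifP => [/eqP rK|/negbT rK]; last first.
    rewrite add0r big1// => l _; rewrite !mxE.
    by case: ifP; rewrite ?mul0r// => /eqP ->; rewrite (negbTE rK) mulr0.
  rewrite invgM !(proj2 aZ, proj2 aG)//; try exact: subgroupV.
  set w := actZ g^-1%g z.
  rewrite -[LHS](subrKA (act g (F w) i)) addrC; congr (_ + _).
  rewrite (linear_partE tG)// => [|l ln rl]; last by rewrite eqF// -rK.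
  apply: eq_bigr => l _; rewrite [c h w l 0]mxE /M mxE.
  by case: eqP => [rl|_]; rewrite ?mul0r// rl rK eqxx.
(* Only the components of rank [K] of the primitive are kept: the coordinates of smaller rank are
   already equivariant and must not move. *)
pose u' z j : R := if insub j is Some k then if rk (k : 'I_n) == K
                     then u z k 0 else 0 else 0.
have u'E z (k : 'I_n) : u' z k = if rk k == K then u z k 0 else 0.
  by rewrite /u' valK.
have u'lt z j : rk j != K -> u' z j = 0.
  by rewrite /u'; case: insubP => // k _ <- /negbTE ->.
have Mu' g z (i : 'I_n) : rk i = K -> Gam g ->
    act g (fun j => F z j + u' z j) i = act g (F z) i + (M g *m u z) i 0.
  move=> rK Gg; apply/eqP; rewrite addrC -subr_eq; apply/eqP.
  rewrite (linear_partE tG)// => [|l ln rl]; last first.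
    by rewrite (u'lt z l) ?addr0// -rK neq_ltn rl.
  rewrite mxE; apply: eq_bigr => l _; rewrite addrC addKr u'E mxE.
  by case: eqP => [rl|_]; rewrite ?mul0r// rl rK eqxx.
exists (fun z j => F z j + u' z j); split.
- case: algA => Ac Aadd Amul i ni; apply: Aadd; first exact: AF.
  have := u'E ^~ (Ordinal ni) => /= /funext ->.
  by case: (rk i == K); [exact: Au|exact: Ac].
- move=> z i ni; rewrite F0n// add0r /u'; case: insubP => // k kn.
  by rewrite ltnNge ni in kn.
- move=> g Gg z i ni; rewrite ltnS leq_eqVlt => /orP [/eqP rK|rK].
    have /= -> := Mu' g (actZ g^-1%g z) (Ordinal ni) rK Gg.
    have := cu g Gg z => /colP /(_ (Ordinal ni)).
    have /= -> := u'E z (Ordinal ni); rewrite !mxE /= rK eqxx => E.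
    lra.
  rewrite (u'lt z) ?addr0; last by rewrite neq_ltn rK.
  rewrite -[RHS](eqF _ Gg)//; apply: (triangular_dep tG) => // l ln rl.
  by rewrite (u'lt _ l) ?addr0// neq_ltn (leq_ltn_trans rl rK).
- move=> z Zz; rewrite -(FF0 z)//; apply/funext => j.
  rewrite /u'; case: insubP => [k _ _|_]; rewrite ?addr0//.
  rewrite u0// ?mxE ?if_same ?addr0// => g Gg; apply/colP => i; rewrite !mxE.
  case: ifP => // _; have Zw : Z0 (actZ g^-1%g z).
    by apply: stZ0 => //; apply: subgroupV.
  by rewrite !FF0// -eqF0// (actsK _ sG aZ)// subrr.
Qed.

(** Ranks are corrected in increasing order: a coordinate of rank [K] of the target action only
    involves coordinates of rank at most [K], and correcting it does not disturb the lower ones. *)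
Lemma equivariant_map (F0 : Z -> S) :
  (forall i, (i < n)%N -> A (fun z => F0 z i)) ->
  (forall z i, (n <= i)%N -> F0 z i = 0) ->
  (forall g z, Gam g -> Z0 z -> F0 (actZ g z) = act g (F0 z)) ->
  exists F : Z -> S,
    [/\ forall i, (i < n)%N -> A (fun z => F z i),
        forall z i, (n <= i)%N -> F z i = 0,
        forall g, Gam g -> forall z, F (actZ g z) = act g (F z)
      & forall z, Z0 z -> F z = F0 z].
Proof.
move=> AF0 F0n eqF0.
have part K : exists F, partial F0 K F.
  elim: K => [|K [F /partial_step]]; first by exists F0; split.
  exact.
have [F [AF Fn eqF FF0]] := part (\max_(i < n) rk i).+1.
exists F; split=> // g Gg z; apply/funext => i.
have [ni|ni] := leqP n i; first by rewrite Fn// (proj1 (tG Gg))// Fn.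
rewrite -(eqF g Gg) ?(actsKV _ sG aZ)//.
by rewrite ltnS (leq_bigmax (Ordinal ni)).
Qed.

End EquivariantMap.
End Actions.

(** * Polynomial models of poly-Z groups *)

Section Antidifference.
Context {R : realType} {V : lmodType R}.
Variables (t s : {linear V -> V}).
Hypothesis ts : forall v, t (s v) = s (t v) - t v.

Definition polyact (p : {poly R}) (v : V) := \sum_(k < size p) p`_k *: iter k t v.

Lemma polyactE n (p : {poly R}) v : (size p <= n)%N ->
  polyact p v = \sum_(k < n) p`_k *: iter k t v.
Proof.
move=> pn; rewrite /polyact (big_ord_widen _ (fun k => p`_k *: iter k t v) pn).
rewrite big_mkcond; apply: eq_bigr => k _; case: ltnP => // kp.
by rewrite nth_default// scale0r.
Qed.

Lemma polyactD p q v : polyact (p + q) v = polyact p v + polyact q v.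
Proof.
pose n := maxn (size p) (size q).
rewrite !(@polyactE n) ?leq_maxl ?leq_maxr ?(leq_trans (size_polyD _ _))//.
by rewrite -big_split; apply: eq_bigr => k _; rewrite coefD scalerDl.
Qed.

Lemma polyactC c v : polyact c%:P v = c *: v.
Proof.
by rewrite (@polyactE 1) ?size_polyC_leq1// big_ord1 coefC.
Qed.

Lemma polyactXM p v : polyact ('X * p) v = t (polyact p v).
Proof.
rewrite (@polyactE (size p).+1); last first.
  by have [->|p0] := eqVneq p 0; rewrite ?mulr0 ?size_poly0// mulrC size_mulX.
rewrite big_ord_recl coefXM/= scale0r add0r.
rewrite /polyact linear_sum; apply: eq_bigr => k _.
by rewrite coefXM/= linearZ.
Qed.

Lemma polyactM p q v : polyact (p * q) v = polyact p (polyact q v).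
Proof.
elim/poly_ind: p => [|p c IH]; first by rewrite mul0r !polyactC !scale0r.
rewrite mulrDl !polyactD [p * 'X]mulrC -mulrA !polyactXM IH.
congr (_ + _); rewrite polyactC.
elim/poly_ind: q {IH} => [|q d IH].
  by rewrite mulr0 polyactC !scale0r scaler0.
rewrite mulrDr !polyactD [q * 'X]mulrC mulrCA !polyactXM IH scalerDr linearZ.
by rewrite -polyCM !polyactC scalerA.
Qed.

Lemma polyactN p v : polyact p (- v) = - polyact p v.
Proof.
have itN k : iter k t (- v) = - iter k t v by elim: k => //= k ->; rewrite linearN.
by rewrite -sumrN; apply: eq_bigr => k _; rewrite itN scalerN.
Qed.

Lemma polyactNp p v : polyact (- p) v = - polyact p v.
Proof.
by rewrite /polyact size_polyN -sumrN; apply: eq_bigr => k _; rewrite coefN scaleNr.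
Qed.

(** The form in which finite dimension enters: some non-zero polynomial in [t] kills [v]. *)
Definition algebraic_vector v := exists2 p, p != 0 & polyact p v = 0.

(** Moving [s] past a polynomial in [t] leaves a remainder in [t] alone, [p(t) s = s p(t) + q(t)];
    hence [p(t)^2] kills [s v]. *)
Lemma algebraic_vector_s v : algebraic_vector v -> algebraic_vector (s v).
Proof.
move=> [p p0 pv].
have [q qE] : exists q, forall w, polyact p (s w) = s (polyact p w) + polyact q w.
  elim/poly_ind: {p0 pv}p => [|p c [q qE]].
    by exists 0 => w; rewrite !polyactC !scale0r linear0 addr0.
  exists ('X * (q - p)) => w.
  rewrite [p * 'X]mulrC !polyactD !polyactXM !polyactC qE polyactD linearD ts.
  rewrite polyactNp !linearD linearN linearZ/=.
  by rewrite [LHS](ACl (1*4*3*2))%AC [RHS]addrA.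
exists (p * p); first by rewrite mulf_neq0.
rewrite polyactM qE pv linear0 add0r -polyactM mulrC polyactM pv.
by rewrite /polyact big1// => k _; rewrite iter_fix ?scaler0// linear0.
Qed.

Definition antidifferent (W : V -> Prop) v := exists2 p, W p & v = p - t p.

Variable W : V -> Prop.
Hypotheses (WD : forall u v, W u -> W v -> W (u + v))
  (WZ : forall c v, W v -> W (c *: v))
  (Wt : forall v, W v -> W (t v)) (Ws : forall v, W v -> W (s v)).

Lemma antidifferentD u v : antidifferent W u -> antidifferent W v ->
  antidifferent W (u + v).
Proof.
move=> [p Wp ->] [q Wq ->]; exists (p + q); first exact: WD.
by rewrite linearD opprD addrACA.
Qed.

Lemma antidifferentZ c v : antidifferent W v -> antidifferent W (c *: v).
Proof.
move=> [p Wp ->]; exists (c *: p); first exact: WZ.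
by rewrite linearZ scalerBr.
Qed.

Lemma antidifferentN v : antidifferent W v -> antidifferent W (- v).
Proof. by move=> /(antidifferentZ (-1)); rewrite scaleN1r. Qed.

(* [rising k] is multiplication by s (s + 1) ... (s + k - 1) / k!, a discrete
   primitive of [rising k.-1] for the backward difference. *)
Fixpoint rising k v :=
  if k is k'.+1 then k%:R^-1 *: (s (rising k' v) + k'%:R *: rising k' v) else v.

Arguments rising : simpl never.

Lemma risingS j w : j.+1%:R *: rising j.+1 w = s (rising j w) + j%:R *: rising j w.
Proof. by rewrite /rising scalerA mulfV ?pnatr_eq0// scale1r. Qed.

Lemma rising_closed k v : W v -> W (rising k v).
Proof.
by move=> Wv; elim: k => //= k IH; apply/WZ/WD; [apply: Ws|apply: WZ].
Qed.

Lemma risingD k u v : rising k (u + v) = rising k u + rising k v.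
Proof.
elim: k => // k IH; have k1 : k.+1%:R != 0 :> R by rewrite pnatr_eq0.
by apply: (scalerI k1); rewrite scalerDr !risingS IH linearD scalerDr addrACA.
Qed.

(** The commutation rule [ts] replaces [s] by [s - 1]; on rising binomials this is Pascal's rule. *)
Lemma rising_t k v : t (rising k.+1 v) = rising k.+1 (t v) - rising k (t v).
Proof.
have step j w : s (rising j w) = j.+1%:R *: rising j.+1 w - j%:R *: rising j w.
  by rewrite risingS addrK.
elim: k => [|k IH].
  have r1 w : rising 1 w = s w by have := risingS 0 w; rewrite scale1r scale0r addr0.
  by rewrite !r1 ts.
have k2 : k.+2%:R != 0 :> R by rewrite pnatr_eq0.
have tZ c w : t (c *: w) = c *: t w by exact: linearZ.
have sB u w : s (u - w) = s u - s w by exact: linearB.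
apply: (scalerI k2); rewrite -tZ risingS linearD tZ ts IH !scalerBr (risingS k.+1).
rewrite sB (step k) -[k.+2%:R]natr1 -[k.+1%:R]natr1 !scalerDl !scale1r.
move: (rising k.+1 (t v)) (rising k (t v)) => a b.
move: (s a) (k%:R *: a + a) (k%:R *: b) => sa P Q.
have -> : P - (Q + b) = P - Q - b by rewrite opprD addrA.
have -> : sa + P - (P + a) = sa - a by rewrite opprD addrA addrK.
move: (P - Q) => Y.
by rewrite opprB addrACA subrK [b - a - b]addrAC subrr sub0r.
Qed.

Lemma rising_diff k v :
  rising k.+1 v - t (rising k.+1 v) = rising k.+1 (v - t v) + rising k v - rising k (v - t v).
Proof.
have risingN j w : rising j (- w) = - rising j w.
  apply/eqP; rewrite -subr_eq0 opprK -risingD addNr; apply/eqP.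
  by apply: (addrI (rising j 0)); rewrite -risingD !addr0.
rewrite rising_t !risingD !risingN.
move: (rising k.+1 v) (rising k.+1 (t v)) (rising k v) (rising k (t v)) => x y z w.
by rewrite !opprB -addrA [z + _]addrC subrK addrA [RHS]addrAC.
Qed.

(** Summation by parts: [rising_diff] writes [rising k v] as a difference plus terms in [v - t v],
    which a smaller power of [1 - t] kills. *)
Lemma antidifferent_unipotent a v : W v -> iter a (fun w => w - t w) v = 0 ->
  forall k, antidifferent W (rising k v).
Proof.
have WB u w : W u -> W w -> W (u - w).
  by move=> Wu Ww; rewrite -scaleN1r; apply/WD/WZ.
elim: a v => [|a IH] v Wv.
  move=> /= -> k; have -> : rising k 0 = 0.
    by apply: (addrI (rising k 0)); rewrite -risingD !addr0.
  by exists 0; [rewrite -(scale0r v); exact: WZ|rewrite linear0 subr0].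
rewrite iterSr => /IH {}IH k.
have {}IH := IH (WB _ _ Wv (Wt Wv)).
have -> : rising k v = (rising k.+1 v - t (rising k.+1 v))
    - rising k.+1 (v - t v) + rising k (v - t v).
  by rewrite rising_diff [_ + rising k v]addrC [_ - rising k.+1 _]addrAC addrK subrK.
apply: antidifferentD; last exact: IH.
apply: antidifferentD; last by apply: antidifferentN.
by exists (rising k.+1 v) => //; apply: rising_closed.
Qed.

(** Write the annihilator as [q * ('X - 1) ^+ m] with [q.[1] != 0]. Then [polyact q v] falls under
    the unipotent case, and [q.[1] *: v] differs from it by a difference, since [q - q.[1]] is
    divisible by ['X - 1]. *)
Lemma antidifferent_algebraic v : W v -> algebraic_vector v -> antidifferent W v.
Proof.
move=> Wv [p p0 pv].
have WB u w : W u -> W w -> W (u - w).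
  by move=> Wu Ww; rewrite -scaleN1r; apply/WD/WZ.
have Wp q w : W w -> W (polyact q w).
  move=> Ww; elim/poly_ind: q => [|q c IH]; first by rewrite polyactC; apply: WZ.
  by rewrite polyactD mulrC polyactXM polyactC; apply: WD; [apply: Wt|apply: WZ].
have [m [q q1 E]] := multiplicity_XsubC p 1.
rewrite p0 /= in q1; have q10 : q.[1] != 0 by [].
have [r qE] : exists r, q = r * ('X - 1%:P) + q.[1]%:P.
  have /factor_theorem [r rE] : root (q - q.[1]%:P) 1.
    by rewrite /root !hornerE subrr.
  by exists r; rewrite -rE subrK.
have -> : v = q.[1]^-1 *: (polyact q v + (polyact r v - t (polyact r v))).
  rewrite [in polyact q v]qE polyactD polyactC mulrBr mulr1 polyactD polyactNp mulrC polyactXM.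
  rewrite addrAC [_ - _ + (_ - _)]addrC -[polyact r v - _]opprB addNr add0r.
  by rewrite scalerA mulVf// scale1r.
apply: antidifferentZ; apply: antidifferentD; last first.
  by exists (polyact r v) => //; apply: Wp.
apply: (@antidifferent_unipotent m (polyact q v) (Wp _ _ Wv) _ 0%N).
have X1 j w : polyact (('X - 1%:P) ^+ j) w = (-1) ^+ j *: iter j (fun w => w - t w) w.
  elim: j w => [|j IH] w; first by rewrite !expr0 polyactC.
  rewrite exprSr polyactM iterSr exprSr mulrN1 scaleNr -IH -polyactN.
  congr polyact; rewrite polyactD polyactNp -['X]mulr1 polyactXM !polyactC !scale1r.
  by rewrite opprB.
apply: (@scalerI _ _ ((-1) ^+ m)); first by rewrite signr_eq0.
by rewrite scaler0 -X1 -polyactM mulrC -E.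
Qed.

End Antidifference.

(** In the application [W] consists of invariant polynomial functions, [E] of those free of the new
    variable, and the sum on the left expands a member of [W] in that variable by interpolation. *)
Lemma antidifferent_sum (R : realType) (V : lmodType R) (t s : V -> V)
    (W : V -> Prop) (E : V -> Prop) :
  linear t -> linear s -> (forall v, t (s v) = s (t v) - t v) ->
  (forall u v, W u -> W v -> W (u + v)) -> (forall c v, W v -> W (c *: v)) ->
  (forall v, W v -> W (t v)) -> (forall v, W v -> W (s v)) ->
  (forall v, E v -> W v) ->
  (forall v, E v -> exists2 p : {poly R}, p != 0 &
     \sum_(k < size p) p`_k *: iter k t v = 0) ->
  forall (n : nat) (e : nat -> V) (q : nat -> {poly R}), (forall i, E (e i)) ->
  exists2 p, W p &
    \sum_(i < n) \sum_(k < size (q i)) (q i)`_k *: iter k s (e i) = p - t p.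
Proof.
move=> lt ls ts WD WZ Wt Ws EW Ealg n e q Ee.
pose t' : {linear V -> V} := HB.pack t (GRing.isLinear.Build _ _ _ _ t lt).
pose s' : {linear V -> V} := HB.pack s (GRing.isLinear.Build _ _ _ _ s ls).
have W0 : W 0 by rewrite -(scale0r (e 0%N)); apply/WZ/EW.
have A0 : antidifferent t' W 0.
  by exists 0 => //; rewrite linear0 subr0.
have alg_iter k v : E v -> algebraic_vector t' (iter k s' v).
  move=> Ev; elim: k => [|k IH] /=; first exact: Ealg.
  exact: (@algebraic_vector_s _ _ t' s' ts).
have W_iter k v : E v -> W (iter k s v).
  by move=> Ev; elim: k => [|k IH] /=; [apply: EW|apply: Ws].
suff : antidifferent t' W
    (\sum_(i < n) \sum_(k < size (q i)) (q i)`_k *: iter k s (e i)) by [].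
elim/big_ind: _ => // [u v|i _]; first exact: antidifferentD.
elim/big_ind: _ => // [u v|k _]; first exact: antidifferentD.
apply: antidifferentZ => //; apply: (@antidifferent_algebraic _ _ t' s') => //.
  exact: W_iter.
exact: alg_iter.
Qed.

Section IntegerIteration.
Variables (T : Type) (f f' : T -> T).
Hypotheses (fK : cancel f f') (f'K : cancel f' f).

Definition iterz (z : int) (x : T) :=
  match z with Posz n => iter n f x | Negz n => iter n.+1 f' x end.

Lemma iterzS z x : iterz (1 + z) x = f (iterz z x).
Proof.
case: z => [n //|n]; rewrite /= f'K.
case: n => [//|n]; by have -> : 1 + Negz n.+1 = Negz n by rewrite !NegzE; lia.
Qed.

Lemma iterzP z x : iterz (-1 + z) x = f' (iterz z x).
Proof. by rewrite -{2}[z](addKr (-1)) opprK iterzS fK. Qed.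

Lemma iterzD z w x : iterz (z + w) x = iterz z (iterz w x).
Proof.
elim: z => [|n IH|n IH]; first by rewrite add0r.
  by rewrite intS -!addrA !iterzS IH -iterzS.
by rewrite intS opprD -!addrA !iterzP IH -iterzP.
Qed.

End IntegerIteration.

Section IntegerPowers.
Context {G : groupType}.
Implicit Types (t x : G) (z w : int).

Lemma expgzE t z x :
  (expgz t z * x)%g = iterz ( *%g t) ( *%g t^-1%g) z x.
Proof.
case: z => n; rewrite /expgz /iterz iter_mulg//.
by rewrite -expVgn.
Qed.

Lemma expgzD t z w : expgz t (z + w) = (expgz t z * expgz t w)%g.
Proof.
rewrite -[LHS]mulg1 -[expgz t w]mulg1 !expgzE iterzD//.
  exact: mulKg.
exact: mulVKg.
Qed.

Lemma expgz0 t : expgz t 0 = 1%g. Proof. by []. Qed.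

Lemma expgz1 t : expgz t 1 = t. Proof. by []. Qed.

Lemma expgzN t z : expgz t (- z) = ((expgz t z)^-1)%g.
Proof.
by apply: (mulIg (expgz t z)); rewrite -expgzD addNr mulVg.
Qed.

Lemma expgzM t z w : expgz t (z * w) = expgz (expgz t z) w.
Proof.
elim: w => [|n IH|n IH]; first by rewrite mulr0.
  by rewrite intS mulrDr mulr1 !expgzD IH expgz1.
by rewrite intS opprD mulrDr mulrN1 !expgzD IH !expgzN.
Qed.

Lemma subgroup_expgz (H : set G) t z : is_subgroup H -> H t -> H (expgz t z).
Proof.
move=> sH Ht; elim: z => [|n IH|n IH]; first exact: subgroup1.
  by rewrite intS expgzD; apply: subgroupM.
rewrite intS opprD expgzD; apply: subgroupM => //.
by rewrite expgzN; apply: subgroupV.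
Qed.

Lemma conj_expgz (H : set G) t : is_subgroup H ->
  (forall x, H x <-> H (t * x * t^-1)%g) ->
  forall z x, H x <-> H (expgz t z * x * (expgz t z)^-1)%g.
Proof.
move=> sH Ht; elim=> [|n IH|n IH] x; first by rewrite expgz0 invg1 mulg1 mul1g.
  rewrite intS expgzD expgz1 invgM; rewrite (IH x) (Ht (_ * _)%g).
  by rewrite !mulgA.
rewrite intS opprD expgzD expgzN expgz1 invgM invgK.
rewrite (IH x) [X in _ <-> X]Ht.
by rewrite !mulgA mulgV mul1g -!mulgA mulgV mulg1 !mulgA.
Qed.

(* A subnormal series [Gam 0 = 1, ..., Gam h = H] with infinite cyclic
   quotients, [Gam i.+1] being generated by [Gam i] and [t i], which refines a
   series of normal subgroups of [H]: the index [i] lies in the block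
   [[st i, en i)], and the quotient [Gam (en i) / Gam (st i)] is abelian. *)
Record good_chain (H : set G) (h : nat) (Gam : nat -> set G) (t : nat -> G)
    (st en : nat -> nat) : Prop := GoodChain {
  chain0 : Gam 0%N = [set 1%g];
  chain_top : Gam h = H;
  chain_subgroup : forall i, (i <= h)%N -> is_subgroup (Gam i);
  chain_step : forall i, (i < h)%N -> forall g,
    Gam i.+1 g <-> exists x z, Gam i x /\ g = (x * expgz (t i) z)%g;
  chain_conj : forall i, (i < h)%N -> forall x,
    Gam i x <-> Gam i (t i * x * (t i)^-1)%g;
  chain_inf : forall i, (i < h)%N -> forall z, Gam i (expgz (t i) z) -> z = 0;
  chain_block : forall i, (i < h)%N -> (st i <= i < en i)%N && (en i <= h)%N;
  chain_same : forall i j, (i < h)%N -> (st i <= j < en i)%N ->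
    st j = st i /\ en j = en i;
  chain_normal_st : forall i, (i < h)%N -> forall g x, H g -> Gam (st i) x ->
    Gam (st i) (g * x * g^-1)%g;
  chain_normal_en : forall i, (i < h)%N -> forall g x, H g -> Gam (en i) x ->
    Gam (en i) (g * x * g^-1)%g;
  chain_abelian : forall i, (i < h)%N -> forall g g',
    Gam (en i) g -> Gam (en i) g' -> Gam (st i) (g * g' * g^-1 * g'^-1)%g
}.

Section ChainTheory.
Variables (H : set G) (h : nat) (Gam : nat -> set G) (t : nat -> G)
  (st en : nat -> nat).
Hypothesis gc : good_chain H h Gam t st en.

Lemma chain_succ i x : (i < h)%N -> Gam i x -> Gam i.+1 x.
Proof.
by move=> ih Gx; apply/(chain_step gc ih); exists x, 0; rewrite expgz0 mulg1.
Qed.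

Lemma chain_mono i j : (i <= j)%N -> (j <= h)%N -> Gam i `<=` Gam j.
Proof.
move=> + jh x Gx; elim: j jh => [|j IH] jh; first by rewrite leqn0 => /eqP <-.
rewrite leq_eqVlt => /orP [/eqP <-//|ij]; apply: chain_succ => //.
by apply: IH => //; apply: ltnW.
Qed.

Lemma chain_gen i : (i < h)%N -> Gam i.+1 (t i).
Proof.
move=> ih; apply/(chain_step gc ih); exists 1%g, 1.
by rewrite mul1g expgz1; split=> //; exact: (subgroup1 (chain_subgroup gc (ltnW ih))).
Qed.

Lemma chain_sub_top i : (i <= h)%N -> Gam i `<=` H.
Proof. by move=> ih; rewrite -(chain_top gc); apply: chain_mono. Qed.

Lemma chain_ind i (Q : G -> Prop) : (i < h)%N ->
  (forall g, Gam i g -> Q g) -> Q (t i) ->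
  (forall g g', Gam i.+1 g -> Gam i.+1 g' -> Q g -> Q g' -> Q (g * g')%g) ->
  (forall g, Gam i.+1 g -> Q g -> Q g^-1%g) ->
  forall g, Gam i.+1 g -> Q g.
Proof.
move=> ih QG Qt QM QV g /(chain_step gc ih) [x [z [Gx ->]]].
have sG := chain_subgroup gc ih; have Gt := chain_gen ih.
apply: (QM); [exact: chain_succ|exact: subgroup_expgz|exact: QG|].
elim: z => [|n IH|n IH].
- by apply: (QG); exact: (subgroup1 (chain_subgroup gc (ltnW ih))).
- by rewrite intS expgzD; apply: (QM) => //; exact: subgroup_expgz.
- rewrite intS opprD expgzD expgzN; apply: (QM) => //; last exact: QV.
    exact: subgroupV.
  exact: subgroup_expgz.
Qed.

End ChainTheory.
End IntegerPowers.

(** * The polynomial model and its triangular structure *)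

Section Models.
Context {R : realType} {G : groupType}.
Local Notation S := (nat -> R).
Local Notation lt i := (fun l : nat => (l < i)%N).
Local Notation between j i := (fun l : nat => (j <= l)%N && (l < i)%N).
Variables (H : set G) (h : nat) (Gam : nat -> set G) (t : nat -> G)
  (st en : nat -> nat).
Hypothesis gc : good_chain H h Gam t st en.

(** The induction hypothesis after [i] generators. [model_dense] is Zariski density of every orbit;
    [model_block], with the block of [j] cut off at stage [i], says that the block translates the
    coordinate [j], which is what keeps the action linear on blocks. *)
Record model (i : nat) (act : G -> S -> S) : Prop := Model {
  model_acts : acts (Gam i) act;
  model_above : forall g, Gam i g -> forall x l, (i <= l)%N -> act g x l = x l;
  model_poly : forall g, Gam i g -> forall l, (l < i)%N ->
    polyfun (lt i) (fun x => act g x l);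
  model_fix : forall j, (j < i)%N -> forall g, Gam j g -> forall x, act g x j = x j;
  model_shift : forall j, (j < i)%N -> forall x, act (t j) x j = x j + 1;
  model_block : forall j, (j < i)%N -> forall g, Gam (minn (en j) i) g ->
    exists k, forall x, act g x j = x j + k;
  model_dense : forall f, polyfun (lt i) f -> forall x0,
    (forall g, Gam i g -> f (act g x0) = 0) -> forall x, f x = 0;
  model_H1 : H1_trivial (Gam i) act (polyfun (lt i)) set0
}.

(** The action on a coordinate involves coordinates of its own and of later blocks; later blocks
    therefore form the base and get the smaller rank. *)
Definition chain_rank (j : nat) := (h - en j)%N.

Section Model.
Variables (i : nat) (act : G -> S -> S).
Hypotheses (ih : (i <= h)%N) (md : model i act).

Let sG j : (j <= i)%N -> is_subgroup (Gam j).
Proof. by move=> ji; apply: (chain_subgroup gc); apply: leq_trans ih. Qed.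

Lemma model_fix_ge j l g x : (j <= l)%N -> (l < i)%N -> Gam j g -> act g x l = x l.
Proof.
move=> jl li Gg; apply: (model_fix md) => //.
exact: (chain_mono gc jl (leq_trans (ltnW li) ih)).
Qed.

Lemma model_dep g x y l : Gam i g -> (l < i)%N ->
  (forall k, (k < i)%N -> x k = y k) -> act g x l = act g y l.
Proof. by move=> Gg li xy; apply: (polyfun_dep (model_poly md Gg li)). Qed.

Lemma model_polyfun_act g f : Gam i g -> polyfun (lt i) f ->
  polyfun (lt i) (fun x => f (act g x)).
Proof. by move=> Gg pf; apply: polyfun_comp pf _ => l; apply: (model_poly md). Qed.

(** [t j] adds one to [x j] and fixes the later coordinates, so once the earlier variables are gone
    [polyfun_periodic] removes [x j]. *)
Lemma model_invariant j f : (j <= i)%N -> polyfun (lt i) f ->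
  (forall g, Gam j g -> forall x, f (act g x) = f x) -> polyfun (between j i) f.
Proof.
move=> + pf; elim: j => [|j IH] ji fG; first exact: polyfunW pf.
have jh : (j < h)%N by apply: leq_trans ih.
have {IH} pj : polyfun (between j i) f.
  by apply: IH (ltnW ji) _ => g Gg; apply: fG; apply: (chain_succ gc).
have Gt := chain_gen gc jh.
apply: polyfunW (polyfun_periodic (i := j) pj (oner_neq0 R) _).
  by move=> l /andP [/andP [jl ->]]; rewrite andbT ltn_neqAle jl eq_sym => ->.
move=> x; rewrite -[RHS](fG _ Gt); apply: (polyfun_dep pj) => l /andP [jl li].
move: jl; rewrite leq_eqVlt => /orP [/eqP <-|jl].
  by rewrite upd_same (model_shift md).
by rewrite upd_other ?gtn_eqF// (@model_fix_ge j.+1).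
Qed.

(** [F x j] is invariant under [Gam (st j)] and is translated by [Gam u]. Climbing the block, one
    subtracts [w * x k] for each generator [t k], where [w] is the amount of its translation; what
    is left is invariant under [Gam u], hence a function of the later blocks. *)
Lemma model_block_decomposition j (F : S -> S) (th : G -> G) :
  let u := minn (en j) i in
  (j < i)%N -> polyfun (lt i) (fun x => F x j) ->
  (forall g, Gam u g -> Gam u (th g)) ->
  (forall g, Gam (st j) g -> Gam (st j) (th g)) ->
  (forall g x, Gam u g -> F (act g x) j = act (th g) (F x) j) ->
  exists (m : nat -> R) (c : S -> R),
    polyfun (between (en j) i) c /\
    forall x, F x j = \sum_(l < i | en l == en j) m l * x l + c x.
Proof.
move=> u ji pF thu thst eqF.
have jh : (j < h)%N by apply: leq_trans ih.
have /andP [/andP [stj jen] enh] := chain_block gc jh.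
have ui : (u <= i)%N by rewrite geq_minr.
have ju : (j < u)%N by rewrite leq_min jen.
have Q k : (st j <= k <= u)%N -> exists (m : nat -> R) (c : S -> R),
  [/\ polyfun (lt i) c,
      forall x, F x j = \sum_(l < i | en l == en j) m l * x l + c x,
      forall g, Gam k g -> forall x, c (act g x) = c x
    & forall g, Gam u g -> exists d, forall x, c (act g x) = c x + d].
  elim: k => [|k IH].
    rewrite leqn0 => /andP [/eqP st0 _].
    exists (fun=> 0), (fun x => F x j); split=> // [x|g|g Gg].
    - by rewrite big1 ?add0r// => l _; rewrite mul0r.
    - rewrite (chain0 gc) => -> x; by rewrite (proj1 (model_acts md)).
    - have [d dE] := model_block md ji (thu _ Gg); exists d => x.
      by rewrite eqF// dE.
  move=> /andP [+ ku]; rewrite leq_eqVlt => /orP [/eqP stk|stk].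
    exists (fun=> 0), (fun x => F x j); split=> // [x|g Gg x|g Gg].
    - by rewrite big1 ?add0r// => l _; rewrite mul0r.
    - rewrite eqF; last by apply: (chain_mono gc _ _ Gg); rewrite ?stk// (leq_trans ui).
      apply: (@model_fix_ge (st j)) => //; apply: thst; by rewrite stk.
    - have [d dE] := model_block md ji (thu _ Gg); exists d => x.
      by rewrite eqF// dE.
  have {IH} [|m [c [pc E cG cu]]] := IH; first by rewrite -ltnS stk ltnW.
  have ki : (k < i)%N by apply: leq_trans ui.
  have kh : (k < h)%N by apply: leq_trans ih.
  have ken : (k < en j)%N by apply: leq_trans ku (geq_minl _ _).
  have [_ enk] : st k = st j /\ en k = en j.
    by apply: (chain_same gc jh); rewrite -ltnS stk.
  have Gtk := chain_gen gc kh.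
  have Gtu : Gam u (t k) by apply: (chain_mono gc ku) Gtk; apply: leq_trans ih.
  have [w wE] := cu _ Gtu.
  exists (fun l => m l + (l == k)%:R * w), (fun x => c x - w * x k); split.
  - by apply: polyfun_sub => //; apply/polyfun_scale/polyfun_var.
  - move=> x; rewrite E.
    under [in RHS]eq_bigr => l _ do rewrite mulrDl.
    rewrite big_split /= [X in _ = _ + X + _](bigD1 (Ordinal ki)) ?enk//= eqxx
      [X in _ + (_ + X) + _]big1.
      by rewrite -[true%:R]/1; ring.
    by move=> l; rewrite -val_eqE /= => /andP [_ /negbTE ->]; rewrite !mul0r.
  - have gen : forall g, Gam k.+1 g -> forall x, c (act g x) - w * act g x k = c x - w * x k.
      have sk : is_subgroup (Gam k.+1) by apply: sG.
      have Gki g : Gam k.+1 g -> Gam i g by apply: (chain_mono gc).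
      apply: (chain_ind gc kh) => [g Gg x|x|g g' Gg Gg' Eg Eg' x|g Gg Eg x].
      + by rewrite cG// (model_fix md).
      + by rewrite wE (model_shift md)// mulrDr mulr1 opprD addrACA subrr addr0.
      + by rewrite (proj2 (model_acts md)) ?Eg ?Eg'//; apply: Gki.
      + rewrite -[in RHS](actsK x (sG (leqnn i)) (model_acts md) (Gki _ Gg)).
        by rewrite Eg.
    by [].
  - move=> g Gg; have [d dE] := cu _ Gg.
    have [d' dE'] : exists d', forall x, act g x k = x k + d'.
      by apply: (model_block md) => //; rewrite enk.
    exists (d - w * d') => x; rewrite dE dE'; ring.
have [|m [c [pc E cG _]]] := Q u; first by rewrite (leq_trans stj (ltnW ju)) leqnn.
exists m, c; split=> //.
apply: polyfunW (model_invariant ui pc cG) => l /andP [ul li].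
by rewrite li andbT; move: ul; rewrite geq_min => /orP [//|]; rewrite leqNgt li.
Qed.

Lemma chain_rank_lt j l : (j < i)%N -> (l < i)%N -> (en j <= l)%N ->
  (chain_rank l < chain_rank j)%N.
Proof.
move=> ji li jl; have lh := leq_trans li ih.
have /andP [/andP [_ len] lenh] := chain_block gc lh.
by rewrite /chain_rank ltn_sub2l// (leq_ltn_trans jl).
Qed.

Lemma chain_rank_eq j l : (j < i)%N -> (l < i)%N ->
  (chain_rank l == chain_rank j) = (en l == en j).
Proof.
move=> ji li; have lh := leq_trans li ih; have jh := leq_trans ji ih.
have /andP [_ lenh] := chain_block gc lh.
have /andP [_ jenh] := chain_block gc jh.
by rewrite /chain_rank; apply/eqP/eqP => [|->//]; lia.
Qed.

Lemma twisted_triangular (s : G) : H s ->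
  (forall g, Gam i g -> Gam i (s * g * s^-1)%g) ->
  triangular (Gam i) i chain_rank (fun g => act (s * g * s^-1)%g).
Proof.
move=> Hs nGi g Gg; split=> [x l il|j ji].
  by apply: (model_above md) => //; apply: nGi.
have jh := leq_trans ji ih.
have Ga := nGi g Gg; set a := (s * g * s^-1)%g in Ga *.
have Ha : H a by apply: (chain_sub_top gc ih).
have sGi := sG (leqnn i).
have [|||||m [c [pc E]]] :=
    @model_block_decomposition j (act a) (fun g' => (a * g' * a^-1)%g) => //.
- exact: (model_poly md).
- rewrite /minn; case: ltnP => _ b Gb; first exact: (chain_normal_en gc jh).
  exact: subgroupM sGi (subgroupM sGi Ga Gb) (subgroupV sGi Ga).
- by move=> b; apply: (chain_normal_st gc jh).
- move=> b x Gb; have Gib : Gam i b by exact: (chain_mono gc (geq_minr _ _) ih Gb).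
  have aG := model_acts md; rewrite -!(proj2 aG)//; first by rewrite mulgVK.
  exact: subgroupM sGi (subgroupM sGi Ga Gib) (subgroupV sGi Ga).
exists m, c; split=> [|x].
  apply: polyfunW pc => l /andP [jl li]; rewrite li /=; exact: chain_rank_lt.
by rewrite E; congr (_ + _); apply: eq_bigl => l; rewrite chain_rank_eq.
Qed.

Lemma model_triangular : triangular (Gam i) i chain_rank act.
Proof.
move=> g Gg; have [||] := @twisted_triangular 1%g _ _ g Gg.
- exact: (chain_sub_top gc ih (subgroup1 (sG (leqnn i)))).
- by move=> g'; rewrite mul1g invg1 mulg1.
- by rewrite mul1g invg1 mulg1.
Qed.

End Model.
End Models.

(** * Intertwining the model with its transform by the next generator *)

Section Extension.
Context {R : realType} {G : groupType}.
Local Notation S := (nat -> R).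
Local Notation lt i := (fun l : nat => (l < i)%N).
Local Notation between j i := (fun l : nat => (j <= l)%N && (l < i)%N).
Variables (H : set G) (h : nat) (Gam : nat -> set G) (t : nat -> G)
  (st en : nat -> nat).
Hypothesis gc : good_chain H h Gam t st en.
Variables (i : nat) (act : G -> S -> S).
Hypotheses (ih : (i < h)%N) (md : model Gam t en i act).

Let il := ltnW ih.
Let sGi : is_subgroup (Gam i) := chain_subgroup gc il.
Let sGS : is_subgroup (Gam i.+1) := chain_subgroup gc ih.
Let sH : is_subgroup H.
Proof. by rewrite -(chain_top gc); apply: (chain_subgroup gc). Qed.
Let Ht : H (t i) := chain_sub_top gc ih (chain_gen gc ih).

Definition poly_map (F : S -> S) :=
  (forall l, (l < i)%N -> polyfun (lt i) (fun x => F x l)) /\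
  (forall x l, (i <= l)%N -> F x l = x l).

Lemma poly_map_comp F F' : poly_map F -> poly_map F' -> poly_map (F \o F').
Proof.
move=> [pF Fi] [pF' F'i]; split=> [l li|x l le] /=; last by rewrite Fi// F'i.
exact: polyfun_comp (pF l li) pF'.
Qed.

(** Obstruction theory from the model to its conjugate by [s]; the result is how [s] will act on the
    first [i] coordinates. *)
Lemma twist s : H s -> (forall g, Gam i g -> Gam i (s * g * s^-1)%g) ->
  exists2 F, poly_map F &
    forall g x, Gam i g -> F (act g x) = act (s * g * s^-1)%g (F x).
Proof.
move=> Hs nGi; pose act' g := act (s * g * s^-1)%g.
have aG' : acts (Gam i) act'.
  rewrite /act'; split=> [x|g g' Gg Gg' x].
    by rewrite mulg1 mulgV (proj1 (model_acts md)).
  rewrite -(proj2 (model_acts md)); [|exact: nGi|exact: nGi].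
  by congr act; rewrite !mulgA mulgVK.
have [|||||F [pF F0 eqF _]] := @equivariant_map R G S (Gam i) act (polyfun (lt i))
    set0 i (chain_rank h en) act' sGi (model_acts md) aG'
    (twisted_triangular gc il md Hs nGi) (polyfun_funalg _) _ _ (model_H1 md)
    (fun=> fun=> 0) => //.
- by move=> g f Gg; apply: (model_polyfun_act md).
- by move=> *; apply: polyfun_cst.
pose F' x l := if (l < i)%N then F x l else x l.
have eqF' g x y : Gam i g -> (forall l, (l < i)%N -> x l = y l) ->
    forall l, (l < i)%N -> act g x l = act g y l.
  by move=> Gg xy l li; apply: (model_dep md).
exists F' => [|g x Gg].
  split=> [l li|x l le]; last by rewrite /F' ltnNge le.
  by rewrite /F' li; apply: pF.
apply/funext => l; rewrite {1}/F'; case: ltnP => li.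
  rewrite eqF//; apply: (model_dep md) => //; first exact: nGi.
  by move=> k ki; rewrite /F' ki.
rewrite !(model_above md)//; last exact: nGi.
by rewrite /F' ltnNge li.
Qed.

(* In the coordinate [l] an equivariant map is the identity up to a function
   invariant under [Gam l.+1], that is a function of the coordinates [> l]. *)
Lemma self_map_inverse F : poly_map F ->
  (forall g x, Gam i g -> F (act g x) = act g (F x)) ->
  exists F', [/\ poly_map F', cancel F F' & cancel F' F].
Proof.
move=> [pF Fi] eqF.
have tri l : (l < i)%N -> polyfun (between l.+1 i) (fun x => F x l - x l).
  move=> li; have lh := ltn_trans li ih.
  apply: (model_invariant gc il md) => //.
    by apply: polyfun_sub; [exact: pF|exact: polyfun_var].
  have Gli g : Gam l.+1 g -> Gam i g by apply: (chain_mono gc).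
  apply: (chain_ind gc lh) => [g Gg x|x|g g' Gg Gg' Eg Eg' x|g Gg Eg x].
  - rewrite eqF; last exact: Gli (chain_succ gc lh Gg).
    by rewrite !(model_fix md).
  - rewrite eqF; last exact: Gli (chain_gen gc lh).
    by rewrite !(model_shift md)// opprD addrACA subrr addr0.
  - by rewrite (proj2 (model_acts md)) ?Eg ?Eg'//; apply: Gli.
  - rewrite -[in RHS](actsK x sGi (model_acts md) (Gli _ Gg)).
    by rewrite Eg.
(* The inversion goes from the last coordinate down: the correction [d] of the coordinate [j] only
   involves coordinates that are already inverted. *)
have [F' [[pF' F'i] K1 K2]] : exists F', [/\ poly_map F',
    forall x l, (i - i <= l)%N -> F' (F x) l = x l
  & forall x l, (i - i <= l)%N -> F (F' x) l = x l].
  have : (i <= i)%N by []; elim: {1 4 6}i => [|k IH] ki.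
    exists id; split=> // [|x l|x l]; rewrite ?subn0.
    - by split=> // l li; apply: polyfun_var.
    - by move=> le; rewrite /= Fi.
    - by move=> le; rewrite /= Fi.
  have {IH} [F' [[pF' F'i] K1 K2]] := IH (ltnW ki).
  pose j := (i - k.+1)%N.
  have ji : (j < i)%N by rewrite /j; lia.
  have jk : (i - k = j.+1)%N by rewrite /j; lia.
  pose d x := F x j - x j.
  have dd x y : (forall l, (j < l)%N -> x l = y l) -> d x = d y.
    by move=> xy; apply: (polyfun_dep (tri j ji)) => l /andP [jl _]; apply: xy.
  exists (fun x => upd (F' x) j (x j - d (F' x))); split.
  - split=> [l li|x l le]; last first.
      by rewrite upd_other ?F'i// gtn_eqF// (leq_trans ji).
    have [->|lj] := eqVneq l j.
      apply: (@polyfun_ext _ _ (fun x => x j - d (F' x))).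
        by move=> x; rewrite upd_same.
      apply: polyfun_sub; first exact: polyfun_var.
      have pd : polyfun (lt i) d by apply: polyfunW (tri j ji) => a /andP [].
      exact: polyfun_comp pd pF'.
    by apply: polyfun_ext (pF' l li) => x; rewrite upd_other.
  - move=> x l; rewrite -/j leq_eqVlt => /orP [/eqP <-|jl].
      rewrite upd_same (dd _ x) => [|l' jl']; last by rewrite K1// jk.
      by rewrite /d subKr.
    by rewrite upd_other ?gtn_eqF// K1// jk.
  - move=> x l; rewrite -/j; set y := upd _ _ _ => jl.
    have yF l' : (j < l')%N -> y l' = F' x l' by move=> ?; rewrite /y upd_other ?gtn_eqF.
    have Fy l' : (j < l')%N -> F y l' = F (F' x) l'.
      move=> jl'; have [li|li] := leqP i l'; first by rewrite !Fi// yF.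
      have : F y l' - y l' = F (F' x) l' - F' x l'.
        apply: (polyfun_dep (x := y) (y := F' x) (tri l' li)) => a /andP [la _].
        by apply: yF; apply: ltn_trans la.
      by rewrite yF// => /addIr.
    move: jl; rewrite leq_eqVlt => /orP [/eqP <-|jl]; last first.
      by rewrite Fy// K2// jk.
    rewrite -(subrK (y j) (F y j)) -/(d y) (dd _ _ yF).
    by rewrite /y upd_same addrC subrK.
by exists F'; split=> // x; apply/funext => l; rewrite (K1, K2)// subnn.
Qed.

(** The composites of the intertwiners for [t i] and for its inverse are equivariant self-maps,
    hence invertible. *)
Lemma twist_bijection : exists F F', [/\ poly_map F, poly_map F',
  cancel F F', cancel F' F
  & forall g x, Gam i g -> F (act g x) = act (t i * g * (t i)^-1)%g (F x)].
Proof.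
have nt g : Gam i g -> Gam i (t i * g * (t i)^-1)%g by rewrite -(chain_conj gc).
have nt' g : Gam i g -> Gam i ((t i)^-1 * g * (t i)^-1^-1)%g.
  by move=> Gg; rewrite (chain_conj gc ih) invgK !mulgA mulgV mul1g mulgK.
have [F pF eqF] := twist Ht nt.
have [F' pF' eqF'] := twist (subgroupV sH Ht) nt'.
have [|A [pA A1 A2]] := self_map_inverse (poly_map_comp pF' pF).
  move=> g x Gg /=; rewrite eqF// eqF'; last exact: nt.
  by rewrite invgK !mulgA mulVg mul1g mulgVK.
have [|B [pB B1 B2]] := self_map_inverse (poly_map_comp pF pF').
  move=> g x Gg /=; rewrite eqF'// eqF; last exact: nt'.
  by rewrite invgK !mulgA mulgV mul1g mulgK.
have FK : cancel F (A \o F') by move=> x; apply: A1.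
exists F, (A \o F'); split=> //; first exact: poly_map_comp.
by move=> y; rewrite -{1}(B2 y) /= A1; apply: B2.
Qed.

End Extension.

(** * The action of the enlarged group *)

Section ExtendedAction.
Context {R : realType} {G : groupType}.
Local Notation S := (nat -> R).
Local Notation lt i := (fun l : nat => (l < i)%N).
Variables (H : set G) (h : nat) (Gam : nat -> set G) (t : nat -> G)
  (st en : nat -> nat).
Hypothesis gc : good_chain H h Gam t st en.
Variables (i : nat) (act : G -> S -> S).
Hypotheses (ih : (i < h)%N) (md : model Gam t en i act).
Variables (F F' : S -> S).
Hypotheses (pF : poly_map i F) (pF' : poly_map i F') (FK : cancel F F')
  (F'K : cancel F' F)
  (eqF : forall g x, Gam i g -> F (act g x) = act (t i * g * (t i)^-1)%g (F x)).

Let il := ltnW ih.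
Let sGi : is_subgroup (Gam i) := chain_subgroup gc il.
Let sGS : is_subgroup (Gam i.+1) := chain_subgroup gc ih.

Lemma poly_map_act g : Gam i g -> poly_map i (act g).
Proof.
by move=> Gg; split=> [l|x l]; [apply: (model_poly md)|apply: (model_above md)].
Qed.

Lemma poly_map_upd (A : S -> S) (x : S) s : poly_map i A -> A (upd x i s) = upd (A x) i s.
Proof.
move=> [pA Ai]; apply/funext => l; have [->|li] := eqVneq l i.
  by rewrite Ai// !upd_same.
rewrite [RHS]upd_other//; have [lti|le] := ltnP l i.
  by apply: (polyfun_dep (pA l lti)) => k ki; rewrite upd_other// ltn_eqF.
by rewrite !Ai// upd_other.
Qed.

Lemma upd_upd (x : S) s s' : upd (upd x i s) i s' = upd x i s'.
Proof. by apply/funext => l; rewrite /upd; case: eqP. Qed.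

(** The future action of [t i]; that it conjugates [Gam i] correctly is the intertwining property of
    [F]. *)
Definition shift_up (x : S) : S := upd (F x) i (x i + 1).
Definition shift_down (x : S) : S := upd (F' x) i (x i - 1).

Lemma shift_upK : cancel shift_up shift_down.
Proof.
move=> x; rewrite /shift_down /shift_up upd_same addrK poly_map_upd// upd_upd FK.
exact: upd_id.
Qed.

Lemma shift_downK : cancel shift_down shift_up.
Proof.
move=> x; rewrite /shift_down /shift_up upd_same subrK poly_map_upd// upd_upd F'K.
exact: upd_id.
Qed.

Definition shift_int := iterz shift_up shift_down.

Lemma shiftD z w x : shift_int (z + w) x = shift_int z (shift_int w x).
Proof. by apply: iterzD; [exact: shift_upK|exact: shift_downK]. Qed.

Lemma shiftN1 x : shift_int (-1) x = shift_down x. Proof. by []. Qed.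

Lemma shift_up_act g x : Gam i g ->
  shift_up (act g x) = act (t i * g * (t i)^-1)%g (shift_up x).
Proof.
move=> Gg; have Gtg : Gam i (t i * g * (t i)^-1)%g by rewrite -(chain_conj gc).
rewrite /shift_up eqF// (poly_map_upd _ _ (poly_map_act Gtg)).
by rewrite (model_above md).
Qed.

Lemma shift_act z g x : Gam i g ->
  shift_int z (act g x) = act (expgz (t i) z * g * (expgz (t i) z)^-1)%g (shift_int z x).
Proof.
have conj := conj_expgz sGi (chain_conj gc ih).
elim: z g x => [|n IH|n IH] g x Gg.
- by rewrite expgz0 mul1g invg1 mulg1.
- rewrite intS !shiftD IH// [LHS]shift_up_act; last by rewrite -conj.
  by rewrite expgzD expgz1 invgM !mulgA.
- rewrite intS opprD !shiftD IH// expgzD (expgzN _ 1) expgz1 invgM invgK !shiftN1.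
  set b := expgz _ _; set y := shift_int _ _.
  apply: (can_inj shift_upK); rewrite shift_downK shift_up_act ?shift_downK.
    by rewrite !mulgA mulgV mul1g mulgK.
  have := chain_conj gc ih; move=> ->; rewrite !mulgA mulgV mul1g mulgK.
  by rewrite -conj.
Qed.

Lemma shift_coord z x : shift_int z x i = x i + z%:~R.
Proof.
elim: z x => [|n IH|n IH] x.
- by rewrite mulr0z addr0.
- rewrite intS shiftD -[shift_int 1 _]/(shift_up _) /shift_up upd_same IH rmorphD /=; ring.
- rewrite intS opprD shiftD shiftN1 /shift_down upd_same IH rmorphD /=; ring.
Qed.

Lemma shift_above z x l : (i < l)%N -> shift_int z x l = x l.
Proof.
have [[_ Fi] [_ F'i]] := (pF, pF').
move=> li; elim: z x => [|n IH|n IH] x //.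
- rewrite intS shiftD -[shift_int 1 _]/(shift_up _) /shift_up upd_other ?gtn_eqF//.
  by rewrite Fi ?IH// ltnW.
- rewrite intS opprD shiftD shiftN1 /shift_down upd_other ?gtn_eqF//.
  by rewrite F'i ?IH// ltnW.
Qed.

Lemma shift_poly z l : (l < i.+1)%N -> polyfun (lt i.+1) (fun x => shift_int z x l).
Proof.
have up (A : S -> S) a : poly_map i A -> forall l, (l < i.+1)%N ->
    polyfun (lt i.+1) (fun x => upd (A x) i (x i + a) l).
  move=> [pA _] k ki; have [->|ki'] := eqVneq k i.
    apply: (@polyfun_ext _ _ (fun x => x i + a)).
      by move=> x; rewrite upd_same.
    by apply: polyfun_add; [apply: polyfun_var|apply: polyfun_cst].
  have lki : (k < i)%N by rewrite ltn_neqAle ki' -ltnS.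
  apply: (@polyfun_ext _ _ (fun x => A x k)).
    by move=> x; rewrite upd_other.
  by apply: polyfunW (pA k lki) => a' /ltnW.
elim: z l => [|n IH|n IH] l li; first exact: polyfun_var.
- apply: (@polyfun_ext _ _ (fun x => shift_up (shift_int n x) l)).
    by move=> x; rewrite intS shiftD.
  exact: (polyfun_comp (F := shift_int n) (up F 1 pF l li) IH).
- apply: (@polyfun_ext _ _ (fun x => shift_down (shift_int (- n%:Z) x) l)).
    by move=> x; rewrite intS opprD shiftD.
  exact: (polyfun_comp (F := shift_int (- n%:Z)) (up F' (-1) pF' l li) IH).
Qed.

(** The exponent of [t i] in the normal form of [g], unique by [chain_inf]; the default 0 is taken
    only outside [Gam i.+1]. *)
Definition chain_exponent g := xget 0 [set z | Gam i (g * expgz (t i) (- z))%g].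

Lemma chain_exponentE g z : Gam i g -> chain_exponent (g * expgz (t i) z)%g = z.
Proof.
move=> Gg; rewrite /chain_exponent; case: xgetP => [w _ /= Gw|/(_ z)]; last first.
  by rewrite /= -mulgA -expgzD subrr mulg1.
have : Gam i (expgz (t i) (z - w)).
  rewrite expgzD; have := subgroupM sGi (subgroupV sGi Gg) Gw.
  by rewrite -mulgA mulKg.
by move=> /(chain_inf gc ih) /eqP; rewrite subr_eq0 => /eqP.
Qed.

Definition extended_act g x :=
  act (g * expgz (t i) (- chain_exponent g))%g (shift_int (chain_exponent g) x).

Lemma extended_actE g z x : Gam i g ->
  extended_act (g * expgz (t i) z)%g x = act g (shift_int z x).
Proof.
by move=> Gg; rewrite /extended_act chain_exponentE// -mulgA -expgzD subrr mulg1.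
Qed.

Lemma extended_act_sub g x : Gam i g -> extended_act g x = act g x.
Proof. by move=> Gg; rewrite -[g in LHS]mulg1 -(expgz0 (t i)) extended_actE. Qed.

Lemma extended_act_gen x : extended_act (t i) x = shift_up x.
Proof.
rewrite -[t i]mul1g -(expgz1 (t i)) extended_actE; last exact: subgroup1.
by rewrite (proj1 (model_acts md)).
Qed.

Lemma extended_acts : acts (Gam i.+1) extended_act.
Proof.
split=> [x|g g' /(chain_step gc ih) [a [z [Ga ->]]] /(chain_step gc ih) [b [w [Gb ->]]] x].
  rewrite extended_act_sub; last exact: subgroup1.
  by rewrite (proj1 (model_acts md)).
have conj := conj_expgz sGi (chain_conj gc ih).
have Gc : Gam i (expgz (t i) z * b * (expgz (t i) z)^-1)%g by rewrite -conj.
have -> : (a * expgz (t i) z * (b * expgz (t i) w) =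
    a * (expgz (t i) z * b * (expgz (t i) z)^-1) * expgz (t i) (z + w))%g.
  by rewrite expgzD !mulgA mulgVK.
rewrite !extended_actE//; last exact: subgroupM.
by rewrite (proj2 (model_acts md))// shiftD shift_act.
Qed.

Lemma extended_above g : Gam i.+1 g -> forall x l, (i.+1 <= l)%N ->
  extended_act g x l = x l.
Proof.
move=> /(chain_step gc ih) [a [z [Ga ->]]] x l il'.
by rewrite extended_actE// (model_above md) ?shift_above// ltnW.
Qed.

Lemma extended_poly g : Gam i.+1 g -> forall l, (l < i.+1)%N ->
  polyfun (lt i.+1) (fun x => extended_act g x l).
Proof.
move=> /(chain_step gc ih) [a [z [Ga ->]]] l li.
apply: (@polyfun_ext _ _ (fun x => act a (shift_int z x) l)).
  by move=> x; rewrite extended_actE.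
have pa : polyfun (lt i.+1) (fun x => act a x l).
  move: li; rewrite ltnS leq_eqVlt => /orP [/eqP ->|li].
    apply: (@polyfun_ext _ _ (fun x => x i)); last exact: polyfun_var.
    by move=> x; rewrite (model_above md).
  by apply: polyfunW (model_poly md Ga li) => k /ltnW.
exact: polyfun_comp pa (shift_poly z).
Qed.

Lemma extended_fix j : (j < i.+1)%N -> forall g, Gam j g -> forall x,
  extended_act g x j = x j.
Proof.
move=> ji g Gg x; have Gi : Gam i g by apply: (chain_mono gc _ il Gg).
rewrite extended_act_sub//; move: ji; rewrite ltnS leq_eqVlt => /orP [/eqP ->|ji].
  by rewrite (model_above md).
exact: (model_fix md).
Qed.

Lemma extended_shift j : (j < i.+1)%N -> forall x,
  extended_act (t j) x j = x j + 1.
Proof.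
rewrite ltnS leq_eqVlt => /orP [/eqP ->|ji] x.
  by rewrite extended_act_gen /shift_up upd_same.
have jh := ltn_trans ji ih.
rewrite extended_act_sub; first exact: (model_shift md).
exact: (chain_mono gc ji il (chain_gen gc jh)).
Qed.

Lemma extended_block j : (j < i.+1)%N -> forall g, Gam (minn (en j) i.+1) g ->
  exists k, forall x, extended_act g x j = x j + k.
Proof.
move=> ji g; have jh := leq_trans ji ih.
have /andP [/andP [stj jen] enh] := chain_block gc jh.
rewrite /minn; case: ltnP => [eni|eni].
  have enle : (en j <= i)%N by rewrite -ltnS.
  move=> Gg; have ji' : (j < i)%N by apply: leq_trans enle.
  have Gig : Gam i g by apply: (chain_mono gc enle il).
  have [k kE] := model_block md ji' (g := g) (ltac:(by rewrite (minn_idPl enle))).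
  by exists k => x; rewrite extended_act_sub.
move: g; apply: (chain_ind gc ih) => [g Gg||g g' Gg Gg' [k kE] [k' kE']|g Gg [k kE]].
- move: ji; rewrite ltnS leq_eqVlt => /orP [/eqP ->|ji].
    by exists 0 => x; rewrite extended_act_sub// (model_above md) ?addr0.
  have [k kE] := model_block md ji (g := g) (ltac:(by rewrite (minn_idPr (ltnW eni)))).
  by exists k => x; rewrite extended_act_sub.
- have [->|ji'] := eqVneq j i.
    by exists 1 => x; rewrite extended_act_gen /shift_up upd_same.
  have {}ji : (j < i)%N by rewrite ltn_neqAle ji' -ltnS.
  (* The block is abelian modulo [Gam (st j)], which fixes the coordinate [j]; so conjugation by
     [t i] keeps the amount by which [g] translates it. Hence [c] is invariant under [Gam i], and so
     constant. *)
  pose c x := F x j - x j.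
  have pc : polyfun (lt i) c.
    by apply: polyfun_sub; [apply: (proj1 pF)|apply: polyfun_var].
  have cG g : Gam i g -> forall x, c (act g x) = c x.
    move=> Gg x; rewrite /c eqF//.
    have Gtg : Gam i (t i * g * (t i)^-1)%g by rewrite -(chain_conj gc).
    have [k kE] := model_block md ji (g := g) (ltac:(by rewrite (minn_idPr (ltnW eni)))).
    rewrite kE; have -> : act (t i * g * (t i)^-1)%g (F x) j = F x j + k; last by ring.
    have Gc : Gam (st j) (t i * g * (t i)^-1 * g^-1)%g.
      apply: (chain_abelian gc jh); first by apply: (chain_mono gc eni enh); apply: (chain_gen gc).
      exact: (chain_mono gc (ltnW eni) enh Gg).
    rewrite -[(t i * g * _)%g](mulgVK g) (proj2 (model_acts md))//; last first.
      exact: (chain_mono gc (leq_trans stj (ltnW ji)) il Gc).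
    by rewrite (model_fix_ge gc il md _ stj)// kE.
  have cst := model_invariant gc il md (leqnn i) pc cG.
  exists (c (fun=> 0)) => x; rewrite extended_act_gen /shift_up upd_other ?ltn_eqF//.
  have -> : c (fun=> 0) = c x.
    by apply: (polyfun_dep cst) => l /andP [a b]; rewrite ltnNge a in b.
  by rewrite /c addrC subrK.
- by exists (k' + k) => x; rewrite (proj2 extended_acts)// kE kE' addrA.
- exists (- k) => x; rewrite -[x in RHS](actsK x sGS extended_acts Gg) kE.
  by rewrite addrK.
Qed.

(** Density for [Gam i] makes [f] vanish on every slice [x i = x0 i + n], and these slices determine
    its coefficients in [x i]. *)
Lemma extended_dense f : polyfun (lt i.+1) f -> forall x0,
  (forall g, Gam i.+1 g -> f (extended_act g x0) = 0) -> forall x, f x = 0.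
Proof.
move=> pf x0 f0 x; have [d [c [pc fE]]] := polyfun_expand i pf.
have pci k : polyfun (lt i) (c k).
  by apply: polyfunW (pc k) => l /andP [li lni]; rewrite ltn_neqAle lni -ltnS.
rewrite fE big1// => k _; suff -> : c k x = 0 by rewrite mulr0.
apply: (@poly_nat_zero _ d (fun k => c k x) (x0 i)) => // n.
apply: (model_dense md (f := fun y => \sum_(k < d) (x0 i + n%:R) ^+ k * c k y) _
          (x0 := shift_int n x0)).
  by apply: polyfun_sum => l _; apply: polyfun_scale.
move=> g Gg; rewrite -[RHS](f0 (g * expgz (t i) n)%g).
  rewrite extended_actE// fE; apply: eq_bigr => l _.
  by rewrite (model_above md)// shift_coord.
by apply/(chain_step gc ih); exists g, n%:Z.
Qed.

End ExtendedAction.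

Section Cocycles.
Context {R : realType} {G : groupType}.
Variables (Z : Type) (Gam : set G) (act : G -> Z -> Z) (r : nat) (M : G -> 'M[R]_r).
Hypotheses (sG : is_subgroup Gam) (aG : acts Gam act) (rM : rep_on Gam M).
Implicit Types (c : G -> Z -> 'cV[R]_r) (u : Z -> 'cV[R]_r).

Lemma cocycle1 c z : cocycle Gam act M c -> c 1%g z = 0.
Proof.
move=> cc; have G1 := subgroup1 sG; have := cc _ _ G1 G1 z.
rewrite mulg1 invg1 (proj1 aG) (proj1 rM) mul1mx => /eqP.
by rewrite -[X in X == _]addr0 (inj_eq (addrI _)) eq_sym => /eqP.
Qed.

Lemma cocycleV c g z : cocycle Gam act M c -> Gam g ->
  c g^-1%g z = - (M g^-1%g *m c g (act g z)).
Proof.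
move=> cc Gg; have := cc _ _ (subgroupV sG Gg) Gg z.
by rewrite mulVg cocycle1// invgK => /esym/eqP; rewrite addr_eq0 => /eqP.
Qed.

Definition coboundary u g z := u z - M g *m u (act g^-1%g z).

Lemma cocycle_sub_coboundary c u : cocycle Gam act M c ->
  cocycle Gam act M (fun g z => c g z - coboundary u g z).
Proof.
move=> cc g g' Gg Gg' z; rewrite /coboundary cc// (proj2 rM)// invgM.
have [Vg Vg'] := (subgroupV sG Gg, subgroupV sG Gg').
rewrite (proj2 aG)// !mulmxBr mulmxA.
set a := M g *m c _ _; set b := M g *m u _; set d := _ *m u _.
move: (u z) (c g z) a b d => x y a b d.
by apply/colP => k; rewrite !mxE; ring.
Qed.

Lemma cocycle_zeroM c g g' : cocycle Gam act M c -> Gam g -> Gam g' ->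
  (forall z, c g z = 0) -> (forall z, c g' z = 0) -> forall z, c (g * g')%g z = 0.
Proof. by move=> cc Gg Gg' cg cg' z; rewrite cc// cg cg' mulmx0 addr0. Qed.

Lemma cocycle_zeroV c g : cocycle Gam act M c -> Gam g ->
  (forall z, c g z = 0) -> forall z, c g^-1%g z = 0.
Proof. by move=> cc Gg cg z; rewrite cocycleV// cg mulmx0 oppr0. Qed.

End Cocycles.

(** * Vanishing of the cohomology for the enlarged group *)

Section ExtendedH1.
Context {R : realType} {G : groupType}.
Local Notation S := (nat -> R).
Local Notation lt i := (fun l : nat => (l < i)%N).
Variables (H : set G) (h : nat) (Gam : nat -> set G) (t : nat -> G)
  (st en : nat -> nat).
Hypothesis gc : good_chain H h Gam t st en.
Variables (i : nat) (act : G -> S -> S).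
Hypotheses (ih : (i < h)%N) (md : model Gam t en i act).
Variables (F F' : S -> S).
Hypotheses (pF : poly_map i F) (pF' : poly_map i F') (FK : cancel F F')
  (F'K : cancel F' F)
  (eqF : forall g x, Gam i g -> F (act g x) = act (t i * g * (t i)^-1)%g (F x)).

Let il := ltnW ih.
Let sGi : is_subgroup (Gam i) := chain_subgroup gc il.
Let sGS : is_subgroup (Gam i.+1) := chain_subgroup gc ih.
Let ea := extended_act Gam t i act F F'.
Let aE : acts (Gam i.+1) ea := extended_acts gc ih md pF pF' FK F'K eqF.
Let eaE g x : Gam i g -> ea g x = act g x := extended_act_sub gc act ih F F' x.
Let Gs g (Gg : Gam i g) : Gam i.+1 g := chain_succ gc ih Gg.

Let ea_upd g x s : Gam i g -> ea g (upd x i s) = upd (ea g x) i s.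
Proof.
by move=> Gg; rewrite !eaE// (poly_map_upd _ _ (poly_map_act md Gg)).
Qed.

Let ea_coord g x : Gam i g -> ea g x i = x i.
Proof. by move=> Gg; rewrite eaE// (model_above md). Qed.

Variables (r : nat) (M : G -> 'M[R]_r).
Hypothesis rM : rep_on (Gam i.+1) M.
Implicit Types (c : G -> S -> 'cV[R]_r) (v : S -> 'cV[R]_r).

Let rMi : rep_on (Gam i) M.
Proof. by split=> [|g g' Gg Gg']; [apply: (proj1 rM)|apply: (proj2 rM); apply: Gs]. Qed.

(** [Gam i] does not move [x i], so the cocycle identity expresses all values on [Gam i] by those at
    finitely many generators without raising the degree in [x i]. *)
Let cocycle_degree c : (forall g, Gam i.+1 g -> forall a, polyfun (lt i.+1) (fun z => c g z a 0)) ->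
  cocycle (Gam i.+1) ea M c ->
  exists d, forall g, Gam i g -> forall a, deg_lt d i (fun z => c g z a 0).
Proof.
move=> pc cc.
have deg_fin (f : 'I_r -> S -> R) : (forall a, exists d, deg_lt d i (f a)) ->
    exists d, forall a, deg_lt d i (f a).
  move=> /choice [d dE]; exists (\max_a d a) => a.
  by apply: deg_ltW (dE a); apply: leq_bigmax.
have deg_act d g (f : S -> R) : Gam i g -> deg_lt d i f -> deg_lt d i (fun z => f (ea g z)).
  move=> Gg df x; have [p pd pE] := df (ea g x); exists p => // s.
  by rewrite ea_upd.
have deg_mul d (A : 'M[R]_r) v : (forall a, deg_lt d i (fun z => v z a 0)) ->
    forall a, deg_lt d i (fun z => (A *m v z) a 0).
  move=> dv a; have := deg_lt_sum (index_enum 'I_r) (fun b => deg_lt_scale (A a b) (dv b)).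
  by congr deg_lt; apply/funext => z; rewrite mxE.
suff: forall j, (j <= i)%N -> exists d, forall g, Gam j g -> forall a,
    deg_lt d i (fun z => c g z a 0) by apply.
elim=> [_|j IH ji].
  exists 0%N => g; rewrite (chain0 gc) => -> a x; exists 0 => [|s]; first by rewrite size_poly0.
  by rewrite (cocycle1 sGS aE rM)// mxE horner0.
have jh : (j < h)%N by apply: leq_trans il.
have Gj g : Gam j.+1 g -> Gam i g by apply: (chain_mono gc).
have [d dE] := IH (ltnW ji).
have [e eE] : exists e, forall a, deg_lt e i (fun z => c (t j) z a 0).
  apply: deg_fin => a; apply: polyfun_deg_lt (pc _ _ a).
  exact/Gs/Gj/(chain_gen gc jh).
exists (maxn d e); apply: (chain_ind gc jh) => [g Gg a|a|g g' Gg Gg' dg dg' a|g Gg dg a].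
- by apply: deg_ltW (dE g Gg a); rewrite leq_maxl.
- by apply: deg_ltW (eE a); rewrite leq_maxr.
- have := deg_lt_add (dg a) (deg_mul _ (M g) _
    (fun b => deg_act _ g^-1%g _ (subgroupV sGi (Gj _ Gg)) (dg' b)) a).
  congr deg_lt; apply/funext => z.
  by rewrite cc ?mxE//; apply/Gs/Gj.
- have := deg_lt_scale (-1) (deg_mul _ (M g^-1%g) _
    (fun b => deg_act _ g _ (Gj _ Gg) (dg b)) a).
  congr deg_lt; apply/funext => z.
  by rewrite (cocycleV sGS aE rM _ cc (Gs (Gj _ Gg))) [RHS]mxE mulN1r.
Qed.

Let polyfun_horner (p : {poly R}) : polyfun (lt i.+1) (fun x => p.[x i]).
Proof.
apply: (@polyfun_ext _ _ (fun x => \sum_(k < size p) p`_k * x i ^+ k)).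
  by move=> x; rewrite horner_coef.
apply: polyfun_sum => k _; apply: polyfun_scale; apply: polyfun_exp.
exact: polyfun_var.
Qed.

Let polyfun_upd (f : S -> R) (s : R) : polyfun (lt i.+1) f -> polyfun (lt i) (fun x => f (upd x i s)).
Proof.
move=> pf; apply: polyfun_comp pf _ => l; rewrite ltnS leq_eqVlt => /orP [/eqP ->|li].
  by apply: (polyfun_ext _ (polyfun_cst _ s)) => x; rewrite upd_same.
apply: (@polyfun_ext _ _ (fun x => x l)); last exact: polyfun_var.
by move=> x; rewrite upd_other ?ltn_eqF.
Qed.

Let interpolate d :
  exists n (L : nat -> {poly R}), forall v, (forall a, deg_lt d i (fun z => v z a 0)) ->
  forall z, v z = \sum_(k < n) (L k).[z i] *: v (upd z i k%:R).
Proof.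
have [L LE] := @interpolation R d.+1 isT; exists d.+1, L => w dw z.
apply/colP => a; rewrite summxE; have [p pd pE] := dw a z.
rewrite -{1}(upd_id z i) pE LE; last exact: leq_trans (leqnSn d).
by apply: eq_bigr => k _; rewrite mxE pE mulrC.
Qed.

(* Along [Gam i] the cocycle can be trivialised coefficientwise in [x i]. *)
Let trivial_below c : (forall g, Gam i.+1 g -> forall a, polyfun (lt i.+1) (fun z => c g z a 0)) ->
  cocycle (Gam i.+1) ea M c ->
  exists2 u : S -> 'cV[R]_r, (forall a, polyfun (lt i.+1) (fun z => u z a 0)) &
    forall g, Gam i g -> forall z, c g z = coboundary ea M u g z.
Proof.
move=> pc cc; have [d dE] := cocycle_degree pc cc.
have [n [L LE]] := interpolate d.
pose good (k : nat) (u : S -> 'cV[R]_r) :=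
  (forall a, polyfun (lt i) (fun z => u z a 0)) /\
  (forall g, Gam i g -> forall z, c g (upd z i k%:R) = u z - M g *m u (act g^-1%g z)).
have /choice [u uE] k : exists u, good k u.
  have [||u [pu uE _]] := @model_H1 _ _ _ _ _ _ _ md r M (fun g z => c g (upd z i (k%:R))) rMi.
  - by move=> g Gg a; apply: (polyfun_upd _ (pc g (Gs Gg) a)).
  - move=> g g' Gg Gg' z; rewrite cc; [|exact: Gs|exact: Gs].
    by have VG := subgroupV sGi Gg; rewrite ea_upd// eaE.
  - by exists u.
exists (fun z => \sum_(k < n) (L k).[z i] *: u k z) => [a|g Gg z].
  apply: (@polyfun_ext _ _ (fun z => \sum_(k < n) (L k).[z i] * u k z a 0)).
    by move=> z; rewrite summxE; apply: eq_bigr => k _; rewrite mxE.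
  apply: polyfun_sum => k _; apply: polyfun_mul; first exact: polyfun_horner.
  by apply: polyfunW (proj1 (uE k) a) => l /ltnW.
rewrite (LE (c g))//; last exact: dE.
rewrite /coboundary mulmx_sumr -sumrB; apply: eq_bigr => k _.
have VG := subgroupV sGi Gg.
by rewrite (proj2 (uE k))// ea_coord// eaE// -scalemxAr scalerBr.
Qed.

Let op g v z := M g *m v (ea g^-1%g z).

Let opM g g' v : Gam i.+1 g -> Gam i.+1 g' -> op g (op g' v) = op (g * g')%g v.
Proof.
move=> Gg Gg'; apply/funext => z; rewrite /op mulmxA (proj2 rM)// invgM.
by rewrite (proj2 aE)//; apply: subgroupV.
Qed.

(** With [s] below, the pair of operators of the difference equations: [ts] holds because [t i]
    translates [x i] by one. *)
Let T := op (t i).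
Let s v (z : S) : 'cV[R]_r := z i *: v z.
Let invariant v := forall g, Gam i g -> op g v = v.

Let Gt := chain_gen gc ih.
Let Vt := subgroupV sGS Gt.

Let conjV g : Gam i g -> Gam i ((t i)^-1 * g * t i)%g.
Proof.
by move=> Gg; apply/(chain_conj gc ih); rewrite !mulgA mulgV mul1g mulgK.
Qed.

Let T_invariant v : invariant v -> invariant (T v).
Proof.
move=> iv g Gg; rewrite /T opM//; last exact: Gs.
rewrite -[in RHS](iv _ (conjV Gg)) opM//; last exact/Gs/conjV.
by congr op; rewrite !mulgA mulgV mul1g.
Qed.

Let ea_t z : ea (t i)^-1%g z = shift_down i F' z.
Proof.
rewrite -[RHS](actsKV _ sGS aE Gt); congr (ea _ _).
by rewrite /ea (extended_act_gen gc ih md) (shift_downK pF F'K).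
Qed.

Let W v := (forall a, polyfun (lt i.+1) (fun z => v z a 0)) /\ invariant v.
Let E v := (forall a, polyfun (lt i) (fun z => v z a 0)) /\ invariant v.

Let W_T v : W v -> W (T v).
Proof.
move=> [pv iv]; split=> [a|]; last exact: T_invariant.
apply: (@polyfun_ext _ _ (fun z => \sum_b M (t i) a b * v (ea (t i)^-1%g z) b 0)).
  by move=> z; rewrite mxE.
apply: polyfun_sum => b _; apply: polyfun_scale; apply: polyfun_comp (pv b) _ => l li.
exact: (extended_poly gc ih md pF pF' FK F'K Vt li).
Qed.

Let E_T v : E v -> E (T v).
Proof.
move=> [pv iv]; split=> [a|]; last exact: T_invariant.
apply: (@polyfun_ext _ _ (fun z => \sum_b M (t i) a b * v (F' z) b 0)).
  move=> z; rewrite mxE; apply: eq_bigr => b _; congr (_ * _).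
  apply: (polyfun_dep (pv b)) => l li.
  by rewrite ea_t /shift_down upd_other// ltn_eqF.
apply: polyfun_sum => b _; apply: polyfun_scale; apply: polyfun_comp (pv b) _ => l li.
exact: (proj1 pF').
Qed.

Let E_lin v w (b : R) : E v -> E w -> E (b *: v + w).
Proof.
move=> [pv iv] [pw iw]; split=> [a|g Gg].
  apply: (@polyfun_ext _ _ (fun z => b * v z a 0 + w z a 0)).
    by move=> z; rewrite !mxE.
  by apply: polyfun_add; first exact: polyfun_scale.
apply/funext => z; rewrite -[in RHS](iv g Gg) -[in RHS](iw g Gg).
by rewrite /op /= mulmxDr -scalemxAr.
Qed.

(* Evaluation at a point embeds the space of invariants into a
   finite-dimensional space. *)
Let E_algebraic v : E v -> exists2 p : {poly R}, p != 0 &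
  \sum_(k < size p) p`_k *: iter k T v = 0.
Proof.
(* The values at the origin of [r.+1] iterates of [T] are linearly dependent. The corresponding
   combination of iterates vanishes at the origin, by invariance on its orbit, and by density
   everywhere. *)
move=> Ev; pose A : 'M[R]_(r.+1, r) := \matrix_(k, a) iter k T v (fun=> 0) a 0.
have : kermx A != 0.
  rewrite -mxrank_eq0 mxrank_ker -lt0n subn_gt0.
  by apply: leq_ltn_trans (rank_leq_col A) _.
move=> /rowV0Pn [x xA x0].
have {}xA : x *m A = 0 by apply/sub_kermxP.
pose p : {poly R} := \poly_(k < r.+1) x 0 (inord k).
exists p.
  apply: contra x0 => /eqP p0; apply/eqP/rowP => k; rewrite mxE.
  have := coef_poly r.+1 (fun k => x 0 (inord k)) k.
  by rewrite -/p p0 coef0 ltn_ord inord_val => <-.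
pose f := \sum_(k < r.+1) x 0 k *: iter k T v.
have fE : f = \sum_(k < size p) p`_k *: iter k T v.
  have sp : (size p <= r.+1)%N by apply: size_poly.
  rewrite (big_ord_widen _ (fun k => p`_k *: iter k T v) sp) big_mkcond /=.
  apply: eq_bigr => k _; case: ltnP => kp; first by rewrite coef_poly ltn_ord inord_val.
  have := coef_poly r.+1 (fun k => x 0 (inord k)) k; rewrite -/p ltn_ord inord_val.
  by rewrite nth_default// => <-; rewrite scale0r.
have Ei k : E (iter k T v) by elim: k => // k IH; apply: E_T.
have E0 : E 0.
  have := E_lin (-1) Ev Ev; by rewrite scaleN1r addNr.
have Ef : E f.
  rewrite /f; elim/big_rec: _ => // k w _ Ew; exact: E_lin.
rewrite -fE; apply/funext => z; apply/colP => a; rewrite [RHS]mxE.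
apply: (model_dense md (proj1 Ef a) (x0 := fun=> 0)) => g Gg.
have VG := subgroupV sGi Gg.
have -> : f (act g (fun=> 0)) = M g *m f (fun=> 0).
  rewrite -[in LHS](proj2 Ef g Gg) /op eaE//.
  by rewrite (actsKV _ sGi (model_acts md)).
suff -> : f (fun=> 0) = 0 by rewrite mulmx0 mxE.
apply/colP => b; rewrite /f fct_sumE summxE [RHS]mxE.
have := congr1 (fun B : 'rV_r => B 0 b) xA; rewrite /= !mxE => xb.
by rewrite -[RHS]xb; apply: eq_bigr => k _; rewrite !mxE.
Qed.

Let ds_iter k v z : iter k s v z = z i ^+ k *: v z.
Proof. by elim: k => [|k IH]; rewrite ?scale1r// iterS /s IH scalerA exprS. Qed.

Let solve q : W q -> exists2 p, W p & q = p - T p.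
Proof.
move=> [pq iq].
have [d dE] : exists d, forall a, deg_lt d i (fun z => q z a 0).
  have /choice [d dE] a := polyfun_deg_lt i (pq a).
  exists (\max_a d a) => a; apply: deg_ltW (dE a); exact: leq_bigmax.
have [n [L LE]] := interpolate d.
have linT : linear T.
  by move=> b v w; apply/funext => z; rewrite /T /op /= mulmxDr -scalemxAr.
have lins : linear s.
  move=> b v w; apply/funext => z; rewrite /s.
  by rewrite !fctE scalerDr !scalerA [z i * b]mulrC.
have inv_lin b v w : invariant v -> invariant w -> invariant (b *: v + w).
  move=> iv iw g Gg; apply/funext => z; rewrite -[in RHS](iv g Gg) -[in RHS](iw g Gg).
  by rewrite /op /= mulmxDr -scalemxAr.
have W_lin b v w : W v -> W w -> W (b *: v + w).
  move=> [pv iv] [pw iw]; split; last exact: inv_lin.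
  move=> a; apply: (@polyfun_ext _ _ (fun z => b * v z a 0 + w z a 0)).
    by move=> z; rewrite !mxE.
  by apply: polyfun_add; first exact: polyfun_scale.
have W0 : W 0.
  by have := W_lin (-1) q q; rewrite scaleN1r addNr; apply.
have [||||||||p Wp pE] := @antidifferent_sum R _ T s W E linT lins _ _ _ _ _ _ _
    n (fun k z => q (upd z i k%:R)) L.
- move=> v; apply/funext => z; rewrite /T /op /s !fctE ea_t /shift_down upd_same.
  by rewrite -scalemxAr scalerBl scale1r.
- by move=> u v Wu Wv; rewrite -[u]scale1r; apply: W_lin.
- by move=> b v Wv; rewrite -[_ *: _]addr0; apply: W_lin.
- exact: W_T.
- move=> v [pv iv]; split=> [a|g Gg].
    apply: (@polyfun_ext _ _ (fun z => z i * v z a 0)).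
      by move=> z; rewrite mxE.
    by apply: polyfun_mul; first exact: polyfun_var.
  apply/funext => z; rewrite /op /s ea_coord; last exact: subgroupV.
  by rewrite -scalemxAr -[in RHS](iv g Gg).
- by move=> v [pv iv]; split=> // a; apply: polyfunW (pv a) => l /ltnW.
- exact: E_algebraic.
- move=> k; split=> [a|g Gg]; first exact: polyfun_upd (pq a).
  apply/funext => z; rewrite /op -ea_upd; last exact: subgroupV.
  by rewrite -[in RHS](iq g Gg).
exists p => //; rewrite -pE; apply/funext => z; rewrite LE// fct_sumE.
apply: eq_bigr => k _; rewrite fct_sumE horner_coef scaler_suml.
by apply: eq_bigr => l _ /=; rewrite scalrfctE ds_iter scalerA.
Qed.

(** After the trivialisation along [Gam i] the cocycle vanishes on [Gam i]; its value [q] at [t i]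
    is then invariant under [Gam i], and what remains is the difference equation [q = p - T p]. *)
Lemma extended_cocycle_trivial c :
  (forall g, Gam i.+1 g -> forall a, polyfun (lt i.+1) (fun z => c g z a 0)) ->
  cocycle (Gam i.+1) ea M c ->
  exists2 u : S -> 'cV[R]_r, (forall a, polyfun (lt i.+1) (fun z => u z a 0)) &
    forall g, Gam i.+1 g -> forall z, c g z = coboundary ea M u g z.
Proof.
move=> pc cc; have [u pu uE] := trivial_below pc cc.
pose c' g z := c g z - coboundary ea M u g z.
have cc' : cocycle (Gam i.+1) ea M c' := cocycle_sub_coboundary sGS aE rM u cc.
have c'0 g : Gam i g -> forall z, c' g z = 0.
  by move=> Gg z; rewrite /c' uE// subrr.
have [p [pp ip] pE] : exists2 p, W p & c' (t i) = p - T p.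
  apply: solve; split=> [a|g Gg].
    apply: (@polyfun_ext _ _ (fun z => c (t i) z a 0 -
        (u z a 0 - \sum_b M (t i) a b * u (ea (t i)^-1%g z) b 0))).
      by move=> z; rewrite /c' /coboundary !mxE.
    apply: polyfun_sub; first exact: pc.
    apply: polyfun_sub => //; apply: polyfun_sum => b _; apply: polyfun_scale.
    apply: polyfun_comp (pu b) _ => l li.
    exact: (extended_poly gc ih md pF pF' FK F'K Vt li).
  apply/funext => z.
  have Ggt : (g * t i = t i * ((t i)^-1 * g * t i))%g by rewrite !mulgA mulgV mul1g.
  have := cc' _ _ (Gs Gg) Gt z; rewrite (c'0 g Gg) add0r /op => <-.
  by rewrite Ggt cc' ?(c'0 _ (conjV Gg)) ?mulmx0 ?addr0//; apply/Gs/conjV.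
exists (fun z => u z + p z) => [a|].
  apply: (@polyfun_ext _ _ (fun z => u z a 0 + p z a 0)).
    by move=> z; rewrite mxE.
  exact: polyfun_add.
have cc2 := cocycle_sub_coboundary sGS aE rM p cc'.
suff Q : forall g, Gam i.+1 g -> forall z, c' g z - coboundary ea M p g z = 0.
  move=> g Gg z; have := Q g Gg z; rewrite /c' /coboundary => /eqP.
  rewrite !subr_eq add0r => /eqP ->.
  rewrite mulmxDr; move: (M g *m u _) (M g *m p _) (u z) (p z) => a b a' b'.
  by apply/colP => k; rewrite !mxE; ring.
apply: (chain_ind gc ih).
- move=> g Gg z; rewrite c'0// /coboundary.
  by have := congr1 (@^~ z) (ip g Gg); rewrite /op => ->; rewrite subrr subr0.
- by move=> z; rewrite pE /coboundary /= -/(op (t i) p z) -/(T) subrr.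
- move=> g g' Gg Gg' Eg Eg'; exact: (cocycle_zeroM cc2 Gg Gg' Eg Eg').
- move=> g Gg Eg; exact: (cocycle_zeroV sGS aE rM cc2 Gg Eg).
Qed.

End ExtendedH1.

Lemma model_extend {R : realType} {G : groupType}
    (H : set G) (h : nat) (Gam : nat -> set G) (t : nat -> G) (st en : nat -> nat)
    (gc : good_chain H h Gam t st en) (i : nat) (act : G -> (nat -> R) -> nat -> R) :
  (i < h)%N -> model Gam t en i act -> exists act' : G -> (nat -> R) -> nat -> R, model Gam t en i.+1 act'.
Proof.
move=> ih md; have [F [F' [pF pF' FK F'K eqF]]] := twist_bijection gc ih md.
exists (extended_act Gam t i act F F'); split.
- exact: (extended_acts gc ih md).
- exact: (extended_above gc ih md).
- exact: (extended_poly gc ih md).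
- exact: (extended_fix gc ih md).
- exact: (extended_shift gc ih md).
- exact: (extended_block gc ih md).
- exact: (extended_dense gc ih md).
- move=> r M c rM pc cc.
  have [u pu uE] := extended_cocycle_trivial gc ih md pF pF' FK F'K eqF rM pc cc.
  by exists u; split.
Qed.

Lemma model_exists {R : realType} {G : groupType}
    (H : set G) (h : nat) (Gam : nat -> set G) (t : nat -> G) (st en : nat -> nat) :
  good_chain H h Gam t st en ->
  exists act : G -> (nat -> R) -> nat -> R, model Gam t en h act.
Proof.
move=> gc; suff : forall i, (i <= h)%N ->
  exists act : G -> (nat -> R) -> nat -> R, model Gam t en i act by apply.
elim=> [_|i IH ih]; last first.
  by have [act md] := IH (ltnW ih); apply: (model_extend gc ih md).
have aG : acts (Gam 0%N) (fun _ : G => @id (nat -> R)) by [].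
exists (fun=> id); split=> // [f pf x0 f0 x|r M c rM pc cc].
  rewrite -[RHS](f0 1%g) ?(chain0 gc)//.
  by apply: polyfun_dep pf _.
have sG := chain_subgroup gc (leq0n h).
exists (fun=> 0); split=> // [a|g].
  by apply: (polyfun_ext _ (polyfun_cst _ 0)) => z; rewrite mxE.
rewrite (chain0 gc) => -> z.
by rewrite (cocycle1 sG aG rM)// mulmx0 subr0.
Qed.

(** * The theorem of Poincare-Miranda *)

(* Cubical cochains modulo 2 on the grid: a cube is a base point [v] with a set
   [D] of directions. *)
Section CubicalCochains.
Variables (n : nat) (F2 : comNzRingType).
Hypothesis addF2 : forall x : F2, x + x = 0.
Implicit Types (v : nat -> nat) (D : {set 'I_n}) (f : (nat -> nat) -> {set 'I_n} -> F2).

Definition step v (d : nat) (e : bool) : nat -> nat := fun i => (v i + (e && (i == d)))%N.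
Definition corner v D : nat -> nat := fun i => (v i + [exists d in D, (d : nat) == i])%N.

(** The cubical coboundary modulo 2: every direction contributes its two opposite faces. *)
Definition codiff f v D : F2 :=
  \sum_(d in D) (f (step v d true) (D :\ d) + f (step v d false) (D :\ d)).

Lemma step_comm v d e d' e' : step (step v d e) d' e' = step (step v d' e') d e.
Proof. by apply/funext => i; rewrite /step addnAC. Qed.

Lemma step_false v d : step v d false = v.
Proof. by apply/funext => i; rewrite /step addn0. Qed.

(** Every unordered pair of directions occurs twice. *)
Lemma sum_symmetric D (g : 'I_n -> 'I_n -> F2) : (forall d d', g d d' = g d' d) ->
  \sum_(d in D) \sum_(d' in D :\ d) g d d' = 0.
Proof.
move=> gC.
rewrite (exchange_big_dep (fun d' => d' \in D)) /=; last first.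
  by move=> d d' _; rewrite !inE => /andP [].
have E : \sum_(d in D) \sum_(d' in D :\ d) g d d' =
    \sum_(d in D) \sum_(d' in D | (d < d')%N) g d d' +
    \sum_(d in D) \sum_(d' in D | (d' < d)%N) g d d'.
  rewrite -big_split; apply: eq_bigr => d dD /=.
  rewrite (bigID (fun d' : 'I_n => (d < d')%N)) /=; congr (_ + _); apply: eq_bigl => d'.
    by rewrite !inE -val_eqE /=; case: ltngtP; rewrite ?andbT ?andbF.
  by rewrite !inE -val_eqE /=; case: ltngtP; rewrite ?andbT ?andbF.
have E2 : \sum_(d in D) \sum_(d' in D | (d' < d)%N) g d d' =
    \sum_(d in D) \sum_(d' in D | (d < d')%N) g d d'.
  rewrite (exchange_big_dep (fun d' => d' \in D)) /=; last by move=> d d' _ /andP [].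
  apply: eq_bigr => d dD; apply: eq_big => [d'|d' _]; last exact: gC.
  by rewrite dD.
transitivity (\sum_(d in D) \sum_(d' in D :\ d) g d d'); last by rewrite E E2 addF2.
apply: eq_bigr => d dD; apply: eq_big => [d'|d' _]; last exact: gC.
by rewrite !inE dD andbT eq_sym andbC.
Qed.

Lemma codiff2 f v D : codiff (codiff f) v D = 0.
Proof.
rewrite /codiff.
under eq_bigr => d _ do rewrite -big_split /=.
pose g (d d' : 'I_n) := (f (step (step v d true) d' true) (D :\ d :\ d') +
                f (step (step v d true) d' false) (D :\ d :\ d')) +
               (f (step (step v d false) d' true) (D :\ d :\ d') +
                f (step (step v d false) d' false) (D :\ d :\ d')).
apply: (@sum_symmetric D g) => d d'; rewrite /g.
have -> : D :\ d :\ d' = D :\ d' :\ d by rewrite !finset.setDDl finset.setUC.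
by rewrite addrACA !(step_comm _ d).
Qed.

Variable s : nat -> (nat -> nat) -> bool.

(** The cup product of the coboundaries of the 0-cochains [s 0], ..., [s k.-1]. As [cup k'] is
    closed, its product with the coboundary of [s k'] is the coboundary of its product with [s k'],
    the latter being evaluated at the last vertex of the cube. *)
Fixpoint cup k v D : F2 :=
  if k is k'.+1 then codiff (fun w D' => cup k' w D' * (s k' (corner w D'))%:R) v D
  else 1.

Definition constant_on j v D := exists b, forall w,
  (forall i, (v i <= w i)%N && (w i <= corner v D i)%N) -> s j w = b.

Lemma corner_face v D d e i : d \in D ->
  (corner (step v d e) (D :\ d) i <= corner v D i)%N.
Proof.
move=> dD; rewrite /corner /step.
case: (i =P (d : nat)) => [->|ne].
  have -> : [exists d0 in D, (d0 : nat) == d] by apply/existsP; exists d; rewrite dD eqxx.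
  have -> : [exists d0 in D :\ d, (d0 : nat) == d] = false.
    apply/negbTE/existsPn => d'; rewrite !inE -val_eqE /=.
    by case: eqP; rewrite ?andbF.
  by rewrite addn0 leq_add2l andbT leq_b1.
rewrite andbF addn0 leq_add2l.
case: existsP => // -[d']; rewrite !inE => /andP [/andP [_ d'D] d'i].
by have -> : [exists d0 in D, (d0 : nat) == i] by apply/existsP; exists d'; rewrite d'D.
Qed.

Lemma constant_on_face j v D d e : d \in D -> constant_on j v D ->
  constant_on j (step v d e) (D :\ d).
Proof.
move=> dD [b bE]; exists b => w wE; apply: bE => i.
have /andP [vw wv] := wE i; rewrite (leq_trans _ vw) ?leq_addr//.
exact: (leq_trans wv (corner_face _ _ _ dD)).
Qed.

(** If [s j] is constant on the cube it comes out of its coboundary, which then is a multiple of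
    [codiff (cup j)] and vanishes; the later products inherit this from the faces. *)
Lemma cup_constant k j v D : (j < k)%N -> constant_on j v D -> cup k v D = 0.
Proof.
elim: k v D => // k IH v D; rewrite ltnS leq_eqVlt => /orP [/eqP ->|jk] cst; last first.
  rewrite /= /codiff big1// => d dD.
  by rewrite !IH ?mul0r ?addr0//; apply: constant_on_face.
have [b bE] := cst.
have sb d e : d \in D -> s k (corner (step v d e) (D :\ d)) = b.
  move=> dD; apply: bE => i; rewrite corner_face// andbT.
  by rewrite /corner /step -addnA leq_addr.
rewrite /= /codiff.
have -> : \sum_(d in D) (cup k (step v d true) (D :\ d) *
      (s k (corner (step v d true) (D :\ d)))%:R +
      cup k (step v d false) (D :\ d) * (s k (corner (step v d false) (D :\ d)))%:R)
    = b%:R * codiff (cup k) v D.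
  rewrite /codiff big_distrr; apply: eq_bigr => d dD /=.
  by rewrite !sb// -mulrDl mulrC.
suff -> : codiff (cup k) v D = 0 by rewrite mulr0.
case: k {IH sb bE cst b} => [|k]; last exact: codiff2.
by rewrite /codiff big1// => d _ /=; rewrite addF2.
Qed.

Variable m : nat.

Definition updn (v : nat -> nat) (i a : nat) : nat -> nat := fun j => if j == i then a else v j.

Fixpoint gridsum k (f : (nat -> nat) -> F2) v : F2 :=
  if k is k'.+1 then \sum_(a < m) gridsum k' f (updn v k' a) else f v.

Lemma gridsumD k (f g : (nat -> nat) -> F2) v :
  gridsum k (fun v => f v + g v) v = gridsum k f v + gridsum k g v.
Proof.
elim: k v => //= k IH v; rewrite -big_split; apply: eq_bigr => a _; exact: IH.
Qed.

Lemma gridsum_eq k (f g : (nat -> nat) -> F2) v :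
  (forall w, (forall i, (k <= i)%N -> w i = v i) -> (forall i, (i < k)%N -> (w i < m)%N) ->
    f w = g w) ->
  gridsum k f v = gridsum k g v.
Proof.
elim: k v => [|k IH] v fg /=; first by apply: fg.
apply: eq_bigr => a _; apply: IH => w wv wm; apply: fg => i.
  by move=> ki; rewrite (wv i (ltnW ki)) /updn; case: eqP => // E; rewrite E ltnn in ki.
rewrite ltnS leq_eqVlt => /orP [/eqP ->|]; last exact: wm.
by rewrite wv// /updn eqxx.
Qed.

Lemma gridsum0 k v : gridsum k (fun=> 0) v = 0.
Proof. by elim: k v => //= k IH v; rewrite big1// => a _; apply: IH. Qed.

Lemma gridsum_step k (f : (nat -> nat) -> F2) d v : (k <= d)%N ->
  gridsum k (fun w => f (step w d true)) v = gridsum k f (step v d true).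
Proof.
elim: k v => //= k IH v kd; apply: eq_bigr => a _; rewrite (IH _ (ltnW kd)).
congr (gridsum _ _ _); apply/funext => i; rewrite /updn /step.
by case: eqP => // ->; rewrite ltn_eqF// addn0.
Qed.

Lemma sum_telescope (g : nat -> F2) k : \sum_(a < k) (g a.+1 + g a) = g k + g 0%N.
Proof.
elim: k => [|k IH]; first by rewrite big_ord0 addF2.
by rewrite big_ord_recr /= IH addrC -addrA (addrA (g k)) addF2 add0r.
Qed.

Lemma gridsum_last k (f : (nat -> nat) -> F2) v :
  gridsum k.+1 (fun w => f (step w k true) + f w) v =
  gridsum k f (updn v k m) + gridsum k f (updn v k 0).
Proof.
rewrite /= -(sum_telescope (fun a => gridsum k f (updn v k a))).
apply: eq_bigr => a _; rewrite gridsumD gridsum_step//; congr (gridsum _ _ _ + _).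
by apply/funext => i; rewrite /step /updn andTb; case: eqP => _; rewrite ?addn0 ?addn1.
Qed.

Lemma gridsum_vanish k (f : (nat -> nat) -> F2) v d : (d < k)%N ->
  (forall w, w d = 0%N \/ w d = m -> f w = 0) ->
  gridsum k (fun w => f (step w d true) + f w) v = 0.
Proof.
move=> + f0; elim: k v => // k IH v; rewrite ltnS leq_eqVlt => /orP [/eqP E|dk]; last first.
  by rewrite /= big1// => a _; apply: IH.
have f0' a : a = 0%N \/ a = m -> gridsum k f (updn v k a) = 0.
  move=> am; rewrite -(gridsum0 k (updn v k a)); apply: gridsum_eq => w wv _.
  by apply: f0; rewrite E wv// /updn eqxx.
by rewrite E gridsum_last !f0' ?addr0//; [left|right].
Qed.

Hypotheses (s0 : forall i w, (i < n)%N -> w i = 0%N -> s i w = false)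
  (sm : forall i w, (i < n)%N -> w i = m -> s i w = true).

(** Stokes' formula. In a direction [d < k] the boundary faces contribute nothing, as [s d] is
    constant there; in the direction [k] only the face [w k = m] counts, where [s k] is 1, and its
    sum is known by induction. *)
Lemma cup_sum k v : (k <= n)%N ->
  gridsum k (fun w => cup k w [set d : 'I_n | (d < k)%N]%SET) v = 1.
Proof.
elim: k v => // k IH v kn; set D := [set d : 'I_n | _]%SET.
pose f d w := cup k w (D :\ d) * (s k (corner w (D :\ d)))%:R.
have -> : gridsum k.+1 (fun w => cup k.+1 w D) v =
    \sum_(d in D) gridsum k.+1 (fun w => f d (step w d true) + f d w) v.
  have gsum (r : seq 'I_n) (P : pred 'I_n) (F : 'I_n -> (nat -> nat) -> F2) w :
      gridsum k.+1 (fun w => \sum_(d <- r | P d) F d w) w =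
      \sum_(d <- r | P d) gridsum k.+1 (F d) w.
    elim: r => [|d r IHr].
      by rewrite big_nil -[RHS](gridsum0 k.+1 w); congr gridsum; apply/funext => x; rewrite big_nil.
    rewrite big_cons -IHr; case: ifP => Pd.
      by rewrite -gridsumD; congr gridsum; apply/funext => x; rewrite big_cons Pd.
    by congr gridsum; apply/funext => x; rewrite big_cons Pd.
  rewrite -gsum; congr gridsum; apply/funext => w /=.
  by apply: eq_bigr => d _; rewrite step_false.
have cornerd w (d : 'I_n) : corner w (D :\ d) d = w d.
  rewrite /corner; have -> : [exists d0 in D :\ d, (d0 : nat) == d] = false.
    apply/negbTE/existsPn => d'; rewrite !inE -val_eqE /=.
    by case: eqP; rewrite ?andbF.
  by rewrite addn0.
pose ko := Ordinal kn.
have koD : ko \in D by rewrite inE /=.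
rewrite (bigD1 ko koD) /=.
rewrite [X in _ + X]big1 ?addr0; last first.
  move=> d /= /andP [dD dk].
  have {}dk : (d < k)%N.
    have : d \in D by []. 
    by move: dk; rewrite /D finset.in_set -val_eqE /= ltnS leq_eqVlt => /negbTE ->.
  apply: (@gridsum_vanish k.+1); first by rewrite ltnS ltnW.
  move=> w wd; rewrite /f (@cup_constant k d) ?mul0r//.
  have [b bE] : exists b, forall w' : nat -> nat, w' d = w d -> s d w' = b.
    by case: wd => ->; [exists false => w'; apply: s0|exists true => w'; apply: sm].
  exists b => w' w'E; apply: bE; have := w'E d; rewrite cornerd.
  by rewrite -eqn_leq => /eqP.
have Dk : D :\ ko = [set d : 'I_n | (d < k)%N]%SET.
  by apply/finset.setP => d; rewrite !inE -val_eqE /= ltnS ltn_neqAle.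
have := gridsum_last k (f ko) v; rewrite /= => ->.
have -> : gridsum k (f ko) (updn v k 0) = 0.
  rewrite -(gridsum0 k (updn v k 0)); apply: gridsum_eq => w wv _.
  by rewrite /f (s0 (i := k)) ?mulr0// (cornerd w ko) wv// /updn eqxx.
rewrite addr0 -[RHS](IH (updn v k m) (ltnW kn)); apply: gridsum_eq => w wv _.
rewrite /f (sm (i := k)) ?mulr1 ?Dk// -Dk (cornerd w ko) wv// /updn eqxx//.
Qed.

(** If every cube had a constant label, all terms of [cup_sum] would vanish, while their sum is
    1. *)
Lemma cube_of_both_values : exists v : nat -> nat,
  (forall i, (i < n)%N -> (v i < m)%N) /\
  forall i b, (i < n)%N -> exists2 w : nat -> nat,
    (forall j, (v j <= w j <= (v j).+1)%N) & s i w = b.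
Proof.
pose D := [set d : 'I_n | (d < n)%N]%SET.
apply: contrapT => no.
have : gridsum n (fun w => cup n w D) (fun=> 0%N) = 1 by apply: cup_sum.
have -> : gridsum n (fun w => cup n w D) (fun=> 0%N) = 0.
  rewrite -(gridsum0 n (fun=> 0%N)); apply: gridsum_eq => v _ vm.
  have [i [b [ni nb]]] : exists i b, (i < n)%N /\ forall w : nat -> nat,
      (forall j, (v j <= w j <= (v j).+1)%N) -> s i w <> b.
    apply: contrapT => all; apply: no; exists v; split=> // i b ni.
    apply: contrapT => nw; apply: all; exists i, b; split=> // w wv sw.
    by apply: nw; exists w.
  apply: (cup_constant ni); exists (~~ b) => w wv.
  have wv' j : (v j <= w j <= (v j).+1)%N.
    have /andP [-> /=] := wv j; rewrite /corner => /leq_trans; apply.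
    by case: existsP => _; rewrite ?addn0 ?addn1.
  by have := nb w wv'; case: (s i w); case: (b).
by move=> /eqP; rewrite eq_sym oner_eq0.
Qed.

End CubicalCochains.

Lemma cubical_miranda (n : nat) (s : nat -> (nat -> nat) -> bool) (m : nat) :
  (forall i w, (i < n)%N -> w i = 0%N -> s i w = false) ->
  (forall i w, (i < n)%N -> w i = m -> s i w = true) ->
  exists v : nat -> nat,
  (forall i, (i < n)%N -> (v i < m)%N) /\
  forall i b, (i < n)%N -> exists2 w : nat -> nat,
    (forall j, (v j <= w j <= (v j).+1)%N) & s i w = b.
Proof.
apply: (@cube_of_both_values n 'F_2) => x.
by rewrite -mulr2n -mulr_natr (pchar_Zp (p := 2)) ?mulr0.
Qed.

(** * Maps of dense image *)

Section LocallyLipschitz.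
Context {R : realType}.
Local Notation S := (nat -> R).
Implicit Types (f g : S -> R) (x y : S) (n m : nat) (r : R).

Definition dist1 n x y : R := \sum_(i < n) `|x i - y i|.
Definition box n r x := forall i, (i < n)%N -> `|x i| <= r.
(** Lipschitz on each box, so that polynomials belong to the class; the distance also forces [f] to
    depend on the first [n] coordinates alone. *)
Definition loclip n f := forall r, exists2 L, 0 <= L &
  forall x y, box n r x -> box n r y -> `|f x - f y| <= L * dist1 n x y.

Lemma dist1_ge0 n x y : 0 <= dist1 n x y.
Proof. exact: sumr_ge0. Qed.

Lemma dist1_ge n x y i : (i < n)%N -> `|x i - y i| <= dist1 n x y.
Proof.
move=> ni; rewrite /dist1 (bigD1 (Ordinal ni)) //= lerDl; exact: sumr_ge0.
Qed.

Lemma boxW n r r' x : r <= r' -> box n r x -> box n r' x.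
Proof. by move=> rr bx i ni; apply: le_trans rr; apply: bx. Qed.

Lemma loclip_cst n c : loclip n (fun=> c).
Proof. by move=> r; exists 0 => // x y _ _; rewrite subrr normr0 mul0r. Qed.

Lemma loclip_var n i : (i < n)%N -> loclip n (fun x => x i).
Proof. by move=> ni r; exists 1 => // x y _ _; rewrite mul1r dist1_ge. Qed.

Lemma loclip_add n f g : loclip n f -> loclip n g -> loclip n (fun x => f x + g x).
Proof.
move=> lf lg r; have [L L0 fL] := lf r; have [M M0 gM] := lg r.
exists (L + M) => [|x y bx byy]; first exact: addr_ge0.
rewrite opprD addrACA mulrDl (le_trans (ler_normD _ _))//.
by rewrite lerD ?fL ?gM.
Qed.

Lemma loclip_bound n f r : loclip n f -> exists2 B, 0 <= B &
  forall x, box n r x -> `|f x| <= B.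
Proof.
move=> /(_ r) [L L0 fL].
have [[x0 b0]|no] := pselect (exists x, box n r x); last first.
  by exists 0 => // x bx; case: no; exists x.
have r0 : 0 <= r *+ n.
  case: n {fL} b0 => [|n] b0; first by rewrite mulr0n.
  by rewrite mulrn_wge0// (le_trans _ (b0 0%N isT)).
exists (`|f x0| + L * (r *+ n + r *+ n)) => [|x bx].
  by rewrite addr_ge0// mulr_ge0// addr_ge0.
rewrite -[f x](subrK (f x0)) (le_trans (ler_normD _ _))// addrC lerD2l.
rewrite (le_trans (fL _ _ bx b0))// ler_wpM2l// /dist1.
have sumr (z : S) : box n r z -> \sum_(i < n) `|z i| <= r *+ n.
  move=> bz; rewrite -[X in _ *+ X]card_ord -sumr_const; apply: ler_sum => i _; exact: bz.
apply: (@le_trans _ _ (\sum_(i < n) `|x i| + \sum_(i < n) `|x0 i|)); last by rewrite lerD ?sumr.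
by rewrite -big_split; apply: ler_sum => i _; apply: ler_normB.
Qed.

Lemma loclip_mul n f g : loclip n f -> loclip n g -> loclip n (fun x => f x * g x).
Proof.
move=> lf lg r; have [L L0 fL] := lf r; have [M M0 gM] := lg r.
have [B B0 fB] := loclip_bound r lf; have [C C0 gC] := loclip_bound r lg.
exists (L * C + B * M) => [|x y bx byy].
  by apply: addr_ge0; apply: mulr_ge0.
have -> : f x * g x - f y * g y = (f x - f y) * g x + f y * (g x - g y) by ring.
rewrite (le_trans (ler_normD _ _))// !normrM mulrDl.
rewrite lerD//.
  by rewrite mulrAC ler_pM// ?fL ?gC.
by rewrite -mulrA ler_pM// ?fB ?gM.
Qed.

Lemma loclip_alg n : funalg (loclip n).
Proof. by split=> *; [exact: loclip_cst|exact: loclip_add|exact: loclip_mul]. Qed.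

Lemma loclip_poly n (P : pred nat) f : (forall i, P i -> (i < n)%N) -> polyfun P f -> loclip n f.
Proof.
move=> Pn pf; apply: (funalg_polyfun (F := id) (loclip_alg n) pf) => i Pi.
exact/loclip_var/Pn.
Qed.

Lemma loclip_contract n f (phi : R -> R) :
  (forall a b, `|phi a - phi b| <= `|a - b|) -> loclip n f -> loclip n (fun x => phi (f x)).
Proof.
move=> c lf r; have [L L0 fL] := lf r; exists L => // x y bx byy.
exact: le_trans (c _ _) (fL _ _ bx byy).
Qed.

Lemma loclip_norm n f : loclip n f -> loclip n (fun x => `|f x|).
Proof. by apply: loclip_contract => a b; apply: ler_dist_dist. Qed.

Lemma loclip_scale n c f : loclip n f -> loclip n (fun x => c * f x).
Proof. by move=> lf; apply: loclip_mul => //; apply: loclip_cst. Qed.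

Lemma loclip_sub n f g : loclip n f -> loclip n g -> loclip n (fun x => f x - g x).
Proof.
move=> lf lg; have := loclip_add lf (loclip_scale (-1) lg).
by congr loclip; apply/funext => x; rewrite mulN1r.
Qed.

Lemma loclip_max n f g : loclip n f -> loclip n g ->
  loclip n (fun x => Num.max (f x) (g x)).
Proof.
move=> lf lg; have := loclip_scale (2%:R^-1)
  (loclip_add (loclip_add lf lg) (loclip_norm (loclip_sub lf lg))).
by congr loclip; apply/funext => x; rewrite maxr_absE mulrC.
Qed.

Lemma loclip_min n f g : loclip n f -> loclip n g ->
  loclip n (fun x => Num.min (f x) (g x)).
Proof.
move=> lf lg; have := loclip_scale (2%:R^-1)
  (loclip_sub (loclip_add lf lg) (loclip_norm (loclip_sub lf lg))).
by congr loclip; apply/funext => x; rewrite minr_absE mulrC.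
Qed.

Lemma loclip_inv n f : (forall x, 1 <= f x) -> loclip n f -> loclip n (fun x => (f x)^-1).
Proof.
move=> f1 lf r; have [L L0 fL] := lf r; exists L => // x y bx byy.
have [fx fy] : 0 < f x /\ 0 < f y by split; apply: lt_le_trans (f1 _).
have -> : (f x)^-1 - (f y)^-1 = (f y - f x) / (f x * f y).
  by field; rewrite !lt0r_neq0.
rewrite normrM distrC (le_trans _ (fL _ _ bx byy))// ler_piMr//.
rewrite normrV ?unitfE ?mulf_neq0 ?lt0r_neq0// invf_le1 ?normr_gt0 ?mulf_neq0 ?lt0r_neq0//.
by rewrite ger0_norm ?mulr_ege1// mulr_ge0 ?ltW.
Qed.

Lemma loclip_sum n I (s : seq I) (F : I -> S -> R) : (forall i, loclip n (F i)) ->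
  loclip n (fun x => \sum_(i <- s) F i x).
Proof.
move=> lF; elim: s => [|i s IH].
  have := loclip_cst n 0; by congr loclip; apply/funext => x; rewrite big_nil.
have := loclip_add (lF i) IH; by congr loclip; apply/funext => x; rewrite big_cons.
Qed.

Lemma loclip_comp n m f (F : S -> S) : loclip m f ->
  (forall i, (i < m)%N -> loclip n (fun x => F x i)) -> loclip n (fun x => f (F x)).
Proof.
move=> lf lF r.
have bnd : exists2 B, 0 <= B & forall x, box n r x -> box m B (F x).
  elim: m {lf} lF => [|m IH] lF; first by exists 0.
  have [i mi|B B0 BF] := IH; first by apply: lF; apply: ltnW.
  have [C C0 CF] := loclip_bound r (lF m (ltnSn m)).
  exists (Num.max B C); first by rewrite le_max B0.
  move=> x bx i; rewrite ltnS leq_eqVlt le_max => /orP [/eqP ->|im].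
    by rewrite CF// orbT.
  by rewrite BF.
have [B B0 BF] := bnd; have [L L0 fL] := lf B.
have lip : exists2 M, 0 <= M & forall x y, box n r x -> box n r y ->
    dist1 m (F x) (F y) <= M * dist1 n x y.
  elim: m {lf BF fL bnd} lF => [|m IH] lF.
    by exists 0 => // x y _ _; rewrite /dist1 big_ord0 mul0r.
  have [i mi|M M0 MF] := IH; first by apply: lF; apply: ltnW.
  have [N N0 NF] := lF m (ltnSn m) r.
  exists (M + N) => [|x y bx byy]; first exact: addr_ge0.
  by rewrite /dist1 big_ord_recr mulrDl lerD// ?MF// NF.
have [M M0 MF] := lip; exists (L * M) => [|x y bx byy]; first exact: mulr_ge0.
by rewrite (le_trans (fL _ _ (BF _ bx) (BF _ byy)))// -mulrA ler_wpM2l// MF.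
Qed.

Lemma loclip_local n f : (forall r, exists2 g, loclip n g & forall x, box n r x -> f x = g x) ->
  loclip n f.
Proof.
move=> loc r; have [g lg fg] := loc r; have [L L0 gL] := lg r; exists L => // x y bx byy.
by rewrite !fg// gL.
Qed.

Lemma loclip_dep n f x y : loclip n f -> (forall i, (i < n)%N -> x i = y i) -> f x = f y.
Proof.
move=> lf xy; pose r := \big[Num.max/0]_(i < n) `|x i|.
have bx : box n r x by move=> i ni; apply: (le_bigmax _ (fun i : 'I_n => `|x i|) (Ordinal ni)).
have byy : box n r y by move=> i ni; rewrite -xy//; apply: bx.
have [L L0 fL] := lf r; have := fL _ _ bx byy.
have -> : dist1 n x y = 0 by rewrite /dist1 big1// => i _; rewrite xy// subrr normr0.
by rewrite mulr0 normr_le0 subr_eq0 => /eqP.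
Qed.

(** Vertices of a fine grid are labelled by the signs of the [f i]; on a cube where each label takes
    both values, every [f i] is within [eps] of a change of sign. *)
Lemma approximate_miranda n (f : nat -> S -> R) (K : R) (eps : R) : 0 < K -> 0 < eps ->
  (forall i, (i < n)%N -> loclip n (f i)) ->
  (forall i x, (i < n)%N -> box n K x -> x i = K -> 0 <= f i x) ->
  (forall i x, (i < n)%N -> box n K x -> x i = - K -> f i x <= 0) ->
  exists2 x, box n K x & forall i, (i < n)%N -> `|f i x| <= eps.
Proof.
move=> K0 e0 lf fK fNK.
have [L L0 fL] : exists2 L, 0 <= L & forall i x y, (i < n)%N -> box n K x -> box n K y ->
    `|f i x - f i y| <= L * dist1 n x y.
  have : forall k, (k <= n)%N -> exists2 L, 0 <= L & forall i x y, (i < k)%N ->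
      box n K x -> box n K y -> `|f i x - f i y| <= L * dist1 n x y.
    elim=> [|k IH] kn; first by exists 0.
    have [L L0 LE] := IH (ltnW kn); have [M M0 ME] := lf k kn K.
    exists (L + M) => [|i x y]; first exact: addr_ge0.
    rewrite ltnS leq_eqVlt => /orP [/eqP ->|ik] bx byy; rewrite mulrDl.
      by rewrite (le_trans (ME _ _ bx byy))// lerDr mulr_ge0// dist1_ge0.
    by rewrite (le_trans (LE _ _ _ ik bx byy))// lerDl mulr_ge0// dist1_ge0.
  by move=> /(_ n (leqnn n)).
(* With [m > A] subdivisions the mesh is [2 * K / m], and the Lipschitz bound over [n] directions is
   at most [eps]. *)
pose A := L * (2 * K) *+ n / eps.
have A0 : 0 <= A.
  by apply: divr_ge0; [apply: mulrn_wge0; apply: mulr_ge0 => //; nra|exact: ltW].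
pose m := (Num.trunc A).+1.
have mA : A < m%:R by have := truncnS_gt A.
have m0 : 0 < m%:R :> R by rewrite ltr0n.
pose pt (v : nat -> nat) : S := fun i => - K + 2 * K * ((minn (v i) m)%:R / m%:R).
have ptb v : box n K (pt v).
  move=> i ni; rewrite /pt.
  have : (minn (v i) m)%:R / m%:R <= 1 :> R by rewrite ler_pdivrMr// mul1r ler_nat geq_minr.
  have : 0 <= (minn (v i) m)%:R / m%:R :> R by rewrite divr_ge0// ltW.
  move: (_ / _) => a a0 a1; rewrite ler_norml; apply/andP; split; nra.
(* On the two extreme faces the label is imposed, because the hypotheses only give weak inequalities
   there. *)
pose s i v := (v i == m) || (v i != 0%N) && (0 < f i (pt v)).
have [||v [vm vs]] := @cubical_miranda n s m.
- by move=> i w ni wi; rewrite /s wi eqxx.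
- by move=> i w ni wi; rewrite /s wi eqxx.
have close w : (forall j, (v j <= w j <= (v j).+1)%N) ->
    forall i, (i < n)%N -> `|f i (pt v) - f i (pt w)| <= eps.
  move=> vw i ni; rewrite (le_trans (fL _ _ _ ni (ptb v) (ptb w)))//.
  have : dist1 n (pt v) (pt w) <= (2 * K / m%:R) *+ n.
    rewrite /dist1 -[X in _ *+ X]card_ord -sumr_const; apply: ler_sum => j _.
    rewrite /pt opprD addrACA subrr add0r -mulrBr -mulrBl normrM ger0_norm; last by nra.
    rewrite ler_pM2l; last by nra.
    rewrite normrM [X in _ * X]gtr0_norm ?invr_gt0// -[leRHS]mul1r ler_pM2r ?invr_gt0//.
    have /andP [wj1 wj2] := vw j; have vj := vm j (ltn_ord j).
    have [<-|->] : (v j = w j) \/ (w j = (v j).+1) by lia.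
      by rewrite subrr normr0.
    rewrite (minn_idPl (ltnW vj)) (minn_idPl vj) -addn1 natrD opprD addrA subrr sub0r.
    by rewrite normrN normr1.
  move=> /(ler_wpM2l L0) /le_trans; apply.
  rewrite mulrnAr mulrA -mulrnAl ler_pdivrMr// [eps * _]mulrC -ler_pdivrMr//.
  exact: ltW.
exists (pt v) => // i ni; rewrite ler_norml.
have [w vw sw] := vs i true ni; have [w' vw' sw'] := vs i false ni.
have fw : 0 <= f i (pt w).
  move: sw; rewrite /s => /orP [/eqP wi|/andP [_ /ltW//]].
  apply: fK => //; rewrite /pt wi minnn divff ?mulr1; last by rewrite gt_eqF.
  by ring.
have fw' : f i (pt w') <= 0.
  move: sw'; rewrite /s => /negbT; rewrite negb_or negb_and negbK => /andP [_ /orP []].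
    by move=> /eqP wi; apply: fNK => //; rewrite /pt wi min0n mul0r mulr0 addr0.
  by rewrite -leNgt.
have := close w vw i ni; have := close w' vw' i ni.
rewrite !ler_norml => /andP [_ c1] /andP [c2 _]; apply/andP; split; lra.
Qed.

Lemma loclipW n m f : (n <= m)%N -> loclip n f -> loclip m f.
Proof.
move=> nm lf r; have [L L0 fL] := lf r; exists L => // x y bx byy.
have /le_trans -> //: `|f x - f y| <= L * dist1 n x y.
  by apply: fL => i ni; [apply: bx|apply: byy]; apply: leq_trans nm.
rewrite ler_wpM2l// /dist1 (big_ord_widen_cond _ predT (fun i => `|x i - y i|) nm).
by rewrite [leRHS](bigID (fun i : 'I_m => (i < n)%N)) /= lerDl sumr_ge0.
Qed.

Definition clip01 (a : R) : R := Num.max 0 (Num.min 1 a).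
Definition bump n c x : R := \prod_(i < n) clip01 (c + 1 - `|x i|).

Lemma clip01_ge0 a : 0 <= clip01 a. Proof. by rewrite le_max lexx. Qed.
Lemma clip01_le1 a : clip01 a <= 1. Proof. by rewrite ge_max ler01 ge_min lexx. Qed.

Lemma bump_ge0 n c x : 0 <= bump n c x.
Proof. by apply: prodr_ge0 => i _; apply: clip01_ge0. Qed.

Lemma bump_le1 n c x : bump n c x <= 1.
Proof.
suff /andP [] : 0 <= bump n c x <= 1 by [].
rewrite /bump; elim: (index_enum _) => [|i s IH]; first by rewrite big_nil ler01 lexx.
rewrite big_cons; move: IH (clip01_ge0 (c + 1 - `|x i|)) (clip01_le1 (c + 1 - `|x i|)).
by move: (clip01 _) (\prod_(_ <- _) _) => a b /andP [? ?] ? ?; apply/andP; split; nra.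
Qed.

Lemma bump1 n c x : box n c x -> bump n c x = 1.
Proof.
move=> bx; rewrite /bump big1// => i _; rewrite /clip01.
have := bx i (ltn_ord i) => xi; rewrite min_l ?max_r//; lra.
Qed.

Lemma bump_eq0 n c x i : (i < n)%N -> c + 1 <= `|x i| -> bump n c x = 0.
Proof.
move=> ni xi; rewrite /bump (bigD1 (Ordinal ni))//= /clip01 min_r; last lra.
by rewrite max_l ?mul0r//; lra.
Qed.

Lemma bump_box n c x : bump n c x != 0 -> box n (c + 1) x.
Proof.
move=> b0 i ni; rewrite leNgt; apply/negP => xi.
by move/eqP: b0; apply; apply: (bump_eq0 ni); apply: ltW.
Qed.

Lemma loclip_bump n c : loclip n (bump n c).
Proof.
have lf (i : 'I_n) : loclip n (fun x => clip01 (c + 1 - `|x i|)).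
  apply: loclip_max; first exact: loclip_cst.
  apply: loclip_min; first exact: loclip_cst.
  apply: loclip_sub; first exact: loclip_cst.
  exact/loclip_norm/loclip_var.
rewrite /bump; elim: (index_enum _) => [|i s IH].
  have := loclip_cst n 1; by congr loclip; apply/funext => x; rewrite big_nil.
have := loclip_mul (lf i) IH; by congr loclip; apply/funext => x; rewrite big_cons.
Qed.

End LocallyLipschitz.

(** * Averaging over a proper cocompact action, and density of images *)

Section ProperActions.
Context {R : realType} {G : groupType}.
Local Notation S := (nat -> R).
Implicit Types (x y : S) (n m : nat) (r : R).

Definition proper_action (Gam : set G) n (act : G -> S -> S) := forall r,
  finite_set [set g | Gam g /\ exists2 x, box n r x & box n r (act g x)].
Definition cocompact_action (Gam : set G) n (act : G -> S -> S) :=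
  exists c : R, forall x, exists2 g, Gam g & box n c (act g x).

Variables (Gam : set G) (n : nat) (act : G -> S -> S).
Hypotheses (sG : is_subgroup Gam) (aG : acts Gam act)
  (lact : forall g i, Gam g -> (i < n)%N -> loclip n (fun x => act g x i))
  (act_fix : forall g x i, Gam g -> (n <= i)%N -> act g x i = x i)
  (pG : proper_action Gam n act) (cG : cocompact_action Gam n act).

Lemma loclip_act m g (f : S -> R) : (n <= m)%N -> Gam g -> loclip m f ->
  loclip m (fun x => f (act g x)).
Proof.
move=> nm Gg lf; apply: loclip_comp lf _ => i im.
have [ni|ni] := ltnP i n; first by apply: loclipW nm _; apply: lact.
have := @loclip_var R m i im; congr loclip; apply/funext => x; by rewrite act_fix.
Qed.

(** Properness: only finitely many translates of the support of the bump meet a given box. *)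
Lemma finite_bump c r : exists s : seq G, [/\ uniq s, (forall g, g \in s -> Gam g) &
  forall x g, box n r x -> Gam g -> g \notin s -> bump n c (act g^-1%g x) = 0].
Proof.
have [s0 sE] := (finite_seqP _).1 (pG (Num.max r (c + 1))).
exists (undup s0); split=> [|g|x g bx Gg]; first exact: undup_uniq.
  by rewrite mem_undup => gs; have : [set` s0] g by []; rewrite -sE => -[].
rewrite mem_undup => /negP gs; apply: contrapT => /eqP b0; apply: gs.
suff : [set` s0] g by [].
rewrite -sE; split=> //; exists (act g^-1%g x).
  by apply: boxW (bump_box b0); rewrite le_max lexx orbT.
by rewrite (actsK _ sG aG)//; apply: boxW bx; rewrite le_max lexx.
Qed.

Definition weighted_sum c (F : G -> R) x : R :=
  \sum_(g \in Gam) (bump n c (act g^-1%g x) * F g).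

Lemma weighted_sumE c F x (s : seq G) : uniq s -> (forall g, g \in s -> Gam g) ->
  (forall g, Gam g -> g \notin s -> bump n c (act g^-1%g x) = 0) ->
  weighted_sum c F x = \sum_(g <- s) (bump n c (act g^-1%g x) * F g).
Proof.
move=> us sGam s0; rewrite /weighted_sum -(fsbig_widen [set` s]).
- by symmetry; apply: fsbig_seq.
- by move=> g /sGam.
- by move=> g [Gg /negP gs] /=; rewrite s0// mul0r.
Qed.

Lemma weighted_sum_translate c F x g : Gam g ->
  weighted_sum c F (act g^-1%g x) = weighted_sum c (fun h => F (g^-1 * h)%g) x.
Proof.
move=> Gg; have Gg' := subgroupV sG Gg.
have [s [us sGam s0]] := finite_bump c (\sum_(i < n) `|x i|).
have bx : box n (\sum_(i < n) `|x i|) x.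
  by move=> i ni; rewrite (bigD1 (Ordinal ni))//= lerDl sumr_ge0.
rewrite [RHS](weighted_sumE _ us sGam); last by move=> h; apply: s0.
have E h : Gam h -> act h^-1%g (act g^-1%g x) = act (g * h)^-1%g x.
  by move=> Gh; rewrite invgM (proj2 aG)//; apply: subgroupV.
rewrite (@weighted_sumE _ _ _ [seq (g^-1 * h)%g | h <- s]).
- rewrite big_map !big_seq; apply: eq_bigr => h /sGam Gh.
  rewrite E; last exact: subgroupM.
  by rewrite mulgA mulgV mul1g.
- by rewrite map_inj_uniq//; apply: mulgI.
- by move=> _ /mapP [h /sGam Gh ->]; apply: subgroupM.
- move=> h Gh hs; rewrite E//; apply: s0 => //; first exact: subgroupM.
  apply: contra hs => hs; apply/mapP; exists (g * h)%g => //.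
  by rewrite mulgA mulVg mul1g.
Qed.

Lemma weighted_sumD c F F' x :
  weighted_sum c (fun g => F g + F' g) x = weighted_sum c F x + weighted_sum c F' x.
Proof.
have [s [us sGam s0]] := finite_bump c (\sum_(i < n) `|x i|).
have bx : box n (\sum_(i < n) `|x i|) x.
  by move=> i ni; rewrite (bigD1 (Ordinal ni))//= lerDl sumr_ge0.
rewrite !(weighted_sumE _ us sGam); try by move=> h; apply: s0.
by rewrite -big_split; apply: eq_bigr => g _; rewrite mulrDr.
Qed.

Lemma weighted_sumZ c a F x : weighted_sum c (fun g => a * F g) x = a * weighted_sum c F x.
Proof.
have [s [us sGam s0]] := finite_bump c (\sum_(i < n) `|x i|).
have bx : box n (\sum_(i < n) `|x i|) x.
  by move=> i ni; rewrite (bigD1 (Ordinal ni))//= lerDl sumr_ge0.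
rewrite !(weighted_sumE _ us sGam); try by move=> h; apply: s0.
by rewrite big_distrr; apply: eq_bigr => g _ /=; rewrite mulrCA.
Qed.

Lemma weighted_sum_lin c k (a : 'I_k -> R) (F : 'I_k -> G -> R) x :
  weighted_sum c (fun g => \sum_j a j * F j g) x = \sum_j a j * weighted_sum c (F j) x.
Proof.
elim: (index_enum _) => [|j s IH].
  rewrite big_nil -[RHS](mul0r (weighted_sum c (fun=> 0) x)) -weighted_sumZ.
  by congr weighted_sum; apply/funext => g; rewrite big_nil mul0r.
rewrite big_cons -IH -weighted_sumZ -weighted_sumD.
by congr weighted_sum; apply/funext => g; rewrite big_cons.
Qed.

Lemma loclip_weighted_sum c m (F : G -> S -> R) : (n <= m)%N ->
  (forall g, Gam g -> loclip m (F g)) -> loclip m (fun x => weighted_sum c (F^~ x) x).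
Proof.
move=> nm lF; apply: loclip_local => r.
have [s [us sGam s0]] := finite_bump c r.
exists (fun x => \sum_(g <- s) (if g \in s then bump n c (act g^-1%g x) * F g x else 0)).
  apply: loclip_sum => g; case: (boolP (g \in s)) => [/sGam Gg|_]; last exact: loclip_cst.
  apply: loclip_mul (lF _ Gg); apply: (@loclip_act _ g^-1%g (bump n c)) => //.
    exact: subgroupV.
  exact/(loclipW nm)/loclip_bump.
move=> x bx; rewrite (weighted_sumE _ us sGam) => [|g]; last first.
  by apply: s0 => i ni; apply: bx; apply: leq_trans nm.
by rewrite big_seq [RHS]big_seq; apply: eq_bigr => g ->.
Qed.

(** The primitive at [x] is the average of [c g x] over [g] with weights [bump n c0 (act g^-1 x)].
    Cocompactness makes the total weight [Phi] at least 1, and the cocycle identity turns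
    translation of the weights into the coboundary formula. *)
Lemma H1_loclip m (Z0 : set S) : (n <= m)%N -> H1_trivial Gam act (@loclip R m) Z0.
Proof.
move=> nm k M c [M1 MM] lc cc; have [c0 cG0] := cG.
pose Phi x := weighted_sum c0 (fun=> 1) x.
have Phi1 x : 1 <= Phi x.
  have [s [us sGam s0]] := finite_bump c0 (\sum_(i < n) `|x i|).
  have bx : box n (\sum_(i < n) `|x i|) x.
    by move=> i ni; rewrite (bigD1 (Ordinal ni))//= lerDl sumr_ge0.
  rewrite /Phi (weighted_sumE _ us sGam); last by move=> h; apply: s0.
  have [g Gg bg] := cG0 x.
  have gs : g^-1%g \in s.
    apply: contraT => gs; have := s0 _ _ bx (subgroupV sG Gg) gs.
    by rewrite invgK bump1// => /eqP; rewrite oner_eq0.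
  rewrite (bigD1_seq _ gs us) /= invgK bump1// mul1r lerDl.
  by apply: sumr_ge0 => h _; rewrite mulr1 bump_ge0.
have Phig g x : Gam g -> Phi (act g^-1%g x) = Phi x.
  by move=> Gg; rewrite /Phi weighted_sum_translate.
pose u x : 'cV[R]_k := \col_i ((Phi x)^-1 * weighted_sum c0 (fun g => c g x i 0) x).
exists u; split.
- move=> i; have := loclip_mul (loclip_inv Phi1 (loclip_weighted_sum c0 nm
    (fun g Gg => loclip_cst m 1))) (loclip_weighted_sum c0 nm (fun g Gg => lc g Gg i)).
  by congr loclip; apply/funext => x; rewrite mxE.
- move=> g Gg x; apply/colP => i; rewrite !mxE.
  have Mu : \sum_j M g i j * u (act g^-1%g x) j 0 =
      (Phi x)^-1 * weighted_sum c0 (fun h => c h x i 0 - c g x i 0) x.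
    under eq_bigr => j _ do rewrite mxE Phig// mulrCA.
    rewrite -big_distrr /= -weighted_sum_lin weighted_sum_translate//; congr (_ * _).
    have [s [us sGam s0]] := finite_bump c0 (\sum_(i < n) `|x i|).
    have bx : box n (\sum_(i < n) `|x i|) x.
      by move=> i' ni; rewrite (bigD1 (Ordinal ni))//= lerDl sumr_ge0.
    rewrite !(weighted_sumE _ us sGam); try by move=> h; apply: s0.
    rewrite big_seq [RHS]big_seq; apply: eq_bigr => h /sGam Gh; congr (_ * _).
    have := cc _ _ Gg (subgroupM sG (subgroupV sG Gg) Gh) x.
    rewrite mulgA mulgV mul1g => ->; rewrite !mxE; ring.
  rewrite Mu; have -> : (fun h => c h x i 0 - c g x i 0) =
      (fun h => c h x i 0 + (- c g x i 0) * 1) by apply/funext => h; rewrite mulr1.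
  rewrite weighted_sumD weighted_sumZ -/(Phi x).
  have := Phi1 x => P1; field; rewrite gt_eqF//; lra.
- move=> z _ c0z; apply/colP => i; rewrite !mxE.
  have [s [us sGam s0]] := finite_bump c0 (\sum_(i < n) `|z i|).
  have bx : box n (\sum_(i < n) `|z i|) z.
    by move=> i' ni; rewrite (bigD1 (Ordinal ni))//= lerDl sumr_ge0.
  rewrite (weighted_sumE _ us sGam); last by move=> h; apply: s0.
  rewrite big_seq big1 ?mulr0// => g /sGam Gg.
  by rewrite c0z// mxE mulr0.
Qed.

Lemma loclip_bound_family m (F : S -> S) r k : (forall i, (i < k)%N -> loclip m (fun x => F x i)) ->
  exists2 B, 0 <= B & forall x, box m r x -> box k B (F x).
Proof.
elim: k => [|k IH] lF; first by exists 0.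
have [i mi|B B0 BF] := IH; first by apply: lF; apply: ltnW.
have [C C0 CF] := loclip_bound r (lF k (ltnSn k)).
exists (Num.max B C); first by rewrite le_max B0.
move=> x bx i; rewrite ltnS leq_eqVlt le_max => /orP [/eqP ->|im].
  by rewrite CF// orbT.
by rewrite BF.
Qed.

(* The coordinate of index [n] is the time of the homotopy. *)
Lemma dense_image (F : S -> S) (Hmt : S -> S) :
  (forall i, (i < n)%N -> loclip n (fun x => F x i)) ->
  (forall i, (i < n)%N -> loclip n.+1 (fun x => Hmt x i)) ->
  (forall g x i, Gam g -> (i < n)%N -> Hmt (act g x) i = act g (Hmt x) i) ->
  (forall x i, x n = 0 -> (i < n)%N -> Hmt x i = x i) ->
  (forall x i, x n = 1 -> (i < n)%N -> Hmt x i = F x i) ->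
  forall r0, exists rho, forall y eps, box n r0 y -> 0 < eps ->
    exists2 x, box n rho x & forall i, (i < n)%N -> `|F x i - y i| <= eps.
Proof.
move=> lF lH eqH H0 H1 r0; have [c cG0] := cG.
have Fdep x y : (forall i, (i < n)%N -> x i = y i) -> forall i, (i < n)%N -> F x i = F y i.
  by move=> xy i ni; apply: loclip_dep (lF i ni) xy.
have [B B0 HB] := loclip_bound_family (Num.max c 1) lH.
have [s sE] := (finite_seqP _).1 (pG (Num.max B (r0 + 1))).
have [rho rhoE] : exists rho, forall g x, g \in s -> box n c x -> box n rho (act g x).
  have sGam g : g \in s -> Gam g.
    by move=> gs; have : [set` s] g by []; rewrite -sE => -[].
  elim: s {sE} sGam => [|g s IH] sGam; first by exists 0.
  have [h hs|rho rhoE] := IH; first by apply: sGam; rewrite inE hs orbT.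
  have [B' _ BE] := @loclip_bound_family n (act g) c n
    (fun i => lact (sGam g (mem_head _ _))).
  exists (Num.max rho B') => h x; rewrite inE => /orP [/eqP ->|hs] bx.
    by apply: boxW (BE _ bx); rewrite le_max lexx orbT.
  by apply: boxW (rhoE _ _ hs bx); rewrite le_max lexx.
(* Properness of the homotopy: [x] is a translate of a point of the box [c], whose image is bounded
   by [B], and only finitely many group elements bring such an image into the box [r0 + 1]. *)
have bounded x : 0 <= x n <= 1 -> box n (r0 + 1) (Hmt x) -> box n rho x.
  move=> /andP [x0 x1] bH; have [g Gg bg] := cG0 x.
  have bH' : box n B (Hmt (act g x)).
    apply: HB => i; rewrite ltnS leq_eqVlt => /orP [/eqP ->|ni].
      by rewrite act_fix// ger0_norm// le_max x1 orbT.
    by rewrite le_max bg.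
  have xE : act g^-1%g (act g x) = x by rewrite (actsKV _ sG aG).
  rewrite -xE; apply: rhoE => //; suff : [set` s] g^-1%g by [].
  rewrite -sE; split; first exact: subgroupV.
  exists (Hmt (act g x)); first by apply: boxW bH'; rewrite le_max lexx.
  move=> i ni; have := bH i ni; rewrite -[x in Hmt x]xE eqH//; last exact: subgroupV.
  by move=> /le_trans; apply; rewrite le_max lexx orbT.
exists rho => y eps byy e0.
wlog e1 : eps e0 / eps <= 1.
  move=> W; have [||x bx xE] := W (Num.min eps 1); first by rewrite lt_min e0 ltr01.
    by rewrite ge_min lexx orbT.
  by exists x => // i ni; apply: le_trans (xE i ni) _; rewrite ge_min lexx.
(* The time is made a function of position: 1 on the box [K - 1], 0 on the boundary of the box [K].
   On the boundary the map is the identity and the sign conditions hold; a solution lies in the box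
   [rho], where the time is 1 and the map is [F]. *)
pose K := Num.max `|r0| `|rho| + 1.
have K0 : 0 < K by rewrite ltr_wpDl// le_max normr_ge0.
have Kr : `|r0| <= K by rewrite ler_wpDr// le_max lexx.
pose X x := upd x n (bump n (K - 1) x).
have Xn x : X x n = bump n (K - 1) x by rewrite /X upd_same.
have XE x i : (i < n)%N -> X x i = x i.
  by move=> ni; rewrite /X upd_other// ltn_eqF.
pose f i x := Hmt (X x) i - y i.
have lf i : (i < n)%N -> loclip n (f i).
  move=> ni; apply: loclip_sub; last exact: loclip_cst.
  apply: (@loclip_comp _ n n.+1 _ X (lH i ni)) => j.
  rewrite ltnS leq_eqVlt => /orP [/eqP ->|nj].
    by have := loclip_bump n (K - 1); congr loclip; apply/funext => x; rewrite Xn.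
  by have := @loclip_var R n j nj; congr loclip; apply/funext => x; rewrite XE.
have yr i : (i < n)%N -> `|y i| <= K.
  by move=> ni; apply: le_trans (byy i ni) _; apply: le_trans (ler_norm _) Kr.
have edge i x : (i < n)%N -> `|x i| = K -> f i x = x i - y i.
  move=> ni xi; have X0 : X x n = 0 by rewrite Xn; apply: (bump_eq0 ni); rewrite xi; lra.
  by rewrite /f H0// XE.
have [||x bx xE] := approximate_miranda K0 e0 lf.
- move=> i x ni _ xi; rewrite edge// xi ?gtr0_norm//.
  by have := yr i ni; rewrite ler_norml => /andP [_]; lra.
- move=> i x ni _ xi; rewrite edge// xi ?normrN ?gtr0_norm//.
  by have := yr i ni; rewrite ler_norml => /andP [+ _]; lra.
have bX : box n rho (X x).
  apply: bounded; first by rewrite Xn bump_ge0 bump_le1.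
  move=> i ni; have := xE i ni; rewrite /f => fx; have yi := byy i ni.
  have -> : Hmt (X x) i = (Hmt (X x) i - y i) + y i by rewrite subrK.
  by rewrite (le_trans (ler_normD _ _))// addrC lerD// (le_trans fx).
have bx' : box n rho x by move=> i ni; rewrite -XE// bX.
exists x => // i ni; rewrite -(Fdep (X x))//; last exact: XE.
rewrite -H1//; first exact: xE.
rewrite Xn bump1// => j nj; rewrite /K addrK le_max.
by apply/orP; right; apply: le_trans (bx' j nj) (ler_norm _).
Qed.

End ProperActions.

(** Pigeonhole: the [m ^ h] points of a grid of mesh [1 / m] have approximate preimages in a box of
    R^n, cut into [(D * m) ^ n] cells. If [n < h], two preimages share a cell, and their images are
    closer than distinct grid points allow. *)
Lemma loclip_dimension {R : realType} (n h : nat) (g : (nat -> R) -> (nat -> R)) (B : R) :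
  (forall i, (i < h)%N -> loclip n (fun x => g x i)) ->
  (forall y eps, box h 1 y -> 0 < eps -> exists2 x, box n B x &
     forall i, (i < h)%N -> `|g x i - y i| <= eps) ->
  (h <= n)%N.
Proof.
move=> lg dense; rewrite leqNgt; apply/negP => nh.
pose b := (Num.trunc `|B|).+1.
have bB : B <= b%:R by apply: le_trans (ler_norm _) _; apply: ltW; apply: truncnS_gt.
have [L L0 gL] : exists2 L, 0 <= L & forall i x y, (i < h)%N -> box n B x -> box n B y ->
    `|g x i - g y i| <= L * dist1 n x y.
  elim: h lg {nh dense} => [|h IH] lg; first by exists 0.
  have [i hi|L L0 LE] := IH; first by apply: lg; apply: ltnW.
  have [M M0 ME] := lg h (ltnSn h) B.
  exists (L + M) => [|i x y]; first exact: addr_ge0.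
  rewrite ltnS leq_eqVlt => /orP [/eqP ->|ik] bx byy; rewrite mulrDl.
    by rewrite (le_trans (ME _ _ bx byy))// lerDr mulr_ge0// dist1_ge0.
  by rewrite (le_trans (LE _ _ _ ik bx byy))// lerDl mulr_ge0// dist1_ge0.
(* Cells have side [1 / (C * m)]; [C > 4 * L * n] bounds the variation of [g] on a cell by
   [1 / (4 * m)]. *)
pose C := (Num.trunc (4 * L * n%:R)).+1.
have CL : 4 * L * n%:R < C%:R by apply: truncnS_gt.
pose D := (2 * b * C).+1.
(* [m > D ^ n] is exactly what gives [(D * m) ^ n < m ^ n.+1]. *)
pose m := (D ^ n).+1.
have m0 : 0 < m%:R :> R by rewrite ltr0n.
have C0 : 0 < C%:R :> R by rewrite ltr0n.
pose y (k : {ffun 'I_h -> 'I_m}) : nat -> R :=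
  fun i => if insub i is Some j then (k j)%:R / m%:R else 0.
have yE k (j : 'I_h) : y k j = (k j)%:R / m%:R by rewrite /y valK.
have by1 k : box h 1 (y k).
  move=> i ih; rewrite (yE k (Ordinal ih)) ger0_norm ?divr_ge0 ?ler0n//.
  by rewrite ler_pdivrMr// mul1r ler_nat ltnW.
have e0 : 0 < (4 * m%:R)^-1 :> R by rewrite invr_gt0 mulr_gt0.
have [z zE] : {z : {ffun 'I_h -> 'I_m} -> (nat -> R) & forall k, box n B (z k) /\
    forall i, (i < h)%N -> `|g (z k) i - y k i| <= (4 * m%:R)^-1}.
  apply: (@choice _ _ (fun k zk => box n B zk /\
    forall i, (i < h)%N -> `|g zk i - y k i| <= (4 * m%:R)^-1)) => k.
  by have [x bx xE] := dense (y k) _ (by1 k) e0; exists x.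
pose idx k (i : 'I_n) : 'I_(D * m) :=
  inord (Num.trunc ((z k i + b%:R) * (C * m)%:R)).
have Dm : (D * m = (D * m).-1.+1)%N by rewrite prednK// muln_gt0.
have zb k (i : 'I_n) : 0 <= z k i + b%:R /\ z k i + b%:R <= (2 * b)%:R.
  have := (zE k).1 i (ltn_ord i); rewrite ler_norml natrM => /andP []; lra.
have tr k (i : 'I_n) : (Num.trunc ((z k i + b%:R) * (C * m)%:R) < D * m)%N.
  have [z0 z1] := zb k i.
  have : (Num.trunc ((z k i + b%:R) * (C * m)%:R))%:R <= (2 * b)%:R * (C * m)%:R :> R.
    apply: (@le_trans _ _ ((z k i + b%:R) * (C * m)%:R)).
      by rewrite truncn_le// mulr_ge0.
    by rewrite ler_wpM2r.
  rewrite -natrM ler_nat => /leq_ltn_trans; apply.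
  have -> : (2 * b * (C * m) = 2 * b * C * m)%N by rewrite mulnA.
  by rewrite /D (mulSn (2 * b * C)) -[X in (X < _)%N]add0n ltn_add2r.
pose phi k : {ffun 'I_n -> 'I_(D * m)} := [ffun i => Ordinal (tr k i)].
have [k [k' [kk phik]]] : exists k k', k != k' /\ phi k = phi k'.
  apply: contrapT => inj.
  have : injective phi.
    move=> k k' E; apply/eqP; apply: contraT => ne; exfalso; apply: inj; by exists k, k'.
  move=> /leq_card; rewrite !card_ffun !card_ord expnMn leqNgt => /negP; apply.
  apply: (@leq_trans (m ^ n.+1)).
    by rewrite expnS ltn_mul2r expn_gt0 /= ltnSn.
  exact: leq_pexp2l.
have close (i : 'I_n) : `|z k i - z k' i| <= (C * m)%:R^-1.
  have : Num.trunc ((z k i + b%:R) * (C * m)%:R) = Num.trunc ((z k' i + b%:R) * (C * m)%:R).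
    by have /ffunP /(_ i) := phik; rewrite !ffunE => -[].
  have [z0 z1] := zb k i; have [z0' z1'] := zb k' i.
  have Cm : 0 < (C * m)%:R :> R by rewrite natrM mulr_gt0.
  have /truncn_itv /andP [a1 a2] : 0 <= (z k i + b%:R) * (C * m)%:R by rewrite mulr_ge0// ltW.
  have /truncn_itv /andP [b1 b2] : 0 <= (z k' i + b%:R) * (C * m)%:R by rewrite mulr_ge0// ltW.
  move=> E; rewrite E in a1 a2; rewrite -div1r ler_pdivlMr// -[X in _ * X]gtr0_norm// -normrM.
  move: a1 a2 b1 b2; rewrite -addn1 natrD => *.
  rewrite ler_norml; apply/andP; split; nra.
have dzz : dist1 n (z k) (z k') <= (C * m)%:R^-1 *+ n.
  by rewrite /dist1 -[X in _ *+ X]card_ord -sumr_const; apply: ler_sum => i _; apply: close.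
have [j kj] : exists j, k j != k' j.
  by apply: contrapT => no; move/eqP: kk; apply; apply/ffunP => j; apply: contrapT => /eqP kj; apply: no; exists j.
have [bz gz] := zE k; have [bz' gz'] := zE k'.
have g1 := gz j (ltn_ord j); have g2 := gz' j (ltn_ord j).
have g3 := le_trans (gL j _ _ (ltn_ord j) bz bz') (ler_wpM2l L0 dzz).
have g4 : L * ((C * m)%:R^-1 *+ n) < (4 * m%:R)^-1.
  have -> : (C * m)%:R^-1 *+ n = (C%:R * m%:R)^-1 * n%:R :> R by rewrite natrM [RHS]mulr_natr.
  rewrite -subr_gt0.
  have -> : (4 * m%:R)^-1 - L * ((C%:R * m%:R)^-1 * n%:R) =
      (C%:R - 4 * L * n%:R) / (4 * C%:R * m%:R) by field; rewrite !gt_eqF.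
  by rewrite divr_gt0 ?subr_gt0// !mulr_gt0.
have g5 : m%:R^-1 <= `|y k j - y k' j|.
  rewrite !yE -mulrBl normrM [X in _ * X]gtr0_norm ?invr_gt0// -[leLHS]mul1r ler_wpM2r ?invr_ge0 ?ler0n//.
  move: kj; rewrite -val_eqE /=; move: (val (k j)) (val (k' j)) => a a' aa.
  rewrite ler_normr; have [lt|lt|E] := ltngtP a a'; last by rewrite E eqxx in aa.
    by apply/orP; right; rewrite opprB lerBrDl natr1 ler_nat.
  by apply/orP; left; rewrite lerBrDl natr1 ler_nat.
have g6 : (4 * m%:R)^-1 * 4 = m%:R^-1 :> R by field; rewrite gt_eqF.
move: g1 g2 g3 g4 g5; rewrite !ler_norml => /andP [a1 a2] /andP [b1 b2] /andP [c1 c2] g4.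
rewrite ler_normr => /orP []; lra.
Qed.

(** * Algebraic relations and inversion *)

Section PolynomialRelations.
Context {R : realType}.
Local Notation S := (nat -> R).
Local Notation lt i := (fun l : nat => (l < i)%N).
Implicit Types (f g : S -> R) (x y : S).

Lemma polyfun_line P f x y : polyfun P f ->
  exists p : {poly R}, forall s, f (fun i => x i + s * (y i - x i)) = p.[s].
Proof.
elim=> [c|i _|g h _ [p pE] _ [q qE]|g h _ [p pE] _ [q qE]].
- by exists c%:P => s; rewrite hornerC.
- by exists ((x i)%:P + 'X * (y i - x i)%:P) => s; rewrite !hornerE.
- by exists (p + q) => s; rewrite hornerD pE qE.
- by exists (p * q) => s; rewrite hornerM pE qE.
Qed.

(** On the line through [x] and [y] both restrict to non-zero polynomials in one variable, whose
    product has finitely many roots. *)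
Lemma polyfun_domain P f g x y : polyfun P f -> polyfun P g -> f x != 0 -> g y != 0 ->
  exists z, f z * g z != 0.
Proof.
move=> /(polyfun_line x y) [p pE] /(polyfun_line x y) [q qE] fx gy.
have line0 : (fun i => x i + 0 * (y i - x i)) = x by apply/funext => i; rewrite mul0r addr0.
have line1 : (fun i => x i + 1 * (y i - x i)) = y by apply/funext => i; rewrite mul1r addrC subrK.
have p0 : p != 0 by apply: contraNneq fx => p0; rewrite -line0 pE p0 horner0.
have q0 : q != 0 by apply: contraNneq gy => q0; rewrite -line1 qE q0 horner0.
apply: contrapT => no.
have pq0 : p * q != 0 by rewrite mulf_neq0.
have := max_poly_roots (rs := [seq i%:R | i <- iota 0 (size (p * q))]) pq0.
rewrite size_map size_iota ltnn => /(_ _ _)/negP; apply => //.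
  apply/allP => _ /mapP [i _ ->]; rewrite rootE hornerM -pE -qE.
  by apply/negPn/negP => nz; apply: no; eexists; exact: nz.
by rewrite map_inj_uniq ?iota_uniq// => i j /eqP; rewrite eqr_nat => /eqP.
Qed.

Definition mdeg d f := forall i x, exists2 p : {poly R},
  (size p <= d.+1)%N & forall s, f (upd x i s) = p.[s].

Lemma mdegW d e f : (d <= e)%N -> mdeg d f -> mdeg e f.
Proof. by move=> de df i x; have [p pd pE] := df i x; exists p => //; apply: leq_trans pd _. Qed.

Lemma mdeg_cst d c : mdeg d (fun=> c).
Proof.
by move=> i x; exists c%:P => [|s]; rewrite ?hornerC// (leq_trans (size_polyC_leq1 _)).
Qed.

Lemma mdeg_add d f g : mdeg d f -> mdeg d g -> mdeg d (fun x => f x + g x).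
Proof.
move=> df dg i x; have [p pd pE] := df i x; have [q qd qE] := dg i x.
exists (p + q) => [|s]; last by rewrite pE qE hornerD.
by rewrite (leq_trans (size_polyD _ _))// geq_max pd.
Qed.

Lemma mdeg_mul d e f g : mdeg d f -> mdeg e g -> mdeg (d + e) (fun x => f x * g x).
Proof.
move=> df dg i x; have [p pd pE] := df i x; have [q qd qE] := dg i x.
exists (p * q) => [|s]; last by rewrite pE qE hornerM.
rewrite (leq_trans (size_polyMleq _ _))//; lia.
Qed.

Lemma mdeg_prod d (I : Type) (r : seq I) (C : pred I) (F : I -> S -> R) :
  (forall i, mdeg d (F i)) -> mdeg (size r * d) (fun x => \prod_(i <- r | C i) F i x).
Proof.
move=> dF; elim: r => [|i r IH].
  by have := mdeg_cst 0 1; congr mdeg; apply/funext => x; rewrite big_nil.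
case: (boolP (C i)) => Ci.
  by have := mdeg_mul (dF i) IH; congr mdeg; apply/funext => x; rewrite big_cons Ci.
apply: (@mdegW (size r * d)); first by rewrite leq_mul2r leqnSn orbT.
by have := IH; congr mdeg; apply/funext => x; rewrite big_cons (negbTE Ci).
Qed.

Lemma mdeg_sum d (I : Type) (r : seq I) (F : I -> S -> R) :
  (forall i, mdeg d (F i)) -> mdeg d (fun x => \sum_(i <- r) F i x).
Proof.
move=> dF; elim: r => [|i r IH].
  by have := mdeg_cst d 0; congr mdeg; apply/funext => x; rewrite big_nil.
by have := mdeg_add (dF i) IH; congr mdeg; apply/funext => x; rewrite big_cons.
Qed.

Lemma mdeg_var i : mdeg 1 (fun x => x i).
Proof.
move=> j x; case: (i =P j) => [->|/eqP ij].
  by exists 'X => [|s]; rewrite ?size_polyX// hornerX upd_same.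
exists (x i)%:P => [|s]; first by rewrite (leq_trans (size_polyC_leq1 _)).
by rewrite hornerC upd_other.
Qed.

Lemma polyfun_mdeg P f : polyfun P f -> exists d, mdeg d f.
Proof.
elim=> [c|i _|g h _ [d dg] _ [e eh]|g h _ [d dg] _ [e eh]].
- by exists 0%N; apply: mdeg_cst.
- by exists 1%N; apply: mdeg_var.
- exists (maxn d e); apply: mdeg_add; [apply: mdegW dg|apply: mdegW eh].
    exact: leq_maxl.
  exact: leq_maxr.
- by exists (d + e)%N; apply: mdeg_mul.
Qed.

Lemma mdeg_grid_zero h d f : polyfun (lt h) f -> mdeg d f ->
  (forall b : {ffun 'I_h -> 'I_d.+1},
     f (fun i => if insub i is Some j then (b j)%:R else 0) = 0) ->
  forall x, f x = 0.
Proof.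
move=> pf df f0.
have part i : (i <= h)%N -> forall x, (forall l, (i <= l < h)%N -> exists2 k, (k < d.+1)%N & x l = k%:R) ->
    f x = 0.
  elim: i => [|i IH] ih x xE.
    have /choice [k kE] : forall l : 'I_h, exists k : 'I_d.+1, x l = k%:R.
      by move=> l; have [k kd ->] := xE l (ltn_ord l); exists (Ordinal kd).
    rewrite -[RHS](f0 [ffun l => k l]); apply: (polyfun_dep pf) => l lh.
    by case: insubP => [v _ vl|/negP//]; rewrite ffunE -kE vl.
  have [p pd pE] := df i x.
  suff p0 : p = 0 by rewrite -[x](upd_id _ i) pE p0 horner0.
  apply/eqP; apply: contraT => p0.
  pose rs : seq R := [seq k%:R | k <- iota 0 d.+1].
  have rrs : all (root p) rs.
    apply/allP => a /mapP [k ki aE]; have kd : (k < d.+1)%N by move: ki; rewrite mem_iota.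
    rewrite aE.
    rewrite rootE -pE; apply/eqP; apply: (IH (ltnW ih)) => l /andP [il lh].
    have [->|li] := eqVneq l i; first by rewrite upd_same; exists k.
    by rewrite upd_other//; apply: xE; rewrite lh andbT ltn_neqAle eq_sym li.
  have urs : uniq rs.
    by rewrite map_inj_uniq ?iota_uniq// => k l /eqP; rewrite eqr_nat => /eqP.
  by have := max_poly_roots p0 rrs urs; rewrite size_map size_iota ltnNge pd.
move=> x; apply: (part h) => // l; lia.
Qed.

(** Counting: the [E ^ N] interpolation products [ell] are independent, while their pullbacks by [p]
    have degree at most [d] in each of [h] variables and are determined by [d.+1 ^ h] values. *)
Lemma algebraic_dependence N h (p : S -> S) : (h < N)%N ->
  (forall l, (l < N)%N -> polyfun (lt h) (fun x => p x l)) ->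
  exists P, [/\ polyfun (lt N) P, forall x, P (p x) = 0 & exists y, P y != 0].
Proof.
move=> hN pp.
have [D pD] : exists D, forall l, (l < N)%N -> mdeg D (fun x => p x l).
  elim: N pp {hN} => [|N IH] pp; first by exists 0%N.
  have [l lN|D DE] := IH; first by apply: pp; apply: ltnW.
  have [D' D'E] := polyfun_mdeg (pp N (ltnSn N)).
  exists (maxn D D') => l; rewrite ltnS leq_eqVlt => /orP [/eqP ->|lN].
    by apply: mdegW D'E; apply: leq_maxr.
  by apply: mdegW (DE l lN); apply: leq_maxl.
(* Since [d.+1 <= (N * D).+1 * E], this choice gives [d.+1 ^ h < E ^ h.+1 <= E ^ N]. *)
pose E := ((N * D).+1 ^ h).+1.
pose d := (N * (E * D))%N.
pose ell (al : {ffun 'I_N -> 'I_E}) (y : S) : R :=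
  \prod_(i < N) \prod_(m < E | m != al i) (y i - m%:R).
pose gridE (al : {ffun 'I_N -> 'I_E}) : S := fun i => if insub i is Some j then (al j)%:R else 0.
pose gridD (b : {ffun 'I_h -> 'I_d.+1}) : S := fun i => if insub i is Some j then (b j)%:R else 0.
have ell_neq al be : al != be -> ell al (gridE be) = 0.
  move=> ab; have [i abi] : exists i, al i != be i.
    apply: contrapT => no; move/eqP: ab; apply; apply/ffunP => i; apply: contrapT => /eqP ?.
    by apply: no; exists i.
  rewrite /ell (bigD1 i)//= (bigD1 (be i)) 1?eq_sym//= /gridE valK subrr mul0r mul0r//.
have ell_same al : ell al (gridE al) != 0.
  apply/prodf_neq0 => i _; apply/prodf_neq0 => m mi; rewrite /gridE valK subr_eq0 eqr_nat.
  by rewrite eq_sym.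
have ell_poly al : polyfun (lt N) (ell al).
  apply: polyfun_prod => i.
  have : polyfun (lt N) (fun y => \prod_(m <- [seq m <- index_enum 'I_E | m != al i]) (y i - m%:R)).
    apply: polyfun_prod => m; apply: polyfun_sub; last exact: polyfun_cst.
    exact: polyfun_var.
  by congr polyfun; apply/funext => y; rewrite big_filter.
have ell_deg al : mdeg d (fun x => ell al (p x)).
  have card0 k : size (index_enum 'I_k) = k by rewrite -sum1_size -[RHS]card_ord -sum1_card; apply: eq_bigl.
  rewrite /d -{1}[N]card0; apply: mdeg_prod => i; rewrite -{1}[E]card0; apply: mdeg_prod => m.
  apply: mdeg_add; last exact: mdeg_cst.
  exact: pD.
pose M : 'M[R]_(#|{ffun 'I_N -> 'I_E}|, #|{ffun 'I_h -> 'I_d.+1}|) :=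
  \matrix_(a, b) ell (enum_val a) (p (gridD (enum_val b))).
have [u [u0 uM]] : exists u : 'rV_#|{ffun 'I_N -> 'I_E}|, u != 0 /\ u *m M = 0.
  have kn : kermx M != 0.
    rewrite kermx_eq0 /row_free; apply/negP => /eqP rM.
    have := rank_leq_col M; rewrite rM !card_ffun !card_ord leqNgt => /negP; apply.
    have E0 : (0 < E)%N by [].
    apply: (@leq_ltn_trans (((N * D).+1 * E) ^ h)).
      by case: (h) => // h'; rewrite leq_exp2r// /d; lia.
    rewrite expnMn; apply: (@leq_trans (E ^ h.+1)); last by rewrite leq_pexp2l.
    by rewrite expnS ltn_mul2r expn_gt0 E0 ltnSn.
  by have /rowV0Pn [u ukM u0] := kn; exists u; split=> //; apply/sub_kermxP.
pose P y := \sum_(a < #|{ffun 'I_N -> 'I_E}|) u 0 a * ell (enum_val a) y.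
exists P; split.
- by apply: polyfun_sum => a _; apply: polyfun_scale.
- apply: (@mdeg_grid_zero h d).
  + apply: polyfun_sum => a _; apply: polyfun_scale; apply: polyfun_comp (ell_poly _) _ => l lN.
    exact: pp.
  + apply: mdeg_sum => a; rewrite -[d]add0n; apply: mdeg_mul (ell_deg _); exact: mdeg_cst.
  + move=> b; have /rowP /(_ (enum_rank b)) := uM; rewrite !mxE => uMb.
    rewrite -[RHS]uMb /P; apply: eq_bigr => a _; rewrite mxE enum_rankK//.
- have [a ua] : exists a, u 0 a != 0.
    apply: contrapT => no; move/eqP: u0; apply; apply/rowP => a; rewrite mxE.
    by apply: contrapT => /eqP ?; apply: no; exists a.
  exists (gridE (enum_val a)); rewrite /P (bigD1 a)//= big1 ?addr0 => [|b ba].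
    by rewrite mulf_neq0.
  by rewrite ell_neq ?mulr0// (inj_eq enum_val_inj).
Qed.

End PolynomialRelations.

(** * The model action is proper and cocompact; stable spaces of polynomials *)

Section ModelGeometry.
Context {R : realType} {G : groupType}.
Local Notation S := (nat -> R).
Local Notation lt i := (fun l : nat => (l < i)%N).
Local Notation between j i := (fun l : nat => (j <= l)%N && (l < i)%N).
Variables (H : set G) (h : nat) (Gam : nat -> set G) (t : nat -> G)
  (st en : nat -> nat).
Hypothesis gc : good_chain H h Gam t st en.
Variable act : G -> S -> S.
Hypothesis md : model Gam t en h act.

Let HE : Gam h = H. Proof. exact: chain_top gc. Qed.
Let sH : is_subgroup H. Proof. by rewrite -HE; apply: (chain_subgroup gc). Qed.
Let aH : acts H act. Proof. by rewrite -HE; apply: (model_acts md). Qed.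

Lemma model_shift_expgz j z x : (j < h)%N -> act (expgz (t j) z) x j = x j + z%:~R.
Proof.
move=> jh; have Ht : H (t j) by apply: (chain_sub_top gc jh); apply: (chain_gen gc).
have HtV := subgroupV sH Ht.
have shiftV y : act (t j)^-1%g y j = y j - 1.
  by rewrite -{2}[y](actsK _ sH aH Ht) (model_shift md)// addrK.
elim: z x => [|n IH|n IH] x.
- by rewrite expgz0 (proj1 aH) addr0.
- rewrite intS expgzD expgz1 (proj2 aH)//; last exact: subgroup_expgz.
  by rewrite (model_shift md)// IH intrD addrA addrAC.
- rewrite intS opprD expgzD expgzN expgz1 (proj2 aH)//; last exact: subgroup_expgz.
  by rewrite shiftV IH intrD mulrN1z; ring.
Qed.

(** Integral parts are removed from the last coordinate to the first, as powers of [t j] fix the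
    coordinates after [j]. *)
Lemma model_cocompact : cocompact_action H h act.
Proof.
exists 1 => x.
have part i : (i <= h)%N -> exists2 g, H g &
    forall l, (h - i <= l < h)%N -> `|act g x l| <= 1.
  elim: i => [|i IH] ih.
    by exists 1%g; [exact: subgroup1|move=> l; rewrite subn0 ltnNge; case: leqP; rewrite ?andbF].
  have [g Hg gE] := IH (ltnW ih); set j := (h - i.+1)%N.
  have jh : (j < h)%N by rewrite /j; lia.
  have Gt : Gam j.+1 (expgz (t j) (- Num.floor (act g x j))).
    by apply: subgroup_expgz (chain_gen gc jh); apply: (chain_subgroup gc).
  have Ht := chain_sub_top gc jh Gt.
  exists (expgz (t j) (- Num.floor (act g x j)) * g)%g; first exact: subgroupM.
  move=> l /andP [jl lh]; rewrite (proj2 aH)//.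
  move: jl; rewrite leq_eqVlt => /orP [/eqP <-|jl].
    rewrite model_shift_expgz// intrN; have := floor_itv (act g x j).
    by rewrite intrD ler_norml => /andP [? ?]; apply/andP; split; lra.
  rewrite (model_fix_ge gc _ md _ jl lh Gt)//; apply: gE.
  by rewrite lh andbT; move: jl; rewrite /j; lia.
have [g Hg gE] := part h (leqnn h); exists g => // i ih; apply: gE.
by rewrite subnn.
Qed.

Lemma model_loclip g i : H g -> (i < h)%N -> loclip h (fun x => act g x i).
Proof.
rewrite -HE => Gg ih; apply: (@loclip_poly _ h (lt h)) => //.
exact: (model_poly md).
Qed.

Lemma finite_int_ball (r : R) : finite_set [set z : int | `|z%:~R| <= r :> R].
Proof.
have [m mr] : exists m, `|r| < m%:R by exists (Num.trunc `|r|).+1; apply: truncnS_gt.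
pose s1 := [seq Posz k | k <- iota 0 m]; pose s2 := [seq Negz k | k <- iota 0 m].
apply: (@sub_finite_set _ _ [set` s1 ++ s2]); last exact: finite_seq.
move=> z /= zr; suff : (z \in s1) || (z \in s2) by rewrite -mem_cat.
have zn : (`|z| < m)%N.
  rewrite -(ltr_nat R); apply: le_lt_trans mr.
  apply: le_trans (ler_norm _); apply: le_trans zr.
  by rewrite -intr_norm -abszE.
case: z zr zn => k _ /= kn; apply/orP; [left|right]; apply/mapP; exists k => //;
  rewrite mem_iota; lia.
Qed.

(** [Gam i] fixes the coordinate [i], so the displacement of that coordinate bounds the exponent of
    [t i]; each of the finitely many exponents leaves the same problem for [Gam i] on a larger
    box. *)
Lemma model_proper : proper_action H h act.
Proof.
rewrite -HE; move: (leqnn h); move: {1 3}h => i; elim: i => [|i IH] ih r.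
  apply: (@sub_finite_set _ _ [set 1%g]) => // g [+ _].
  by rewrite (chain0 gc).
have jh : (i < h)%N := ih.
have Hz z : H (expgz (t i) z).
  apply: (chain_sub_top gc ih); apply: subgroup_expgz; last exact: (chain_gen gc).
  exact: (chain_subgroup gc).
have bnd z : exists B, forall x, box h r x -> box h B (act (expgz (t i) z) x).
  have [B _ BE] := @loclip_bound_family _ h (act (expgz (t i) z)) r h
    (fun l lh => model_loclip (Hz z) lh).
  by exists B.
have [B BE] := choice bnd.
pose T z := [set y | Gam i y /\ exists2 x, box h (Num.max r (B z)) x &
  box h (Num.max r (B z)) (act y x)].
apply: (@sub_finite_set _ _ (\bigcup_(z in [set z : int | `|z%:~R| <= r + r :> R])
    [set (y * expgz (t i) z)%g | y in T z])); last first.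
  apply: bigcup_finite; first exact: finite_int_ball.
  by move=> z _; apply: finite_image; apply: IH; apply: ltnW.
move=> g [/(chain_step gc ih) [y [z [Gy ->]]] [x bx bgx]].
have Hy : H y by apply: (chain_sub_top gc (ltnW ih)).
have E : act (y * expgz (t i) z)%g x = act y (act (expgz (t i) z) x) by rewrite (proj2 aH).
exists z => /=.
  have := bgx i jh; rewrite E (model_fix md)// model_shift_expgz// => b1.
  have -> : z%:~R = (x i + z%:~R) - x i :> R by ring.
  by rewrite (le_trans (ler_normB _ _))// lerD// bx.
exists y => //; split=> //; exists (act (expgz (t i) z) x).
  by apply: boxW (BE _ _ bx); rewrite le_max lexx orbT.
by rewrite -E; apply: boxW bgx; rewrite le_max lexx.
Qed.

(* Lowering the degree in [x j] by the difference operator of [t j]. *)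
Lemma stable_subspace_invariant (J : (S -> R) -> Prop) j f x : (j <= h)%N ->
  (forall f, J f -> polyfun (lt h) f) ->
  (forall f g, J f -> J g -> J (fun x => f x - g x)) ->
  (forall g f, Gam j g -> J f -> J (fun x => f (act g x))) ->
  J f -> f x != 0 ->
  exists f', [/\ J f', polyfun (between j h) f' & exists y, f' y != 0].
Proof.
move=> + Jp JB Jg Jf fx; elim: j Jg => [|j IH] Jg jh.
  by exists f; split=> //; [apply: polyfunW (Jp _ Jf)|exists x].
have [||f0 [Jf0 pf0 [y fy]]] := IH; first by move=> g f' Gg; apply: Jg; apply: (chain_succ gc).
  exact: ltnW.
have [d0 df0] := polyfun_deg_lt j pf0.
pose Q d := `[< exists f', [/\ J f', polyfun (between j h) f', deg_lt d j f' & exists y, f' y != 0] >].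
have exQ : exists d, Q d by exists d0; apply/asboolP; exists f0; split=> //; exists y.
have [d /asboolP [f1 [Jf1 pf1 df1 [y1 f1y]]] dmin] := ex_minnP exQ.
have Gt := chain_gen gc jh.
pose f2 z := f1 (act (t j) z) - f1 z.
have f2E z : f2 z = f1 (upd z j (z j + 1)) - f1 z.
  congr (_ - _); apply: (polyfun_dep pf1) => l /andP [jl lh].
  move: jl; rewrite leq_eqVlt => /orP [/eqP <-|jl].
    by rewrite upd_same (model_shift md).
  by rewrite upd_other ?gtn_eqF// (model_fix_ge gc _ md _ jl lh Gt).
have Jf2 : J f2 by apply: JB => //; apply: Jg.
(* A non-zero difference would be a member of [J] of smaller degree in [x j]. *)
have f20 : forall z, f2 z = 0.
  apply: contrapT => /existsNP [z /eqP nz].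
  have pf2 : polyfun (between j h) f2.
    apply: (@polyfun_ext _ _ (fun z => f1 (upd z j (z j + 1)) - f1 z)); first by move=> z'; rewrite f2E.
    apply: polyfun_sub => //; apply: polyfun_comp pf1 _ => l /andP [jl lh].
    case: (l =P j) => [->|/eqP lj].
      have -> : (fun z : S => upd z j (z j + 1) j) = (fun z => z j + 1) by apply/funext => ?; rewrite upd_same.
      by apply: polyfun_add; [apply: polyfun_var; rewrite leqnn|apply: polyfun_cst].
    have -> : (fun z : S => upd z j (z j + 1) l) = (fun z => z l) by apply/funext => ?; rewrite upd_other.
    by apply: polyfun_var; rewrite jl.
  case: d df1 dmin => [|d] df1 dmin.
    have [p pd pE] := df1 y1; move/eqP: f1y; apply.
    by rewrite -[y1](upd_id _ j) pE; move: pd; rewrite leqn0 size_poly_eq0 => /eqP ->; rewrite horner0.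
  have : (d.+1 <= d)%N; last by rewrite ltnn.
  apply: dmin; apply/asboolP; exists f2; split=> //; last by exists z.
  move=> w; have [p pd pE] := df1 w.
  exists (p \Po ('X + 1%:P) - p) => [|s].
    have [->|p0] := eqVneq p 0; first by rewrite comp_poly0 subr0 size_poly0.
    rewrite -ltnS (leq_trans _ pd)//.
    have sz : size (p \Po ('X + 1%:P)) = size p.
      by rewrite size_comp_poly2// size_XaddC.
    have lc : lead_coef (p \Po ('X + 1%:P)) = lead_coef p.
      by rewrite lead_coef_comp ?size_XaddC// lead_coefXaddC expr1n mulr1.
    rewrite ltn_neqAle; apply/andP; split; last first.
      by rewrite (leq_trans (size_polyD _ _))// size_polyN sz maxnn.
    apply/eqP => szE.
    have : (p \Po ('X + 1%:P) - p)`_(size p).-1 = 0.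
      by rewrite coefB -{1}sz -!lead_coefE lc subrr.
    rewrite -szE -lead_coefE => /eqP; rewrite lead_coef_eq0 => /eqP E.
    by move: szE p0; rewrite E size_poly0 => /esym/eqP; rewrite size_poly_eq0 => ->.
  rewrite f2E hornerD hornerN horner_comp !hornerE -!pE upd_same; congr (f1 _ - _).
  by apply/funext => k; rewrite /upd; case: eqP.
exists f1; split=> //; last by exists y1.
apply: polyfunW (polyfun_periodic (i := j) pf1 (oner_neq0 R) _).
  by move=> l /andP [/andP [jl ->]]; rewrite andbT ltn_neqAle jl eq_sym => ->.
by move=> z; apply/eqP; rewrite -subr_eq0 -f2E f20.
Qed.

End ModelGeometry.

Section CrystallographicActions.
Context {R : realType} {G : groupType}.
Local Notation S := (nat -> R).
Local Notation lt i := (fun l : nat => (l < i)%N).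

Lemma triangular_fix (Gam : set G) n rk (act : G -> S -> S) : triangular Gam n rk act ->
  forall g x i, Gam g -> (n <= i)%N -> act g x i = x i.
Proof. by move=> tG g x i /tG [fx _]; apply: fx. Qed.

Lemma triangular_polyfun_lt (Gam : set G) n rk (act : G -> S -> S) g i :
  triangular Gam n rk act -> Gam g -> (i < n)%N -> polyfun (lt n) (fun x => act g x i).
Proof.
by move=> tG Gg ni; apply: polyfunW (triangular_polyfun tG Gg ni) => l /andP [].
Qed.

Lemma triangular_loclip (Gam : set G) n rk (act : G -> S -> S) : triangular Gam n rk act ->
  forall g i, Gam g -> (i < n)%N -> loclip n (fun x => act g x i).
Proof.
move=> tG g i Gg ni; apply: (@loclip_poly _ n (lt n)) => //.
exact: (triangular_polyfun_lt tG).
Qed.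

Section Homotopy.
Variables (Gam : set G) (n : nat) (rk : nat -> nat) (act : G -> S -> S).
Hypotheses (sG : is_subgroup Gam) (aG : acts Gam act) (tG : triangular Gam n rk act)
  (pG : proper_action Gam n act) (cG : cocompact_action Gam n act).

(* An equivariant map is homotopic to the identity by an equivariant homotopy,
   which is proper. *)
Lemma equivariant_dense (F : S -> S) :
  (forall i, (i < n)%N -> loclip n (fun x => F x i)) ->
  (forall g x i, Gam g -> (i < n)%N -> F (act g x) i = act g (F x) i) ->
  forall r0, exists rho, forall y eps, box n r0 y -> 0 < eps ->
    exists2 x, box n rho x & forall i, (i < n)%N -> `|F x i - y i| <= eps.
Proof.
(* The straight-line homotopy [F0] is equivariant at the times 0 and 1; obstruction theory relative
   to [Z0] makes it equivariant at all times and keeps its two ends. *)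
move=> lF eqF; pose Z0 := [set x : S | x n = 0 \/ x n = 1].
pose F0 (z : S) : S := fun i => if (i < n)%N then (1 - z n) * z i + z n * F z i else 0.
have nS : (n <= n.+1)%N by [].
have fx := triangular_fix tG.
have [|||||||Hmt [lH H0 eqH HF0]] := @equivariant_map R G S Gam act (loclip n.+1) Z0 n rk act
    sG aG aG tG _ _ _ _ F0.
- exact: loclip_alg.
- by move=> g f Gg lf; exact: (loclip_act (triangular_loclip tG) fx nS Gg lf).
- by move=> g z Gg; rewrite /Z0 /= fx.
- exact: (H1_loclip sG aG (triangular_loclip tG) fx pG cG Z0 nS).
- move=> i ni; rewrite /F0 ni.
  have lvar k : (k < n.+1)%N -> loclip n.+1 (fun z : S => z k) by apply: loclip_var.
  apply: loclip_add; apply: loclip_mul.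
  + by apply: loclip_sub; [apply: loclip_cst|apply: lvar].
  + by apply: lvar; apply: leq_trans nS.
  + exact: lvar.
  + by apply: loclipW nS _; apply: lF.
- by move=> z i ni; rewrite /F0 ltnNge ni.
- move=> g z Gg Zz; apply/funext => i; have [ni|ni] := ltnP i n; last first.
    by rewrite fx// /F0 ltnNge ni.
  have dep (w : S) : (forall l, (l < n)%N -> F0 z l = w l) -> act g (F0 z) i = act g w i.
    by move=> wE; apply: (polyfun_dep (triangular_polyfun_lt tG Gg ni)).
  rewrite {1}/F0 ni fx//; case: Zz => zn; rewrite zn.
    rewrite subr0 mul1r mul0r addr0; symmetry; apply: dep => l ln.
    by rewrite /F0 ln zn subr0 mul1r mul0r addr0.
  rewrite subrr mul0r add0r mul1r eqF//; symmetry; apply: dep => l ln.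
  by rewrite /F0 ln zn subrr mul0r add0r mul1r.
apply: (@dense_image _ _ Gam n act sG aG _ _ pG cG F Hmt) => //.
- exact: triangular_loclip tG.
- by move=> g x i Gg ni; rewrite eqH.
- by move=> x i xn ni; rewrite HF0; [rewrite /F0 ni xn subr0 mul1r mul0r addr0|left].
- by move=> x i xn ni; rewrite HF0; [rewrite /F0 ni xn subrr mul0r add0r mul1r|right].
Qed.

End Homotopy.

(** * Transfer of the vanishing of cohomology from the model to a crystallographic action *)

Section Classification.
Variables (H : set G) (h : nat) (Gam : nat -> set G) (t : nat -> G)
  (st en : nat -> nat).
Hypothesis gc : good_chain H h Gam t st en.
Variable act : G -> S -> S.
Hypothesis md : model Gam t en h act.
Variables (n : nat) (rk : nat -> nat) (a1 : G -> S -> S).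
Hypotheses (aN : acts H a1) (tN : triangular H n rk a1)
  (pN : proper_action H n a1) (cN : cocompact_action H n a1).

Let HE : Gam h = H. Proof. exact: chain_top gc. Qed.
Let sH : is_subgroup H. Proof. by rewrite -HE; apply: (chain_subgroup gc). Qed.
Let aH : acts H act. Proof. by rewrite -HE; apply: (model_acts md). Qed.
Let tH : triangular H h (chain_rank h en) act.
Proof. by have := model_triangular gc (leqnn h) md; rewrite HE. Qed.
Let pact g f : H g -> polyfun (lt h) f -> polyfun (lt h) (fun x => f (act g x)).
Proof. by rewrite -HE => Hg; apply: (model_polyfun_act md). Qed.
Let pa1 g f : H g -> polyfun (lt n) f -> polyfun (lt n) (fun x => f (a1 g x)).
Proof.
move=> Hg pf; apply: polyfun_comp pf _ => l ln; exact: (triangular_polyfun_lt tN).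
Qed.

Section Developing.
Variable p : S -> S.
Hypotheses (pp : forall i, (i < n)%N -> polyfun (lt h) (fun x => p x i))
  (p0 : forall x i, (n <= i)%N -> p x i = 0)
  (eqp : forall g, H g -> forall x, p (act g x) = a1 g (p x)).

Let pcomp f : polyfun (lt n) f -> polyfun (lt h) (fun x => f (p x)).
Proof. by move=> pf; apply: polyfun_comp pf _. Qed.

(** The action [a1] is proper and cocompact, so its Lipschitz cohomology vanishes, and the model
    action is a triangular target. *)
Lemma retract_up_to_homotopy : exists g : S -> S,
  [/\ forall i, (i < h)%N -> loclip n (fun y => g y i)
    & forall k y, H k -> g (a1 k y) = act k (g y)].
Proof.
have [|||||||g [lg g0 eqg _]] := @equivariant_map R G S H a1 (loclip n) set0 h (chain_rank h en) act
    sH aN aH tH _ _ _ _ (fun=> fun=> 0).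
- exact: loclip_alg.
- move=> k f Hk lf.
  exact: (loclip_act (triangular_loclip tN) (triangular_fix tN) (leqnn n) Hk lf).
- by [].
- apply: H1_loclip => //; [exact: triangular_loclip tN|exact: triangular_fix tN].
- by move=> i _; apply: loclip_cst.
- by [].
- by [].
by exists g; split=> // k y Hk; apply: eqg.
Qed.

Let loc_p i : (i < n)%N -> loclip h (fun x => p x i).
Proof. by move=> ni; apply: (@loclip_poly _ h (lt h)) => //; apply: pp. Qed.

(** The composite [g o p] has dense image, so [g] alone maps a box of R^n almost onto the unit box
    of R^h. *)
Lemma chain_length_le : (h <= n)%N.
Proof.
have [g [lg eqg]] := retract_up_to_homotopy.
have [rho rhoE] := @equivariant_dense H h (chain_rank h en) act sH aH tH
   (model_proper gc md) (model_cocompact gc md) (fun x => g (p x))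
   (fun i ih => loclip_comp (lg i ih) loc_p)
   (fun k x i Hk ih => congr1 (fun y : S => y i) (etrans (congr1 g (eqp Hk x)) (eqg k (p x) Hk))) 1.
have [B B0 BE] := loclip_bound_family rho loc_p.
apply: (loclip_dimension lg (B := B)) => y eps byy e0.
by have [x bx xE] := rhoE y eps byy e0; exists (p x) => //; apply: BE.
Qed.

(** [p o g] has dense image, so [f] vanishes at points as close to [y] as desired, inside a box on
    which it is Lipschitz. *)
Lemma developing_injective f : polyfun (lt n) f -> (forall x, f (p x) = 0) -> forall y, f y = 0.
Proof.
move=> pf f0 y; have [g [lg eqg]] := retract_up_to_homotopy.
have lpg i : (i < n)%N -> loclip n (fun y => p (g y) i).
  by move=> ni; apply: (loclip_comp (loc_p ni)).
have [rho rhoE] := @equivariant_dense H n rk a1 sH aN tN pN cN (fun y => p (g y)) lpg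
   (fun k y i Hk ni => congr1 (fun z : S => z i) (etrans (congr1 p (eqg k y Hk)) (eqp Hk (g y))))
   (\sum_(i < n) `|y i|).
have byy : box n (\sum_(i < n) `|y i|) y.
  by move=> i' ni; rewrite (bigD1 (Ordinal ni))//= lerDl sumr_ge0.
have lf : loclip n f by apply: (@loclip_poly _ n (lt n)).
have [L L0 LE] := lf (\sum_(i < n) `|y i| + 1).
apply/eqP; rewrite -normr_le0; apply/ler_addgt0Pr => e e0; rewrite add0r.
pose eps := Num.min 1 (e / (L * n%:R + 1)).
have Ln : 0 < L * n%:R + 1 by rewrite ltr_wpDl// mulr_ge0.
have eps0 : 0 < eps by rewrite lt_min ltr01 divr_gt0.
have [x bx xE] := rhoE y eps byy eps0.
have b2 : box n (\sum_(i < n) `|y i| + 1) (p (g x)).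
  move=> i ni; rewrite -[p _ i](subrK (y i)) (le_trans (ler_normD _ _))// addrC lerD ?byy//.
  by rewrite (le_trans (xE i ni))// ge_min lexx.
have := LE _ _ (boxW _ byy) b2; rewrite f0 subr0 => /(_ _)/le_trans; apply.
  by rewrite lerDl.
have dle : dist1 n y (p (g x)) <= eps * n%:R.
  rewrite mulr_natr -[X in _ *+ X]card_ord -sumr_const; apply: ler_sum => i _.
  by rewrite distrC xE.
apply: (le_trans (ler_wpM2l L0 dle)).
have : eps * (L * n%:R + 1) <= e by rewrite -ler_pdivlMr// ge_min lexx orbT.
by nra.
Qed.

Definition pulled_back f := exists2 a, polyfun (lt n) a & forall x, f x = a (p x).

Lemma pulled_back_poly f : pulled_back f -> polyfun (lt h) f.
Proof. by move=> [a pa E]; apply: polyfun_ext (pcomp pa) => x; rewrite E. Qed.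

Lemma pulled_back_cst c : pulled_back (fun=> c).
Proof. by exists (fun=> c) => //; apply: polyfun_cst. Qed.

Lemma pulled_back_add f g : pulled_back f -> pulled_back g -> pulled_back (fun x => f x + g x).
Proof.
move=> [a pa aE] [b pb bE]; exists (fun y => a y + b y); first exact: polyfun_add.
by move=> x; rewrite aE bE.
Qed.

Lemma pulled_back_mul f g : pulled_back f -> pulled_back g -> pulled_back (fun x => f x * g x).
Proof.
move=> [a pa aE] [b pb bE]; exists (fun y => a y * b y); first exact: polyfun_mul.
by move=> x; rewrite aE bE.
Qed.

Lemma pulled_back_scale c f : pulled_back f -> pulled_back (fun x => c * f x).
Proof. by move=> pf; apply: pulled_back_mul => //; apply: pulled_back_cst. Qed.

Lemma pulled_back_sub f g : pulled_back f -> pulled_back g -> pulled_back (fun x => f x - g x).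
Proof.
move=> [a pa aE] [b pb bE]; exists (fun y => a y - b y); first exact: polyfun_sub.
by move=> x; rewrite aE bE.
Qed.

Lemma pulled_back_sum (I : Type) (r : seq I) (C : pred I) (F : I -> S -> R) :
  (forall i, C i -> pulled_back (F i)) -> pulled_back (fun x => \sum_(i <- r | C i) F i x).
Proof.
move=> pF; elim: r => [|i r IH].
  by have := pulled_back_cst 0; congr pulled_back; apply/funext => x; rewrite big_nil.
case: (boolP (C i)) => Ci.
  by have := pulled_back_add (pF i Ci) IH; congr pulled_back; apply/funext => x; rewrite big_cons Ci.
by have := IH; congr pulled_back; apply/funext => x; rewrite big_cons (negbTE Ci).
Qed.

Lemma pulled_back_act g f : H g -> pulled_back f -> pulled_back (fun x => f (act g x)).
Proof.
move=> Hg [a pa aE]; exists (fun y => a (a1 g y)); first exact: pa1.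
by move=> x; rewrite aE eqp.
Qed.

Lemma pulled_back_alg : funalg pulled_back.
Proof.
split; [exact: pulled_back_cst|exact: pulled_back_add|exact: pulled_back_mul].
Qed.

Lemma pulled_back_polyfun P f : polyfun P f ->
  (forall i, P i -> pulled_back (fun x => x i)) -> pulled_back f.
Proof. exact: (funalg_polyfun (F := id) pulled_back_alg). Qed.

Definition relation i d (b : nat -> S -> R) :=
  (forall k, (k <= d)%N -> pulled_back (b k)) /\
  (forall x, \sum_(k < d.+1) b k x * x i ^+ k = 0).

Definition nontrivial_relation i d := exists2 b, relation i d b & exists x, b d x != 0.

(** The coordinate [x i] and the [n] coordinates of [p] are [n.+1 > h] polynomials in [h] variables,
    hence dependent. The coefficients of the dependence do not all vanish after composition with
    [p], by [developing_injective]. *)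
Lemma coordinate_algebraic i : (i < h)%N -> exists d, nontrivial_relation i d.
Proof.
move=> ih; pose q (x : S) : S := fun l => if (l < n)%N then p x l else x i.
have [||P [pP P0 [y Py]]] := @algebraic_dependence R n.+1 h q.
- by rewrite ltnS chain_length_le.
- move=> l _; rewrite /q; case: (ltnP l n) => ln; first exact: pp.
  exact: polyfun_var.
have [D [c [pc PE]]] := polyfun_expand n pP.
have pc' k : polyfun (lt n) (c k).
  by apply: polyfunW (pc k) => l /andP [ln nl]; move: ln; rewrite ltnS leq_eqVlt (negbTE nl).
have [k0 [k0D k0E]] : exists k0, (k0 < D)%N /\ exists x, c k0 (p x) != 0.
  apply: contrapT => no; move/eqP: Py; apply; rewrite PE big1// => k _.
  have -> : c k y = 0; last by rewrite mulr0.
  apply: developing_injective => // x; apply: contrapT => /eqP nz.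
  by apply: no; exists k; split=> //; exists x.
pose Q k := (k < D)%N && `[< exists x, c k (p x) != 0 >].
have exQ : exists k, Q k by exists k0; rewrite /Q k0D; apply/asboolP.
have bQ k : Q k -> (k <= D)%N by move=> /andP [/ltnW].
have [d /andP [dD /asboolP dE] dmax] := ex_maxnP exQ bQ.
exists d, (fun k x => c k (p x)) => //; split=> [k _|x]; first by exists (c k).
rewrite -[RHS](P0 x) PE.
have qE k : c k (q x) = c k (p x).
  by apply: (polyfun_dep (pc' k)) => l ln; rewrite /q ln.
have qn : q x n = x i by rewrite /q ltnn.
under [RHS]eq_bigr => k _ do rewrite qE qn mulrC.
rewrite (big_ord_widen D (fun k => c k (p x) * x i ^+ k) dD) /= big_mkcond /=.
apply: eq_bigr => k _; case: ltnP => // dk.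
suff -> : c k (p x) = 0 by rewrite mul0r.
apply: contrapT => /eqP nz.
by have := dmax k; rewrite leqNgt dk => /(_ _)/negP; apply => //; rewrite /Q ltn_ord; apply/asboolP; exists x.
Qed.

(* The leading coefficients of the relations of minimal degree for the
   coordinate [i] form a subspace which is stable under the block of [i]. *)
Lemma coordinate_multiple i : (i < h)%N ->
  (forall l, (en i <= l < h)%N -> pulled_back (fun x => x l)) ->
  exists c, [/\ pulled_back c, pulled_back (fun x => c x * x i),
    polyfun (fun l => (en i <= l < h)%N) c & exists x, c x != 0].
Proof.
move=> ih top; have [d0 d0E] := coordinate_algebraic ih.
have exd : exists d, `[< nontrivial_relation i d >] by exists d0; apply/asboolP.
have [d /asboolP [b0 [pb0 b0E] [x0 b0x]] dmin'] := ex_minnP exd.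
(* Minimality of [d] kills the leading coefficient of a shorter relation, and then the others one
   after another. *)
have dmin b e : (e < d)%N -> relation i e b -> forall k, (k <= e)%N -> forall x, b k x = 0.
  elim: e => [|e IH] ed relb k ke x; apply: contrapT => /eqP nz.
    have : (d <= 0)%N; last by rewrite leqNgt ed.
    by apply: dmin'; apply/asboolP; exists b => //; move: ke nz; rewrite leqn0 => /eqP ->; exists x.
  have lead y : b e.+1 y = 0.
    apply: contrapT => /eqP nz'; have : (d <= e.+1)%N; last by rewrite leqNgt ed.
    by apply: dmin'; apply/asboolP; exists b => //; exists y.
  move: ke; rewrite leq_eqVlt ltnS => /orP [/eqP kE|ke]; first by move/eqP: nz; rewrite kE lead.
  move/eqP: nz; apply; apply: IH => //; first exact: ltnW.
  case: relb => pb bE; split=> [l le|y]; first by apply: pb; apply: leqW.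
  by have := bE y; rewrite big_ord_recr /= lead mul0r addr0.
have dgt0 : (0 < d)%N.
  rewrite lt0n; apply: contraNneq b0x => dE; have := b0E x0; rewrite dE big_ord_recr big_ord0 /=.
  by rewrite expr0 mulr1 add0r => ->.
set v := en i in top *.
have vh : (v <= h)%N by have /andP [] := chain_block gc ih.
have iv : (i < v)%N by have /andP [/andP []] := chain_block gc ih.
have Hv g : Gam v g -> H g by apply: (chain_sub_top gc).
have sv : is_subgroup (Gam v) by apply: (chain_subgroup gc).
have kap g : Gam v g -> exists k, forall x, act g x i = x i + k.
  by move=> Gg; apply: (model_block md ih); rewrite (minn_idPl vh).
(* Substituting [x i + k] for [x i] in the relation transformed by [g]. *)
have transform g b k : Gam v g -> (forall x, act g x i = x i + k) -> relation i d b ->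
    relation i d (fun j x => \sum_(m < d.+1 | (j <= m)%N) b m (act g x) * (k ^+ (m - j) *+ 'C(m, j))).
  move=> Gg gk [pb bE]; split=> [j jd|x].
    apply: pulled_back_sum => m _; apply: pulled_back_mul (pulled_back_cst _).
    by apply: (@pulled_back_act g (b m)); [exact: Hv|apply: pb; rewrite -ltnS].
  rewrite -[RHS](bE (act g x)) gk.
  transitivity (\sum_(m < d.+1) \sum_(j < d.+1 | (j <= m)%N)
      b m (act g x) * (k ^+ (m - j) *+ 'C(m, j)) * x i ^+ j).
    rewrite (exchange_big_dep predT)//=; apply: eq_bigr => j _; rewrite big_distrl /=.
    by apply: eq_bigr.
  apply: eq_bigr => m _; rewrite addrC exprDn big_distrr /=.
  rewrite (big_ord_widen d.+1 (fun j => b m (act g x) * (k ^+ (m - j) * x i ^+ j *+ 'C(m, j))) (ltn_ord m)).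
  by apply: eq_big => [j|j _]; rewrite ?ltnS// -mulrA mulrnAl.
pose J f := exists2 b, relation i d b & forall x, b d x = f x.
have leadE g (b : nat -> S -> R) (k : R) x : \sum_(m < d.+1 | (d <= m)%N) b m (act g x) * (k ^+ (m - d) *+ 'C(m, d)) =
    b d (act g x) :> R.
  rewrite big_mkcond big_ord_recr /= leqnn subnn binn expr0 mulr1 big1 ?add0r// => m _.
  by rewrite leqNgt ltn_ord.
have [|||||f [[b relb bf] pf [y fy]]] := stable_subspace_invariant gc md (J := J) (f := b0 d) (x := x0) vh.
- move=> f [b [pb _] bf]; apply: polyfun_ext (pulled_back_poly (pb d (leqnn d))) => x.
  by rewrite bf.
- move=> f1 f2 [b1 [pb1 b1E] bf1] [b2 [pb2 b2E] bf2].
  exists (fun k x => b1 k x - b2 k x); last by move=> x; rewrite bf1 bf2.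
  split=> [k kd|x]; first by apply: pulled_back_sub; [apply: pb1|apply: pb2].
  have := congr2 (fun a b => a - b) (b1E x) (b2E x); rewrite subrr -sumrB => E.
  rewrite -[RHS]E; apply: eq_bigr => k _.
  by rewrite mulrBl.
- move=> g f Gg [b relb bf]; have [k gk] := kap g Gg.
  by eexists; [exact: (transform g b k Gg gk relb)|move=> x /=; rewrite leadE bf].
- by exists b0.
- exact: b0x.
have [pb bE] := relb.
have finv g : Gam v g -> forall x, f (act g x) = f x.
  move=> Gg x; apply: (polyfun_dep pf) => l /andP [vl lh].
  exact: (model_fix_ge gc (leqnn h) md x vl lh Gg).
exists f; split.
- by case: (pb d (leqnn d)) => a pa aE; exists a => // x; rewrite -bf aE.
(* The leading coefficient [f] is invariant, so the transformed relation minus the original one has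
   degree below [d] and vanishes. Its coefficient at [d.-1] says that [w] is invariant under the
   block, hence a polynomial in later coordinates, which are known to be pulled back. *)
- pose w x := b d.-1 x + d%:R * (f x * x i).
  have winv g : Gam v g -> forall x, w (act g x) = w x.
    move=> Gg x; have [k gk] := kap g Gg.
    have rel' := transform g b k Gg gk relb.
    have rel'' : relation i d.-1 (fun j x => \sum_(m < d.+1 | (j <= m)%N)
        b m (act g x) * (k ^+ (m - j) *+ 'C(m, j)) - b j x).
      case: rel' => pb' bE'; split=> [j jd|y'].
        have jd' : (j <= d)%N by rewrite (leq_trans jd)// leq_pred.
        by apply: pulled_back_sub; [apply: pb'|apply: pb].
      have := congr2 (fun a b => a - b) (bE' y') (bE y'); rewrite subrr -sumrB.
      rewrite prednK// big_ord_recr /= leadE !bf finv// subrr addr0 => E.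
      by rewrite -[RHS]E; apply: eq_bigr => j _; rewrite mulrBl.
    have d1 : (d.-1 < d)%N by rewrite prednK.
    have := dmin _ _ d1 rel'' d.-1 (leqnn _) x.
    have dE : (d.-1.+1 = d)%N by rewrite prednK.
    have -> : \sum_(m < d.+1 | (d.-1 <= m)%N) b m (act g x) * (k ^+ (m - d.-1) *+ 'C(m, d.-1)) =
        b d.-1 (act g x) + f x * (k * d%:R).
      rewrite big_mkcond -dE !big_ord_recr /= leqnn leqnSn subnn binn expr0 mulr1 big1 ?add0r; last first.
        by move=> m _; rewrite leqNgt ltn_ord.
      by rewrite subSnn expr1 binSn dE bf finv// mulr_natr.
    rewrite /w gk finv// => E.
    by apply/eqP; rewrite -subr_eq0 -[X in _ == X]E; apply/eqP; ring.
  have pw : pulled_back w.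
    apply: (@pulled_back_polyfun (fun l => (v <= l)%N && (l < h)%N)) => //.
    apply: (model_invariant gc (leqnn h) md vh) => //.
    apply: polyfun_add; first by apply: pulled_back_poly; apply: pb; apply: leq_pred.
    apply: polyfun_scale; apply: polyfun_mul; last exact: polyfun_var.
    by apply: polyfunW pf => l /andP [].
  have := pulled_back_scale d%:R^-1 (pulled_back_sub pw (pb d.-1 (leq_pred d))).
  congr pulled_back; apply/funext => x; rewrite /w addrC addKr mulKf// pnatr_eq0.
  by rewrite -lt0n.
- exact: pf.
- by exists y.
Qed.

(** Downward induction on blocks. The multipliers [f] for which all [f x * x l] with [l] in the
    block are pulled back form a space [J], non-zero by multiplying the denominators of the single
    coordinates. [H] acts on the block linearly up to later coordinates, so [J] is stable under [H]
    and contains a non-zero constant. *)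
Lemma coordinate_pulled_back i : (i < h)%N -> pulled_back (fun x => x i).
Proof.
have [m hm] := ubnP (h - i); elim: m i hm => // m IH i him ih.
have /andP [/andP [sti ien] enh] := chain_block gc ih.
set u := st i in sti *; set v := en i in ien enh *.
have top l : (v <= l < h)%N -> pulled_back (fun x => x l).
  by move=> /andP [vl lh]; apply: IH => //; lia.
have blk l : (u <= l < v)%N -> [/\ (l < h)%N, st l = u & en l = v].
  move=> luv; have [-> ->] := chain_same gc ih luv; split=> //.
  by case/andP: luv => _ lv; apply: leq_trans lv enh.
have [c [pc cx [x cxn]]] : exists c, [/\ pulled_back c,
    forall l, (u <= l < v)%N -> pulled_back (fun x => c x * x l) & exists x, c x != 0].
  have part k : (k <= v - u)%N -> exists c, [/\ pulled_back c,
      forall l, (u <= l < u + k)%N -> pulled_back (fun x => c x * x l) & exists x, c x != 0].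
    elim: k => [|k IHk] kv.
      exists (fun=> 1); split; [exact: pulled_back_cst|move=> l; lia|].
      by exists (fun=> 0); rewrite oner_neq0.
    have [c [pc cx [x cxn]]] := IHk (ltnW kv).
    have uk : (u <= u + k < v)%N by lia.
    have [ukh stE enE] := blk _ uk.
    have [|c' [pc' cx' pfc' [y cyn]]] := coordinate_multiple ukh.
      by move=> l; rewrite enE; apply: top.
    exists (fun x => c x * c' x); split.
    - exact: pulled_back_mul.
    - move=> l /andP [ul]; rewrite addnS ltnS leq_eqVlt => /orP [/eqP ->|lk].
        by have := pulled_back_mul pc cx'; congr pulled_back; apply/funext => z; rewrite mulrA.
      have cl : pulled_back (fun x => c x * x l) by apply: cx; rewrite ul.
      by have := pulled_back_mul pc' cl; congr pulled_back; apply/funext => z; rewrite mulrCA mulrA.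
    - exact: (polyfun_domain (pulled_back_poly pc) (pulled_back_poly pc') cxn cyn).
  have [c [pc cx cn]] := part _ (leqnn (v - u)).
  by exists c; split=> // l luv; apply: cx; lia.
pose J f := pulled_back f /\ forall l, (u <= l < v)%N -> pulled_back (fun x => f x * x l).
have [|||||f [[pf fx] pfh [y fy]]] := stable_subspace_invariant gc md (J := J) (f := c) (x := x) (leqnn h).
- by move=> f [pf _]; apply: pulled_back_poly.
- move=> f g [pf fl] [pg gl]; split=> [|l luv]; first exact: pulled_back_sub.
  have := pulled_back_sub (fl l luv) (gl l luv).
  by congr pulled_back; apply/funext => z; rewrite mulrBl.
- rewrite HE => g f Hg [pf fl]; split=> [|l luv]; first exact: pulled_back_act.
  have [lh stE enE] := blk l luv.
  have HgV := subgroupV sH Hg.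
  have [_ /(_ l lh) [mu [e [pe eE]]]] := tH HgV.
  have pe' : pulled_back e.
    apply: pulled_back_polyfun pe _ => k /andP [kh rk']; apply: top; rewrite kh andbT leqNgt.
    apply/negP => kv; move: rk'; rewrite /chain_rank enE.
    have [uk|uk] := leqP u k.
      by have [_ _ ->] := blk k (introT andP (conj uk kv)); rewrite ltnn.
    have /andP [/andP [stk enk] _] := chain_block gc kh.
    have : (en k <= u)%N.
      rewrite leqNgt; apply/negP => ku.
      have [E _] := chain_same gc kh (introT andP (conj (leq_trans stk (ltnW uk)) ku)).
      have := chain_same gc (leq_ltn_trans sti ih) (j := k).
      have [stu enu] := chain_same gc ih (introT andP (conj (leqnn u) (leq_ltn_trans sti ien))).
      have [_ E2] := chain_same gc kh (introT andP (conj (leq_trans stk (ltnW uk)) ku)).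
      by move: E; rewrite stu; move: stk uk; rewrite /u; lia.
    lia.
  have : pulled_back (fun x => f (act g x) *
      (\sum_(k < h | chain_rank h en k == chain_rank h en l) mu k * act g x k + e (act g x))).
    pose F x := f x * (\sum_(k < h | chain_rank h en k == chain_rank h en l) mu k * x k + e x).
    apply: (@pulled_back_act g F) => //; rewrite /F.
    have : pulled_back (fun x => \sum_(k < h | chain_rank h en k == chain_rank h en l)
        mu k * (f x * x k) + f x * e x).
      apply: pulled_back_add; last exact: pulled_back_mul.
      apply: pulled_back_sum => k /eqP rkk; apply: pulled_back_scale; apply: fl.
      have kh := ltn_ord k; have /andP [/andP [stk enk] enkh] := chain_block gc kh.
      have enE' : en k = v by move: rkk; rewrite /chain_rank enE; lia.
      rewrite -enE' enk andbT; rewrite leqNgt; apply/negP => ku.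
      have [stu enu] := chain_same gc ih (introT andP (conj (leqnn u) (leq_ltn_trans sti ien))).
      have uen : (u < en k)%N by rewrite enE' (leq_ltn_trans sti).
      have [E _] := chain_same gc kh (introT andP (conj (leq_trans stk (ltnW ku)) uen)).
      by move: E stk ku; rewrite stu /u; lia.
    congr pulled_back; apply/funext => z; rewrite mulrDr big_distrr /=; congr (_ + _).
    by apply: eq_bigr => k _; rewrite mulrCA.
  congr pulled_back; apply/funext => z; congr (_ * _).
  by rewrite -eE (actsKV _ sH aH).
- by split=> // l luv; apply: cx.
- exact: cxn.
have fc z : f z = f y by apply: (polyfun_dep pfh) => l; lia.
have := pulled_back_scale (f y)^-1 (fx i (introT andP (conj sti ien))).
by congr pulled_back; apply/funext => z; rewrite fc mulKf.
Qed.

(** The polynomials expressing the coordinates through [p] form a map [Q] with [Q o p] the identity.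
    That [p o Q] is the identity and that [Q] is equivariant holds on the image of [p], hence
    everywhere, so cocycles can be moved to the model and back. *)
Lemma H1_polynomial_developing : H1_trivial H a1 (polyfun (lt n)) set0.
Proof.
have /choice [q qE] : forall i : nat, exists a : S -> R, (i < h)%N ->
    polyfun (lt n) a /\ forall x, x i = a (p x).
  move=> i; have [ih|ih] := ltnP i h; last by exists (fun=> 0).
  by have [a pa aE] := coordinate_pulled_back ih; exists a.
pose Q (y : S) : S := fun i => if (i < h)%N then q i y else 0.
have Qp x i : (i < h)%N -> Q (p x) i = x i.
  by move=> ih; rewrite /Q ih; have [_ ->] := qE i ih.
have pQ i : (i < h)%N -> polyfun (lt n) (fun y => Q y i).
  by move=> ih; have [pq _] := qE i ih; rewrite /Q ih.
have PQ y l : (l < n)%N -> p (Q y) l = y l.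
  move=> ln; apply/eqP; rewrite -subr_eq0; apply/eqP.
  apply: (@developing_injective (fun y => p (Q y) l - y l)) => [|x].
    apply: polyfun_sub; last exact: polyfun_var.
    exact: polyfun_comp (pp ln) _.
  apply/eqP; rewrite subr_eq0; apply/eqP; apply: (polyfun_dep (pp ln)) => i ih; exact: Qp.
have eqQ g y i : H g -> (i < h)%N -> Q (a1 g y) i = act g (Q y) i.
  move=> Hg ih; apply/eqP; rewrite -subr_eq0; apply/eqP.
  apply: (@developing_injective (fun y => Q (a1 g y) i - act g (Q y) i)) => [|x].
    apply: polyfun_sub; first exact: (pa1 Hg (pQ i ih)).
    exact: polyfun_comp (triangular_polyfun_lt tH Hg ih) _.
  rewrite -eqp// Qp//; apply/eqP; rewrite subr_eq0; apply/eqP.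
  by apply: (polyfun_dep (triangular_polyfun_lt tH Hg ih)) => l lh; rewrite Qp.
move=> r M c rM pc cc.
have [|||u [pu uE _]] := model_H1 md (r := r) (M := M) (c := fun g x => c g (p x)).
- by rewrite HE.
- by rewrite HE => g Hg i; apply: (pcomp (pc g Hg i)).
- by rewrite HE => g k Hg Hk x; rewrite cc// eqp//; apply: subgroupV.
exists (fun y => u (Q y)); split=> //.
  by move=> i; apply: polyfun_comp (pu i) _.
move=> g Hg y.
have -> : c g y = c g (p (Q y)).
  apply/colP => i; apply: (polyfun_dep (pc g Hg i)) => l ln; by rewrite PQ.
rewrite -HE in Hg; rewrite uE//; congr (_ - _ *m _); rewrite HE in Hg.
apply/colP => i; apply: (polyfun_dep (pu i)) => l lh.
by rewrite eqQ//; apply: subgroupV.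
Qed.

End Developing.

Lemma H1_polynomial : H1_trivial H a1 (polyfun (lt n)) set0.
Proof.
have [|||||||p [pp p0 eqp _]] := @equivariant_map R G S H act (polyfun (lt h)) set0 n rk a1
    sH aH aN tN _ _ _ _ (fun=> fun=> 0).
- exact: polyfun_funalg.
- by move=> g f Hg; apply: pact.
- by [].
- by have := model_H1 md; rewrite HE.
- by move=> i _; apply: polyfun_cst.
- by [].
- by [].
exact: (H1_polynomial_developing pp eqp).
Qed.

End Classification.

Definition finite_index (H : set G) := exists k (r : 'I_k -> G),
  (forall g, exists i, H ((r i)^-1 * g)%g) /\
  (forall i j, H ((r i)^-1 * r j)%g -> i = j).

(** A primitive over [H] reduces to a cocycle that vanishes on [H], whose value then depends only on
    the left coset; its mean over the [k] cosets is a primitive, since left translation permutes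
    them. *)
Lemma H1_finite_index (H : set G) n (a1 : G -> S -> S) : is_subgroup H -> finite_index H ->
  acts [set: G] a1 ->
  (forall g f, polyfun (lt n) f -> polyfun (lt n) (fun x => f (a1 g x))) ->
  H1_trivial H a1 (polyfun (lt n)) set0 -> H1_trivial [set: G] a1 (polyfun (lt n)) set0.
Proof.
move=> sH [k [r [rE rinj]]] aN stN H1H d M c [M1 MM] pc cc.
have [|||u0 [pu0 u0E _]] := H1H d M c; first by split=> // g g' _ _; apply: MM.
- by move=> g _; apply: pc.
- by move=> g g' _ _; apply: cc.
pose c' g x := c g x - (u0 x - M g *m u0 (a1 g^-1%g x)).
have c'H g x : H g -> c' g x = 0 by move=> Hg; rewrite /c' u0E// subrr.
have c'M g g' x : c' (g * g')%g x = c' g x + M g *m c' g' (a1 g^-1%g x).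
  rewrite /c' cc// MM// invgM (proj2 aN)// !mulmxBr mulmxA.
  move: (c g x) (M g *m c g' _) (u0 x) (M g *m u0 _) (_ *m u0 _) => a b e f w.
  by apply/colP => i; rewrite !mxE; ring.
have c'coset g g' x : H (g^-1 * g')%g -> c' g' x = c' g x.
  by move=> Hgg; rewrite -[g'](mulVKg g) c'M (c'H _ _ Hgg) mulmx0 addr0.
have k0 : (0 < k)%N.
  by have [i _] := rE 1%g; apply: leq_trans (ltn_ord i).
pose u x := u0 x + k%:R^-1 *: \sum_(i < k) c' (r i) x.
have pc' g i : polyfun (lt n) (fun x => c' g x i 0).
  have : polyfun (lt n) (fun x => c g x i 0 - (u0 x i 0 - \sum_j M g i j * u0 (a1 g^-1%g x) j 0)).
    apply: polyfun_sub; first exact: pc.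
    apply: polyfun_sub; first exact: pu0.
    apply: polyfun_sum => j _; apply: polyfun_scale.
    exact: (stN g^-1%g (fun x => u0 x j 0)).
  by congr polyfun; apply/funext => x; rewrite !mxE.
exists u; split=> //.
  move=> i; have : polyfun (lt n) (fun x => u0 x i 0 + k%:R^-1 * \sum_(j < k) c' (r j) x i 0).
    by apply: polyfun_add (pu0 i) (polyfun_scale _ _); apply: polyfun_sum.
  by congr polyfun; apply/funext => x; rewrite !mxE summxE.
move=> g _ x.
have [sg sgE] : {sg : 'I_k -> 'I_k & forall i, H ((r (sg i))^-1 * (g * r i))%g}.
  have /choice [sg sgE] : forall i, exists j, H ((r j)^-1 * (g * r i))%g by move=> i; apply: rE.
  by exists sg.
have sgI : injective sg.
  move=> i j E; apply: rinj; have := subgroupM sH (subgroupV sH (sgE i)) (sgE j).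
  by rewrite E !invgM invgK !mulgA mulgK mulgVK.
have avg : \sum_(i < k) c' (r i) x - M g *m (\sum_(i < k) c' (r i) (a1 g^-1%g x)) = c' g x *+ k.
  rewrite (reindex_inj sgI) /= mulmx_sumr -sumrB -[X in _ *+ X]card_ord -sumr_const.
  apply: eq_bigr => i _; rewrite -(c'coset _ _ x (sgE i)) c'M addrK//.
have -> : c g x = c' g x + (u0 x - M g *m u0 (a1 g^-1%g x)) by rewrite /c' subrK.
have -> : c' g x = k%:R^-1 *: (c' g x *+ k).
  by rewrite -[c' g x *+ k]scaler_nat scalerA mulVf ?scale1r// pnatr_eq0 -lt0n.
rewrite -avg /u mulmxDr -scalemxAr scalerBr.
move: (_ *: _) (_ *: (_ *m _)) (u0 x) (_ *m u0 _) => a b e f.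
by apply/colP => i; rewrite !mxE; ring.
Qed.

Lemma cocompact_finite_index (H : set G) n (act : G -> S -> S) : is_subgroup H -> finite_index H ->
  acts [set: G] act -> (forall g i, (i < n)%N -> loclip n (fun x => act g x i)) ->
  cocompact_action [set: G] n act -> cocompact_action H n act.
Proof.
move=> sH [k [r [rE _]]] aG lact [c cE].
have [B BE] : exists B, forall i x, box n c x -> box n B (act (r i)^-1%g x).
  have : exists B, forall i, i \in index_enum 'I_k -> forall x, box n c x -> box n B (act (r i)^-1%g x).
    elim: (index_enum _) => [|i s [B BE]]; first by exists 0.
    have [B' _ BE'] := loclip_bound_family c (lact (r i)^-1%g).
    exists (Num.max B B') => j; rewrite inE => /orP [/eqP ->|js] x bx.
      by apply: boxW (BE' _ bx); rewrite le_max lexx orbT.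
    by apply: boxW (BE j js x bx); rewrite le_max lexx.
  by move=> [B BE]; exists B => i; apply: BE; rewrite mem_index_enum.
exists B => x; have [g _ bg] := cE x; have [i Hi] := rE g.
by exists ((r i)^-1 * g)%g => //; rewrite (proj2 aG)//; apply: BE.
Qed.

Theorem polynomial_equivariant_map (H : set G) (h : nat) (Gam : nat -> set G) (t : nat -> G)
    (st en : nat -> nat) (n1 n2 : nat) (rk1 rk2 : nat -> nat) (a1 a2 : G -> S -> S) :
  good_chain H h Gam t st en -> finite_index H ->
  acts [set: G] a1 -> triangular [set: G] n1 rk1 a1 ->
  proper_action [set: G] n1 a1 -> cocompact_action [set: G] n1 a1 ->
  acts [set: G] a2 -> triangular [set: G] n2 rk2 a2 ->
  exists F : S -> S, [/\ forall i, (i < n2)%N -> polyfun (lt n1) (fun x => F x i),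
    forall x i, (n2 <= i)%N -> F x i = 0 & forall g x, F (a1 g x) = a2 g (F x)].
Proof.
move=> gc fi aa1 t1 pr1 co1 aa2 t2.
have sT : is_subgroup [set: G] by [].
have sH : is_subgroup H by rewrite -(chain_top gc); apply: (chain_subgroup gc).
have [act md] := model_exists gc (R := R).
have st1 g f : polyfun (lt n1) f -> polyfun (lt n1) (fun x => f (a1 g x)).
  by move=> pf; apply: polyfun_comp pf _ => l ln; apply: (triangular_polyfun_lt t1).
have H1 : H1_trivial [set: G] a1 (polyfun (lt n1)) set0.
  apply: (H1_finite_index sH) => //; apply: (H1_polynomial gc md (rk := rk1)).
  - by case: aa1 => e m; split=> // g g' _ _; apply: m.
  - by move=> g _; apply: t1.
  - by move=> r; apply: sub_finite_set (pr1 r) => g [_ gx].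
  - by apply: cocompact_finite_index => // g i ni; apply: (triangular_loclip t1).
have [|||||||F [pF F0 eqF _]] := @equivariant_map R G S [set: G] a1 (polyfun (lt n1)) set0 n2 rk2 a2
    sT aa1 aa2 t2 _ _ _ _ (fun=> fun=> 0).
- exact: polyfun_funalg.
- by move=> g f _; apply: st1.
- by [].
- exact: H1.
- by move=> i _; apply: polyfun_cst.
- by [].
- by [].
by exists F; split=> // g x; apply: eqF.
Qed.

End CrystallographicActions.

(** * Virtually polycyclic groups *)

Section PolyZ.
Context {G : groupType}.
Implicit Types (H K L : set G) (x t : G).

Definition normalizes x H := forall y, H y <-> H (x * y * x^-1)%g.

Definition cyclic_step K L t := [/\ is_subgroup K, is_subgroup L, normalizes t K,
  forall g, L g <-> exists x z, K x /\ g = (x * expgz t z)%g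
  & forall z, K (expgz t z) -> z = 0].

Fixpoint polyz n H := if n is n'.+1 then exists K t, polyz n' K /\ cyclic_step K H t
  else H = [set 1%g].

Definition int_hom H (f : G -> int) := forall x y, H x -> H y -> f (x * y)%g = f x + f y.
Definition hom_kernel H (f : G -> int) : set G := [set x | H x /\ f x = 0].

Lemma subgroup_one : is_subgroup [set (1%g : G)].
Proof.
split=> //; split=> [x y -> ->|x ->]; by rewrite ?mulg1 ?invg1.
Qed.

Lemma polyz_subgroup n H : polyz n H -> is_subgroup H.
Proof. by case: n => [->|n [K [t [_ []]]]//]; apply: subgroup_one. Qed.

Lemma subgroupI H K : is_subgroup H -> is_subgroup K -> is_subgroup (H `&` K).
Proof.
move=> sH sK; split; first by split; exact: subgroup1.
by split=> [x y [? ?] [? ?]|x [? ?]]; split; (apply: subgroupM || apply: subgroupV).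
Qed.

Lemma int_hom1 H f : is_subgroup H -> int_hom H f -> f 1%g = 0.
Proof. by move=> sH hf; have := hf 1%g 1%g (subgroup1 sH) (subgroup1 sH); rewrite mulg1; lia. Qed.

Lemma int_homV H f x : is_subgroup H -> int_hom H f -> H x -> f x^-1%g = - f x.
Proof.
move=> sH hf Hx; have := hf _ _ Hx (subgroupV sH Hx).
rewrite mulgV (int_hom1 sH hf); lia.
Qed.

Lemma int_hom_expgz H f x z : is_subgroup H -> int_hom H f -> H x -> f (expgz x z) = z * f x.
Proof.
move=> sH hf Hx; elim: z => [|n IH|n IH].
- by rewrite expgz0 (int_hom1 sH hf) mul0r.
- by rewrite intS expgzD expgz1 hf ?IH//; [lia|exact: subgroup_expgz].
- rewrite intS opprD expgzD expgzN expgz1 hf; [|exact: subgroupV|exact: subgroup_expgz].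
  by rewrite IH (int_homV sH hf)//; lia.
Qed.

Lemma int_hom_conj H f x y : is_subgroup H -> int_hom H f -> H x -> H y ->
  f (x * y * x^-1)%g = f y.
Proof.
move=> sH hf Hx Hy; rewrite !hf//; try exact: subgroupV; try exact: subgroupM.
by rewrite (int_homV sH hf)//; lia.
Qed.

Lemma hom_kernel_subgroup H f : is_subgroup H -> int_hom H f -> is_subgroup (hom_kernel H f).
Proof.
move=> sH hf; split; first by split; [exact: subgroup1|exact: int_hom1 hf].
split=> [x y [Hx fx] [Hy fy]|x [Hx fx]]; split.
- exact: subgroupM.
- by rewrite hf// fx fy.
- exact: subgroupV.
- by rewrite (int_homV sH hf)// fx oppr0.
Qed.

Lemma normalizes_subgroup x H : is_subgroup H -> H x -> normalizes x H.
Proof.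
move=> sH Hx y; split=> Hy; first exact: subgroupM sH (subgroupM sH Hx Hy) (subgroupV sH Hx).
have := subgroupM sH (subgroupM sH (subgroupV sH Hx) Hy) Hx.
by rewrite !mulgA mulVg mul1g mulgVK.
Qed.

Lemma hom_kernel_normal H f x : is_subgroup H -> int_hom H f -> H x ->
  normalizes x (hom_kernel H f).
Proof.
move=> sH hf Hx y; have nx := normalizes_subgroup sH Hx.
split=> [[Hy fy]|[Hy fy]]; first by split; [apply/(nx y)|rewrite (int_hom_conj sH hf)].
have Hy' : H y by apply/(nx y).
by split=> //; rewrite -fy (int_hom_conj sH hf).
Qed.

(** The generator [t] has the least positive value of [f]; division with remainder sends every
    element into the kernel times a power of [t]. *)
Lemma cyclic_step_hom L f : is_subgroup L -> int_hom L f -> (exists2 x, L x & f x != 0) ->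
  exists t, cyclic_step (hom_kernel L f) L t.
Proof.
move=> sL hf [x0 Lx0 fx0].
pose Q (m : nat) := (0 < m)%N && `[< exists2 x, L x & f x = m >].
have exQ : exists m, Q m.
  exists `|f x0|%N; rewrite /Q absz_gt0 fx0; apply/asboolP.
  have [f0|f0] := lerP 0 (f x0); first by exists x0; rewrite ?gez0_abs.
  exists x0^-1%g; first exact: subgroupV.
  by rewrite (int_homV sL hf)//; lia.
have [m /andP [m0 /asboolP [t Lt ft]] mmin] := ex_minnP exQ.
have sK := hom_kernel_subgroup sL hf.
exists t; split=> //; first exact: hom_kernel_normal.
- move=> g; split=> [Lg|[x [z [[Lx _] ->]]]]; last first.
    by apply: subgroupM => //; apply: subgroup_expgz.
  have Lz z : L (g * expgz t z)%g by apply: subgroupM => //; apply: subgroup_expgz.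
  pose q := (f g %/ m)%Z.
  have fr : f (g * expgz t (- q))%g = (f g %% m)%Z.
    rewrite hf//; last exact: subgroup_expgz.
    by rewrite (int_hom_expgz _ sL hf)// ft mulNr; have := divz_eq (f g) m; rewrite -/q; lia.
  exists (g * expgz t (- q))%g, q; split; last by rewrite -mulgA -expgzD addNr expgz0 mulg1.
  split=> //; rewrite fr; apply: contrapT => /eqP r0.
  have m0' : (m : int) != 0 by lia.
  have r1 := modz_ge0 (f g) m0'; have r2 : (f g %% m)%Z < m by apply: ltz_pmod; lia.
  have : (m <= `|(f g %% m)%Z|)%N; last by lia.
  apply: mmin; rewrite /Q absz_gt0 r0; apply/asboolP; exists (g * expgz t (- q))%g => //.
  by rewrite fr gez0_abs.
- by move=> z [_]; rewrite (int_hom_expgz _ sL hf)// ft => /eqP; rewrite mulf_eq0; lia.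
Qed.

Lemma cyclic_step_exponent K H t : cyclic_step K H t ->
  exists f, [/\ int_hom H f, hom_kernel H f = K & exists2 x, H x & f x != 0].
Proof.
move=> [sK sH nt HE inf].
have uniqz g z z' : K (g * expgz t (- z))%g -> K (g * expgz t (- z'))%g -> z = z'.
  move=> K1 K2; have := subgroupM sK (subgroupV sK K1) K2.
  rewrite invgM -mulgA mulKg -expgzN -expgzD opprK => /inf; lia.
have exz g : exists z, H g -> K (g * expgz t (- z))%g.
  have [Hg|nHg] := pselect (H g); last by exists 0.
  have [x [z [Kx ->]]] := (HE g).1 Hg; exists z => _.
  by rewrite -mulgA -expgzD subrr expgz0 mulg1.
have [f fE] := choice exz.
have fval x z : K x -> f (x * expgz t z)%g = z.
  move=> Kx; apply: (uniqz (x * expgz t z)%g).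
    by apply: fE; apply/HE; exists x, z.
  by rewrite -mulgA -expgzD subrr expgz0 mulg1.
have nz z x : K x -> K (expgz t z * x * (expgz t z)^-1)%g.
  by move=> Kx; apply/(conj_expgz sK nt z x).
exists f; split.
- move=> _ _ /HE [x [z [Kx ->]]] /HE [y [w [Ky ->]]].
  have -> : (x * expgz t z * (y * expgz t w) =
      x * (expgz t z * y * (expgz t z)^-1) * expgz t (z + w))%g.
    by rewrite expgzD !mulgA mulgVK.
  by rewrite !fval//; apply: subgroupM => //; apply: nz.
- apply/seteqP; split=> [_ [/HE [x [z [Kx ->]]]]|x Kx].
    by rewrite fval// => ->; rewrite expgz0 mulg1.
  have xE : x = (x * expgz t 0)%g by rewrite expgz0 mulg1.
  by split; [apply/HE; exists x, 0|rewrite xE fval].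
- exists t; first by apply/HE; exists 1%g, 1; rewrite mul1g; split=> //; exact: subgroup1.
  by have := fval 1%g 1 (subgroup1 sK); rewrite mul1g expgz1 => ->.
Qed.

Lemma cyclic_step_sub K H t L : cyclic_step K H t -> is_subgroup L -> L `<=` H ->
  L `<=` K \/ exists s, cyclic_step (L `&` K) L s.
Proof.
move=> cs sL LH; have [f [hf fK _]] := cyclic_step_exponent cs.
have hfL : int_hom L f by move=> x y /LH Hx /LH Hy; apply: hf.
have E : hom_kernel L f = L `&` K.
  rewrite -fK; apply/seteqP; split=> [x [Lx fx]|x [Lx [_ fx]]] //; split=> //.
  by split=> //; apply: LH.
have [nz|z] := pselect (exists2 x, L x & f x != 0).
  by right; rewrite -E; apply: cyclic_step_hom.
left=> x Lx; rewrite -fK; split; first exact: LH.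
by apply: contrapT => /eqP fx; apply: z; exists x.
Qed.

Lemma polyz_sub n H L : polyz n H -> is_subgroup L -> L `<=` H ->
  exists2 m, (m <= n)%N & polyz m L.
Proof.
elim: n H L => [|n IH] H L /= pH sL LH.
  exists 0%N => //=; apply/seteqP; split=> [x /LH|x ->]; first by rewrite pH.
  exact: subgroup1.
have [K [t [pK cs]]] := pH; have sK := polyz_subgroup pK.
have [m mn pm] := IH K (L `&` K) pK (subgroupI sL sK) (fun _ => @proj2 _ _).
have [LK|[s cs']] := cyclic_step_sub cs sL LH.
  have E : L `&` K = L by apply/seteqP; split=> [x []//|x Lx]; split=> //; apply: LK.
  by exists m; [exact: leqW|rewrite -E].
by exists m.+1 => //; exists (L `&` K), s.
Qed.

(** Either [f] is non-zero on [K], and the kernel in [K] is shorter by induction, or [f] is a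
    multiple of the exponent of [t] and its kernel is [K] itself. *)
Lemma polyz_hom_kernel n L f : polyz n L -> int_hom L f -> (exists2 x, L x & f x != 0) ->
  exists2 m, (m < n)%N & polyz m (hom_kernel L f).
Proof.
elim: n L => [|n IH] L pL hf [x0 Lx0 fx0].
  have sL := polyz_subgroup pL; move: Lx0 fx0; rewrite pL => -> .
  by rewrite (int_hom1 sL hf).
have sL := polyz_subgroup pL; have sk := hom_kernel_subgroup sL hf.
have [K [t [pK cs]]] := pL; have sK := polyz_subgroup pK.
have [_ _ nt LE inf] := cs.
have KL : K `<=` L by move=> x Kx; apply/LE; exists x, 0; rewrite expgz0 mulg1.
have Lt : L t by apply/LE; exists 1%g, 1; rewrite mul1g; split=> //; exact: subgroup1.
have hfK : int_hom K f by move=> x y /KL Lx /KL Ly; apply: hf.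
have [nz|z] := pselect (exists2 x, K x & f x != 0).
  have [m mn pm] := IH K pK hfK nz.
  have E : hom_kernel L f `&` K = hom_kernel K f.
    apply/seteqP; split=> [x [[Lx fx] Kx]|x [Kx fx]] //; split=> //; split=> //; exact: KL.
  have [sub|[s cs']] := cyclic_step_sub cs sk (fun _ => @proj1 _ _).
    have E2 : hom_kernel L f = hom_kernel K f.
      by rewrite -E; apply/seteqP; split=> [x kx|x []//]; split=> //; apply: sub.
    by exists m; [exact: leqW|rewrite E2].
  by exists m.+1 => //; exists (hom_kernel K f), s; rewrite -E; split=> //; rewrite E.
have fK x : K x -> f x = 0.
  by move=> Kx; apply: contrapT => /eqP fx; apply: z; exists x.
have fE x w : K x -> f (x * expgz t w)%g = w * f t.
  move=> Kx; rewrite hf; [|exact: KL|exact: subgroup_expgz].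
  by rewrite fK// add0r (int_hom_expgz _ sL hf).
have ft : f t != 0.
  move: fx0; have [x [w [Kx ->]]] := (LE x0).1 Lx0.
  by rewrite fE//; apply: contra => /eqP ->; rewrite mulr0.
exists n => //; suff -> : hom_kernel L f = K by [].
apply/seteqP; split=> [_ [/LE [x [w [Kx ->]]]]|x Kx]; last by split; [exact: KL|exact: fK].
by rewrite fE// => /eqP; rewrite mulf_eq0 (negbTE ft) orbF => /eqP ->; rewrite expgz0 mulg1.
Qed.

(** The elements whose class in the abelianization of [H] is killed by all homomorphisms to the
    integers: a characteristic subgroup with abelian quotient. *)
Definition hom_core H : set G := [set x | H x /\ forall f, int_hom H f -> f x = 0].

Lemma hom_core_subgroup H : is_subgroup H -> is_subgroup (hom_core H).
Proof.
move=> sH; split; first by split=> [|f hf]; [exact: subgroup1|exact: int_hom1 hf].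
split=> [x y [Hx x0] [Hy y0]|x [Hx x0]]; split=> [|f hf].
- exact: subgroupM.
- by rewrite hf// x0// y0.
- exact: subgroupV.
- by rewrite (int_homV sH hf)// x0 ?oppr0.
Qed.

Lemma hom_core_normal H g : is_subgroup H -> normalizes g H -> normalizes g (hom_core H).
Proof.
move=> sH ng.
have half g' x : normalizes g' H -> hom_core H x -> hom_core H (g' * x * g'^-1)%g.
  move=> ng' [Hx x0]; split=> [|f hf]; first by apply/(ng' x).
  apply: (x0 (fun y => f (g' * y * g'^-1)%g)) => y y' Hy Hy'.
  rewrite -hf; [|by apply/(ng' y)|by apply/(ng' y')].
  by rewrite !mulgA mulgVK.
have ngV : normalizes g^-1%g H.
  by move=> y; rewrite (ng (g^-1 * y * g^-1^-1)%g) invgK !mulgA mulgV mul1g mulgK.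
move=> x; split=> [|/(half _ _ ngV)]; first exact: half.
by rewrite invgK !mulgA mulVg mul1g mulgVK.
Qed.

Lemma hom_core_commutator H g g' : is_subgroup H -> H g -> H g' ->
  hom_core H (g * g' * g^-1 * g'^-1)%g.
Proof.
move=> sH Hg Hg'; have HV := subgroupV sH Hg; have HV' := subgroupV sH Hg'.
have Hc := subgroupM sH (subgroupM sH Hg Hg') HV.
split; first exact: subgroupM.
move=> f hf; rewrite hf// (int_hom_conj sH hf)// (int_homV sH hf)//; lia.
Qed.

(** The last block is [H] modulo its [hom_core]; the earlier ones come from the core, which is
    poly-Z of smaller length. The clause on normalizers is carried through the induction to make the
    ends of the blocks normal in the whole group. *)
Lemma polyz_good_chain n H : polyz n H -> exists h Gam (t : nat -> G) st en,
  good_chain H h Gam t st en /\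
  forall g, normalizes g H -> forall i, (i < h)%N ->
    normalizes g (Gam (st i)) /\ normalizes g (Gam (en i)).
Proof.
have [N] := ubnP n; elim: N n H => // N IH n H nN pH; have sH := polyz_subgroup pH.
case: n nN pH => [|n] nN pH.
  exists 0%N, (fun=> H), (fun=> 1%g), id, id; split=> //.
set D := hom_core H; have sD : is_subgroup D by apply: hom_core_subgroup.
have [m mn pD] : exists2 m, (m <= n)%N & polyz m D.
  have [K [t [pK cs]]] := pH; have [f [hf fK _]] := cyclic_step_exponent cs.
  apply: (polyz_sub pK sD) => x [Hx x0]; rewrite -fK; split=> //; exact: x0.
have [k [Gam0 [t0 [st0 [en0 [gc nc]]]]]] := IH m D (leq_ltn_trans mn nN) pD.
have nD g : H g -> normalizes g D.
  by move=> Hg; apply: hom_core_normal => //; apply: normalizes_subgroup.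
(* The steps inside the last block: while [L] exceeds [D], some homomorphism of [H] is non-zero on
   [L], and its kernel in [L] still contains [D] and is shorter. *)
have ext : forall m L, polyz m L -> D `<=` L -> L `<=` H -> exists h Gam (t : nat -> G),
   [/\ (k <= h)%N, forall i, (i <= k)%N -> Gam i = Gam0 i, forall i, (i < k)%N -> t i = t0 i,
      Gam h = L & [/\ forall i, (i <= h)%N -> is_subgroup (Gam i),
     forall i, (i < h)%N -> cyclic_step (Gam i) (Gam i.+1) (t i) & 
     forall i, (k <= i <= h)%N -> D `<=` Gam i]].
  move=> m'; have [N'] := ubnP m'; elim: N' m' => // N' IHN m' mN' L pL DL LH.
  have sL := polyz_subgroup pL.
  have [LD|nLD] := pselect (L `<=` D).
    have E : L = D by apply/seteqP.
    exists k, Gam0, t0; split=> //; first by rewrite (chain_top gc) E.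
    split; [exact: (chain_subgroup gc)| |].
      move=> i ik; split; [exact: (chain_subgroup gc) (ltnW ik)|exact: (chain_subgroup gc)|..].
      - by move=> x; apply: (chain_conj gc).
      - by move=> g; apply: (chain_step gc).
      - exact: (chain_inf gc).
    by move=> i; rewrite -eqn_leq => /eqP <-; rewrite (chain_top gc).
  have [x Lx [f [hf fx]]] : exists2 x, L x & exists f, int_hom H f /\ f x != 0.
    apply: contrapT => no; apply: nLD => x Lx; split=> [|f hf]; first exact: LH.
    by apply: contrapT => /eqP fx; apply: no; exists x => //; exists f.
  have hfL : int_hom L f by move=> y y' /LH Hy /LH Hy'; apply: hf.
  have nz : exists2 x, L x & f x != 0 by exists x.
  have [m'' mm pk] := polyz_hom_kernel pL hfL nz.
  have [s cs] := cyclic_step_hom sL hfL nz.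
  have [|||h [Gam [t [kh G0 tt0 Gh [sG cG DG]]]]] := IHN m'' _ (hom_kernel L f) pk.
  - by rewrite (leq_trans mm).
  - by move=> y Dy; split; [exact: DL|case: Dy => _; apply].
  - by move=> y [Ly _]; apply: LH.
  exists h.+1, (fun i => if (i <= h)%N then Gam i else L), (fun i => if (i < h)%N then t i else s).
  split; first exact: leqW.
  - by move=> i ik; rewrite (leq_trans ik kh) G0.
  - by move=> i ik; rewrite (leq_trans ik kh) tt0.
  - by rewrite ltnn.
  split.
  - by move=> i _; case: ifP => [/sG|].
  - move=> i ih1; have [ih|ih|->] := ltngtP i h; [exact: cG|by rewrite ltnNge ih in ih1|].
    by rewrite Gh.
  - by move=> i /andP [ki ih1]; case: (leqP i h) => ih //; apply: DG; rewrite ki.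
have [h [Gam [t [kh G0 tt0 Gh [sG cG DG]]]]] := ext _ _ pH (fun _ => @proj1 _ _) (fun _ => id).
pose st i := if (i < k)%N then st0 i else k.
pose en i := if (i < k)%N then en0 i else h.
have blk i : (i < k)%N -> [/\ st0 i <= i, i < en0 i & en0 i <= k]%N.
  by move=> /(chain_block gc) /andP [/andP []].
have Gst i : (i < k)%N -> Gam (st i) = Gam0 (st0 i).
  by move=> ik; rewrite /st ik G0//; have [s1 _ _] := blk i ik; apply: leq_trans s1 (ltnW ik).
have Gen i : (i < k)%N -> Gam (en i) = Gam0 (en0 i).
  by move=> ik; rewrite /en ik G0//; have [] := blk i ik.
have GkD : Gam k = D by rewrite G0// (chain_top gc).
have norm g i : normalizes g H -> (i < h)%N -> normalizes g (Gam (st i)) /\ normalizes g (Gam (en i)).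
  move=> ng ih; have [ik|ki] := ltnP i k.
    by rewrite Gst// Gen//; apply: nc => //; apply: hom_core_normal.
  by rewrite /st /en !ltnNge ki /= GkD Gh; split=> //; apply: hom_core_normal.
exists h, Gam, t, st, en; split; last by move=> g ng i ih; apply: norm.
split=> //.
- by rewrite G0// (chain0 gc).
- by move=> i ih g; have [_ _ _ E _] := cG i ih; apply: E.
- by move=> i ih x; have [_ _ E _ _] := cG i ih; apply: E.
- by move=> i ih; have [_ _ _ _ E] := cG i ih.
- move=> i ih; rewrite /st /en; case: ltnP => ik; last by rewrite ik ih leqnn.
  by have [-> -> e3] := blk i ik; rewrite (leq_trans e3 kh).
- move=> i j ih; rewrite /st /en; case: (ltnP i k) => ik ij.
    have [s1 s2 s3] := blk i ik; have jk : (j < k)%N by case/andP: ij => _ /leq_trans; apply.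
    by rewrite jk; apply: (chain_same gc).
  by case/andP: ij => kj _; rewrite ltnNge kj.
- move=> i ih g x Hg; have [n1 _] := norm g i (normalizes_subgroup sH Hg) ih; exact: (n1 x).1.
- move=> i ih g x Hg; have [_ n1] := norm g i (normalizes_subgroup sH Hg) ih; exact: (n1 x).1.
- move=> i ih g g'; have [ik|ki] := ltnP i k.
    by rewrite Gst// Gen//; apply: (chain_abelian gc).
  rewrite /st /en !ltnNge ki /= GkD Gh; exact: hom_core_commutator.
Qed.

(** Finite index with possibly repeated representatives, which is easier to compose than a
    transversal. *)
Definition covers H K := exists s : seq G, (forall g, g \in s -> K g) /\
  forall g, K g -> exists2 r, r \in s & H (r^-1 * g)%g.

Lemma covers_trans H K L : is_subgroup L -> K `<=` L -> covers H K -> covers K L -> covers H L.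
Proof.
move=> sL KL [s [sK sE]] [u [uL uE]].
exists [seq (a * b)%g | a <- u, b <- s]; split.
  by move=> _ /allpairsP [[a b] /= [/uL La /sK/KL Lb ->]]; apply: subgroupM.
move=> g Lg; have [a au Ka] := uE g Lg; have [b bs Hb] := sE _ Ka.
exists (a * b)%g; first by apply/allpairsP; exists (a, b).
by rewrite invgM -mulgA.
Qed.

(** Modulo [K] the exponents of the generators of the series only matter modulo [M], so finitely
    many normal forms remain. *)
Lemma polyz_power_cover n P K M : polyz n P -> is_subgroup K -> (0 < M)%N ->
  (forall g, P g -> K (g ^+ M)%g) -> (forall g x, P g -> K x -> K (g * x * g^-1)%g) ->
  covers K P.
Proof.
move=> + sK M0; elim: n P => [|n IH] P pP KM Kn.
  exists [:: 1%g]; rewrite pP; split=> [g|g ->]; first by rewrite inE => /eqP ->.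
  by exists 1%g; rewrite ?inE// invg1 mul1g; exact: subgroup1.
have sP := polyz_subgroup pP; have [Q [t [pQ cs]]] := pP.
have [sQ _ nt PE _] := cs.
have QP : Q `<=` P by move=> x Qx; apply/PE; exists x, 0; rewrite expgz0 mulg1.
have Pt : P t by apply/PE; exists 1%g, 1; rewrite mul1g; split=> //; exact: subgroup1.
have [s [sQ' sE]] := IH Q pQ (fun g Qg => KM g (QP g Qg)) (fun g x Qg => Kn g x (QP g Qg)).
exists [seq (b * t ^+ a)%g | a <- iota 0 M, b <- s]; split.
  move=> _ /allpairsP [[a b] /= [_ /sQ'/QP Pb ->]]; apply: subgroupM => //.
  exact: (subgroup_expgz (Posz a) sP Pt).
move=> _ /PE [x [z [Qx ->]]]; have [b bs Kb] := sE x Qx.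
have M0' : (M : int) != 0 by lia.
have r1 := modz_ge0 z M0'; have r2 : (z %% M)%Z < M by apply: ltz_pmod; lia.
have [a aE] : exists a : nat, (z %% M)%Z = a by exists `|(z %% M)%Z|%N; rewrite gez0_abs.
exists (b * t ^+ a)%g.
  apply/allpairsP; exists (a, b); split=> //=; rewrite mem_iota; lia.
have zE : z = (z %/ M)%Z * M + a by rewrite -aE -divz_eq.
have -> : ((b * t ^+ a)^-1 * (x * expgz t z) =
    (t ^+ a)^-1 * (b^-1 * x) * t ^+ a * expgz (expgz t M) (z %/ M)%Z)%g.
  rewrite -expgzM {1}zE addrC expgzD invgM -!mulgA; congr (_ * (_ * (_ * _)))%g.
  by rewrite mulrC.
apply: subgroupM => //; last by apply: subgroup_expgz => //; apply: KM.
have := Kn (t ^+ a)^-1%g _ _ Kb; rewrite invgK; apply.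
apply: subgroupV => //; exact: (subgroup_expgz (Posz a) sP Pt).
Qed.

(** Two of the powers [g ^+ 0], ..., [g ^+ (size s)] share a representative, so [H] contains some
    [g ^+ d] with [0 < d <= size s]; all such [d] divide the factorial of [size s]. *)
Lemma covers_power H K : is_subgroup H -> is_subgroup K -> covers H K -> exists2 M, (0 < M)%N &
  forall g, K g -> H (g ^+ M)%g.
Proof.
move=> sH sK [s [_ sE]]; exists (size s)`! => [|g Kg]; first exact: fact_gt0.
have gp i : K (g ^+ i)%g by exact: (subgroup_expgz (Posz i) sK Kg).
have [f fE] : exists f : nat -> G, forall i, f i \in s /\ H ((f i)^-1 * g ^+ i)%g.
  have /choice [f fE] : forall i : nat, exists r, r \in s /\ H (r^-1 * g ^+ i)%g.
    by move=> i; have [r rs Hr] := sE _ (gp i); exists r.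
  by exists f.
have [i [j [ij js E]]] : exists i j, [/\ (i < j)%N, (j <= size s)%N & f i = f j].
  apply: contrapT => no.
  have un : uniq [seq f i | i <- iota 0 (size s).+1].
    rewrite map_inj_in_uniq ?iota_uniq// => i j; rewrite !mem_iota /= !add0n !ltnS => ci cj E.
    apply: contrapT => /eqP; rewrite neq_ltn => /orP [lt|lt]; apply: no; [exists i, j|exists j, i] => //.
  have := uniq_leq_size un (s2 := s); rewrite size_map size_iota ltnn => /(_ _)/negP; apply => //.
  by move=> _ /mapP [i _ ->]; case: (fE i).
have Hd : H (g ^+ (j - i))%g.
  have [_ Hi] := fE i; have [_ Hj] := fE j.
  have := subgroupM sH (subgroupV sH Hi) Hj.
  by rewrite E invgM invgK -mulgA mulVKg -{1}(subnKC (ltnW ij)) expgnDr mulKg.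
have d0 : (0 < j - i)%N by rewrite subn_gt0.
have : (j - i %| (size s)`!)%N by rewrite dvdn_fact// d0 (leq_trans (leq_subr _ _)).
move=> /dvdnP [q ->]; rewrite mulnC expgnA.
exact: (subgroup_expgz (Posz q) sH Hd).
Qed.

Lemma subgroup_generatedP (A : set G) : is_subgroup (subgroup_generated A).
Proof.
split; first by move=> B [[B1 _] _].
split=> [x y sx sy B bB|x sx B bB].
  by case: (bB) => [[_ [BM _]] _]; apply: BM; [apply: sx|apply: sy].
by case: (bB) => [[_ [_ BV]] _]; apply: BV; apply: sx.
Qed.

Lemma subgroup_generated_conj (A : set G) g : (forall x, A x -> A (g * x * g^-1)%g) ->
  forall x, subgroup_generated A x -> subgroup_generated A (g * x * g^-1)%g.
Proof.
move=> Ag x sx; have sA := subgroup_generatedP A.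
apply: (sx [set y | subgroup_generated A (g * y * g^-1)%g]); split.
  split; first by rewrite /= mulg1 mulgV; exact: subgroup1.
  split=> [y y' /= Hy Hy'|y /= Hy].
    by have := subgroupM sA Hy Hy'; rewrite !mulgA mulgVK.
  by have := subgroupV sA Hy; rewrite !invgM invgK mulgA.
by move=> y Ay B [_ AB]; apply: AB; apply: Ag.
Qed.

(** In an infinite cyclic step the subgroup [P] found so far need not be normalized by [t]. It is
    replaced by the subgroup [K] generated by the [M]-th powers of [S i], which lies in [P], is
    stable under conjugation by [S i.+1], and still has finite index. *)
Lemma virtually_polycyclic_polyz : virtually_polycyclic G ->
  exists n H, polyz n H /\ covers H [set: G].
Proof.
move=> [k [S [S0 Sk step]]].
suff part i : (i <= k)%N -> exists n H, [/\ polyz n H, H `<=` S i & covers H (S i)].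
  by have [n [H [pH _ cH]]] := part k (leqnn k); exists n, H; rewrite -Sk.
elim: i => [|i IH] ik.
  exists 0%N, [set 1%g]; rewrite S0; split=> //; exists [:: 1%g]; split=> [g|g ->].
    by rewrite inE => /eqP ->.
  by exists 1%g; rewrite ?inE// mulVg.
have [n [P [pP PS cP]]] := IH (ltnW ik); have sP := polyz_subgroup pP.
have [[sS sS' SS' nS] quot] := step i ik.
have nS' t : S i.+1 t -> normalizes t (S i).
  move=> St y; split=> Sy.
    by have := nS y t^-1%g Sy (subgroupV sS' St); rewrite /conjg invgK mulgA.
  have := nS _ t Sy St; rewrite /conjg !mulgA mulVg mul1g mulgVK//.
case: quot => [fq|[t St bij]].
  exists n, P; split=> //; first by move=> x /PS; apply: SS'.
  apply: (covers_trans sS' SS' cP).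
  have [L LE] := (finite_seqP _).1 fq.
  pose rep (A : set G) := xget 1%g [set x | S i.+1 x /\ A = left_coset (S i) x].
  have repP x : S i.+1 x -> S i.+1 (rep (left_coset (S i) x)) /\
      left_coset (S i) x = left_coset (S i) (rep (left_coset (S i) x)).
    move=> Sx; rewrite /rep; case: xgetP => [y _ [Sy yE]|/(_ x) no]; first by split.
    by case: no.
  exists [seq rep A | A <- L]; split.
    move=> _ /mapP [A AL ->]; have : [set` L] A by [].
    rewrite -LE => -[x Sx <-]; by have [] := repP x Sx.
  move=> g Sg; have [_ E] := repP g Sg.
  exists (rep (left_coset (S i) g)).
    apply/mapP; exists (left_coset (S i) g) => //.
    suff : [set` L] (left_coset (S i) g) by [].
    by rewrite -LE; exists g.
  have : left_coset (S i) (rep (left_coset (S i) g)) g.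
    by rewrite -E; exists 1%g; [exact: subgroup1|rewrite mulg1].
  by move=> [y Sy yE]; rewrite -[X in (_ * X)%g]yE mulKg.
have [M M0 PM] := covers_power sP sS cP.
pose K := subgroup_generated [set (g ^+ M)%g | g in S i].
have sK : is_subgroup K by apply: subgroup_generatedP.
have KP : K `<=` P by move=> x; apply; split=> // _ [g Sg <-]; apply: PM.
have nK g : S i.+1 g -> forall x, K x -> K (g * x * g^-1)%g.
  move=> Sg; apply: subgroup_generated_conj => _ [y Sy <-]; exists (g * y * g^-1)%g.
    by apply/(nS' g Sg y).
  elim: (M) => [|m IHm]; first by rewrite !expg0 mulg1 mulgV.
  by rewrite !expgS IHm !mulgA mulgVK.
have nKt : normalizes t K.
  move=> y; split=> [|Ky]; first exact: nK.
  have := nK t^-1%g (subgroupV sS' St) _ Ky.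
  by rewrite invgK !mulgA mulVg mul1g mulgVK.
have [m mn pK] := polyz_sub pP sK KP.
have KM g : S i g -> K (g ^+ M)%g by move=> Sg B [_]; apply; exists g.
have cK : covers K (S i).
  apply: (covers_trans sS PS) cP.
  apply: (polyz_power_cover pP sK M0) => [g /PS|g x /PS/SS' Sg]; [exact: KM|exact: nK].
have inf z : S i (expgz t z) -> z = 0.
  move=> Sz; have [_ inj _] := bij.
  apply: (inj z 0); rewrite ?inE// expgz0; apply/seteqP; split=> _ [y Sy <-].
    by exists (expgz t z * y)%g; [exact: subgroupM|rewrite mul1g].
  exists ((expgz t z)^-1 * y)%g; last by rewrite mulVKg mul1g.
  by apply: subgroupM => //; apply: subgroupV.
pose K' := [set g | exists x z, K x /\ g = (x * expgz t z)%g].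
have nz z x : K x -> K (expgz t z * x * (expgz t z)^-1)%g.
  by move=> Kx; apply/(conj_expgz sK nKt z x).
have KS x : K x -> S i x by move=> /KP/PS.
have sK' : is_subgroup K'.
  split; first by exists 1%g, 0; rewrite mul1g expgz0; split=> //; exact: subgroup1.
  split=> [_ _ [x [z [Kx ->]]] [y [w [Ky ->]]]|_ [x [z [Kx ->]]]].
    exists (x * (expgz t z * y * (expgz t z)^-1))%g, (z + w); split.
      exact: (subgroupM sK Kx (nz z y Ky)).
    by rewrite expgzD !mulgA mulgVK.
  exists (expgz t (- z) * x^-1 * (expgz t (- z))^-1)%g, (- z); split.
    exact: (nz (- z) _ (subgroupV sK Kx)).
  by rewrite mulgVK invgM expgzN.
exists m.+1, K'; split.
- exists K, t; split=> //; split=> // z Kz; exact: inf (KS _ Kz).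
- move=> _ [x [z [/KS/SS' Sx ->]]]; apply: subgroupM => //; exact: subgroup_expgz.
have [s [sS1 sE]] := cK; exists s; split=> [g /sS1|g Sg]; first exact: SS'.
have [z zE] : exists z, S i (g * expgz t (- z))%g.
  have [_ _ /(_ (left_coset (S i) g))[|z _ zE]] := bij; first by exists g.
  exists z; have : left_coset (S i) g g by exists 1%g; [exact: subgroup1|rewrite mulg1].
  rewrite -zE => -[y Sy <-]; rewrite expgzN.
  by apply/(conj_expgz sS (nS' t St) z y).
have [r rs Kr] := sE _ zE; exists r => //.
exists (r^-1 * (g * expgz t (- z)))%g, z; split=> //.
by rewrite -!mulgA -expgzD addNr expgz0 mulg1.
Qed.

Lemma covers_finite_index H : is_subgroup H -> covers H [set: G] -> finite_index H.
Proof.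
move=> sH [s [_ sE]].
have [k [r [rs rinj]]] : exists k (r : 'I_k -> G),
    (forall x, x \in s -> exists i, H ((r i)^-1 * x)%g) /\
    (forall i j, H ((r i)^-1 * r j)%g -> i = j).
  elim: s {sE} => [|x s [k [r [rs rinj]]]].
    by exists 0%N, (fun=> 1%g); split=> // -[].
  have [[i Hi]|no] := pselect (exists i, H ((r i)^-1 * x)%g).
    exists k, r; split=> // y; rewrite inE => /orP [/eqP ->|]; [by exists i|exact: rs].
  pose r' (i : 'I_k.+1) := if unlift ord_max i is Some j then r j else x.
  have r'l j : r' (lift ord_max j) = r j by rewrite /r' liftK.
  have r'm : r' ord_max = x by rewrite /r' unlift_none.
  exists k.+1, r'; split.
    move=> y; rewrite inE => /orP [/eqP ->|/rs [i Hi]].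
      by exists ord_max; rewrite r'm mulVg; exact: subgroup1.
    by exists (lift ord_max i); rewrite r'l.
  move=> i j; case: (unliftP ord_max i) => [i' ->|->]; case: (unliftP ord_max j) => [j' ->|->] //.
  - by rewrite !r'l => /rinj ->.
  - by rewrite r'l r'm => Hi; case: no; exists i'.
  - rewrite r'l r'm => Hi; case: no; exists j'; have := subgroupV sH Hi.
    by rewrite invgM invgK.
exists k, r; split=> // g; have [x xs Hx] := sE g I; have [i Hi] := rs x xs.
by exists i; have := subgroupM sH Hi Hx; rewrite -mulgA mulVKg.
Qed.

Theorem virtually_polycyclic_chain : virtually_polycyclic G -> exists H h Gam (t : nat -> G) st en,
  good_chain H h Gam t st en /\ finite_index H.
Proof.
move=> /virtually_polycyclic_polyz [n [H [pH cH]]].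
have [h [Gam [t [st [en [gc _]]]]]] := polyz_good_chain pH.
exists H, h, Gam, t, st, en; split=> //; apply: covers_finite_index => //.
exact: polyz_subgroup pH.
Qed.

End PolyZ.

(** * Polynomials in Mal'cev coordinates *)

Section Frechet.
Context {R : realType}.
Implicit Types (h : R -> R) (p : {poly R}).

(** Frechet's polynomial functions of degree less than [d]: all iterated differences of order [d]
    vanish. *)
Fixpoint dpol d h : Prop :=
  if d is d'.+1 then forall a, dpol d' (fun s => h (s + a) - h s) else forall s, h s = 0.

Lemma dpol_sub d h h' : dpol d h -> dpol d h' -> dpol d (fun s => h s - h' s).
Proof.
elim: d h h' => [|d IH] h h' /= dh dh' a; first by rewrite dh dh' subrr.
have := IH _ _ (dh a) (dh' a); congr dpol; apply/funext => s; ring.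
Qed.

Lemma dpol_scale d h b : dpol d h -> dpol d (fun s => h (b * s)).
Proof.
elim: d h => [|d IH] h /= dh a; first exact: dh.
have := IH _ (dh (b * a)); congr dpol; apply/funext => s; by rewrite mulrDr.
Qed.

Lemma dpol_shift d h b : dpol d h -> dpol d (fun s => h (b + s)).
Proof.
elim: d h => [|d IH] h /= dh a; first exact: dh.
have := IH _ (dh a); congr dpol; apply/funext => s; by rewrite addrA.
Qed.

Lemma size_shift_sub p a : (size (p \Po ('X + a%:P) - p)%R <= (size p).-1)%N.
Proof.
have [->|p0] := eqVneq p 0; first by rewrite comp_poly0 subr0 size_poly0.
have sz : size (p \Po ('X + a%:P)) = size p by rewrite size_comp_poly2// size_XaddC.
have lc : lead_coef (p \Po ('X + a%:P)) = lead_coef p.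
  by rewrite lead_coef_comp ?size_XaddC// lead_coefXaddC expr1n mulr1.
have le : (size (p \Po ('X + a%:P) - p)%R <= size p)%N.
  by rewrite (leq_trans (size_polyD _ _))// size_polyN sz maxnn.
rewrite -ltnS prednK ?size_poly_gt0// ltn_neqAle le andbT; apply/eqP => szE.
have : (p \Po ('X + a%:P) - p)`_(size p).-1 = 0.
  by rewrite coefB -{1}sz -!lead_coefE lc subrr.
rewrite -szE -lead_coefE => /eqP; rewrite lead_coef_eq0 => /eqP E.
by move: szE p0; rewrite E size_poly0 => /esym/eqP; rewrite size_poly_eq0 => ->.
Qed.

Lemma dpol_poly d p : (size p <= d)%N -> dpol d (fun s => p.[s]).
Proof.
elim: d p => [|d IH] p /=; first by rewrite leqn0 size_poly_eq0 => /eqP -> s; rewrite horner0.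
move=> pd a; have := IH (p \Po ('X + a%:P) - p).
rewrite (leq_trans (size_shift_sub p a)); last by case: (size p) pd.
move=> /(_ isT); congr dpol; apply/funext => s.
by rewrite hornerD hornerN horner_comp !hornerE.
Qed.

Lemma dpol_nat_zero d h : dpol d h -> (forall n : nat, (n < d)%N -> h n%:R = 0) ->
  forall n : nat, h n%:R = 0.
Proof.
elim: d h => [|d IH] h /= dh h0 n; first exact: dh.
have step : forall m : nat, h (m%:R + 1) - h m%:R = 0.
  apply: IH (dh 1) _ => m md; rewrite natr1 h0; last by rewrite ltnS.
  by rewrite h0 ?subrr// leqW.
elim: n => [|n IHn]; first exact: h0.
by have := step n; rewrite IHn subr0 natr1.
Qed.

Lemma sized_interpolation (d : nat) : (0 < d)%N -> exists L : nat -> {poly R},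
  [/\ forall n, (size (L n) <= d)%N,
      forall n m : nat, (n < d)%N -> (m < d)%N -> (L n).[m%:R] = (n == m)%:R
    & forall p : {poly R}, (size p <= d)%N ->
        forall s, p.[s] = \sum_(n < d) p.[n%:R] * (L n).[s]].
Proof.
move=> d0; have inj : injective (fun n : nat => n%:R : R).
  by move=> m n /eqP; rewrite eqr_nat => /eqP.
exists (fun n => if insub n is Some k
  then (lagrange d (fun n : nat => n%:R : R))`_(k : 'I_d) : {poly R} else 0); split.
- move=> n; case: insubP => [k _ _|_]; last by rewrite size_poly0.
  exact: size_npoly.
- move=> n m nd md; have := lagrange_sample d0 inj (Ordinal nd) (Ordinal md).
  by rewrite (insubT (fun n => n < d)%N nd) nth_lagrange -val_eqE /=.
- move=> p pd s; rewrite {1}(lagrange_gen d0 inj pd) horner_sum; apply: eq_bigr => n _.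
  by rewrite hornerM hornerC valK nth_lagrange.
Qed.

Lemma dpol_nat_poly d h : dpol d h ->
  exists2 p : {poly R}, (size p <= d)%N & forall n : nat, h n%:R = p.[n%:R].
Proof.
case: d => [|d] dh; first by exists 0 => [|n]; rewrite ?size_poly0// horner0 dh.
have [L [Ls Lv _]] := sized_interpolation (ltn0Sn d).
pose p := \sum_(n < d.+1) h n%:R *: L n.
have pd : (size p <= d.+1)%N.
  apply: (leq_trans (size_sum _ _ _)); apply/bigmax_leqP => n _.
  exact: leq_trans (size_scale_leq _ _) (Ls n).
exists p => // n; apply/eqP; rewrite -subr_eq0; apply/eqP.
apply: (dpol_nat_zero (dpol_sub dh (dpol_poly pd))) => {n} m md.
rewrite /p horner_sum (bigD1 (Ordinal md))//= hornerZ Lv// eqxx mulr1.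
rewrite big1 ?addr0 ?subrr// => k kn; rewrite hornerZ Lv//.
by move: kn; rewrite -val_eqE /= => /negbTE ->; rewrite mulr0.
Qed.

(* A continuous function whose differences of order [d] vanish is determined
   by its values at the integers, hence is polynomial. *)
Lemma frechet d h : continuous h -> dpol d h ->
  exists2 p : {poly R}, (size p <= d)%N & forall s, h s = p.[s].
Proof.
move=> ch dh; have [p pd pE] := dpol_nat_poly dh; exists p => // s.
pose f s := h s - p.[s].
have df : dpol d f by apply: dpol_sub (dpol_poly pd).
have f0 (n : nat) : f n%:R = 0 by rewrite /f pE subrr.
have cf : continuous f.
  move=> x; apply: cvgB; first exact: ch.
  exact: continuous_horner.
(* Along such a progression [f] is a polynomial [q] in [n], with a root at every [n] where the
   argument is a natural number. The points of these progressions are dense. *)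
have frac (K m n : nat) : f (- K%:R + m.+1%:R^-1 * n%:R) = 0.
  have [q qd qE] := dpol_nat_poly (dpol_scale m.+1%:R^-1 (dpol_shift (- K%:R) df)).
  rewrite /= in qE; rewrite qE.
  suff -> : q = 0 by rewrite horner0.
  apply/eqP; apply: contraT => q0; exfalso.
  pose rs : seq R := [seq (m.+1 * (K + k))%:R | k <- iota 0 (size q)].
  have rq : all (root q) rs.
    apply/allP => _ /mapP [k _ ->]; rewrite rootE -qE natrM mulKf ?pnatr_eq0//.
    by rewrite natrD addKr f0.
  have urs : uniq rs.
    rewrite map_inj_uniq ?iota_uniq// => i j /eqP; rewrite eqr_nat eqn_pmul2l// eqn_add2l.
    by move/eqP.
  by have := max_poly_roots q0 rq urs; rewrite size_map size_iota ltnn.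
apply/eqP; rewrite -subr_eq0 -/(f s); apply: contraT => fs0.
have := cf s => /cvgrPdist_lt /(_ `|f s|); rewrite normr_gt0 => /(_ fs0).
rewrite near_simpl => /nbhs_ballP [e /= e0 eE].
pose K := (Num.trunc `|s|).+1; pose m := Num.trunc e^-1.
have sK : 0 <= s + K%:R.
  have := truncnS_gt `|s|; rewrite -/K; have := ler_norm (- s); rewrite normrN; lra.
have m0 : 0 < m.+1%:R :> R by rewrite ltr0n.
pose n := Num.trunc ((s + K%:R) * m.+1%:R).
have /truncn_itv /andP [n1 n2] : 0 <= (s + K%:R) * m.+1%:R by rewrite mulr_ge0 // ltW.
have em : m.+1%:R^-1 < e.
  by rewrite -[e]invrK ltf_pV2 ?posrE ?invr_gt0// truncnS_gt.
have := eE (- K%:R + m.+1%:R^-1 * n%:R); rewrite frac subr0 ltxx => /(_ _)/negP.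
move=> /(_ _)/negP; apply; rewrite /ball /=.
apply: le_lt_trans em.
have -> : s - (- K%:R + m.+1%:R^-1 * n%:R) = m.+1%:R^-1 * ((s + K%:R) * m.+1%:R - n%:R).
  by field; rewrite gt_eqF// ltr0n.
rewrite normrM gtr0_norm ?invr_gt0// -[leRHS]mulr1 ler_pM2l ?invr_gt0//.
by rewrite ler_norml; move: n1 n2; rewrite -/n -addn1 natrD => *; apply/andP; split; lra.
Qed.

End Frechet.

(** * Weighted degrees, and polynomial functions on groups *)

Section Weights.
Context {R : realType}.
Local Notation S := (nat -> R).
Variables (P : pred nat) (w : nat -> nat).

(* Polynomial functions of weighted degree less than [W]. *)
Inductive fil : nat -> (S -> R) -> Prop :=
| fil_zero W : fil W (fun=> 0)
| fil_cst W c : fil W.+1 (fun=> c)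
| fil_var W i : P i -> (w i < W)%N -> fil W (fun x => x i)
| fil_add W f g : fil W f -> fil W g -> fil W (fun x => f x + g x)
| fil_mul W a b f g : fil a.+1 f -> fil b.+1 g -> (a + b < W)%N -> fil W (fun x => f x * g x).

Lemma fil_eq0 f : fil 0 f -> forall x, f x = 0.
Proof.
have gen W : fil W f -> W = 0%N -> forall x, f x = 0; last by move=> /gen; apply.
elim=> {W f} [//|//|W i _ wi W0|W f1 f2 _ IH1 _ IH2 W0 x|W a b f1 f2 _ _ _ _ ab W0].
- by rewrite W0 in wi.
- by rewrite IH1// IH2// addr0.
- by rewrite W0 in ab.
Qed.

Lemma filW W W' f : (W <= W')%N -> fil W f -> fil W' f.
Proof.
move=> + ff; elim: ff W' => [{}W|{}W c|{}W i Pi wi|{}W g h _ IHg _ IHh|{}W a b g h fg _ fh _ ab] W' WW.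
- exact: fil_zero.
- by case: W' WW => // W' _; apply: fil_cst.
- by apply: fil_var => //; apply: leq_trans WW.
- by apply: fil_add; [apply: IHg|apply: IHh].
- by apply: fil_mul fg fh _; apply: leq_trans WW.
Qed.

Lemma fil_scale W c f : fil W f -> fil W (fun x => c * f x).
Proof.
case: W => [f0|W ff]; last by apply: (fil_mul (fil_cst 0 c) ff).
have -> : (fun x => c * f x) = fun=> 0 by apply/funext => x; rewrite (fil_eq0 f0) mulr0.
exact: fil_zero.
Qed.

Lemma fil_sum W k (F : nat -> S -> R) : (forall i, (i < k)%N -> fil W (F i)) ->
  fil W (fun x => \sum_(i < k) F i x).
Proof.
elim: k => [|k IH] fF.
  by have := fil_zero W; congr fil; apply/funext => x; rewrite big_ord0.
have := fil_add (IH (fun i ik => fF i (ltnW ik))) (fF k (ltnSn k)).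
by congr fil; apply/funext => x; rewrite big_ord_recr.
Qed.

Lemma fil_polyfun W f : fil W f -> polyfun P f.
Proof.
elim=> *; [exact: polyfun_cst|exact: polyfun_cst|exact: polyfun_var|exact: polyfun_add|exact: polyfun_mul].
Qed.

Lemma fil_horner W i (p : {poly R}) d : P i -> (size p <= d.+1)%N -> (d * w i < W)%N ->
  fil W (fun x => p.[x i]).
Proof.
move=> Pi pd dW.
have pow k : fil (k * w i).+1 (fun x => x i ^+ k).
  elim: k => [|k IH]; first by have := fil_cst 0 1; congr fil; apply/funext => x; rewrite expr0.
  have fv : fil (w i).+1 (fun x => x i) by apply: fil_var.
  have := fil_mul fv IH (W := (k.+1 * w i).+1); rewrite -mulSn ltnSn => /(_ isT).
  by congr fil; apply/funext => x; rewrite exprS.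
have : fil W (fun x => \sum_(k < d.+1) p`_k * x i ^+ k).
  apply: (fil_sum (F := fun k x => p`_k * x i ^+ k)) => k kd.
  apply: fil_scale; apply: filW (pow k); apply: leq_ltn_trans dW.
  by rewrite leq_mul2r -ltnS kd orbT.
by congr fil; apply/funext => x; rewrite (horner_coef_wide _ pd).
Qed.

(** The substitution changes each variable by terms of smaller weight, and the product rule for
    differences propagates the drop of the weight by one. *)
Lemma fil_substitution W f (sg : S -> S) :
  (forall i, P i -> fil (w i) (fun x => sg x i - x i)) -> fil W f ->
  fil W.-1 (fun x => f (sg x) - f x).
Proof.
move=> sgP ff; elim: ff => {W f} [W|W c|W i Pi wi|W f g _ IHf _ IHg|W a b f g ff IHf fg IHg ab].
- by have := fil_zero W.-1; congr fil; apply/funext => x; rewrite subrr.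
- by have := fil_zero W; congr fil; apply/funext => x; rewrite subrr.
- by apply: filW (sgP i Pi); case: W wi.
- by have := fil_add IHf IHg; congr fil; apply/funext => x; ring.
have fgs : fil b.+1 (fun x => g (sg x)).
  have := fil_add (filW (leqnSn b) IHg) fg; congr fil; apply/funext => x; ring.
have E : (fun x => f (sg x) * g (sg x) - f x * g x) =
    fun x => (f (sg x) - f x) * g (sg x) + f x * (g (sg x) - g x).
  by apply/funext => x; ring.
rewrite E; apply: fil_add.
  case: a ff ab IHf => [|a] ff ab /= IHf; last by apply: (fil_mul IHf fgs); case: W ab.
  have -> : (fun x => (f (sg x) - f x) * g (sg x)) = fun=> 0.
    by apply/funext => x; rewrite (fil_eq0 IHf) mul0r.
  exact: fil_zero.
case: b fg ab IHg {fgs} => [|b] fg ab /= IHg.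
  have -> : (fun x => f x * (g (sg x) - g x)) = fun=> 0.
    by apply/funext => x; rewrite (fil_eq0 IHg) mulr0.
  exact: fil_zero.
by apply: (fil_mul ff IHg); case: W ab => // W; rewrite addnS.
Qed.

End Weights.

Lemma fil_weaken {R : realType} (P Q : pred nat) w W (f : (nat -> R) -> R) :
  (forall i, P i -> Q i) -> fil P w W f -> fil Q w W f.
Proof.
move=> PQ; elim=> {W f} [W|W c|W i Pi wi|W f g _ IHf _ IHg|W a b f g _ IHf _ IHg ab].
- exact: fil_zero.
- exact: fil_cst.
- by apply: fil_var => //; apply: PQ.
- exact: fil_add.
- exact: (fil_mul IHf IHg).
Qed.

Section PolynomialGroupFunctions.
Context {R : realType} {N : groupType}.
Implicit Types (T : set N) (f : N -> R).

(** The analogue of [dpol] on a group, with differences along right translations by [T]. *)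
Fixpoint pol T d f : Prop :=
  if d is d'.+1 then forall g, T g -> pol T d' (fun y => f (y * g)%g - f y)
  else forall y, T y -> f y = 0.

Lemma pol_eq T d f f' : is_subgroup T -> (forall y, T y -> f y = f' y) -> pol T d f -> pol T d f'.
Proof.
move=> sT; elim: d f f' => [|d IH] f f' /= ff pf; first by move=> y Ty; rewrite -ff// pf.
move=> g Tg; apply: IH (pf g Tg) => y Ty; rewrite !ff//; exact: subgroupM.
Qed.

Lemma polS T d f : is_subgroup T -> pol T d f -> pol T d.+1 f.
Proof.
move=> sT; elim: d f => [|d IH] f pf.
  by move=> g Tg y Ty; rewrite !pf ?subrr//; exact: subgroupM.
by move=> g Tg; apply: IH; apply: pf.
Qed.

Lemma polW T d e f : is_subgroup T -> (d <= e)%N -> pol T d f -> pol T e f.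
Proof.
by move=> sT /subnK <- pf; elim: (e - d)%N => // k IH; rewrite addSn; apply: polS.
Qed.

Lemma pol_sub T d f f' : pol T d f -> pol T d f' -> pol T d (fun y => f y - f' y).
Proof.
elim: d f f' => [|d IH] f f' /= pf pf'; first by move=> y Ty; rewrite pf// pf'// subrr.
move=> g Tg; have := IH _ _ (pf g Tg) (pf' g Tg); congr pol; apply/funext => y; ring.
Qed.

(** [th] need not be a morphism: it is enough that it carries right translations to right
    translations, through [al]. *)
Lemma pol_precomp T T' d f (th al : N -> N) : 
  (forall y, T' y -> T (th y)) -> (forall h, T' h -> T (al h)) ->
  (forall y h, T' y -> T' h -> th (y * h)%g = (th y * al h)%g) -> is_subgroup T' ->
  pol T d f -> pol T' d (fun y => f (th y)).
Proof.
move=> thT alT thM sT'; elim: d f => [|d IH] f /= pf; first by move=> y Ty; rewrite pf//; apply: thT.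
move=> g Tg; apply: pol_eq (IH _ (pf _ (alT _ Tg))) => //= y Ty.
by rewrite thM.
Qed.

End PolynomialGroupFunctions.

Section LieContinuity.
Context {R : realType} {N : lieGroupType R}.

Definition contN (Y : topologicalType) (f : Y -> N) := continuous f.
Definition contR (Y : topologicalType) (f : Y -> R) := continuous f.

Lemma lie_mul_continuous : continuous (fun u : N * N => (u.1 * u.2)%g : N).
Proof. by have [] := @lie_mul_smooth R N. Qed.

Lemma lie_inv_continuous : contN (fun x : N => x^-1%g).
Proof. by have [] := @lie_inv_smooth R N. Qed.

Lemma contMg (Y : topologicalType) (f g : Y -> N) : contN f -> contN g ->
  contN (fun y => (f y * g y)%g).
Proof.
move=> cf cg y.
apply: (@cvg_comp2 _ _ _ _ _ _ _ _ _ _ _ f g (fun u v : N => (u * v)%g) (cf y) (cg y)).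
have := @lie_mul_continuous (f y, g y); exact.
Qed.

Lemma contNN (Y : topologicalType) (f : Y -> N) (g : N -> N) : contN f -> contN g ->
  contN (fun y => g (f y)).
Proof. by move=> cf cg y; apply: (@cvg_comp _ _ _ f g); [exact: cf|exact: cg]. Qed.

Lemma contNR (Y : topologicalType) (f : Y -> N) (g : N -> R) : contN f -> contR g ->
  contR (fun y => g (f y)).
Proof. by move=> cf cg y; apply: (@cvg_comp _ _ _ f g); [exact: cf|exact: cg]. Qed.

Lemma contRN (Y : topologicalType) (f : Y -> R) (g : R -> N) : contR f -> contN g ->
  contN (fun y => g (f y)).
Proof. by move=> cf cg y; apply: (@cvg_comp _ _ _ f g); [exact: cf|exact: cg]. Qed.

Lemma contVg (Y : topologicalType) (f : Y -> N) : contN f -> contN (fun y => (f y)^-1%g).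
Proof. by move=> cf; apply: contNN cf lie_inv_continuous. Qed.

Lemma contN_id : contN (fun y : N => y). Proof. by move=> y; apply: cvg_id. Qed.

Lemma contN_cst (Y : topologicalType) (g : N) : contN (fun y : Y => g).
Proof. by move=> y; apply: cvg_cst. Qed.

End LieContinuity.

Section MalcevChains.
Context {R : realType} {N : lieGroupType R}.
Local Notation S := (nat -> R).
Local Notation lt i := (fun l : nat => (l < i)%N).
Local Notation between j i := (fun l : nat => (j <= l)%N && (l < i)%N).

Definition additive_on (A : set N) (f : N -> R) :=
  forall x y, A x -> A y -> f (x * y)%g = f x + f y.

(* A descending central series [T 0 = N, ..., T n = 1] with quotients R, the
   quotient [T i / T i.+1] being given by the homomorphism [tau i] and split
   by the one-parameter subgroup [X i]; it refines a series of characteristic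
   subgroups, the index [i] lying in the block [[st i, en i)]. *)
Record malcev_chain n (T : nat -> set N) (tau : nat -> N -> R) (X : nat -> R -> N)
    (st en : nat -> nat) : Prop := MalcevChain {
  mc_top : T 0%N = [set: N];
  mc_bot : T n = [set 1%g];
  mc_subgroup : forall i, (i <= n)%N -> is_subgroup (T i);
  mc_succ : forall i, (i < n)%N -> T i.+1 = [set x | T i x /\ tau i x = 0];
  mc_one : forall i, (i < n)%N -> one_parameter_subgroup (X i);
  mc_X : forall i s, (i < n)%N -> T i (X i s);
  mc_tauX : forall i s, (i < n)%N -> tau i (X i s) = s;
  mc_hom : forall i, (i < n)%N -> additive_on (T i) (tau i);
  mc_cont : forall i, (i < n)%N -> contR (tau i);
  mc_inv : forall i g x, (i < n)%N -> T i x -> tau i (g * x * g^-1)%g = tau i x;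
  mc_norm : forall i g x, (i <= n)%N -> T i x -> T i (g * x * g^-1)%g;
  mc_block : forall i, (i < n)%N -> (st i <= i < en i)%N && (en i <= n)%N;
  mc_same : forall i j, (i < n)%N -> (st i <= j < en i)%N -> st j = st i /\ en j = en i;
  mc_block_hom : forall i, (i < n)%N -> additive_on (T (st i)) (tau i);
  mc_char : forall i, (i < n)%N -> T (en i) = [set x | T (st i) x /\
    forall f : N -> R, contR f -> additive_on (T (st i)) f -> f x = 0]
}.

Variables (n : nat) (T : nat -> set N) (tau : nat -> N -> R) (X : nat -> R -> N)
  (st en : nat -> nat).
Hypothesis mc : malcev_chain n T tau X st en.

Let sT i : (i <= n)%N -> is_subgroup (T i). Proof. exact: mc_subgroup mc i. Qed.

Lemma mc_mono i j : (i <= j)%N -> (j <= n)%N -> T j `<=` T i.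
Proof.
elim: j => [|j IH]; first by rewrite leqn0 => /eqP -> _ x.
rewrite leq_eqVlt => /orP [/eqP -> _ x //|ij jn x]; rewrite (mc_succ mc jn) => -[Tx _].
by apply: (IH ij) => //; exact: ltnW.
Qed.

Lemma X_add i s u : (i < n)%N -> X i (s + u) = (X i s * X i u)%g.
Proof. by move=> /(mc_one mc) [_]; apply. Qed.

Lemma X_continuous i : (i < n)%N -> contN (X i).
Proof. by move=> /(mc_one mc) []. Qed.

Lemma X0 i : (i < n)%N -> X i 0 = 1%g.
Proof.
by move=> ni; apply: (mulgI (X i 0)); rewrite -X_add// addr0 mulg1.
Qed.

Lemma XN i s : (i < n)%N -> X i (- s) = (X i s)^-1%g.
Proof.
by move=> ni; apply: (mulIg (X i s)); rewrite -X_add// addNr X0// mulVg.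
Qed.

Lemma additive_on1 (A : set N) f : is_subgroup A -> additive_on A f -> f 1%g = 0.
Proof.
move=> sA fA; have := fA 1%g 1%g (subgroup1 sA) (subgroup1 sA).
by rewrite mulg1 => E; apply: (addrI (f 1%g)); rewrite addr0 -E.
Qed.

Lemma additive_onV (A : set N) f x : is_subgroup A -> additive_on A f -> A x -> f x^-1%g = - f x.
Proof.
move=> sA fA Ax; have := fA _ _ Ax (subgroupV sA Ax).
by rewrite mulgV (additive_on1 sA fA) => /eqP; rewrite eq_sym addrC addr_eq0 => /eqP.
Qed.

(* [res i y] is the component of [y] in [T i]. *)
Fixpoint res i (y : N) : N :=
  if i is i'.+1 then (X i' (- tau i' (res i' y)) * res i' y)%g else y.

Definition co i y := tau i (res i y).
Definition cv y : S := fun i => if (i < n)%N then co i y else 0.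
Definition pt k j (x : S) : N := (\prod_(k <= l < j) X l (x l))%g.

Lemma res_in i y : (i <= n)%N -> T i (res i y).
Proof.
elim: i => [|i IH] ni /=; first by rewrite (mc_top mc).
have Ti := IH (ltnW ni); rewrite (mc_succ mc ni) /=; split.
  by apply: (subgroupM (sT (ltnW ni))) => //; apply: (mc_X mc).
by rewrite (mc_hom mc)//; [rewrite (mc_tauX mc)// addNr|apply: (mc_X mc)].
Qed.

Lemma res_continuous i : (i <= n)%N -> contN (res i).
Proof.
elim: i => [|i IH] ni /=; first exact: contN_id.
have cr := IH (ltnW ni); apply: contMg => //.
apply: (contRN (f := fun y => - tau i (res i y))); last exact: X_continuous.
by move=> y; apply: cvgN; exact: (contNR cr (mc_cont mc ni)).
Qed.

Lemma co_continuous i : (i < n)%N -> contR (co i).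
Proof. by move=> ni; apply: contNR (res_continuous (ltnW ni)) (mc_cont mc ni). Qed.

Lemma res_mul i l y u : (l <= i)%N -> (i <= n)%N -> T i u -> res l (y * u)%g = (res l y * u)%g.
Proof.
move=> + ni Tu; elim: l => [//|l IH] li /=; rewrite (IH (ltnW li)).
have ln := leq_trans li ni.
rewrite (mc_hom mc ln); [|exact: res_in (ltnW ln)|exact: mc_mono (ltnW li) ni _ Tu].
have : T l.+1 u by apply: mc_mono Tu.
by rewrite (mc_succ mc ln) => -[_ ->]; rewrite addr0 mulgA.
Qed.

Lemma co_mul_lt i l y u : (l < i)%N -> (i <= n)%N -> T i u -> co l (y * u)%g = co l y.
Proof.
move=> li ni Tu; have ln := leq_trans li ni; rewrite /co (res_mul _ (ltnW li) ni Tu).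
rewrite (mc_hom mc ln); [|exact: res_in (ltnW ln)|exact: mc_mono (ltnW li) ni _ Tu].
have : T l.+1 u by apply: mc_mono Tu.
by rewrite (mc_succ mc ln) => -[_ ->]; rewrite addr0.
Qed.

Lemma co_mul i y u : (i < n)%N -> T i u -> co i (y * u)%g = co i y + tau i u.
Proof.
move=> ni Tu; rewrite /co (res_mul _ (leqnn i) (ltnW ni) Tu) (mc_hom mc)//.
exact: res_in (ltnW ni).
Qed.

Lemma res_same k l y : (l <= k)%N -> (k <= n)%N -> T k y -> res l y = y.
Proof.
move=> lk kn Ty; rewrite -{1}[y]mul1g (res_mul _ lk kn Ty).
suff -> : res l 1%g = 1%g by rewrite mul1g.
elim: l lk => [//|l IH] lk /=; rewrite IH ?(ltnW lk)// mulg1.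
have ln := leq_trans lk kn.
by rewrite (additive_on1 (sT (ltnW ln)) (mc_hom mc ln)) oppr0 X0.
Qed.

Lemma res_res k j y : (k <= j)%N -> (j <= n)%N -> res j (res k y) = res j y.
Proof.
move=> + jn; elim: j jn => [|j IH] jn kj; first by move: kj; rewrite leqn0 => /eqP ->.
move: kj; rewrite leq_eqVlt => /orP [/eqP E|kj]; last by rewrite /= IH// ltnW.
by rewrite -E in jn *; exact: res_same (leqnn k) jn (res_in y jn).
Qed.

Lemma co_res k j y : (k <= j)%N -> (j < n)%N -> co j (res k y) = co j y.
Proof. by move=> kj jn; rewrite /co res_res// ltnW. Qed.

Lemma res_decomp k j y : (k <= j)%N -> (j <= n)%N ->
  res k y = (pt k j (cv y) * res j y)%g.
Proof.
move=> kj jn; elim: j jn kj => [|j IH] jn kj.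
  by move: kj; rewrite leqn0 => /eqP ->; rewrite /pt big_nil mul1g.
move: kj; rewrite leq_eqVlt => /orP [/eqP <-|kj]; first by rewrite /pt big_geq// mul1g.
rewrite (IH (ltnW jn) kj) /pt big_nat_recr//= {3}/cv jn -mulgA; congr (_ * _)%g.
by rewrite XN// mulVKg.
Qed.

Lemma pt_cv y : pt 0 n (cv y) = y.
Proof.
have := res_decomp y (leq0n n) (leqnn n); have := res_in y (leqnn n).
by rewrite (mc_bot mc) => ->; rewrite mulg1.
Qed.

Lemma pt_in k j x : (k <= j)%N -> (j <= n)%N -> T k (pt k j x).
Proof.
move=> kj jn; have sk := sT (leq_trans kj jn); rewrite /pt big_nat.
apply: (big_ind (T k)) => [|a b|l /andP [kl lj]]; [exact: subgroup1|exact: subgroupM|].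
have ln := leq_trans lj jn.
by apply: (mc_mono kl (ltnW ln)); apply: (mc_X mc).
Qed.

Lemma pt_left k j x : (k < j)%N -> pt k j x = (X k (x k) * pt k.+1 j x)%g.
Proof. by move=> kj; rewrite /pt big_ltn. Qed.

Lemma tau_pt k j x : (k < j)%N -> (j <= n)%N -> tau k (pt k j x) = x k.
Proof.
move=> kj jn; have kn := leq_trans kj jn; have Tr := pt_in x kj jn.
rewrite pt_left// (mc_hom mc)//; [|exact: (mc_X mc)|exact: (mc_mono (leqnSn k) kn)].
by rewrite (mc_tauX mc)//; move: Tr; rewrite (mc_succ mc)// => -[_ ->]; rewrite addr0.
Qed.

Lemma res_pt i j x : (i <= j)%N -> (j <= n)%N -> res i (pt 0 j x) = pt i j x.
Proof.
move=> + jn; elim: i => [//|i IH] ij /=; rewrite (IH (ltnW ij)) tau_pt//.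
by rewrite pt_left// XN ?mulKg//; apply: leq_trans jn.
Qed.

Lemma co_pt j l x : (l < j)%N -> (j <= n)%N -> co l (pt 0 j x) = x l.
Proof. by move=> lj jn; rewrite /co res_pt ?tau_pt// ltnW. Qed.

Lemma cv_pt x l : (l < n)%N -> cv (pt 0 n x) l = x l.
Proof. by move=> ln; rewrite /cv ln co_pt. Qed.

Lemma pt_dep k j x y : (forall l, (k <= l < j)%N -> x l = y l) -> pt k j x = pt k j y.
Proof. by move=> xy; apply: eq_big_nat => l lj; rewrite xy. Qed.

Lemma cv_in_T k y l : (k <= n)%N -> T k y -> (l < k)%N -> cv y l = 0.
Proof.
move=> kn Ty lk; rewrite /cv (leq_trans lk kn) -[y]mul1g (co_mul_lt _ lk kn Ty).
have ln := leq_trans lk kn.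
rewrite /co (res_same (leqnn l) (ltnW ln)); last exact: subgroup1 (sT (ltnW ln)).
exact: (additive_on1 (sT (ltnW ln)) (mc_hom mc ln)).
Qed.

Lemma pol_dpol k j d f p : (k <= j)%N -> (j < n)%N -> pol (T k) d f -> T k p ->
  dpol d (fun s => f (p * X j s)%g).
Proof.
move=> kj jn; have TX s : T k (X j s).
  by apply: (mc_mono kj (ltnW jn)); apply: (mc_X mc).
have sk := sT (leq_trans kj (ltnW jn)).
elim: d f => [|d IH] f /= pf Tp; first by move=> s; apply: pf; apply: subgroupM.
move=> a; have := IH _ (pf _ (TX a)) Tp; congr dpol; apply/funext => s.
by rewrite X_add// mulgA.
Qed.

Lemma continuous_mulgr g : contN (fun y : N => (y * g)%g).
Proof. by apply: contMg; [exact: contN_id|exact: contN_cst]. Qed.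

Lemma continuous_mulgl g : contN (fun y : N => (g * y)%g).
Proof. by apply: contMg; [exact: contN_cst|exact: contN_id]. Qed.

(** Along the last line [X j] the function is a polynomial of degree at most [d] by [frechet];
    interpolation expresses it by its values at [x j = 0, ..., d], which involve one coordinate
    fewer. *)
Lemma pol_coordinates k j d (f : N -> R) w : (k <= j)%N -> (j <= n)%N ->
  contR f -> pol (T k) d.+1 f ->
  exists P, fil (between k j) w (d * \sum_(k <= l < j) w l).+1 P /\
    forall x, f (pt k j x) = P x.
Proof.
move=> kj; elim: j kj f => [|j IH] kj f jn cf pf.
  exists (fun=> f 1%g); split; first exact: fil_cst.
  by move=> x; rewrite /pt big_geq.
move: kj; rewrite leq_eqVlt => /orP [/eqP E|kj].
  exists (fun=> f 1%g); split; first exact: fil_cst.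
  by move=> x; rewrite /pt big_geq// E.
rewrite ltnS in kj; have sk := sT (leq_trans kj (ltnW jn)).
have TX s : T k (X j s) by apply: (mc_mono kj (ltnW jn)); apply: (mc_X mc).
have /choice [Pm PmE] : forall m : nat, exists P,
    fil (between k j) w (d * \sum_(k <= l < j) w l).+1 P /\
    forall x, f (pt k j x * X j m%:R)%g = P x.
  move=> m; apply: (IH kj (fun y => f (y * X j m%:R)%g) (ltnW jn)).
    by apply: contNR; [exact: continuous_mulgr|exact: cf].
  apply: (pol_precomp (T := T k) (al := fun h => ((X j m%:R)^-1 * h * X j m%:R)%g)) pf => //.
  - by move=> y Ty; apply: subgroupM.
  - by move=> y Ty; apply: (subgroupM sk (subgroupM sk (subgroupV sk (TX _)) Ty) (TX _)).
  - by move=> y y' _ _; rewrite -!mulgA mulVKg.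
have [L [Ls _ Lp]] := sized_interpolation (R := R) (ltn0Sn d).
exists (fun x => \sum_(m < d.+1) Pm m x * (L m).[x j]); split.
  have bw i : between k j i -> between k j.+1 i by move=> /andP [-> /leqW].
  apply: (fil_sum (F := fun m x => Pm m x * (L m).[x j])) => m md.
  have f1 := fil_weaken bw (PmE m).1.
  have f2 : fil (between k j.+1) w (d * w j).+1 (fun x => (L m).[x j]).
    by apply: (fil_horner _ (d := d)); rewrite ?kj ?ltnSn ?Ls.
  by apply: (fil_mul f1 f2); rewrite (big_nat_recr j)//= mulnDr ltnSn.
move=> x; have Tp : T k (pt k j x) by apply: pt_in => //; apply: ltnW.
have -> : pt k j.+1 x = (pt k j x * X j (x j))%g by rewrite /pt big_nat_recr.
have [|p pd pE] := frechet _ (pol_dpol kj jn pf Tp).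
  have cX := X_continuous jn; suff : contR (fun s => f (pt k j x * X j s)%g) by [].
  by apply: contNR; [apply: contMg; [exact: contN_cst|exact: cX]|exact: cf].
rewrite pE (Lp p pd); apply: eq_bigr => m _; congr (_ * _).
by rewrite -pE (PmE m).2.
Qed.

(** In coordinates a right translation by [T k] is a substitution that lowers weights, so [W]
    differences annihilate a function of weight less than [W]. *)
Lemma pol_of_fil k W P w f : (k <= n)%N ->
  (forall g j, T k g -> (k <= j < n)%N -> exists Q, fil (between k n) w (w j) Q /\
     forall y, T k y -> co j (y * g)%g - co j y = Q (cv y)) ->
  fil (between k n) w W P -> (forall y, T k y -> f y = P (cv y)) -> pol (T k) W f.
Proof.
move=> kn coQ; have sk := sT kn.
elim: W P f => [|W IH] P f fP fE; first by move=> y Ty; rewrite fE// (fil_eq0 fP).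
move=> g Tg.
have /choice [Q QE] : forall j, exists Q, (k <= j < n)%N -> fil (between k n) w (w j) Q /\
     forall y, T k y -> co j (y * g)%g - co j y = Q (cv y).
  move=> j; case: (boolP (k <= j < n)%N) => [kj|_]; last by exists (fun=> 0).
  by have [Q QE] := coQ g j Tg kj; exists Q.
pose sg (x : S) : S := fun j => if (k <= j < n)%N then x j + Q j x else x j.
apply: (IH (fun x => P (sg x) - P x)).
  apply: (fil_substitution (W := W.+1)) fP => j kj.
  have [fQ _] := QE j kj; have := fQ; congr fil; apply/funext => x.
  by rewrite /sg kj addrC addKr.
move=> y Ty; rewrite !fE//; last exact: subgroupM.
congr (_ - _); apply: (polyfun_dep (fil_polyfun fP)) => j kj.
have [_ Qy] := QE j kj; rewrite /sg kj -Qy//.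
by have /andP [_ jn] := kj; rewrite /cv jn addrC subrK.
Qed.

(* By induction from the bottom of the chain: right translations by [T k] add
   to [co j] a polynomial in the previous coordinates whose degree is bounded
   independently of the translation. *)
Lemma co_pol k : (k <= n)%N -> exists d, forall j, (k <= j < n)%N -> pol (T k) d (co j).
Proof.
move=> kn; rewrite -(subKn kn); elim: (n - k)%N (leq_subr k n) => {k kn} [|i IH] ni.
  by exists 0%N => j; rewrite subn0; case: ltnP => //; rewrite andbF.
have [d dE] := IH (ltnW ni); set k := (n - i.+1)%N.
have kE : (n - i = k.+1)%N by rewrite /k; lia.
have kn : (k < n)%N by rewrite /k; lia.
rewrite kE in dE; have sk := sT (ltnW kn); have sk1 := sT kn.
(* The weights solve [1 + d * (w 0 + ... + w j.-1) = w j]: a polynomial of degree at most [d] in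
   each earlier coordinate has weight less than [w j]. *)
pose w j := (d.+1 ^ j)%N.
have wE j : ((d * \sum_(k.+1 <= l < j) w l).+1 <= w j)%N.
  have E : ((d * \sum_(0 <= l < j) w l).+1 = w j)%N.
    elim: j => [|j IHj]; first by rewrite big_geq// muln0.
    by rewrite big_nat_recr//= mulnDr -addSn IHj /w expnS mulSn.
  rewrite -E ltnS leq_mul2l; apply/orP; right.
  have [kj|kj] := leqP k.+1 j; last by rewrite big_geq// ltnW.
  by rewrite [leqRHS](big_cat_nat (n := k.+1))//= leq_addl.
have coQ g j : T k g -> (k <= j < n)%N -> exists Q, fil (between k n) w (w j) Q /\
     forall y, T k y -> co j (y * g)%g - co j y = Q (cv y).
  move=> Tg /andP [kj jn]; move: kj; rewrite leq_eqVlt => /orP [/eqP <-|kj].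
    exists (fun=> tau k g); split; last by move=> y Ty; rewrite co_mul// addrC addKr.
    by apply: filW (fil_cst _ _ 0 _); rewrite expn_gt0.
  (* The component of [g] along [X k] is split off; moving it to the front conjugates the rest of
     [y] by [c], and everything then takes place in [T k.+1]. *)
  pose s' := tau k g; pose g' := (X k (- s') * g)%g.
  have TX u : T k (X k u) by apply: (mc_X mc).
  have Tg' : T k.+1 g'.
    rewrite (mc_succ mc kn); split; first exact: subgroupM.
    by rewrite (mc_hom mc kn)// (mc_tauX mc)// addNr.
  pose c z := (X k (- s') * z * X k s')%g.
  have cE z : c z = (X k (- s') * z * (X k (- s'))^-1)%g by rewrite /c -XN// opprK.
  have cT l z : (l <= n)%N -> T l z -> T l (c z) by move=> ln Tz; rewrite cE; apply: (mc_norm mc).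
  have cM y z : c (y * z)%g = (c y * c z)%g.
    by rewrite !cE !mulgA mulgVK.
  (* At [z = res k.+1 y] this is the change of the coordinate [j] of [y] under right translation by
     [g]. *)
  pose D z := co j (c z * g')%g - co j z.
  pose al h := (g'^-1 * c h * g')%g.
  have alE a h : (a * c h * g' = a * g' * al h)%g.
    by rewrite /al; move: (g') (c h) => u v; rewrite -!mulgA mulVKg.
  have alT l h : (l <= n)%N -> T l h -> T l (al h).
    by move=> ln Th; have := mc_norm mc g'^-1%g ln (cT _ _ ln Th); rewrite invgK.
  have cD : contR D.
    move=> z; apply: cvgB; last exact: (co_continuous jn).
    apply: (contNR (f := fun z => (c z * g')%g)); last exact: co_continuous.
    apply: contMg; last exact: contN_cst.
    by apply: contMg; [exact: continuous_mulgl|exact: contN_cst].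
  have pD : pol (T k.+1) d.+1 D.
    apply: (polS sk1); apply: pol_sub; last by apply: dE; rewrite kj.
    apply: (pol_precomp (T := T k.+1) (al := al)) => //.
    - by move=> y Ty; apply: subgroupM => //; apply: cT.
    - by move=> h; apply: alT.
    - by move=> y h _ _; rewrite cM alE.
    - by apply: dE; rewrite kj.
  have [P [fP DP]] := pol_coordinates w kj (ltnW jn) cD pD.
  exists P; split.
    apply: filW (wE j) _; apply: fil_weaken fP => l /andP [kl lj].
    by rewrite (ltnW kl) (ltn_trans lj jn).
  move=> y Ty; rewrite -(DP (cv y)).
  have ry : res k y = y by exact: res_same (leqnn k) (ltnW kn) Ty.
  have E1 : res k.+1 (y * g)%g = (c (res k.+1 y) * g')%g.
    rewrite /= (res_mul _ (leqnn k) (ltnW kn) Tg) ry (mc_hom mc kn)//.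
    by rewrite opprD addrC X_add// /c /g' -!mulgA (mulgA (X k s')) -X_add// subrr X0// mul1g.
  (* [tau j] is invariant under conjugation, so the two terms of [D] change by the same amount;
     hence [D] only sees the coordinates before [j]. *)
  have Dinv z u : T j u -> D (z * u)%g = D z.
    move=> Tu; rewrite /D cM.
    rewrite alE (co_mul _ jn (alT _ _ (ltnW jn) Tu)) (co_mul _ jn Tu).
    have -> : tau j (al u) = tau j u.
      have := mc_inv mc g'^-1%g jn (cT _ _ (ltnW jn) Tu); rewrite invgK => ->.
      by rewrite cE (mc_inv mc).
    by ring.
  rewrite -(Dinv _ (res j y)); last exact: res_in (ltnW jn).
  by rewrite -res_decomp// ?(ltnW jn)// /D -E1 !co_res.
exists (d.+1 ^ n).+1 => j /andP [kj jn].
have Pj : fil (between k n) w (w j).+1 (fun x : S => x j) by apply: fil_var; rewrite ?kj.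
apply: (polW sk (_ : (w j).+1 <= _)%N); first by rewrite ltnS leq_pexp2l// ltnW.
by apply: (pol_of_fil (ltnW kn) coQ Pj) => y Ty; rewrite /cv jn.
Qed.

Lemma continuous_additive_linear (h : R -> R) : continuous h -> (forall s u, h (s + u) = h s + h u) ->
  forall s, h s = s * h 1.
Proof.
move=> ch hD s.
have h0 : h 0 = 0 by apply: (addrI (h 0)); rewrite addr0 -hD addr0.
have [|p pd pE] := frechet (d := 2) ch; first by move=> a b u; rewrite !hD; ring.
have := pE s; have := pE 1; have := pE 0.
rewrite !(horner_coef_wide _ pd) !big_ord_recl !big_ord0 /= /bump /= !expr0 !expr1.
rewrite h0 => E0 -> ->; move: E0; rewrite !mulr0 !mulr1 !addr0 => <-; ring.
Qed.

Lemma additive_on_pt i (f : N -> R) u v x : (i <= u)%N -> (u <= v)%N -> (v <= n)%N ->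
  additive_on (T i) f -> f (pt u v x) = \sum_(u <= l < v) f (X l (x l)).
Proof.
move=> iu + + fA; elim: v => [|v IH] uv vn.
  by rewrite /pt !big_geq//; apply: (additive_on1 (sT _) fA); move: iu uv; lia.
move: uv; rewrite leq_eqVlt => /orP [/eqP E|uv].
  rewrite E /pt !big_geq//; apply: (additive_on1 (sT _) fA); lia.
have iv : (i <= v)%N by lia.
rewrite ltnS in uv.
rewrite /pt !big_nat_recr//= fA; first by rewrite (IH uv (ltnW vn)).
  by apply: (mc_mono iu); [lia|apply: pt_in => //; apply: ltnW].
by apply: (mc_mono iv (ltnW vn)); apply: (mc_X mc).
Qed.

(** Within a block each [tau l] is additive on all of [T (st i)], and the coordinates are obtained
    from these by a unitriangular linear change. *)
Lemma co_additive i : (i < n)%N -> forall l, (st i <= l < en i)%N -> additive_on (T (st i)) (co l).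
Proof.
move=> ni l; have [k lk] := ubnP l; elim: k l lk => // k IH l lk sl.
have /andP [/andP [sti ien] eni] := mc_block mc ni.
have /andP [ul lv] := sl; have ln := leq_trans lv eni.
have un : (st i <= n)%N by lia.
have [stl enl] := mc_same mc ni sl.
have tl := mc_block_hom mc ln; rewrite stl in tl.
have E y : T (st i) y -> co l y = tau l y - \sum_(st i <= m < l) co m y * tau l (X m 1).
  move=> Ty; have := res_decomp y ul (ltnW ln); rewrite (res_same (leqnn _) un Ty) => yE.
  rewrite {2}yE tl; [|exact: pt_in (ltnW ln)|exact: (mc_mono ul (ltnW ln)) _ (res_in _ (ltnW ln))].
  rewrite (additive_on_pt _ (leqnn _) ul (ltnW ln) tl).
  rewrite -/(co l y); have -> : \sum_(st i <= m < l) tau l (X m (cv y m)) =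
      \sum_(st i <= m < l) co m y * tau l (X m 1); last by rewrite [X in X - _]addrC addrK.
  apply: eq_big_nat => m /andP [um ml]; have mn := ltn_trans ml ln.
  rewrite /cv mn; apply: (continuous_additive_linear (h := fun s => tau l (X m s))).
    exact: (contNR (X_continuous mn) (mc_cont mc ln)).
  by move=> s s'; rewrite X_add// tl//; apply: (mc_mono um (ltnW mn)); apply: (mc_X mc).
move=> y z Ty Tz; rewrite !E//; last exact: (subgroupM (sT un)).
rewrite tl//; have -> : \sum_(st i <= m < l) co m (y * z)%g * tau l (X m 1) =
   \sum_(st i <= m < l) co m y * tau l (X m 1) + \sum_(st i <= m < l) co m z * tau l (X m 1).
  rewrite -big_split /=; apply: eq_big_nat => m /andP [um ml].
  by rewrite -mulrDl (IH m)//; [lia|rewrite um (ltn_trans ml lv)].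
by ring.
Qed.

Section AffineMaps.
Variables (x : N) (de de' : N -> N).
Hypotheses (deM : {morph de : y z / (y * z)%g}) (deC : contN de).

Lemma mc_pred_block i : (i < n)%N -> (0 < st i)%N -> en (st i).-1 = st i.
Proof.
move=> ni s0; have /andP [/andP [sti ien] eni] := mc_block mc ni.
have jn : ((st i).-1 < n)%N by lia.
have /andP [/andP [stj jen] enj] := mc_block mc jn.
have [stu _] := mc_same mc ni (introT andP (conj (leqnn (st i)) (leq_ltn_trans sti ien))).
apply/eqP; rewrite eqn_leq; apply/andP; split; last by lia.
rewrite leqNgt; apply/negP => lt.
have [E _] := mc_same mc jn (introT andP (conj (leq_trans stj (leq_pred _)) lt)).
by move: E stj; rewrite stu; lia.
Qed.

(** The end of a block is the common kernel of the continuous homomorphisms of its start to R, and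
    composition with [de] permits an induction over the blocks. *)
Lemma mc_characteristic i y : (i < n)%N -> T (st i) y -> T (st i) (de y).
Proof.
have [k] := ubnP (st i); elim: k i y => // k IH i y ik ni.
have [->|s0] := posnP (st i); first by rewrite (mc_top mc).
have := mc_pred_block ni s0; set j := (st i).-1 => enj.
have /andP [/andP [sti ien] eni] := mc_block mc ni.
have jn : (j < n)%N by rewrite /j; lia.
have /andP [/andP [stj jen] _] := mc_block mc jn.
rewrite -enj (mc_char mc jn) => -[Ty y0].
have IHj z : T (st j) z -> T (st j) (de z) by apply: IH => //; lia.
split=> [|f cf fA]; first exact: IHj.
apply: (y0 (fun z => f (de z))); first exact: (contNR deC cf).
by move=> z z' Tz Tz'; rewrite deM fA//; apply: IHj.
Qed.

(** The point is cut before and after the block of [i]. The tail lies in [T (en i)], which the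
    homomorphism [h] kills; the middle part enters through [h], linearly; the head gives the
    polynomial [c]. *)
Lemma affine_coordinates i : (i < n)%N -> exists (m : nat -> R) (c : S -> R),
  polyfun (fun l => (l < n)%N && (st l < st i)%N) c /\
  forall s, co i (x * de (pt 0 n s))%g = \sum_(l < n | st l == st i) m l * s l + c s.
Proof.
move=> ni; have /andP [/andP [sti ien] eni] := mc_block mc ni.
set u := st i in sti *; set v := en i in ien eni *.
have un : (u <= n)%N by lia.
have su := sT un.
have cA : additive_on (T u) (co i) by apply: (co_additive ni); rewrite sti.
have coM z q : T u q -> co i (z * q)%g = co i z + co i q.
  move=> Tq; rewrite -(co_res _ sti ni) (res_mul _ (leqnn u) un Tq) cA//; last exact: res_in.
  by rewrite co_res.
have cf : contR (fun y => co i (x * de y)%g).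
  apply: contNR; last exact: co_continuous.
  by apply: contMg; [exact: contN_cst|exact: deC].
have [d dE] := co_pol (leq0n n).
have pf : pol (T 0%N) d.+1 (fun y => co i (x * de y)%g).
  apply: (polS (sT (leq0n n))); apply: (pol_precomp (T := T 0%N) (al := de)) (dE i ni) => //.
  - by rewrite (mc_top mc).
  - by rewrite (mc_top mc).
  - by move=> y h _ _; rewrite deM mulgA.
  - exact: sT.
have [P [fP PE]] := pol_coordinates (fun=> 0%N) (leq0n u) un cf pf.
pose h y := co i (de y).
have ch : contR h by exact: (contNR deC (co_continuous ni)).
have hA : additive_on (T u) h.
  by move=> y z Ty Tz; rewrite /h deM cA//; apply: mc_characteristic.
exists (fun l => h (X l 1)), P; split.
  apply: polyfunW (fil_polyfun fP) => l /andP [_ lu].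
  have ln : (l < n)%N by lia.
  by have /andP [/andP [stl _] _] := mc_block mc ln; rewrite ln (leq_ltn_trans stl).
move=> s; have -> : pt 0 n s = (pt 0 u s * (pt u v s * pt v n s))%g.
  have uv' : (u <= v)%N by lia.
  by rewrite /pt -(big_cat_nat _ (n := v))//= -(big_cat_nat _ (n := u)).
have uv : (u <= v)%N by lia.
have T1 : T u (pt u v s) by apply: pt_in.
have T2 : T v (pt v n s) by apply: pt_in.
have T2u : T u (pt v n s) by apply: (mc_mono uv eni).
have T12 : T u (pt u v s * pt v n s)%g by apply: subgroupM.
rewrite deM mulgA coM; last exact: mc_characteristic.
rewrite PE addrC; congr (_ + _); rewrite -/(h _) hA//.
have -> : h (pt v n s) = 0.
  by move: T2; rewrite /v (mc_char mc ni) => -[_]; apply.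
rewrite addr0 (additive_on_pt _ (leqnn u) uv eni hA).
transitivity (\sum_(u <= l < v) h (X l 1) * s l).
  apply: eq_big_nat => l /andP [ul lv]; have ln := leq_trans lv eni.
  rewrite mulrC; apply: (continuous_additive_linear (h := fun r => h (X l r))).
    exact: (contNR (X_continuous ln) ch).
  by move=> a b; rewrite X_add// hA//; apply: (mc_mono ul (ltnW ln)); apply: (mc_X mc).
rewrite (big_nat_widen _ _ n)// (big_nat_widenl _ 0)//= big_mkord; apply: eq_bigl => l.
have /andP [/andP [stl lenl] enl] := mc_block mc (ltn_ord l).
apply/andP/eqP => [[lv ul]|stlu].
  by have [] := mc_same mc ni (introT andP (conj ul lv)).
split; last by rewrite -stlu.
rewrite ltnNge; apply/negP => vl.
have il : (st l <= i < en l)%N by rewrite stlu sti (leq_trans _ lenl)//; lia.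
by have [_] := mc_same mc (ltn_ord l) il; rewrite -/v; lia.
Qed.

End AffineMaps.
End MalcevChains.

(** * The exponential map *)

Section RowNorm.
Context {R : realType} {n : nat}.
Implicit Types (x : 'rV[R]_n).

Lemma rV_coord_le x i : `|x 0 i| <= `|x|.
Proof.
rewrite [leRHS]/Num.norm/= mx_normrE.
exact: (le_bigmax _ (fun ij : 'I_1 * 'I_n => `|x ij.1 ij.2|) (0, i)).
Qed.

Lemma rV_norm_le x e : 0 <= e -> (forall i, `|x 0 i| <= e) -> `|x| <= e.
Proof.
move=> e0 xe; rewrite [leLHS]/Num.norm/= mx_normrE; apply: bigmax_le => // -[j i] _ /=.
by rewrite (ord1 j).
Qed.

Lemma rV_norm_lt x e : 0 < e -> (forall i, `|x 0 i| < e) -> `|x| < e.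
Proof.
move=> e0 xe; rewrite [ltLHS]/Num.norm/= mx_normrE; apply: bigmax_lt => // -[j i] _ /=.
by rewrite (ord1 j).
Qed.

Lemma rV_sum_le x : \sum_i `|x 0 i| <= n%:R * `|x|.
Proof.
rewrite mulrC mulr_natr -[X in _ *+ X]card_ord -sumr_const; apply: ler_sum => i _.
exact: rV_coord_le.
Qed.

End RowNorm.

Section DoubleDifference.
Context {R : realType} {p : nat}.
Implicit Types (f : 'rV[R]_p -> R) (x y z w : 'rV[R]_p).
Local Notation de i := (delta_mx 0 i : 'rV[R]_p).

(** The two conditions on [s] place it between 0 and [d], whatever the sign of [d]. *)
Lemma line_mvt (h dh : R -> R) d K :
  (forall s : R, `|s| <= `|d| -> 0 <= s * d -> is_derive s 1 h (dh s) /\ `|dh s| <= K) ->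
  `|h d - h 0| <= K * `|d|.
Proof.
move=> H; have := normr_ge0 d; rewrite le_eqVlt => /orP [|d0].
  by rewrite eq_sym normr_eq0 => /eqP ->; rewrite subrr !normr0 mulr0.
have K0 : 0 <= K.
  have H0 := H 0; rewrite normr0 mul0r in H0.
  have [_ dK] := H0 (normr_ge0 _) (lexx _); exact: le_trans (normr_ge0 _) dK.
have seg a b : (forall s, s \in `[a, b]%R -> `|s| <= `|d| /\ 0 <= s * d) -> a <= b ->
    `|h b - h a| <= K * (b - a).
  move=> sab ab; have cont : {within `[a, b], continuous h}.
    apply: derivable_within_continuous => s /sab [s1 s2].
    by have [[]] := H s s1 s2.
  have [|c cab ->] := MVT_segment (df := dh) ab _ cont.
    move=> s sab'; have [s1 s2] : `|s| <= `|d| /\ 0 <= s * d.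
      by apply: sab; move: sab'; rewrite !in_itv /= => /andP [/ltW -> /ltW ->].
    by have [] := H s s1 s2.
  have [s1 s2] := sab c cab; have [_ dK] := H c s1 s2.
  by rewrite normrM [X in _ * X]ger0_norm ?subr_ge0// ler_wpM2r// subr_ge0.
have [dp|dn] := lerP 0 d.
  have := seg 0 d; rewrite subr0 (ger0_norm dp); apply => // s.
  rewrite in_itv /= => /andP [s0 sd]; rewrite mulr_ge0// !ger0_norm//.
have := seg d 0; rewrite sub0r (ltr0_norm dn) distrC; apply; last exact: ltW.
move=> s; rewrite in_itv /= => /andP [sd s0]; split; last by rewrite mulr_le0// ltW.
by rewrite (ler0_norm s0) lerN2.
Qed.

Definition between_coords z x y := forall i,
  (x 0 i <= z 0 i <= y 0 i) || (y 0 i <= z 0 i <= x 0 i).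
Definition coord_convex (D : set 'rV[R]_p) := forall x y z, D x -> D y ->
  between_coords z x y -> D z.

Lemma derive_line f x i s : derivable f (x + s *: de i) (de i) ->
  is_derive s 1 (fun t => f (x + t *: de i)) ('D_(de i) f (x + s *: de i)).
Proof.
have E : (fun h : R => h^-1 *: ((f \o shift (x + s *: de i)) (h *: de i) - f (x + s *: de i))) =
    (fun h : R => h^-1 *: (((fun t => f (x + t *: de i)) \o shift s) (h *: (1 : R)) - f (x + s *: de i))).
  apply/funext => h /=; congr (_ *: (f _ - _)).
  by rewrite scalerDl addrCA [h%:A]mulr1.
move=> df; split; first by move: df; rewrite /derivable E.
by rewrite /derive E.
Qed.

Lemma partial_mvt f (D : set 'rV[R]_p) i K x x' : coord_convex D ->
  (forall z, D z -> derivable f z (de i) /\ `|'D_(de i) f z| <= K) ->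
  D x -> D x' -> (forall j, j != i -> x 0 j = x' 0 j) ->
  `|f x' - f x| <= K * `|x' 0 i - x 0 i|.
Proof.
move=> cD fD Dx Dx' xx'; set d := x' 0 i - x 0 i.
have coordE t j : (x + t *: de i) 0 j = x 0 j + t * (j == i)%:R.
  by rewrite !mxE eqxx.
have xE : x + d *: de i = x'.
  apply/rowP => j; rewrite coordE; case: eqP => [->|/eqP ji].
    by rewrite /d mulr1 addrC subrK.
  by rewrite mulr0 addr0 xx'.
have := @line_mvt (fun t => f (x + t *: de i)) (fun t => 'D_(de i) f (x + t *: de i)) d K.
rewrite xE scale0r addr0; apply => s s1 s2.
have Dz : D (x + s *: de i).
  apply: cD Dx Dx' _ => j; rewrite coordE; case: (j =P i) => [->|/eqP ji]; last first.
    by rewrite mulr0 addr0 -xx'// lexx.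
  rewrite mulr1; have -> : x' 0 i = x 0 i + d by rewrite /d addrC subrK.
  rewrite !lerD2l !gerDl !lerDl; clear xE coordE xx' fD; have [d0|d0] := lerP 0 d.
    move: s1; rewrite (ger0_norm d0) ler_norml => /andP [a b]; rewrite b andbT.
    by have -> : 0 <= s by rewrite leNgt; apply/negP => sn; nra.
  move: s1; rewrite (ltr0_norm d0) ler_norml opprK => /andP [a b]; rewrite a /=.
  have s0 : s <= 0 by rewrite leNgt; apply/negP => sn; nra.
  by rewrite s0 orbT.
by have [df dK] := fD _ Dz; split; [exact: derive_line|exact: dK].
Qed.

Lemma cube_lipschitz f (D : set 'rV[R]_p) (Q : pred 'I_p) K x x' : coord_convex D ->
  (forall i z, Q i -> D z -> derivable f z (de i) /\ `|'D_(de i) f z| <= K) ->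
  D x -> D x' -> (forall j, ~~ Q j -> x 0 j = x' 0 j) ->
  `|f x' - f x| <= K * \sum_(i | Q i) `|x' 0 i - x 0 i|.
Proof.
move=> cD fD Dx Dx' xx'.
pose z k : 'rV[R]_p := \row_j if (j < k)%N then x' 0 j else x 0 j.
have Dz k : D (z k).
  apply: cD Dx Dx' _ => j; rewrite mxE; case: ifP => _; rewrite !lexx /= ?andbT; exact: le_total.
have z0 : z 0%N = x by apply/rowP => j; rewrite mxE.
have zp : z p = x' by apply/rowP => j; rewrite mxE ltn_ord.
have part k : (k <= p)%N -> `|f (z k) - f x| <= K * \sum_(i | Q i && (i < k)%N) `|x' 0 i - x 0 i|.
  elim: k => [|k IH] kp; first by rewrite z0 subrr normr0 big1 ?mulr0// => i /andP [].
  pose ki := Ordinal kp.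
  have zk j : j != ki -> z k 0 j = z k.+1 0 j.
    by move=> jk; have jk' : (j : nat) != k := jk; rewrite !mxE ltnS; case: (ltngtP j k) jk'.
  have zk1 : z k.+1 0 ki = x' 0 ki by rewrite mxE /= ltnSn.
  have zk0 : z k 0 ki = x 0 ki by rewrite mxE /= ltnn.
  have [Qk|nQk] := boolP (Q ki); last first.
    have -> : z k.+1 = z k.
      apply/rowP => j; have [->|/zk //] := eqVneq j ki; by rewrite zk1 zk0 xx'.
    rewrite (eq_bigl (fun i : 'I_p => Q i && (i < k)%N)); first exact: IH (ltnW kp).
    move=> i; rewrite ltnS leq_eqVlt; case: (i =P k :> nat) => // ik.
    by have -> : i = ki by [apply: val_inj]; rewrite (negbTE nQk).
  rewrite (bigD1 ki) /=; last by rewrite Qk ltnSn.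
  rewrite mulrDr -(subrKA (f (z k))); apply: le_trans (ler_normD _ _) _; apply: lerD.
    rewrite -zk1 -[x 0 ki]zk0; apply: (partial_mvt cD) => // w Dw; exact: fD.
  rewrite (eq_bigl (fun i : 'I_p => Q i && (i < k)%N)); first exact: IH (ltnW kp).
  move=> i; rewrite ltnS -val_eqE /= [(i < k)%N]ltn_neqAle -andbA; congr (_ && _).
  by rewrite andbC.
have := part p (leqnn p); rewrite zp (eq_bigl Q)// => i; by rewrite ltn_ord andbT.
Qed.

Definition mix (Q : pred 'I_p) z w : 'rV[R]_p := \row_j if Q j then z 0 j else w 0 j.

(** The mean value estimate is used twice: in the directions of [Q] for the difference of [f]
    between two settings of the other coordinates, then in those other directions for its partial
    derivatives. Only mixed second derivatives enter. *)
Lemma double_difference f z0 rho (Q : pred 'I_p) K z w :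
  let D := [set x | `|x - z0| < rho] in
  (forall i x, Q i -> D x -> derivable f x (de i)) ->
  (forall i k x, Q i -> ~~ Q k -> D x -> derivable ('D_(de i) f) x (de k) /\
     `|'D_(de k) ('D_(de i) f) x| <= K) ->
  D z -> D w ->
  `|(f z - f (mix Q z w)) - (f (mix Q w z) - f w)| <=
    (K * \sum_(k | ~~ Q k) `|z 0 k - w 0 k|) * \sum_(i | Q i) `|z 0 i - w 0 i|.
Proof.
move=> D df ddf Dz Dw.
have rho0 : 0 < rho by apply: le_lt_trans Dz.
have Dcoord x : D x <-> forall i, `|x 0 i - z0 0 i| < rho.
  split=> [Dx i|xi].
    by apply: le_lt_trans Dx; have := rV_coord_le (x - z0) i; rewrite !mxE.
  by apply: rV_norm_lt => // i; rewrite !mxE.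
have cD : coord_convex D.
  move=> x y v /Dcoord Dx /Dcoord Dy bv; apply/Dcoord => i.
  move: (Dx i) (Dy i) (bv i); rewrite !ltr_norml => /andP [? ?] /andP [? ?] /orP [] /andP [? ?];
    apply/andP; split; lra.
have Dmix x y : D x -> D y -> D (mix Q x y).
  by move=> /Dcoord Dx /Dcoord Dy; apply/Dcoord => i; rewrite mxE; case: ifP.
have mixzz x : mix Q x x = x by apply/rowP => j; rewrite mxE if_same.
have mixE x y j : mix Q x y 0 j = if Q j then x 0 j else y 0 j by rewrite mxE.
pose e x := f (mix Q x z) - f (mix Q x w).
have mixD x y h i : Q i -> mix Q (h *: de i + x) y = h *: de i + mix Q x y.
  move=> Qi; apply/rowP => j; rewrite !mxE eqxx /=; case: ifP => // nQj.
  have -> : (j == i) = false by apply/eqP => ji; rewrite ji Qi in nQj.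
  by rewrite mulr0 add0r.
have dmix y x i : Q i -> D x -> D y -> derivable (fun x => f (mix Q x y)) x (de i) /\
    'D_(de i) (fun x => f (mix Q x y)) x = 'D_(de i) f (mix Q x y).
  move=> Qi Dx Dy.
  have E : (fun h : R => h^-1 *: (((fun x => f (mix Q x y)) \o shift x) (h *: de i) - f (mix Q x y))) =
      (fun h : R => h^-1 *: ((f \o shift (mix Q x y)) (h *: de i) - f (mix Q x y))).
    by apply/funext => h /=; rewrite mixD.
  split; last by rewrite /derive E.
  by have := df i _ Qi (Dmix _ _ Dx Dy); rewrite /derivable -E.
have ez : f z - f (mix Q z w) = e z by rewrite /e mixzz.
have ew : f (mix Q w z) - f w = e w by rewrite /e mixzz.
rewrite ez ew.
pose D' := [set x | D x /\ forall j, ~~ Q j -> x 0 j = z 0 j].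
have bnd : `|e (mix Q z z) - e (mix Q w z)| <=
    (K * \sum_(k | ~~ Q k) `|z 0 k - w 0 k|) * \sum_(i | Q i) `|mix Q z z 0 i - mix Q w z 0 i|.
  apply: (cube_lipschitz (D := D) (Q := Q) cD); last first.
  - by move=> j nQ; rewrite !mixE (negbTE nQ).
  - exact: Dmix.
  - exact: Dmix.
  move=> i x Qi Dx; have [d1 e1] := dmix z x i Qi Dx Dz; have [d2 e2] := dmix w x i Qi Dx Dw.
  split; first exact: derivableB.
  rewrite /e deriveB// e1 e2.
  have := @cube_lipschitz ('D_(de i) f) D (fun k => ~~ Q k) K (mix Q x w) (mix Q x z) cD.
  move=> /(_ _ (Dmix _ _ Dx Dw) (Dmix _ _ Dx Dz)).
  have -> : \sum_(k | ~~ Q k) `|mix Q x z 0 k - mix Q x w 0 k| = \sum_(k | ~~ Q k) `|z 0 k - w 0 k|.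
    by apply: eq_bigr => k nQ; rewrite !mixE (negbTE nQ).
  apply; first by move=> k y nQ Dy; apply: ddf.
  by move=> k; rewrite negbK => Qk; rewrite !mixE Qk.
have emix x : e (mix Q x z) = e x.
  by rewrite /e; congr (f _ - f _); apply/rowP => j; rewrite !mxE; case: (Q j).
rewrite !emix in bnd; apply: le_trans bnd _.
rewrite le_eqVlt; apply/orP; left; apply/eqP; congr (_ * _); apply: eq_bigr => i Qi.
by rewrite !mixE Qi.
Qed.

End DoubleDifference.

Section LocalCharts.
Context {R : realType} {N : lieGroupType R}.

(* A chart at the identity, centered at the origin, in which the product is
   the sum up to a term which is Lipschitz in each variable with a constant
   proportional to the size of the other one. *)
Record local_chart n (phi : 'rV[R]_n -> N) (m : 'rV[R]_n -> 'rV[R]_n -> 'rV[R]_n) (r C : R)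
  : Prop := LocalChart {
  lc_r : 0 < r;
  lc_C : 0 <= C;
  lc_0 : phi 0 = 1%g;
  lc_inj : forall x y, `|x| < r -> `|y| < r -> phi x = phi y -> x = y;
  lc_nbhs : forall d, 0 < d -> nbhs (1%g : N) [set phi x | x in [set x | `|x| < d]];
  lc_cont : forall x, `|x| < r -> phi y @[y --> x] --> phi x;
  lc_mul : forall x y, `|x| < r -> `|y| < r -> phi (m x y) = (phi x * phi y)%g;
  lc_x0 : forall x, `|x| < r -> m x 0 = x;
  lc_0x : forall x, `|x| < r -> m 0 x = x;
  lc_left : forall x x' y, `|x| < r -> `|x'| < r -> `|y| < r ->
    `|m x y - m x' y - (x - x')| <= C * `|y| * `|x - x'|;
  lc_right : forall x y y', `|x| < r -> `|y| < r -> `|y'| < r ->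
    `|m x y - m x y' - (y - y')| <= C * `|x| * `|y - y'|
}.

Local Notation n := (@lie_dim R N).

Lemma row_mx_norm (u v : 'rV[R]_n) e : 0 < e -> (`|row_mx u v| < e) = (`|u| < e) && (`|v| < e).
Proof.
move=> e0; apply/idP/andP => [uv|[u1 v1]].
  split; apply: rV_norm_lt => // i; apply: le_lt_trans uv.
    by have := rV_coord_le (row_mx u v) (lshift n i); rewrite row_mxEl.
  by have := rV_coord_le (row_mx u v) (rshift n i); rewrite row_mxEr.
apply: rV_norm_lt => // i; case: (split_ordP i) => j ->; rewrite ?row_mxEl ?row_mxEr.
  exact: le_lt_trans (rV_coord_le _ _) u1.
exact: le_lt_trans (rV_coord_le _ _) v1.
Qed.

(** As [m x 0 = x] and [m 0 x = x], the left sides of [lc_left] and [lc_right] are double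
    differences of the product in coordinates, bounded by its second derivatives near the
    identity. *)
Lemma exists_local_chart : exists phi m r C, @local_chart n phi m r C.
Proof.
have [ach cov _] := @lie_smooth_atlas R N.
have [c Ac c1] := cov (1%g : N).
have [odom oim cmap cinv invK] := ach c Ac.
set dom := chart_dom c in c1 odom cmap cinv invK oim.
set ka := chart_map c in oim cmap cinv invK; set iv := chart_inv c in cinv invK.
set V := ka @` dom in oim cinv.
set a := ka 1%g.
have Va : V a by exists 1%g.
have kiv x : V x -> ka (iv x) = x by move=> [q dq <-]; rewrite invK.
have ivd x : V x -> dom (iv x) by move=> [q dq <-]; rewrite invK.
have civ x : V x -> iv y @[y --> x] --> iv x.
  by move=> Vx; move: cinv; rewrite continuous_open_subspace// => /(_ x); rewrite inE; apply.
have cka x : dom x -> ka y @[y --> x] --> ka x.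
  by move=> dx; move: cmap; rewrite continuous_open_subspace// => /(_ x); rewrite inE; apply.
have [cmul smul] := @lie_mul_smooth R N.
pose M (z : 'rV[R]_(n + n)) := ka (iv (lsubmx z) * iv (rsubmx z))%g.
pose z0 : 'rV[R]_(n + n) := row_mx a a.
have [U [nU UE smU]] : exists U : set 'rV[R]_(n + n), [/\ nbhs z0 U,
    forall z, U z -> [/\ V (lsubmx z), V (rsubmx z) & dom (iv (lsubmx z) * iv (rsubmx z))%g] &
    smooth_on U M].
  pose cc := prod_chart c c.
  exists (chart_map cc @` (chart_dom cc `&` (fun u : N * N => (u.1 * u.2)%g) @^-1` dom)); split.
  - have : nbhs (a, a) [set uv : 'rV[R]_n * 'rV[R]_n | dom (iv uv.1 * iv uv.2)%g].
      have -> : [set uv : 'rV[R]_n * 'rV[R]_n | dom (iv uv.1 * iv uv.2)%g] =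
          (fun uv : 'rV[R]_n * 'rV[R]_n => (iv uv.1 * iv uv.2)%g) @^-1` dom by [].
      have cv : (iv uv.1 * iv uv.2)%g @[uv --> (nbhs a, nbhs a)] --> (1%g : N).
        have H := @cvg_comp2 _ _ _ _ (filter_prod (nbhs a) (nbhs a)) _ _ _ _ _ _
          (fun uv => iv uv.1) (fun uv => iv uv.2) (fun x y : N => (x * y)%g)
          (cvg_comp _ _ cvg_fst (civ a Va)) (cvg_comp _ _ cvg_snd (civ a Va)).
        have E : (iv a * iv a)%g = 1%g by rewrite /a invK// mulg1.
        by rewrite -E; apply: H; have := @lie_mul_continuous R N (iv a, iv a); exact.
      by apply: cv; apply: open_nbhs_nbhs; split.
    move=> /nbhs_ballP [e /= e0 eE].
    have /nbhs_ballP [e' /= e'0 e'E] : nbhs a V by apply: open_nbhs_nbhs; split.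
    apply/nbhs_ballP; exists (Num.min e e') => /=; first by rewrite lt_min e0.
    move=> z; rewrite -ball_normE /= -opprB normrN lt_min => /andP [ze ze'].
    have zE : z - z0 = row_mx (lsubmx z - a) (rsubmx z - a).
      by rewrite /z0 -{1}[z]hsubmxK opp_row_mx add_row_mx.
    move: ze ze'; rewrite zE !row_mx_norm// => /andP [l1 r1] /andP [l2 r2].
    have Vl : V (lsubmx z) by apply: e'E; rewrite -ball_normE /= distrC.
    have Vr : V (rsubmx z) by apply: e'E; rewrite -ball_normE /= distrC.
    exists (iv (lsubmx z), iv (rsubmx z)); last by rewrite /= -/ka !kiv// hsubmxK.
    split; first by split; apply: ivd.
    by apply: (eE (lsubmx z, rsubmx z)); split; rewrite -ball_normE /= distrC.
  - move=> _ [[x y] [[/= dx dy] dxy] <-]; rewrite /= row_mxKl row_mxKr; split.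
    + by exists x.
    + by exists y.
    + by move: dxy; rewrite /= !invK.
  - by apply: smul => //; exists (c, c).
have sm2 := smU 2%N; rewrite /= in sm2.
have nball : exists2 rho : R, 0 < rho & exists K : R, forall z, `|z - z0| < rho ->
    U z /\ forall i k j, `|'D_(delta_mx 0 k) ('D_(delta_mx 0 i) M) z 0 j| <= K.
  pose DD i k := 'D_(delta_mx 0 k : 'rV[R]_(n + n)) ('D_(delta_mx 0 i : 'rV[R]_(n + n)) M).
  have near1 i k : \forall z \near z0, `|DD i k z| <= `|DD i k z0| + 1.
    have [_ /(_ i) [_ [_ /(_ k) [_ [cDD _]]]]] := sm2.
    have Uz0 : U z0 by exact: nbhs_singleton nU.
    move: cDD => /subspace_continuousP /(_ z0 Uz0) /cvgrPdist_le /(_ 1 ltr01).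
    rewrite near_withinE => H.
    have H2 : \forall z \near z0, U z -> `|DD i k z0 - DD i k z| <= 1 by exact: H.
    near=> z.
    have Uz : U z by near: z.
    have : `|DD i k z0 - DD i k z| <= 1 by move: Uz; near: z.
    move=> H1; rewrite -[DD i k z](subKr (DD i k z0)) (le_trans (ler_normB _ _))//.
    by rewrite lerD2l.
  have near2 : \forall z \near z0, forall ik : 'I_(n + n) * 'I_(n + n),
      `|DD ik.1 ik.2 z| <= `|DD ik.1 ik.2 z0| + 1.
    pose PP (ik : 'I_(n + n) * 'I_(n + n)) := [set z | `|DD ik.1 ik.2 z| <= `|DD ik.1 ik.2 z0| + 1].
    have H : \forall ik \near z0, forall l : 'I_(n + n) * 'I_(n + n), PP l ik.
      by apply: (@filter_forall _ _ PP (nbhs z0) _) => ik; apply: near1.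
    exact: H.
  have : nbhs z0 (U `&` [set z | forall ik : 'I_(n + n) * 'I_(n + n),
      `|DD ik.1 ik.2 z| <= `|DD ik.1 ik.2 z0| + 1]) by exact: filterI.
  move=> /nbhs_ballP [rho /= rho0 rhoE].
  exists rho => //; exists (\sum_(ik : 'I_(n + n) * 'I_(n + n)) (`|DD ik.1 ik.2 z0| + 1)).
  move=> z zr; have [Uz DDz] : U z /\ forall ik : 'I_(n + n) * 'I_(n + n),
      `|DD ik.1 ik.2 z| <= `|DD ik.1 ik.2 z0| + 1.
    by apply: rhoE; rewrite -ball_normE /= distrC.
  split=> // i k j; apply: le_trans (rV_coord_le (DD i k z) j) _; apply: le_trans (DDz (i, k)) _.
  by rewrite (bigD1 (i, k))//= lerDl; apply: sumr_ge0 => ik _; rewrite addr_ge0.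
have [rho rho0 [K KE]] := nball.
have K0 : 0 <= `|K| by [].
pose C := `|K| * n%:R * n%:R.
pose phi x := iv (x + a).
pose m x y := M (row_mx (x + a) (y + a)) - a.
have inD x y : `|x| < rho -> `|y| < rho -> `|row_mx (x + a) (y + a) - z0| < rho.
  by move=> xr yr; rewrite /z0 opp_row_mx add_row_mx !addrK row_mx_norm// xr.
have Vx x : `|x| < rho -> V (x + a).
  move=> xr; have [+ _] := KE _ (inD x x xr xr).
  by move=> /UE []; rewrite row_mxKl.
have phi0 : phi 0 = 1%g by rewrite /phi add0r /a invK.
have dd x x' y y' : `|x| < rho -> `|x'| < rho -> `|y| < rho -> `|y'| < rho ->
    `|(m x y - m x y') - (m x' y - m x' y')| <= C * `|y - y'| * `|x - x'|.
  move=> xr x'r yr y'r; apply: rV_norm_le => [|j]; first by rewrite !mulr_ge0.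
  pose Q (i : 'I_(n + n)) := (i < n)%N.
  pose f (z : 'rV[R]_(n + n)) := M z 0 j.
  have := @double_difference R _ f z0 rho Q `|K| (row_mx (x + a) (y + a)) (row_mx (x' + a) (y' + a)).
  have mixE (u v u' v' : 'rV[R]_n) : mix Q (row_mx u v) (row_mx u' v') = row_mx u v'.
    apply/rowP => i; rewrite mxE /Q; case: (split_ordP i) => l ->.
      by rewrite !row_mxEl.
    by rewrite !row_mxEr.
  rewrite /= !mixE => /(_ _ _ (inD _ _ xr yr) (inD _ _ x'r y'r)).
  have sumQ (u v : 'rV[R]_(n + n)) : \sum_(i | Q i) `|u 0 i - v 0 i| <= n%:R * `|lsubmx u - lsubmx v|.
    apply: le_trans (rV_sum_le _); rewrite big_split_ord /= [X in _ + X]big1 ?addr0; last first.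
      by move=> i; rewrite /Q /= ltnNge leq_addr.
    rewrite big_mkcond /=; apply: ler_sum => i _; rewrite !mxE.
    by case: ifP => // _; apply: normr_ge0.
  have sumnQ (u v : 'rV[R]_(n + n)) : \sum_(i | ~~ Q i) `|u 0 i - v 0 i| <= n%:R * `|rsubmx u - rsubmx v|.
    apply: le_trans (rV_sum_le _); rewrite big_split_ord /= big1 ?add0r; last first.
      by move=> i; rewrite /Q /= ltn_ord.
    rewrite big_mkcond /=; apply: ler_sum => i _; rewrite !mxE.
    by case: ifP => // _; apply: normr_ge0.
  have fder i z : `|z - z0| < rho -> derivable f z (delta_mx 0 i) /\
      'D_(delta_mx 0 i) f z = 'D_(delta_mx 0 i) M z 0 j.
    move=> /KE [Uz _]; have [_ /(_ i) [/(_ z Uz) dM _]] := sm2.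
    split; first exact: (derivable_mxP M z (delta_mx 0 i)).1 dM 0 j.
    by rewrite (derive_mx dM) mxE.
  move=> H; have {}H : `|f (row_mx (x + a) (y + a)) - f (row_mx (x + a) (y' + a)) -
      (f (row_mx (x' + a) (y + a)) - f (row_mx (x' + a) (y' + a)))| <=
      `|K| * (n%:R * `|y - y'|) * (n%:R * `|x - x'|).
    have := H; move=> /(_ _ _)/le_trans; apply.
    - by move=> i z _ zr; have [] := fder i z zr.
    - move=> i k z _ _ zr; have [Uz DDz] := KE z zr.
      have [_ /(_ i) [_ [_ /(_ k) [/(_ z Uz) dM _]]]] := sm2.
      have E : \forall y \near z, 'D_(delta_mx 0 i) f y = 'D_(delta_mx 0 i) M y 0 j.
        have /nbhs_ballP : nbhs z [set y | `|y - z0| < rho].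
          apply: open_nbhs_nbhs; split=> //.
          have -> : [set y | `|y - z0| < rho] = ball z0 rho.
            by apply/seteqP; split=> q; rewrite -ball_normE /= distrC.
          exact: ball_open.
        move=> [e /= e0 eE]; apply/nbhs_ballP; exists e => //= q /eE qr.
        by have [] := fder i q qr.
      have dcoord : derivable (fun y => 'D_(delta_mx 0 i) M y 0 j) z (delta_mx 0 k).
        exact: (derivable_mxP _ z (delta_mx 0 k)).1 dM 0 j.
      split.
        by apply: near_eq_derivable dcoord => //; near=> q; symmetry; near: q.
      rewrite (near_eq_derive _ E).
      have -> : 'D_(delta_mx 0 k) (fun y => 'D_(delta_mx 0 i) M y 0 j) z =
          'D_(delta_mx 0 k) ('D_(delta_mx 0 i) M) z 0 j by rewrite (derive_mx dM) mxE.
      by apply: le_trans (DDz i k j) _; apply: ler_norm.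
    apply: ler_pM.
    - by rewrite mulr_ge0// sumr_ge0.
    - exact: sumr_ge0.
    - apply: ler_wpM2l => //; apply: le_trans (sumnQ _ _) _.
      by rewrite !row_mxKr opprD addrACA subrr addr0.
    - apply: le_trans (sumQ _ _) _.
      by rewrite !row_mxKl opprD addrACA subrr addr0.
  have -> : ((m x y - m x y') - (m x' y - m x' y')) 0 j =
     f (row_mx (x + a) (y + a)) - f (row_mx (x + a) (y' + a)) -
      (f (row_mx (x' + a) (y + a)) - f (row_mx (x' + a) (y' + a))).
    rewrite /m /f !mxE; ring.
  apply: le_trans H _; rewrite /C le_eqVlt; apply/orP; left; apply/eqP; ring.
have mx0 x : `|x| < rho -> m x 0 = x.
  move=> xr; rewrite /m add0r /M row_mxKl row_mxKr /a (invK _ c1) mulg1 kiv; last exact: Vx.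
  by rewrite addrK.
have m0x x : `|x| < rho -> m 0 x = x.
  move=> xr; rewrite /m add0r /M row_mxKl row_mxKr /a (invK _ c1) mul1g kiv; last exact: Vx.
  by rewrite addrK.
have n0 : `|0 : 'rV[R]_n| < rho by rewrite normr0.
exists phi, m, rho, C; split=> //.
- by rewrite !mulr_ge0.
- move=> x y xr yr E; apply: (addIr a); rewrite -(kiv (x + a)); last exact: Vx.
  by rewrite -(kiv (y + a)); [rewrite -/(phi x) E|exact: Vx].
- move=> d d0; have /cvgrPdist_lt /(_ d d0) := cka 1%g c1; rewrite near_simpl => H.
  have ndom : nbhs (1%g : N) dom by apply: open_nbhs_nbhs; split.
  near=> g; have dg : dom g by near: g.
  exists (ka g - a); last by rewrite /phi subrK invK.
  by rewrite /= distrC; near: g.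
- move=> x xr; have ct : continuous (fun y : 'rV[R]_n => y + a).
    move=> y A /nbhs_ballP [e /= e0 eA]; apply/nbhs_ballP; exists e => //= z.
    rewrite -ball_normE /= => yz; apply: eA.
    by rewrite -ball_normE /= opprD addrACA subrr addr0.
  exact: (@cvg_comp _ _ _ (fun y : 'rV[R]_n => y + a) iv _ _ _ (ct x) (civ _ (Vx x xr))).
- move=> x y xr yr; rewrite /phi /m subrK /M row_mxKl row_mxKr.
  have [+ _] := KE _ (inD x y xr yr); move=> /UE [_ _]; rewrite row_mxKl row_mxKr => dxy.
  by rewrite invK.
- move=> x x' y xr x'r yr; have := dd x x' y 0 xr x'r yr n0.
  rewrite !mx0// subr0; congr (`|_| <= _).
  by apply/rowP => i; rewrite !mxE; ring.
- move=> x y y' xr yr y'r; have := dd x 0 y y' xr n0 yr y'r.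
  by rewrite !m0x// subr0 mulrAC.
Unshelve. all: by end_near.
Qed.

End LocalCharts.

Section SequenceLimits.
Context {R : realType} {n : nat}.
Local Notation V := 'rV[R]_n.
Implicit Types (u : nat -> V) (l : V).

Definition tends u l := forall e : R, 0 < e -> exists k0, forall k, (k0 <= k)%N -> `|u k - l| <= e.

Lemma tends_uniq u l l' : tends u l -> tends u l' -> l = l'.
Proof.
move=> ul ul'; apply/eqP; rewrite -subr_eq0 -normr_le0; apply/ler_addgt0Pr => e e0.
have e2 : 0 < e / 2 by rewrite divr_gt0.
have [k kE] := ul _ e2; have [k' kE'] := ul' _ e2.
have := kE (maxn k k') (leq_maxl _ _); have := kE' (maxn k k') (leq_maxr _ _).
set x := u _ => h1 h2; have -> : l - l' = (x - l') - (x - l) by apply/rowP => i; rewrite !mxE; ring.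
apply: le_trans (ler_normB _ _) _; lra.
Qed.

Lemma geometric_limit_real (u : nat -> R) c q : 0 <= q < 1 ->
  (forall k, `|u k.+1 - u k| <= c * q ^+ k) ->
  exists l : R, forall k, `|u k - l| <= c / (1 - q) * q ^+ k.
Proof.
(* [b * q ^+ k] is the sum of all later increments [c * q ^+ j], so [u k - b * q ^+ k] increases,
   [u k + b * q ^+ k] decreases, and they enclose the limit. *)
move=> /andP [q0 q1] uq; set b := c / (1 - q).
have bE : b = c + b * q by rewrite /b; field; lra.
have b0 : 0 <= b by rewrite divr_ge0//; [have := uq 0%N; rewrite expr0 mulr1; apply: le_trans|lra].
pose a k := u k - b * q ^+ k; pose d k := u k + b * q ^+ k.
have stepE k : b * q ^+ k = c * q ^+ k + b * q ^+ k.+1 by rewrite {1}bE exprS; ring.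
have a_mono : {homo a : j k / (j <= k)%N >-> j <= k}.
  apply: homo_leq => [x|y x z|k]; [exact: lexx|exact: le_trans|].
  by have := uq k; rewrite ler_norml /a (stepE k) => /andP [? _]; lra.
have d_mono : {homo d : j k / (j <= k)%N >-> k <= j}.
  apply: (homo_leq (r := fun x y : R => y <= x)) => [x|y x z xy yz|k]; [exact: lexx|exact: le_trans yz xy|].
  by have := uq k; rewrite ler_norml /d (stepE k) => /andP [_ ?]; lra.
have ad j k : a j <= d k.
  apply: le_trans (a_mono _ _ (leq_maxl j k)) _; apply: le_trans (d_mono _ _ (leq_maxr j k)).
  by rewrite /a /d lerBlDr -addrA lerDl addr_ge0// mulr_ge0// exprn_ge0.
have supA : has_sup (range a).
  by split; [exists (a 0%N), 0%N|exists (d 0%N) => _ [j _ <-]].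
exists (sup (range a)) => k.
have h1 : a k <= sup (range a) by apply: ub_le_sup; [exact: supA.2|exists k].
have h2 : sup (range a) <= d k by apply: ge_sup; [exact: supA.1|move=> _ [j _ <-]].
by rewrite ler_norml; move: h1 h2; rewrite /a /d => *; apply/andP; split; lra.
Qed.

Lemma small_power (q e : R) : 0 <= q < 1 -> 0 < e -> exists k0, forall k, (k0 <= k)%N -> q ^+ k <= e.
Proof.
move=> /andP [q0 q1] e0; have q1' : `|q| < 1 by rewrite ger0_norm.
have /cvgrPdist_le /(_ e e0) := cvg_expr q1'; move=> [k0 _ kE]; exists k0 => k kk.
by have := kE k kk; rewrite /= sub0r normrN ger0_norm// exprn_ge0.
Qed.

Lemma geometric_tends u l c q : 0 <= q < 1 -> (forall k, `|u k - l| <= c * q ^+ k) -> tends u l.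
Proof.
move=> q01 ul e e0; have c0 : 0 <= c by have := ul 0%N; rewrite expr0 mulr1; apply: le_trans.
have c1 : 0 < c + 1 by lra.
have [k0 kE] := small_power q01 (divr_gt0 e0 c1); exists k0 => k kk; apply: le_trans (ul k) _.
apply: le_trans (ler_wpM2l c0 (kE k kk)) _; rewrite mulrA ler_pdivrMr// mulrC.
by apply: ler_wpM2l; lra.
Qed.

Lemma geometric_limit u c q : 0 <= q < 1 -> (forall k, `|u k.+1 - u k| <= c * q ^+ k) ->
  exists l, tends u l.
Proof.
move=> q01 uq.
have c0 : 0 <= c by have := uq 0%N; rewrite expr0 mulr1; apply: le_trans.
have coord i : exists l : R, forall k, `|u k 0 i - l| <= c / (1 - q) * q ^+ k.
  apply: geometric_limit_real => // k; apply: le_trans (uq k).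
  by have := rV_coord_le (u k.+1 - u k) i; rewrite !mxE.
have /choice [l lE] := coord; exists (\row_i l i).
apply: (geometric_tends (c := c / (1 - q)) q01) => k; apply: rV_norm_le => [|i].
  by move: q01 => /andP [? ?]; rewrite mulr_ge0 ?exprn_ge0// divr_ge0//; lra.
by rewrite !mxE.
Qed.

Lemma tends_le u l a c : tends u l -> (forall k, `|u k - a| <= c) -> `|l - a| <= c.
Proof.
move=> ul uc; apply/ler_addgt0Pr => e e0; have [k kE] := ul e e0.
have -> : l - a = (u k - a) - (u k - l) by apply/rowP => i; rewrite !mxE; ring.
by apply: le_trans (ler_normB _ _) _; apply: lerD; [exact: uc|exact: kE].
Qed.

Lemma tends_cst l : tends (fun=> l) l.
Proof. by move=> e e0; exists 0%N => k _; rewrite subrr normr0 ltW. Qed.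

Lemma tends_eq u u' l : u =1 u' -> tends u l -> tends u' l.
Proof. by move=> /funext ->. Qed.

Lemma tendsD u l u' l' : tends u l -> tends u' l' -> tends (fun k => u k + u' k) (l + l').
Proof.
move=> ul ul' e e0; have e2 : 0 < e / 2 by rewrite divr_gt0.
have [k kE] := ul _ e2; have [k' kE'] := ul' _ e2; exists (maxn k k') => j.
rewrite geq_max => /andP [/kE h /kE' h']; rewrite opprD addrACA.
apply: le_trans (ler_normD _ _) _; lra.
Qed.

Lemma tendsZ u l a : tends u l -> tends (fun k => a *: u k) (a *: l).
Proof.
move=> ul e e0; have a0 : 0 < `|a| + 1 by have := normr_ge0 a; lra.
have [k kE] := ul _ (divr_gt0 e0 a0); exists k => j /kE h; rewrite -scalerBr normrZ.
apply: le_trans (ler_wpM2l (normr_ge0 a) h) _; rewrite mulrA ler_pdivrMr// mulrC.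
by apply: ler_wpM2l; lra.
Qed.

Lemma tends_shift u l j : tends u l -> tends (fun k => u (k + j)%N) l.
Proof. by move=> ul e /ul [k kE]; exists k => i ki; apply: kE; apply: leq_trans (leq_addr _ _). Qed.

Lemma tends_lip (f : V -> V) u l a K : tends u l -> f l = a -> 0 <= K ->
  (forall k, `|f (u k) - f l| <= K * `|u k - l|) -> tends (fun k => f (u k)) a.
Proof.
move=> ul <- K0 fl e e0; have K1 : 0 < K + 1 by lra.
have [k kE] := ul _ (divr_gt0 e0 K1); exists k => j /kE h; apply: le_trans (fl j) _.
apply: le_trans (ler_wpM2l K0 h) _; rewrite mulrA ler_pdivrMr// mulrC.
by apply: ler_wpM2l; lra.
Qed.

End SequenceLimits.

(** Additivity along lines is not among the fields: it is derived from the doubling rule, the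
    second-order estimate [em_mul] and the uniqueness of small logarithms given by [em_dist]. *)
Record exponential_map {R : realType} {N : lieGroupType R} {n : nat}
  (ex : 'rV[R]_n -> N) (e0 K : R) : Prop := ExponentialMap {
  em_e0 : 0 < e0;
  em_K : 0 <= K;
  em_double : forall v, ex (2 *: v) = (ex v * ex v)%g;
  em_cont : contN ex;
  em_nbhs : forall d, 0 < d -> nbhs (1%g : N) [set ex v | v in [set v | `|v| < d]];
  em_mul : forall u v, `|u| <= e0 -> `|v| <= e0 ->
    exists2 w, (ex u * ex v)%g = ex w & `|w - (u + v)| <= K * (`|u| + `|v|) ^+ 2;
  em_dist : forall u v w, `|u| <= e0 -> `|v| <= e0 -> `|w| <= e0 ->
    (ex u * (ex v)^-1)%g = ex w -> `|u - v| <= 2 * `|w|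
}.

(** * Construction of the exponential map by iterated squaring *)

Section LocalExponential.
Context {R : realType} {N : lieGroupType R} {n : nat}.
Local Notation V := 'rV[R]_n.
Variables (phi : V -> N) (m : V -> V -> V) (r C : R).
Hypothesis lc : local_chart phi m r C.
Implicit Types u v w x y : V.

Let C0 : 0 <= C. Proof. exact: lc_C lc. Qed.
(** The first bound keeps vectors of size [2 * rho] inside the chart; the second gives
    [C * rho <= 1 / 16], which makes squaring a small perturbation of doubling. *)
Let rho := Num.min (r / 4) (16 * (C + 1))^-1.
Let rho0 : 0 < rho.
Proof. by rewrite lt_min divr_gt0 ?(lc_r lc)//= invr_gt0; have := C0; lra. Qed.
Let rho_r : rho <= r / 4. Proof. by rewrite ge_min lexx. Qed.
Let Crho : C * rho <= 1 / 16.
Proof.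
have c1 : 0 < 16 * (C + 1) by have := C0; lra.
have : rho * (16 * (C + 1)) <= 1 by rewrite -ler_pdivlMr// div1r ge_min lexx orbT.
have := C0; have := rho0; move=> *; nra.
Qed.
Let small x : `|x| <= 2 * rho -> `|x| < r.
Proof. by move=> xr; have := rho_r; have := lc_r lc; lra. Qed.

Definition chart_square x := m x x.
Local Notation sq := chart_square.

Lemma square_lipschitz x y : `|x| < r -> `|y| < r ->
  `|sq x - sq y - 2 *: (x - y)| <= C * (`|x| + `|y|) * `|x - y|.
Proof.
move=> xr yr; have -> : sq x - sq y - 2 *: (x - y) =
    (m x x - m y x - (x - y)) + (m y x - m y y - (x - y)).
  by apply/rowP => i; rewrite !mxE; ring.
apply: le_trans (ler_normD _ _) _; rewrite mulrDr mulrDl.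
by apply: lerD; [apply: lc_left lc _ _ _ _ _ _|apply: lc_right lc _ _ _ _ _ _].
Qed.

Lemma square0 : sq 0 = 0.
Proof. by rewrite /sq (lc_x0 lc)// normr0 (lc_r lc). Qed.

Fixpoint iterated_square k v := if k is k'.+1 then sq (iterated_square k' (2^-1 *: v)) else v.
Local Notation Ek := iterated_square.

Lemma Ek0 k : Ek k 0 = 0.
Proof. by elim: k => //= k IH; rewrite scaler0 IH square0. Qed.

Lemma normr_half v : `|2^-1 *: v| = `|v| / 2.
Proof. by rewrite normrZ ger0_norm ?invr_ge0// mulrC. Qed.

Lemma half_small v : `|v| <= rho -> `|2^-1 *: v| <= rho.
Proof. by move=> vr; rewrite normr_half; have := normr_ge0 v; lra. Qed.

Lemma norm_from_diff (F : V -> V) v : F 0 = 0 -> `|v| <= rho ->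
  `|F v - F 0 - (v - 0)| <= C * (`|v| + `|0 : V|) * `|v - 0| ->
  `|F v - v| <= C * `|v| * `|v| /\ `|F v| <= 17 / 16 * `|v|.
Proof.
move=> F0 vr; rewrite F0 normr0 addr0 !subr0 => H; split=> //.
have -> : F v = v + (F v - v) by rewrite addrC subrK.
apply: le_trans (ler_normD _ _) _.
have : C * `|v| * `|v| <= 1 / 16 * `|v|.
  apply: ler_wpM2r => //; apply: le_trans Crho; exact: ler_wpM2l.
lra.
Qed.

(** The constant [C] survives the recursion: halving the arguments divides the bound by 4, doubling
    gives back a factor 2, and the error of squaring, with factor [(17 / 32) ^ 2 < 1 / 2], fits into
    the remaining half. *)
Lemma Ek_diff k u v : `|u| <= rho -> `|v| <= rho ->
  `|Ek k u - Ek k v - (u - v)| <= C * (`|u| + `|v|) * `|u - v|.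
Proof.
elim: k u v => [|k IH] u v ur vr /=.
  by rewrite subrr normr0 !mulr_ge0// addr_ge0.
have hu := half_small ur; have hv := half_small vr.
have z0 : `|0 : V| <= rho by rewrite normr0 ltW.
have [_ Eu] := norm_from_diff (Ek0 k) hu (IH _ _ hu z0).
have [_ Ev] := norm_from_diff (Ek0 k) hv (IH _ _ hv z0).
have := IH _ _ hu hv; rewrite -scalerBr; set x := Ek k _ in Eu *; set y := Ek k _ in Ev *.
rewrite !normr_half in Eu Ev *; move=> D1.
have xr : `|x| < r by apply: small; have := normr_ge0 u; lra.
have yr : `|y| < r by apply: small; have := normr_ge0 v; lra.
have D2 := square_lipschitz xr yr.
have d0 := normr_ge0 (u - v); set d := `|u - v| in D1 d0 *.
have a0 := normr_ge0 u; have b0 := normr_ge0 v.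
set a := `|u| in a0 ur Eu D1 *; set b := `|v| in b0 vr Ev D1 *.
have Cab : C * (a + b) <= 1 / 8.
  by have := ler_wpM2l C0 ur; have := ler_wpM2l C0 vr; move: Crho; rewrite mulrDr; lra.
have Cabd : C * (a + b) * d <= 1 / 8 * d by apply: ler_wpM2r.
have xy : `|x - y| <= 17 / 32 * d.
  have -> : x - y = (x - y - 2^-1 *: (u - v)) + 2^-1 *: (u - v) by rewrite subrK.
  apply: le_trans (ler_normD _ _) _; rewrite normr_half -/d; lra.
have -> : sq x - sq y - (u - v) =
    (sq x - sq y - 2 *: (x - y)) + 2 *: (x - y - 2^-1 *: (u - v)).
  by apply/rowP => i; rewrite !mxE; field.
apply: le_trans (ler_normD _ _) _; rewrite normrZ ger0_norm//.
have P1 : C * (`|x| + `|y|) <= C * (17 / 32 * (a + b)) by apply: ler_wpM2l => //; lra.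
have P2 : C * (`|x| + `|y|) * `|x - y| <= C * (17 / 32 * (a + b)) * (17 / 32 * d).
  by apply: ler_pM => //; rewrite mulr_ge0// addr_ge0.
have P3 : 0 <= C * (a + b) * d by rewrite !mulr_ge0// addr_ge0.
lra.
Qed.

(** The ratio 5/8 is 1/4 times 5/2: the bound is quadratic in [v], which is halved, and squaring
    expands distances by at most [2 + 1 / 2]. *)
Lemma Ek_cauchy k v : `|v| <= rho -> `|Ek k.+1 v - Ek k v| <= (C * `|v| * `|v| / 4) * (5 / 8) ^+ k.
Proof.
have z0 : `|0 : V| <= rho by rewrite normr0 ltW.
elim: k v => [|k IH] v vr.
  rewrite expr0 mulr1 /=; have hv := half_small vr.
  have := square_lipschitz (small (le_trans hv _)) (small (le_trans z0 _)).
  rewrite square0 normr0 addr0 !subr0 normr_half => /(_ _ _).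
  have -> : 2 *: (2^-1 *: v) = v by rewrite scalerA divff// scale1r.
  by move=> H; apply: le_trans (H _ _) _; have := rho0; lra.
have hv := half_small vr; have IHv := IH _ hv.
have -> : Ek k.+2 v - Ek k.+1 v = sq (Ek k.+1 (2^-1 *: v)) - sq (Ek k (2^-1 *: v)) by [].
have [_ Eu] := norm_from_diff (Ek0 k.+1) hv (Ek_diff k.+1 hv z0).
have [_ Ev] := norm_from_diff (Ek0 k) hv (Ek_diff k hv z0).
set x := Ek k.+1 _ in IHv Eu *; set y := Ek k _ in IHv Ev *.
rewrite !normr_half in Eu Ev IHv.
have v0 := normr_ge0 v; set a := `|v| in v0 vr Eu Ev IHv *.
have xr : `|x| < r by apply: small; lra.
have yr : `|y| < r by apply: small; lra.
have D2 := square_lipschitz xr yr.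
have -> : sq x - sq y = (sq x - sq y - 2 *: (x - y)) + 2 *: (x - y) by rewrite subrK.
apply: le_trans (ler_normD _ _) _; rewrite normrZ ger0_norm//.
have Ca : C * a <= 1 / 16 by apply: le_trans Crho; apply: ler_wpM2l.
have P1 : C * (`|x| + `|y|) <= 1 / 2.
  have : C * (`|x| + `|y|) <= C * (17 / 16 * a) by apply: ler_wpM2l => //; lra.
  lra.
have P2 : C * (`|x| + `|y|) * `|x - y| <= 1 / 2 * `|x - y| by apply: ler_wpM2r.
rewrite exprS; set t := (5 / 8) ^+ k in IHv *.
have -> : C * a * a / 4 * (5 / 8 * t) = 5 / 2 * (C * (a / 2) * (a / 2) / 4 * t) by field.
lra.
Qed.

Lemma local_exponential : exists E : V -> V,
  [/\ forall v, `|v| <= rho -> E v = sq (E (2^-1 *: v)), E 0 = 0 &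
    forall u v, `|u| <= rho -> `|v| <= rho ->
      `|E u - E v - (u - v)| <= C * (`|u| + `|v|) * `|u - v|].
Proof.
have q01 : 0 <= (5 / 8 : R) < 1 by apply/andP; split; lra.
have ex v : exists l, `|v| <= rho -> tends (fun k => Ek k v) l.
  have [vr|//] := lerP `|v| rho; last by exists 0.
  have [l lE] := geometric_limit q01 (fun k => Ek_cauchy k vr); by exists l.
have /choice [E EE] := ex.
have z0 : `|0 : V| <= rho by rewrite normr0 ltW.
have E0 : E 0 = 0.
  by apply: tends_uniq (EE 0 z0) _; apply: tends_eq (tends_cst 0) => k; rewrite Ek0.
have diff u v : `|u| <= rho -> `|v| <= rho ->
    `|E u - E v - (u - v)| <= C * (`|u| + `|v|) * `|u - v|.
  move=> ur vr; apply: (tends_le (u := fun k => Ek k u - Ek k v)); last by move=> k; apply: Ek_diff.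
  apply: tendsD; first exact: EE.
  rewrite -scaleN1r; apply: tends_eq (tendsZ (-1) (EE v vr)) => k /=; by rewrite scaleN1r.
exists E; split=> // v vr; have hv := half_small vr.
apply: (tends_uniq (tends_shift 1 (EE v vr))).
have -> : (fun k => Ek (k + 1) v) = fun k => sq (Ek k (2^-1 *: v)).
  by apply/funext => k; rewrite addn1.
have [_ Eh] := norm_from_diff E0 hv (diff _ _ hv z0).
apply: (tends_lip (EE _ hv) (erefl _) (K := 3)) => // k.
have [_ Ek1] := norm_from_diff (Ek0 k) hv (Ek_diff k hv z0).
set x := Ek k _ in Ek1 *; set y := E _ in Eh *.
have xr : `|x| < r by apply: small; have := normr_ge0 v; lra.
have yr : `|y| < r by apply: small; have := normr_ge0 v; lra.
have -> : sq x - sq y = (sq x - sq y - 2 *: (x - y)) + 2 *: (x - y) by rewrite subrK.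
apply: le_trans (ler_normD _ _) _; rewrite normrZ ger0_norm//.
have := square_lipschitz xr yr.
have P1 : C * (`|x| + `|y|) <= 1.
  have : C * (`|x| + `|y|) <= C * (34 / 16 * rho) by apply: ler_wpM2l => //; lra.
  by move: Crho; lra.
have P2 : C * (`|x| + `|y|) * `|x - y| <= 1 * `|x - y| by apply: ler_wpM2r.
lra.
Qed.

Section Exponential.
Variable E : V -> V.
Hypothesis E_double : forall v, `|v| <= rho -> E v = sq (E (2^-1 *: v)).
Hypothesis E0 : E 0 = 0.
Hypothesis E_diff : forall u v, `|u| <= rho -> `|v| <= rho ->
      `|E u - E v - (u - v)| <= C * (`|u| + `|v|) * `|u - v|.

Lemma E_norm v : `|v| <= rho -> `|E v - v| <= C * `|v| * `|v| /\ `|E v| <= 17 / 16 * `|v|.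
Proof. move=> vr; have z0 : `|0 : V| <= rho by rewrite normr0 ltW.
by apply: norm_from_diff => //; apply: E_diff. Qed.

Lemma E_contraction u v : `|u| <= rho -> `|v| <= rho -> `|E u - E v - (u - v)| <= 1 / 8 * `|u - v|.
Proof.
move=> ur vr; apply: le_trans (E_diff ur vr) _; apply: ler_wpM2r => //.
have := ler_wpM2l C0 ur; have := ler_wpM2l C0 vr; move: Crho; rewrite mulrDr; lra.
Qed.

(** [E] minus the identity is Lipschitz with constant 1/8, so iterating [v + (y - E v)] from 0
    converges. *)
Lemma E_surjective y : `|y| <= rho / 2 -> exists2 v, `|v| <= 2 * `|y| & E v = y.
Proof.
move=> yr; pose T v := v + (y - E v); pose w k := iter k T 0.
have yn := normr_ge0 y.
have wr k : `|w k| <= 2 * `|y|.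
  elim: k => [|k IH]; first by rewrite normr0; lra.
  have wk : `|w k| <= rho by lra.
  have [h _] := E_norm wk.
  have -> : w k.+1 = y - (E (w k) - w k) by rewrite /w /= /T opprB addrCA.
  apply: le_trans (ler_normB _ _) _.
  have : C * `|w k| * `|w k| <= 1 / 16 * `|w k|.
    apply: ler_wpM2r => //; apply: le_trans Crho; exact: ler_wpM2l.
  lra.
have wr' k : `|w k| <= rho by have := wr k; lra.
have wd k : `|w k.+1 - w k| <= `|y| * (1 / 2) ^+ k.
  elim: k => [|k IH]; first by rewrite /w /= /T E0 add0r !subr0 expr0 mulr1.
  have -> : w k.+2 - w k.+1 = - (E (w k.+1) - E (w k) - (w k.+1 - w k)).
    by rewrite /w /= /T; apply/rowP => i; rewrite !mxE; ring.
  rewrite normrN; have := E_contraction (wr' k.+1) (wr' k).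
  rewrite exprS; set t := _ ^+ k in IH *; move=> h; apply: le_trans h _; have := normr_ge0 (w k.+1 - w k); lra.
have q01 : 0 <= (1 / 2 : R) < 1 by apply/andP; split; lra.
have [l wl] := geometric_limit q01 wd.
have lr : `|l| <= 2 * `|y|.
  have := tends_le wl (a := 0) (c := 2 * `|y|); rewrite subr0; apply => k; by rewrite subr0.
exists l => //; have lr' : `|l| <= rho by lra.
have t1 : tends (fun k => E (w k)) (E l).
  apply: (tends_lip wl (erefl _) (K := 2)) => // k.
  have -> : E (w k) - E l = (E (w k) - E l - (w k - l)) + (w k - l) by rewrite subrK.
  apply: le_trans (ler_normD _ _) _; have := E_contraction (wr' k) lr'; have := normr_ge0 (w k - l); lra.
apply: (tends_uniq t1); apply: (geometric_tends (c := `|y|) q01) => k.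
apply: le_trans (wd k); rewrite -normrN.
have -> : - (E (w k) - y) = w k.+1 - w k; last exact: lexx.
by rewrite /w /= /T; apply/rowP => i; rewrite !mxE; ring.
Qed.

Let ex1 v := phi (E v).
(** Extension to all vectors: by doubling, [F k v] does not depend on [k] once the scaled vector is
    small. *)
Let F k v := (ex1 ((2 ^- k) *: v) ^+ (2 ^ k))%g.

Lemma E_small v : `|v| <= rho -> `|E v| < r.
Proof. by move=> vr; apply: small; have [_] := E_norm vr; have := normr_ge0 v; lra. Qed.

Lemma ex1_double v : `|v| <= rho -> ex1 v = (ex1 (2^-1 *: v) * ex1 (2^-1 *: v))%g.
Proof.
move=> vr; rewrite /ex1 E_double//; have h := E_small (half_small vr).
exact: (lc_mul lc h h).
Qed.

Lemma F_stable j k v : `|2 ^- k *: v| <= rho -> F (j + k) v = F k v.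
Proof.
move=> kv; elim: j => [//|j <-]; rewrite /F addSn.
have jk : `|2 ^- (j + k) *: v| <= rho.
  apply: le_trans kv; rewrite !normrZ; apply: ler_wpM2r => //.
  rewrite !ger0_norm ?invr_ge0 ?exprn_ge0// lef_pV2 ?posrE ?exprn_gt0//.
  by rewrite ler_weXn2l ?leq_addl//; lra.
rewrite (ex1_double jk) scalerA -invfM -exprS expnS.
set g := ex1 _; by rewrite expgnA -[(g ^+ 2)%g]/(g * g)%g.
Qed.

Lemma exists_scale v : exists k, `|2 ^- k *: v| <= rho.
Proof.
exists (Num.truncn (`|v| / rho)); set k := Num.truncn _.
have h : `|v| / rho < k.+1%:R by apply: truncnS_gt.
rewrite normrZ ger0_norm ?invr_ge0 ?exprn_ge0// mulrC ler_pdivrMr ?exprn_gt0//.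
rewrite -ler_pdivrMl// mulrC; apply: le_trans (ltW h) _.
by rewrite -natrX ler_nat ltn_expl.
Qed.

Lemma exists_exponential_aux : exists ex e0 K, @exponential_map R N n ex e0 K.
Proof.
have /choice [kk kkE] := exists_scale; pose ex v := F (kk v) v.
have exE k v : `|2 ^- k *: v| <= rho -> ex v = F k v.
  move=> kv; rewrite /ex; have [/subnK <-|/ltnW/subnK <-] := leqP (kk v) k.
    by rewrite F_stable.
  by rewrite F_stable.
have exS v : `|v| <= rho -> ex v = phi (E v).
  by move=> vr; rewrite (exE 0%N) /F expr0 invr1 scale1r.
have C1 := C0; have rho1 := rho0; have cr := Crho.
exists ex, (rho / 8), (10 * C); split.
- lra.
- lra.
- move=> v; rewrite (exE (kk v).+1); last by rewrite scalerA exprSr invfM mulrVK ?unitfE//; apply: kkE.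
  rewrite /ex /F scalerA exprSr invfM mulrVK ?unitfE// expnS mulnC.
  by set g := ex1 _; rewrite expgnA -[RHS]/(_ ^+ 2)%g.
- move=> v0; pose k := (kk v0).+1.
  have kv0 : `|2 ^- k *: v0| <= rho / 2.
    have := kkE v0; rewrite /k exprSr invfM -scalerA !normrZ [`|2^-1|]ger0_norm ?invr_ge0//; lra.
  have kv0' : `|2 ^- k *: v0| <= rho by lra.
  have near v : `|v - v0| <= rho / 2 -> `|2 ^- k *: v| <= rho.
    move=> vv0; have -> : 2 ^- k *: v = 2 ^- k *: v0 + 2 ^- k *: (v - v0) by rewrite -scalerDr subrKC.
    apply: le_trans (ler_normD _ _) _; rewrite [X in _ + X]normrZ ger0_norm ?invr_ge0 ?exprn_ge0//.
    have : 2 ^- k * `|v - v0| <= 1 * `|v - v0|.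
      by apply: ler_wpM2r => //; rewrite invf_le1 ?exprn_gt0// exprn_ege1//; lra.
    lra.
  have cpow (j : nat) : contN (fun g : N => (g ^+ j)%g).
    elim: j => [|j IH]; first exact: contN_cst.
    have -> : (fun g : N => (g ^+ j.+1)%g) = fun g => (g * g ^+ j)%g.
      by apply/funext => g; rewrite expgS.
    by apply: contMg IH; exact: contN_id.
  move=> A; rewrite (exE k v0 kv0') /F => nA.
  have := lc_cont lc (E_small kv0') (cpow (2 ^ k)%N _ _ nA).
  move=> /nbhs_ballP [e /= e0 eE]; apply/nbhs_ballP; exists (Num.min (rho / 2) (e / 2)) => /=.
    by rewrite lt_min !divr_gt0.
  move=> v; rewrite -ball_normE /= distrC lt_min => /andP [v1 v2].
  have kv := near v (ltW v1); rewrite /= (exE k v kv) /F; apply: (eE (E (2 ^- k *: v))).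
  rewrite -ball_normE /= distrC.
  have := E_contraction kv kv0'; rewrite -scalerBr.
  set d := 2 ^- k *: (v - v0) => h.
  have dn : `|d| <= `|v - v0|.
    rewrite /d normrZ ger0_norm ?invr_ge0 ?exprn_ge0// -[leRHS]mul1r; apply: ler_wpM2r => //.
    by rewrite invf_le1 ?exprn_gt0// exprn_ege1//; lra.
  rewrite -[X in `|X|](subrK d); apply: le_lt_trans (ler_normD _ _) _; have := normr_ge0 d; lra.
- move=> d d0; have d'0 : 0 < Num.min (d / 2) (rho / 2) by rewrite lt_min !divr_gt0.
  apply: filterS (lc_nbhs lc d'0) => _ [x /= xd <-].
  move: xd; rewrite lt_min => /andP [x1 x2].
  have [v v1 vE] := E_surjective (ltW x2); exists v; first by rewrite /=; lra.
  by rewrite exS ?vE//; lra.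
(* For [em_mul]: [y] is the product in the chart and [w] its logarithm. The chart product differs
   from the sum, and [E] from the identity, by quadratic terms, which add up to the constant
   [10 * C]. *)
- move=> u v ur vr.
  have ur' : `|u| <= rho by lra. have vr' : `|v| <= rho by lra.
  have [eu1 eu2] := E_norm ur'; have [ev1 ev2] := E_norm vr'.
  have n0 := normr_ge0 u; have n1 := normr_ge0 v.
  have z0 : `|0 : V| < r by rewrite normr0 (lc_r lc).
  have := lc_left lc (E_small ur') z0 (E_small vr').
  rewrite (lc_0x lc (E_small vr')) subr0; set y := m _ _ => ym.
  have p1 : C * `|E v| * `|E u| <= C * (17 / 16 * `|v|) * (17 / 16 * `|u|).
    by apply: ler_pM => //; [rewrite mulr_ge0|apply: ler_wpM2l].
  have cu : C * `|u| <= 1 / 128 by have := ler_wpM2l C1 ur; lra.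
  have cuv : C * `|u| * `|v| <= 1 / 128 * `|v| by apply: ler_wpM2r.
  have yr : `|y| <= 6 / 5 * (`|u| + `|v|).
    have -> : y = (y - E v - E u) + E u + E v by rewrite !subrK.
    apply: le_trans (ler_normD _ _) _; have := ler_normD (y - E v - E u) (E u); lra.
  have [|w w1 wE] := E_surjective (y := y); first lra.
  have wr : `|w| <= rho by lra.
  exists w; first by rewrite !exS// wE /y (lc_mul lc)//; apply: E_small.
  have [ew1 _] := E_norm wr; rewrite wE in ew1.
  have -> : w - (u + v) = (y - E v - E u) - (y - w) + (E v - v) + (E u - u).
    by apply/rowP => i; rewrite !mxE; ring.
  apply: le_trans (ler_normD _ _) _; have := ler_normD (y - E v - E u - (y - w)) (E v - v).
  have := ler_normB (y - E v - E u) (y - w).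
  have p2 : C * `|w| * `|w| <= C * (12 / 5 * (`|u| + `|v|)) * (12 / 5 * (`|u| + `|v|)).
    have wb : `|w| <= 12 / 5 * (`|u| + `|v|) by lra.
    by apply: ler_pM => //; [rewrite mulr_ge0|apply: ler_wpM2l].
  have p3 : 0 <= C * `|u| * `|u| by rewrite !mulr_ge0.
  have p4 : 0 <= C * `|v| * `|v| by rewrite !mulr_ge0.
  have p5 : 0 <= C * `|u| * `|v| by rewrite !mulr_ge0.
  rewrite expr2; lra.
- move=> u v w ur vr wr uvw.
  have ur' : `|u| <= rho by lra. have vr' : `|v| <= rho by lra. have wr' : `|w| <= rho by lra.
  have [_ ev2] := E_norm vr'; have [_ ew2] := E_norm wr'.
  have n1 := normr_ge0 v; have n0 := normr_ge0 w.
  have z0 : `|0 : V| < r by rewrite normr0 (lc_r lc).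
  have := lc_left lc (E_small wr') z0 (E_small vr').
  rewrite (lc_0x lc (E_small vr')) subr0; set y := m _ _ => ym.
  have cv : C * `|E v| <= 1 / 16.
    have : C * `|E v| <= C * (17 / 16 * `|v|) by apply: ler_wpM2l.
    have := ler_wpM2l C1 vr; lra.
  have p1 : C * `|E v| * `|E w| <= 1 / 16 * `|E w| by apply: ler_wpM2r.
  have yE : E u = y.
    apply: (lc_inj lc); first exact: E_small.
      apply: small; have -> : y = (y - E v - E w) + E w + E v by rewrite !subrK.
      apply: le_trans (ler_normD _ _) _; have := ler_normD (y - E v - E w) (E w); lra.
    rewrite /y (lc_mul lc); [|exact: E_small|exact: E_small].
    by rewrite -!exS// -uvw mulgVK.
  have := E_contraction ur' vr'; rewrite yE => h.
  have tri : `|u - v| <= `|y - E v - E w| + `|E w| + `|y - E v - (u - v)|.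
    have {1}-> : u - v = (y - E v - E w) + E w - (y - E v - (u - v)).
      by apply/rowP => i; rewrite !mxE; ring.
    by apply: le_trans (ler_normB _ _) _; rewrite lerD2r ler_normD.
  lra.
Qed.

End Exponential.

Lemma exists_exponential : exists ex e0 K, @exponential_map R N n ex e0 K.
Proof. by have [E [E1 E2 E3]] := local_exponential; apply: exists_exponential_aux E1 E2 E3. Qed.

End LocalExponential.

Lemma dyadic_closed {R : realType} (A : set R) d : closed A -> 0 < d ->
  (forall k m : nat, A (m%:R * (d / 2 ^+ k))) -> forall s, 0 <= s -> A s.
Proof.
move=> cA d0 Ad s s0; apply: cA => B /nbhs_ballP [e /= e0 eB].
have q01 : 0 <= (1 / 2 : R) < 1 by apply/andP; split; lra.
have [k /(_ k (leqnn k)) kE] := small_power q01 (divr_gt0 e0 (ltr_wpDl (ltW d0) d0)).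
pose t := d / 2 ^+ k; have t0 : 0 < t by rewrite divr_gt0// exprn_gt0.
have te : t < e.
  have : d * (1 / 2) ^+ k <= d * (e / (d + d)) by rewrite ler_pM2l.
  have -> : d * (e / (d + d)) = e / 2 by field; lra.
  by rewrite /t div1r exprVn; lra.
have /truncn_itv /andP [m1 m2] : 0 <= s / t by rewrite divr_ge0// ltW.
set m := Num.truncn _ in m1 m2; exists (m%:R * t); split; first exact: Ad.
apply: eB; rewrite /ball /=; move: m1 m2; rewrite ler_pdivlMr// ltr_pdivrMr// -natr1 mulrDl mul1r => m1 m2.
by rewrite ger0_norm; lra.
Qed.

Section ExponentialGroup.
Context {R : realType} {N : lieGroupType R} {n : nat}.
Local Notation V := 'rV[R]_n.
Variables (ex : V -> N) (e0 K : R).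
Hypothesis em : exponential_map ex e0 K.
Implicit Types u v w : V.

Let e00 : 0 < e0. Proof. exact: em_e0 em. Qed.
Let K0 : 0 <= K. Proof. exact: em_K em. Qed.

Lemma ex0 : ex 0 = 1%g.
Proof. by have := em_double em 0; rewrite scaler0 => E; apply: (mulgI (ex 0)); rewrite -E mulg1. Qed.

Lemma ex_inj u v : `|u| <= e0 -> `|v| <= e0 -> ex u = ex v -> u = v.
Proof.
move=> ur vr uv; have z0 : `|0 : V| <= e0 by rewrite normr0 ltW.
have := em_dist em ur vr z0; rewrite uv mulgV ex0 normr0 mulr0 => /(_ erefl).
by rewrite normr_le0 subr_eq0 => /eqP.
Qed.

Lemma ex_pow2 k v : ex (2 ^+ k *: v) = (ex v ^+ (2 ^ k))%g.
Proof.
elim: k v => [|k IH] v; first by rewrite expr0 scale1r.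
by rewrite exprS -scalerA (em_double em) IH expnS mulnC expgnA.
Qed.

Lemma ex_half k v : ex v = (ex (2 ^- k *: v) ^+ (2 ^ k))%g.
Proof. by rewrite -ex_pow2 scalerA divff ?scale1r// expf_neq0. Qed.

Let e1 := Num.min (e0 / 4) (K + 1)^-1.
Let e10 : 0 < e1.
Proof. by have := K0; have := e00; rewrite lt_min invr_gt0 => *; apply/andP; split; lra. Qed.

Lemma small_half k v d : `|v| <= d -> `|2 ^- k *: v| <= d.
Proof.
move=> vd; apply: le_trans vd; rewrite normrZ -[leRHS]mul1r; apply: ler_wpM2r => //.
by rewrite ger0_norm ?invr_ge0 ?exprn_ge0// invf_le1 ?exprn_gt0// exprn_ege1//; lra.
Qed.

(** Let [z k] be the logarithm of the product at scale [2 ^- k]. Commutation gives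
    [z k = 2 *: z k.+1], so [z 0] is [2 ^+ k *: z k]; the error of [em_mul] at that scale is of
    order [4 ^- k] and disappears in the limit. *)
Lemma ex_commute_small u v : `|u| + `|v| <= e1 ->
  (forall k, commute (ex (2 ^- k *: u)) (ex (2 ^- k *: v))) -> ex (u + v) = (ex u * ex v)%g.
Proof.
move=> uv cuv; have u0 := normr_ge0 u; have v0 := normr_ge0 v; have K1 := K0.
have [a1 a2] : e1 <= e0 / 4 /\ e1 <= (K + 1)^-1 by rewrite !ge_min !lexx orbT.
set a := `|u| + `|v| in uv.
have a0 : 0 <= a by rewrite addr_ge0.
have Ka : K * a <= 1.
  have : a * (K + 1) <= 1 by rewrite -ler_pdivlMr ?div1r//; [apply: le_trans a2|lra].
  by rewrite mulrDr mulr1 mulrC; lra.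
have ex_z k : exists z, (ex (2 ^- k *: u) * ex (2 ^- k *: v))%g = ex z /\
    `|z - 2 ^- k *: (u + v)| <= K * a ^+ 2 * (1 / 4) ^+ k.
  have [||w wE wd] := em_mul em (u := 2 ^- k *: u) (v := 2 ^- k *: v).
  - by apply: small_half; rewrite /a in uv *; lra.
  - by apply: small_half; rewrite /a in uv *; lra.
  exists w; split=> //; rewrite scalerDr; apply: le_trans wd _.
  rewrite !normrZ ger0_norm ?invr_ge0 ?exprn_ge0// -mulrDr exprMn.
  have -> : 2 ^- k ^+ 2 = (1 / 4) ^+ k :> R.
    rewrite expr2 -invfM -exprMn -exprVn; by congr (_ ^+ _); field.
  by rewrite [X in K * X]mulrC mulrA.
have /choice [z zE] := ex_z.
have z_small k : `|z k| <= e0 / 2.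
  have [_] := zE k; have := @small_half k (u + v) a (ler_normD _ _).
  have : (1 / 4 : R) ^+ k <= 1 by apply: exprn_ile1; lra.
  set t := _ ^+ k => t1 h1 h2.
  have -> : z k = (z k - 2 ^- k *: (u + v)) + 2 ^- k *: (u + v) by rewrite subrK.
  apply: le_trans (ler_normD _ _) _.
  have : K * a ^+ 2 * t <= K * a ^+ 2 * 1 by apply: ler_wpM2l => //; rewrite mulr_ge0// exprn_ge0.
  have : K * a * a <= 1 * a by apply: ler_wpM2r.
  by rewrite expr2; lra.
have z_double k : z k = 2 *: z k.+1.
  apply: ex_inj; first by have := z_small k; have := e00; lra.
    by rewrite normrZ ger0_norm//; have := z_small k.+1; lra.
  rewrite (em_double em) -(zE k).1 -(zE k.+1).1.
  have half x : 2 ^- k *: x = 2 *: (2 ^- k.+1 *: x) :> V.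
    by rewrite scalerA exprS invfM mulrA divff// mul1r.
  rewrite (half u) (half v) !(em_double em).
  rewrite -!mulgA; congr (_ * _)%g; rewrite !mulgA; congr (_ * _)%g; exact: cuv.
have zk k : z 0%N = 2 ^+ k *: z k.
  by elim: k => [|k IH]; rewrite ?expr0 ?scale1r// IH z_double scalerA -exprSr.
have -> : u + v = z 0%N.
  have q01 : 0 <= (1 / 2 : R) < 1 by apply/andP; split; lra.
  apply/esym; apply: tends_uniq (tends_cst _) _.
  apply: (geometric_tends (c := K * a ^+ 2) q01) => k; rewrite /= (zk k).
  have -> : u + v = 2 ^+ k *: (2 ^- k *: (u + v)) by rewrite scalerA divff ?scale1r// expf_neq0.
  rewrite -scalerBr normrZ ger0_norm ?exprn_ge0//.
  apply: le_trans (ler_wpM2l _ (zE k).2) _; first exact: exprn_ge0.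
  rewrite mulrCA -exprMn; have -> : 2 * (1 / 4) = 1 / 2 :> R by field.
  exact: lexx.
by have [<- _] := zE 0%N; rewrite expr0 invr1 !scale1r.
Qed.

Lemma exists_small_scale u v : exists k, `|2 ^- k *: u| + `|2 ^- k *: v| <= e1.
Proof.
have q01 : 0 <= (1 / 2 : R) < 1 by apply/andP; split; lra.
have c0 : 0 < `|u| + `|v| + 1 by rewrite ltr_wpDl// addr_ge0.
have [k /(_ k (leqnn k)) kE] := small_power q01 (divr_gt0 e10 c0); exists k.
rewrite !normrZ ger0_norm ?invr_ge0 ?exprn_ge0// -mulrDr.
move: kE; rewrite div1r exprVn ler_pdivlMr// => kE.
by have : 0 <= 2 ^- k :> R by [rewrite invr_ge0 exprn_ge0]; lra.
Qed.

Lemma ex_commute_add u v : (forall k, commute (ex (2 ^- k *: u)) (ex (2 ^- k *: v))) ->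
  ex (u + v) = (ex u * ex v)%g.
Proof.
move=> cuv; have [k ks] := exists_small_scale u v.
have comb j x : 2 ^- j *: (2 ^- k *: x) = 2 ^- (j + k) *: x :> V by rewrite scalerA -invfM -exprD.
rewrite (ex_half k) scalerDr (ex_commute_small ks); last by move=> j; rewrite !comb.
by rewrite expgMn -?ex_half//; apply: cuv.
Qed.

Lemma ex_muln m v : ex (m%:R *: v) = (ex v ^+ m)%g.
Proof.
elim: m v => [|m IH] v; first by rewrite scale0r ex0.
rewrite -natr1 addrC scalerDl scale1r ex_commute_add ?IH ?expgS// => k.
have -> : 2 ^- k *: (m%:R *: v) = m%:R *: (2 ^- k *: v) by rewrite !scalerA mulrC.
by rewrite IH; apply: commuteX.
Qed.

Lemma ex_near1 (A : set N) : nbhs (1%g : N) A -> exists2 d, 0 < d & forall v, `|v| < d -> A (ex v).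
Proof.
rewrite -ex0 => nA; have := em_cont em nA; move=> /nbhs_ballP [d /= d0 dA]; exists d => // v vd.
by apply: dA; rewrite -ball_normE /= sub0r normrN.
Qed.

(** Near 1 the inverse of [ex v] has a logarithm [w], whose halves are the logarithms of the
    inverses of the halves; the commuting case gives [ex (v + w) = 1], and injectivity [w = - v]. *)
Lemma ex_opp v : ex (- v) = (ex v)^-1%g.
Proof.
suff small_opp : exists2 d, 0 < d & forall v, `|v| <= d -> ex (- v) = (ex v)^-1%g.
  have [d d0 dE] := small_opp.
  have q01 : 0 <= (1 / 2 : R) < 1 by apply/andP; split; lra.
  have c0 : 0 < `|v| + 1 by rewrite ltr_wpDl.
  have [k /(_ k (leqnn k)) kE] := small_power q01 (divr_gt0 d0 c0).
  rewrite (ex_half k) scalerN dE ?expVgn -?ex_half//.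
  rewrite normrZ ger0_norm ?invr_ge0 ?exprn_ge0//.
  move: kE; rewrite div1r exprVn ler_pdivlMr// => kE.
  by have : 0 <= 2 ^- k :> R by [rewrite invr_ge0 exprn_ge0]; lra.
have e12 : 0 < e1 / 2 by have := e10; lra.
have [d d0 dE] : exists2 d, 0 < d & forall v, `|v| < d ->
    exists2 w, `|w| < e1 / 2 & ex w = (ex v)^-1%g.
  have : nbhs (1%g : N) ((fun x : N => x^-1%g) @^-1` [set ex v | v in [set v | `|v| < e1 / 2]]).
    by apply: (@lie_inv_continuous R N 1%g); rewrite invg1; apply: em_nbhs em _ e12.
  move=> /ex_near1 [d d0 dE].
  by exists d => // w /dE [x xe xE]; exists x.
have a1 : e1 <= e0 / 4 by rewrite ge_min lexx.
have d'0 : 0 < Num.min (d / 2) (e1 / 2) by rewrite lt_min e12 divr_gt0.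
exists (Num.min (d / 2) (e1 / 2)) => // {}v; rewrite le_min => /andP [vd ve].
have vk k : `|2 ^- k *: v| < d by apply: le_lt_trans (small_half k vd) _; lra.
have /choice [w wE] : forall k, exists w, `|w| < e1 / 2 /\ ex w = (ex (2 ^- k *: v))^-1%g.
  by move=> k; have [w w1 w2] := dE _ (vk k); exists w.
have w_double k : w k = 2 *: w k.+1.
  apply: ex_inj; first by have := (wE k).1; have := e00; lra.
    by rewrite normrZ ger0_norm//; have := (wE k.+1).1; have := e00; lra.
  rewrite (em_double em) (wE k).2 (wE k.+1).2 -invgM -(em_double em).
  by rewrite scalerA exprS invfM mulrA divff// mul1r.
have wk k : 2 ^- k *: w 0%N = w k.
  elim: k => [|k IH]; first by rewrite expr0 invr1 scale1r.
  by rewrite exprS invfM -scalerA IH w_double scalerA mulVf// scale1r.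
have w0 : ex (w 0%N) = (ex v)^-1%g by rewrite (wE 0%N).2 expr0 invr1 scale1r.
have sum1 : ex (v + w 0%N) = 1%g.
  rewrite ex_commute_small ?w0 ?mulgV//; first by have := (wE 0%N).1; lra.
  by move=> k; rewrite wk (wE k).2; apply: commuteV.
have : v + w 0%N = 0.
  apply: ex_inj; rewrite ?ex0 ?normr0 ?ltW//.
  by apply: le_lt_trans (ler_normD _ _) _; have := (wE 0%N).1; have := e00; lra.
by rewrite addrC => /eqP; rewrite addr_eq0 => /eqP <-.
Qed.

Lemma ex_line_continuous v : contN (fun s : R => ex (s *: v)).
Proof.
move=> s A nA; have := em_cont em nA; move=> /nbhs_ballP [d /= d0 dA].
have v1 : 0 < `|v| + 1 by rewrite ltr_wpDl.
apply/nbhs_ballP; exists (d / (`|v| + 1)) => /=; first exact: divr_gt0.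
move=> t; rewrite /ball /= ltr_pdivlMr// mulrDr mulr1 => st.
apply: dA; rewrite -ball_normE /= -scalerBl normrZ.
by apply: le_lt_trans st; rewrite lerDl.
Qed.

Lemma closed_eqN (Y : topologicalType) (f g : Y -> N) : contN f -> contN g ->
  closed [set y | f y = g y].
Proof.
move=> cf cg y cy; apply: (@lie_hausdorff R N) => A B nA nB.
have hA : nbhs y (f @^-1` A) := cf y _ nA; have hB : nbhs y (g @^-1` B) := cg y _ nB.
have [z [/= fgz [Az Bz]]] := cy _ (filterI hA hB).
by exists (f z); split=> //; rewrite fgz.
Qed.

(** For dyadic parameters both sides are powers of one element; closedness of commutation does the
    rest. *)
Lemma ex_line_commute v s t : commute (ex (s *: v)) (ex (t *: v)).
Proof.
have pos u : forall s t : R, 0 <= s -> 0 <= t -> commute (ex (s *: u)) (ex (t *: u)).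
  have cl (g : N) : closed [set s : R | (ex (s *: u) * g)%g = (g * ex (s *: u))%g].
    by apply: closed_eqN; apply: contMg; (try exact: contN_cst); exact: ex_line_continuous.
  move=> {}s {}t s0 t0; apply: (dyadic_closed (cl _) ltr01) => // k m.
  rewrite /=; set g := ex (m%:R * _ *: u); suff E : [set s | (ex (s *: u) * g)%g = (g * ex (s *: u))%g] t.
    by rewrite /= in E; rewrite E.
  apply: (dyadic_closed (cl g) ltr01) => // j l; rewrite /= {}/g !div1r.
  have cm (i i' : nat) : 2 ^- i *: u = (2 ^ i')%:R *: (2 ^- (i + i') *: u).
    by rewrite scalerA natrX exprD invfM mulrCA divff ?mulr1// expf_neq0.
  rewrite -!scalerA (cm k j) (cm j k) [(j + k)%N]addnC !ex_muln.
  by rewrite -!expgnA -!expgnDr [(_ * _ + _)%N]addnC.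
have posN u s' t' : 0 <= s' -> commute (ex (s' *: u)) (ex (t' *: u)).
  move=> s0; have [t0|/ltW t0] := lerP 0 t'; first exact: pos.
  have -> : t' *: u = - ((- t') *: u) by rewrite scaleNr opprK.
  by rewrite ex_opp; apply: commuteV; apply: pos; rewrite ?oppr_ge0.
have [s0|/ltW s0] := lerP 0 s; first exact: posN.
have -> : s *: v = - ((- s) *: v) by rewrite scaleNr opprK.
by rewrite ex_opp; apply/commute_sym/commuteV/commute_sym; apply: posN; rewrite oppr_ge0.
Qed.

Lemma exD s t v : ex ((s + t) *: v) = (ex (s *: v) * ex (t *: v))%g.
Proof. by rewrite scalerDl ex_commute_add// => k; rewrite !scalerA; apply: ex_line_commute. Qed.

Lemma ex_one_parameter v : one_parameter_subgroup (fun s : R => ex (s *: v)).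
Proof. by split=> [|s t]; [exact: ex_line_continuous|exact: exD]. Qed.

Lemma one_parameter_0 (X : R -> N) : one_parameter_subgroup X -> X 0 = 1%g.
Proof. by move=> [_ XD]; apply: (mulgI (X 0)); rewrite -XD addr0 mulg1. Qed.

(** The small logarithms of [X (d / 2 ^+ k)] are successive halves of one vector, so [X] and an
    exponential line agree at dyadic multiples of [d]. *)
Lemma one_parameter_ex (X : R -> N) : one_parameter_subgroup X ->
  exists w, forall s, X s = ex (s *: w).
Proof.
move=> oX; have X0 := one_parameter_0 oX; have [cX XD] := oX.
have e02 : 0 < e0 / 2 by have := e00; lra.
have [d d0 dX] : exists2 d, 0 < d & forall s, `|s| <= d -> exists2 w, `|w| < e0 / 2 & X s = ex w.
  have : nbhs (0 : R) (X @^-1` [set ex v | v in [set v | `|v| < e0 / 2]]).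
    by apply: cX; rewrite X0; apply: em_nbhs em _ e02.
  move=> /nbhs_ballP [d /= d0 dE]; exists (d / 2); first by rewrite divr_gt0.
  move=> s sd; have [|w we <-] := dE s; last by exists w.
  by rewrite /ball /= sub0r normrN; lra.
have dk k : `|d / 2 ^+ k| <= d.
  rewrite ger0_norm ?divr_ge0 ?exprn_ge0//; [|exact: ltW].
  by rewrite ler_pdivrMr ?exprn_gt0// ler_peMr ?exprn_ege1//; lra.
have /choice [y yE] : forall k, exists w, `|w| < e0 / 2 /\ X (d / 2 ^+ k) = ex w.
  by move=> k; have [w w1 w2] := dX _ (dk k); exists w.
have y_double k : y k = 2 *: y k.+1.
  apply: ex_inj; first by have := (yE k).1; have := e00; lra.
    by rewrite normrZ ger0_norm//; have := (yE k.+1).1; lra.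
  rewrite (em_double em) -(yE k).2 -(yE k.+1).2 -XD exprS invfM; congr X; field.
  by rewrite expf_neq0.
have yk k : y k = 2 ^- k *: y 0%N.
  elim: k => [|k IH]; first by rewrite expr0 invr1 scale1r.
  by rewrite exprS invfM -scalerA -IH (y_double k) scalerA mulVf// scale1r.
exists (d^-1 *: y 0%N) => s; set w := d^-1 *: _.
have cl : closed [set s | X s = ex (s *: w)] by apply: closed_eqN => //; exact: ex_line_continuous.
have base k : X (d / 2 ^+ k) = ex ((d / 2 ^+ k) *: w).
  by rewrite (yE k).2 yk /w scalerA mulrAC divff ?mul1r// gt_eqF.
have pos t : 0 <= t -> X t = ex (t *: w).
  apply: (dyadic_closed cl d0) => k m /=; set b := d / _.
  elim: m => [|m IH]; first by rewrite mul0r scale0r ex0.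
  by rewrite -natr1 mulrDl mul1r XD exD IH base.
have [|/ltW s0] := lerP 0 s; first exact: pos.
have := pos (- s); rewrite oppr_ge0 => /(_ s0) E.
apply: (mulIg (X (- s))); rewrite -XD subrr X0 E -exD subrr scale0r ex0.
by [].
Qed.

End ExponentialGroup.

(** * The adjoint action *)

Section LowerCentralSeries.
Context {G : groupType}.
Implicit Types (g x : G).

Definition commutator_gx g x := (g * x * g^-1 * x^-1)%g.

Lemma lcs_subgroup k : is_subgroup (lower_central_series k : set G).
Proof. by case: k => [|k]; [split|exact: subgroup_generatedP]. Qed.

Lemma lcs_commutator k g x : (lower_central_series k : set G) x ->
  (lower_central_series k.+1 : set G) (commutator_gx g x).
Proof.
move=> gx; have sk := lcs_subgroup k.
have -> : commutator_gx g x = ([~ x^-1, g^-1]^-1)%g.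
  by rewrite /commutator_gx commgEl !conjgE !invgM !invgK ?mulgA.
apply: (subgroupV (lcs_subgroup k.+1)).
move=> B [_]; apply; exists (x^-1%g, g^-1%g) => //; split=> //=.
exact: subgroupV.
Qed.

Lemma lcs_iterated k (gs : seq G) x : (lower_central_series k : set G) x ->
  (lower_central_series (size gs + k) : set G) (foldr commutator_gx x gs).
Proof. by move=> kx; elim: gs => //= g gs IH; apply: lcs_commutator. Qed.

End LowerCentralSeries.

Section AdjointAction.
Context {R : realType} {N : lieGroupType R} {n : nat}.
Local Notation V := 'rV[R]_n.
Variables (ex : V -> N) (e0 K : R).
Hypothesis em : exponential_map ex e0 K.
Implicit Types (u v w : V) (g h : N).

Let e00 : 0 < e0. Proof. exact: em_e0 em. Qed.
Let K0 : 0 <= K. Proof. exact: em_K em. Qed.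
Let ex0 := ex0 em.
Let ex_inj := ex_inj em.
Let ex_opp := ex_opp em.

Lemma large_nat (M : R) : exists k0, forall k, (k0 <= k)%N -> M <= k.+1%:R.
Proof.
exists (Num.truncn M) => k kM; apply: le_trans (ltW (truncnS_gt M)) _.
by rewrite ler_nat ltnS.
Qed.

(* The sequence [x k] of group elements is [ex (v / k + o(1 / k))]. *)
Definition tangent (x : nat -> N) v := exists z : nat -> V,
  (exists k0, forall k, (k0 <= k)%N -> x k = ex (z k)) /\ tends (fun k => k.+1%:R *: z k) v.

Lemma tangent_norm (z : nat -> V) v : tends (fun k => k.+1%:R *: z k) v ->
  exists k0, forall k, (k0 <= k)%N -> k.+1%:R * `|z k| <= `|v| + 1.
Proof.
move=> /(_ 1 ltr01) [k0 kE]; exists k0 => k /kE h.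
have -> : k.+1%:R * `|z k| = `|k.+1%:R *: z k| by rewrite normrZ ger0_norm.
rewrite -[_ *: _](subrK v); apply: le_trans (ler_normD _ _) _; lra.
Qed.

Lemma tangent_small (z : nat -> V) v e : 0 < e -> tends (fun k => k.+1%:R *: z k) v ->
  exists k0, forall k, (k0 <= k)%N -> `|z k| <= e.
Proof.
move=> ep /tangent_norm [k0 kE]; have [k1 kE1] := large_nat ((`|v| + 1) / e).
exists (maxn k0 k1) => k; rewrite geq_max => /andP [/kE h /kE1].
rewrite ler_pdivrMr// => h1; have kp : 0 < k.+1%:R :> R by rewrite ltr0Sn.
by rewrite -(ler_pM2l kp); apply: le_trans h _.
Qed.

Lemma tangent_exp v : tangent (fun k => ex (k.+1%:R^-1 *: v)) v.
Proof.
exists (fun k => k.+1%:R^-1 *: v); split; first by exists 0%N.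
by apply: tends_eq (tends_cst v) => k; rewrite scalerA divff ?scale1r// pnatr_eq0.
Qed.

Lemma tangent1 : tangent (fun=> 1%g) 0.
Proof.
exists (fun=> 0); split; first by exists 0%N => k _; rewrite ex0.
by apply: tends_eq (tends_cst 0) => k; rewrite scaler0.
Qed.

(** The error of [em_mul] is of order [1 / k ^ 2] and vanishes after multiplication by [k]. *)
Lemma tangentM x y u v : tangent x u -> tangent y v -> tangent (fun k => (x k * y k)%g) (u + v).
Proof.
move=> [z [[k0 kE] zu]] [z' [[k0' kE'] zv]].
have [ks ksE] := tangent_small e00 zu; have [ks' ksE'] := tangent_small e00 zv.
have [kn knE] := tangent_norm zu; have [kn' knE'] := tangent_norm zv.
have /choice [w wE] : forall k, exists w, `|z k| <= e0 -> `|z' k| <= e0 ->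
    (ex (z k) * ex (z' k))%g = ex w /\ `|w - (z k + z' k)| <= K * (`|z k| + `|z' k|) ^+ 2.
  move=> k; have [h|_] := lerP `|z k| e0; last by exists 0.
  have [h'|_] := lerP `|z' k| e0; last by exists 0.
  by have [w w1 w2] := em_mul em h h'; exists w.
exists w; split.
  exists (maxn (maxn k0 k0') (maxn ks ks')) => k; rewrite !geq_max.
  move=> /andP [/andP [/kE -> /kE' ->] /andP [/ksE h /ksE' h']].
  by have [] := wE k h h'.
move=> e ep; have e3 : 0 < e / 3 by rewrite divr_gt0.
have [ka kaE] := zu _ e3; have [kb kbE] := zv _ e3.
set M := `|u| + `|v| + 2; have M0 : 0 <= M by rewrite !addr_ge0.
have [kc kcE] := large_nat (K * M ^+ 2 / (e / 3)).
exists (maxn (maxn (maxn ka kb) (maxn ks ks')) (maxn (maxn kn kn') kc)) => k; rewrite !geq_max.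
move=> /andP [/andP [/andP [/kaE ha /kbE hb] /andP [/ksE h /ksE' h']] /andP [/andP [/knE hn /knE' hn'] /kcE]].
rewrite ler_pdivrMr// => hc.
have [_ wd] := wE k h h'; set c := k.+1%:R in ha hb hn hn' hc *.
have c0 : 0 < c by rewrite /c ltr0Sn.
have -> : c *: w k - (u + v) = c *: (w k - (z k + z' k)) + (c *: z k - u) + (c *: z' k - v).
  by apply/rowP => i; rewrite !mxE; ring.
apply: le_trans (ler_normD _ _) _; have := ler_normD (c *: (w k - (z k + z' k))) (c *: z k - u).
rewrite normrZ (gtr0_norm c0).
suff : c * `|w k - (z k + z' k)| <= e / 3 by lra.
apply: le_trans (ler_wpM2l (ltW c0) wd) _; rewrite -(ler_pM2l c0).
apply: le_trans hc; set s := `|z k| + `|z' k|.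
have -> : c * (c * (K * s ^+ 2)) = K * (c * s) ^+ 2 by ring.
have s0 : 0 <= c * s by rewrite mulr_ge0 ?addr_ge0// ltW.
have sM : c * s <= M by rewrite /s /M mulrDr; lra.
by apply: ler_wpM2l => //; rewrite !expr2; apply: ler_pM.
Qed.

Lemma tangentV x v : tangent x v -> tangent (fun k => (x k)^-1%g) (- v).
Proof.
move=> [z [[k0 kE] zv]]; exists (fun k => - z k); split; first by exists k0 => k /kE ->; rewrite ex_opp.
rewrite -scaleN1r; apply: tends_eq (tendsZ (-1) zv) => k /=.
by rewrite scalerN scaleN1r.
Qed.

Lemma tangent_uniq x u v : tangent x u -> tangent x v -> u = v.
Proof.
move=> [z [[k0 kE] zu]] [z' [[k0' kE'] zv]].
have [ks ksE] := tangent_small e00 zu; have [ks' ksE'] := tangent_small e00 zv.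
apply: tends_uniq zu _ => e /zv [k1 k1E]; exists (maxn (maxn k0 k0') (maxn (maxn ks ks') k1)) => k.
rewrite !geq_max => /andP [/andP [/kE h /kE' h'] /andP [/andP [/ksE s /ksE' s'] /k1E]].
by have -> : z k = z' k by apply: ex_inj => //; rewrite -h -h'.
Qed.

Lemma ex_line_inj u v : (forall s, ex (s *: u) = ex (s *: v)) -> u = v.
Proof.
by move=> uv; apply: tangent_uniq (tangent_exp u) _; have := tangent_exp v;
   rewrite (_ : (fun k => _) = fun k => ex (k.+1%:R^-1 *: u))//; apply/funext => k; rewrite uv.
Qed.

Lemma exists_adjoint : exists Ad : N -> V -> V,
  forall g v s, (g * ex (s *: v) * g^-1)%g = ex (s *: Ad g v).
Proof.
have H : forall gv : N * V, exists w, forall s, (gv.1 * ex (s *: gv.2) * gv.1^-1)%g = ex (s *: w).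
  move=> [g v] /=; have [|w wE] := one_parameter_ex em (X := fun s => (g * ex (s *: v) * g^-1)%g).
    split; last first.
      by move=> s t; rewrite (exD em) !mulgA mulgVK.
    have := @contMg R N _ (fun s : R => (g * ex (s *: v))%g) (fun=> g^-1%g) _ _; apply.
      by apply: contMg; [exact: contN_cst|exact: ex_line_continuous em v].
    exact: contN_cst.
  by exists w.
by have [f fE] := choice H; exists (fun g v => f (g, v)) => g v s; exact: fE (g, v) s.
Qed.

Variable Ad : N -> V -> V.
Hypothesis AdE : forall g v s, (g * ex (s *: v) * g^-1)%g = ex (s *: Ad g v).

Lemma Ad_ex g v : (g * ex v * g^-1)%g = ex (Ad g v).
Proof. by have := AdE g v 1; rewrite !scale1r. Qed.

Lemma AdZ g a v : Ad g (a *: v) = a *: Ad g v.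
Proof. by apply: ex_line_inj => s; rewrite -AdE !scalerA AdE. Qed.

Lemma AdM g h v : Ad (g * h)%g v = Ad g (Ad h v).
Proof. by apply: ex_line_inj => s; rewrite -!AdE invgM !mulgA. Qed.

(** If [Ad g v] were large, a smaller multiple of [v] would have its image on the sphere of radius
    [e'], whereas the conjugate of its exponential has a logarithm strictly inside; small logarithms
    are unique. *)
Lemma Ad_small g0 e : 0 < e -> exists2 d, 0 < d &
  \forall g \near g0, forall v, `|v| <= d -> `|Ad g v| <= e.
Proof.
move=> ep; pose e' := Num.min e e0.
have e'0 : 0 < e' by rewrite lt_min ep.
have [e'e e'e0] : e' <= e /\ e' <= e0 by rewrite !ge_min !lexx orbT.
pose F (p : N * V) := (p.1 * ex p.2 * p.1^-1)%g.
have cF : contN F.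
  have c1 : contN (fun p : N * V => p.1) by move=> p; apply: cvg_fst.
  have c2 : contN (fun p : N * V => ex p.2).
    by move=> p; apply: (@cvg_comp _ _ _ (fun p : N * V => p.2) ex); [exact: cvg_snd|exact: em_cont em p.2].
  by apply: contMg; [exact: contMg|exact: contVg].
have nF : nbhs (g0, 0 : V) (F @^-1` [set ex v | v in [set v | `|v| < e']]).
  by apply: cF; rewrite /F /= ex0 mulg1 mulgV; apply: em_nbhs em _ e'0.
move: nF => [[A B] /= [nA nB] AB].
move: nB => /nbhs_ballP [d /= d0 dB]; exists (d / 2); first by rewrite divr_gt0.
near=> g => v vd; have Ag : A g by near: g.
apply: le_trans e'e; rewrite leNgt; apply/negP => big.
have a0 : 0 < `|Ad g v| by apply: lt_trans big.
pose s := e' / `|Ad g v|.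
have s0 : 0 <= s by rewrite divr_ge0 ?ltW.
have s1 : s <= 1 by rewrite ler_pdivrMr// mul1r ltW.
have [|w we wE] := AB (g, s *: v) _.
  split=> //=; apply: dB; rewrite -ball_normE /= sub0r normrN normrZ ger0_norm//.
  have : s * `|v| <= 1 * `|v| by apply: ler_wpM2r.
  lra.
have nw : `|s *: Ad g v| = e' by rewrite normrZ ger0_norm// divfK// gt_eqF.
have wE' : w = s *: Ad g v.
  apply: ex_inj; rewrite ?nw//; first by rewrite /= in we; lra.
  by rewrite wE /F /= AdE.
by move: we; rewrite /= wE' nw ltxx.
Unshelve. all: by end_near.
Qed.

(** Additivity of [Ad g] will be deduced from this continuity, so the estimate comes from [em_dist]
    applied to small multiples [t *: v], with homogeneity alone. *)
Lemma Ad_continuous_at g v e : 0 < e -> exists2 d, 0 < d &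
  forall v', `|v' - v| <= d -> `|Ad g v' - Ad g v| <= e.
Proof.
move=> ep; have [d1 d10 /nbhs_singleton A1] := Ad_small g e00.
pose D := Num.min d1 e0; have D0 : 0 < D by rewrite lt_min d10.
have [Dd De] : D <= d1 /\ D <= e0 by rewrite !ge_min !lexx orbT.
pose t := D / (2 * (`|v| + 1)).
have v1 : 0 < `|v| + 1 by rewrite ltr_wpDl.
have t0 : 0 < t by rewrite divr_gt0// mulr_gt0.
have tE : t * (`|v| + 1) = D / 2 by rewrite /t; field; lra.
have e'0 : 0 < Num.min (t * e / 2) e0 by rewrite lt_min e00 divr_gt0// mulr_gt0.
have [d2 d20 /nbhs_singleton A2] := Ad_small g e'0.
pose d3 := Num.min d2 e0; have d30 : 0 < d3 by rewrite lt_min d20.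
have [d32 d3e] : d3 <= d2 /\ d3 <= e0 by rewrite !ge_min !lexx orbT.
have nE : nbhs (t *: v) [set x | [set ex w | w in [set w | `|w| < d3]] (ex x * (ex (t *: v))^-1)%g].
  have cm : contN (fun x : V => (ex x * (ex (t *: v))^-1)%g).
    by apply: contMg; [exact: em_cont em|exact: contN_cst].
  by apply: cm; rewrite mulgV; apply: em_nbhs em _ d30.
move: nE => /nbhs_ballP [d4 /= d40 d4E].
exists (Num.min 1 (d4 / (2 * t))) => [|v']; first by rewrite lt_min ltr01/= divr_gt0// mulr_gt0.
rewrite le_min => /andP [h1 h2].
have tv' : `|t *: v'| <= D.
  rewrite normrZ gtr0_norm// -[v'](subrK v).
  have : t * `|v' - v + v| <= t * (`|v| + 1).
    by rewrite ler_pM2l//; apply: le_trans (ler_normD _ _) _; lra.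
  lra.
have tv : `|t *: v| <= D.
  rewrite normrZ gtr0_norm//; have := ltW t0; move: tE; rewrite mulrDr mulr1; lra.
have [|w we wE] := d4E (t *: v').
  rewrite -ball_normE /= -scalerBr normrZ gtr0_norm// distrC.
  have : t * `|v' - v| <= t * (d4 / (2 * t)) by rewrite ler_pM2l.
  have -> : t * (d4 / (2 * t)) = d4 / 2 by field; lra.
  lra.
rewrite /= in we.
have H : (ex (Ad g (t *: v')) * (ex (Ad g (t *: v)))^-1)%g = ex (Ad g w).
  by rewrite -!Ad_ex wE !invgM invgK !mulgA mulgVK.
have wr : `|w| <= d2 by lra.
have := A2 w wr; rewrite le_min => /andP [w1 w2].
have := em_dist em (A1 _ (le_trans tv' Dd)) (A1 _ (le_trans tv Dd)) w2 H.
rewrite !AdZ -scalerBr normrZ gtr0_norm// => h.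
rewrite -(ler_pM2l t0); lra.
Qed.

Lemma tangent_conj g x v : tangent x v -> tangent (fun k => (g * x k * g^-1)%g) (Ad g v).
Proof.
move=> [z [[k0 kE] zv]]; exists (fun k => Ad g (z k)); split.
  by exists k0 => k /kE ->; rewrite Ad_ex.
move=> e /(Ad_continuous_at g v) [d d0 dE]; have [k1 k1E] := zv d d0.
by exists k1 => k /k1E /dE; rewrite AdZ.
Qed.

(** The tangent of the conjugate of [ex (u / k) ex (v / k)] is computed in two ways. *)
Lemma AdD g u v : Ad g (u + v) = Ad g u + Ad g v.
Proof.
have t1 := tangent_conj g (tangentM (tangent_exp u) (tangent_exp v)).
have t2 := tangentM (tangent_conj g (tangent_exp u)) (tangent_conj g (tangent_exp v)).
apply: tangent_uniq t1 _; move: t2; congr tangent; apply/funext => k.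
by rewrite !mulgA mulgVK.
Qed.

Lemma Ad_tends g0 v e : 0 < e -> \forall g \near g0, `|Ad g v - Ad g0 v| <= e.
Proof.
move=> ep; have [d1 d10 nA] := Ad_small g0 e00.
have v1 : 0 < `|v| + 1 by rewrite ltr_wpDl.
pose t := d1 / (`|v| + 1); have t0 : 0 < t by rewrite divr_gt0.
have tv : `|t *: v| <= d1.
  rewrite normrZ gtr0_norm// /t mulrAC ler_pdivrMr// ler_pM2l//; lra.
have e'0 : 0 < Num.min (t * e / 2) e0 by rewrite lt_min e00 divr_gt0// mulr_gt0.
have nB : nbhs g0 [set g | [set ex w | w in [set w | `|w| < Num.min (t * e / 2) e0]]
    (g * ex (t *: v) * g^-1 * (g0 * ex (t *: v) * g0^-1)^-1)%g].
  have cm : contN (fun g : N => (g * ex (t *: v) * g^-1 * (g0 * ex (t *: v) * g0^-1)^-1)%g).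
    apply: contMg; last exact: contN_cst.
    apply: contMg; last by apply: contVg; exact: contN_id.
    by apply: contMg; [exact: contN_id|exact: contN_cst].
  by apply: cm; rewrite mulgV; apply: em_nbhs em _ e'0.
have nA0 := nbhs_singleton nA.
near=> g.
have A1 : forall v, `|v| <= d1 -> `|Ad g v| <= e0 by near: g.
have : [set ex w | w in [set w | `|w| < Num.min (t * e / 2) e0]]
    (g * ex (t *: v) * g^-1 * (g0 * ex (t *: v) * g0^-1)^-1)%g by near: g.
rewrite !Ad_ex => -[w]; rewrite /= lt_min => /andP [w1 w2] wE.
have := em_dist em (A1 _ tv) (nA0 _ tv) (ltW w2) (esym wE).
rewrite !AdZ -scalerBr normrZ gtr0_norm// => h.
rewrite -(ler_pM2l t0); lra.
Unshelve. all: by end_near.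
Qed.

Lemma Ad_coord_continuous v i : contR (fun g : N => Ad g v 0 i).
Proof.
move=> g0; apply/cvgrPdist_le => e ep; near=> g.
have : `|Ad g v - Ad g0 v| <= e by near: g; exact: Ad_tends.
by rewrite distrC; apply: le_trans; have := rV_coord_le (Ad g0 v - Ad g v) i; rewrite !mxE distrC.
Unshelve. all: by end_near.
Qed.

Definition Ad_sub1 g v := Ad g v - v.

Lemma tangent_commutators gs x v : tangent x v ->
  tangent (fun k => foldr commutator_gx (x k) gs) (foldr Ad_sub1 v gs).
Proof.
move=> xv; elim: gs => //= g gs IH.
exact: tangentM (tangent_conj g IH) (tangentV IH).
Qed.

(** The iterated commutators with [ex (v / k)] are trivial, and their tangent is the iterate of
    [Ad - 1] at [v]. *)
Lemma Ad_unipotent c : lower_central_series c = [set (1%g : N)] ->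
  forall gs v, size gs = c -> foldr Ad_sub1 v gs = 0.
Proof.
move=> Nc gs v sc; apply: tangent_uniq (tangent_commutators gs (tangent_exp v)) _.
have -> : (fun k => foldr commutator_gx (ex (k.+1%:R^-1 *: v)) gs) = fun=> 1%g; last exact: tangent1.
apply/funext => k; have := @lcs_iterated N 0 gs (ex (k.+1%:R^-1 *: v)) I.
by rewrite addn0 sc Nc.
Qed.

(* The additive function is a coordinate of [Ad s w - w], with [w] fixed modulo
   the fixed vectors. *)
Lemma adjoint_additive (A : set N) : nilpotent_group N -> is_subgroup A ->
  (forall s v, A s -> Ad s v = v) \/
  exists f : N -> R, [/\ contR f, additive_on A f & exists2 s, A s & f s != 0].
Proof.
move=> [c Nc] sA.
have [triv|nt] := pselect (forall s v, A s -> Ad s v = v); first by left.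
right; have [s0 [v0 [As0 sv0]]] : exists s v, A s /\ Ad_sub1 s v <> 0.
  apply: contrapT => H; apply: nt => s v As; apply: contrapT => sv; apply: H; exists s, v; split=> //.
  by move=> /eqP; rewrite subr_eq0 => /eqP.
(* [w] is replaced by its images under [Ad t - 1] as long as two successive applications can be
   non-zero; unipotence bounds the number of replacements. *)
have gen m : forall w, (forall gs, (forall g, g \in gs -> A g) -> size gs = m -> foldr Ad_sub1 w gs = 0) ->
    (exists2 s, A s & Ad_sub1 s w <> 0) ->
    exists2 w', (forall s t, A s -> A t -> Ad_sub1 s (Ad_sub1 t w') = 0) &
      exists2 s, A s & Ad_sub1 s w' <> 0.
  elim: m => [|m IH] w wm [s As sw].
    have w0 : w = 0 by exact: (wm [::]).
    by exfalso; apply: sw; rewrite w0 /Ad_sub1 -(scale0r (0 : V)) AdZ !scale0r subrr.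
  have [all0|nall] := pselect (forall s t, A s -> A t -> Ad_sub1 s (Ad_sub1 t w) = 0).
    by exists w => //; exists s.
  have [s1 [t1 [As1 [At1 st]]]] : exists s t, A s /\ A t /\ Ad_sub1 s (Ad_sub1 t w) <> 0.
    apply: contrapT => H; apply: nall => s' t' As' At'; apply: contrapT => st; apply: H.
    by exists s', t'.
  apply: (IH (Ad_sub1 t1 w)); last by exists s1.
  move=> gs gsA sz; have := wm (rcons gs t1); rewrite foldr_rcons; apply.
    by move=> g; rewrite mem_rcons inE => /orP [/eqP ->|/gsA].
  by rewrite size_rcons sz.
have [||w w2 [s1 As1 s1w]] := gen c v0.
- by move=> gs _ sz; apply: Ad_unipotent Nc _ _ sz.
- by exists s0.
have [i iw] : exists i, Ad_sub1 s1 w 0 i != 0.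
  apply: contrapT => H; apply: s1w; apply/rowP => i; rewrite [RHS]mxE; apply: contrapT => iw.
  by apply: H; exists i; apply/eqP.
exists (fun s => Ad_sub1 s w 0 i); split; last by exists s1.
  have -> : (fun s => Ad_sub1 s w 0 i) = fun s => Ad s w 0 i - w 0 i.
    by apply/funext => s; rewrite !mxE.
  by move=> s; apply: cvgB; [exact: Ad_coord_continuous|exact: cvg_cst].
move=> s t As At; have := w2 s t As At; rewrite {1}/Ad_sub1 => /eqP.
rewrite subr_eq0 => /eqP st.
have -> : Ad_sub1 (s * t)%g w = Ad s (Ad_sub1 t w) + Ad_sub1 s w.
  by rewrite /Ad_sub1 AdM AdD -[in Ad s (- w)]scaleN1r AdZ scaleN1r addrA subrK.
by rewrite st mxE addrC.
Qed.

End AdjointAction.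

(** * Additive functions on retracts *)

Section Retracts.
Context {R : realType} {N : lieGroupType R} {n : nat}.
Local Notation V := 'rV[R]_n.
Variables (ex : V -> N) (e0 K : R).
Hypothesis em : exponential_map ex e0 K.
Implicit Types (u v w : V) (T : set N).

Let e00 : 0 < e0. Proof. exact: em_e0 em. Qed.

(** Stands for a closed connected Lie subgroup. The retraction transfers connectedness and
    contractions of loops from [N] to [T]; [rs_local] says that small logarithms of elements of [T]
    span lines inside [T]. *)
Record retract_subgroup T (r : N -> N) : Prop := RetractSubgroup {
  rs_subgroup : is_subgroup T;
  rs_cont : contN r;
  rs_in : forall x, T (r x);
  rs_id : forall x, T x -> r x = x;
  rs_local : exists2 e, 0 < e & forall v, `|v| < e -> T (ex v) -> forall s, T (ex (s *: v))
}.

Lemma retract_near T r d : retract_subgroup T r -> 0 < d -> forall x,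
  \forall y \near x, exists v, [/\ `|v| < d, forall s, T (ex (s *: v)) & r y = (r x * ex v)%g].
Proof.
move=> rT d0 x; have [e ep eE] := rs_local rT.
have dd : 0 < Num.min d e by rewrite lt_min d0.
have c : contN (fun y => ((r x)^-1 * r y)%g) by apply: contMg; [exact: contN_cst|exact: rs_cont rT].
have nx : nbhs x [set y | [set ex v | v in [set v | `|v| < Num.min d e]] ((r x)^-1 * r y)%g].
  by apply: c; rewrite mulVg; apply: em_nbhs em _ dd.
apply: filterS nx => y [v /=]; rewrite lt_min => /andP [vd ve] vE; exists v; split=> //.
  apply: eE => //; rewrite vE; have sT := rs_subgroup rT.
  by apply: subgroupM => //; [apply: subgroupV => //|]; apply: rs_in rT _.
by rewrite vE mulVKg.
Qed.

Lemma retract_ind T r (P : N -> Prop) : connected [set: N] -> retract_subgroup T r -> P 1%g ->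
  (exists2 d, 0 < d & forall x v, T x -> (forall s, T (ex (s *: v))) -> `|v| < d ->
     (P x <-> P (x * ex v)%g)) ->
  forall x, T x -> P x.
Proof.
move=> cN rT P1 [d d0 dE] x Tx.
have nP y : \forall z \near y, P (r y) <-> P (r z).
  apply: filterS (retract_near rT d0 y) => z [v [vd vT ->]].
  by apply: dE => //; apply: rs_in rT _.
have opn (Q : set N) : (forall y z, (P (r y) <-> P (r z)) -> Q y -> Q z) -> open Q.
  move=> QP; rewrite openE => y Qy; apply: filterS (nP y) => z yz; exact: QP yz Qy.
have AT : [set y | P (r y)] = [set: N].
  apply: cN.
  - by exists 1%g; rewrite /= (rs_id rT)//; apply: subgroup1 (rs_subgroup rT).
  - exists [set y | P (r y)]; last by rewrite setTI.
    by apply: opn => y z /= yz; rewrite yz.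
  - exists [set y | P (r y)]; last by rewrite setTI.
    rewrite -openC; apply: opn => y z /= yz; by rewrite yz.
have : [set y | P (r y)] x by rewrite AT.
by rewrite /= (rs_id rT).
Qed.

Lemma retract_generated T r : connected [set: N] -> retract_subgroup T r ->
  forall G : set N, is_subgroup G -> (forall v, (forall s, T (ex (s *: v))) -> G (ex v)) -> T `<=` G.
Proof.
move=> cN rT G sG Gex; apply: (retract_ind cN rT); first exact: subgroup1 sG.
exists 1 => // x v Tx vT _; split=> [Gx|Gxv]; first by apply: subgroupM => //; apply: Gex.
rewrite -(mulgK (ex v) x); apply: subgroupM => //; apply: subgroupV => //; exact: Gex.
Qed.

Definition clamp (t : R) : R := if t <= 0 then 0 else if 1 <= t then 1 else t.

Lemma clamp_lipschitz s t : `|clamp s - clamp t| <= `|s - t|.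
Proof.
rewrite /clamp; rewrite ler_norml.
have h1 := ler_norm (s - t); have h2 := ler_norm (t - s); have h3 := normr_ge0 (s - t).
rewrite distrC in h2.
by case: (lerP s 0) => s0; case: (lerP t 0) => t0; case: (lerP 1 s) => s1; case: (lerP 1 t) => t1;
  apply/andP; split; lra.
Qed.

Lemma clamp_in t : `[0, 1]%classic (clamp t).
Proof.
rewrite /clamp /= in_itv /=; case: (lerP t 0) => t0; first by rewrite lexx ler01.
by case: (lerP 1 t) => t1; rewrite ?ler01 ?lexx// !ltW.
Qed.

Lemma clamp_id t : 0 <= t <= 1 -> clamp t = t.
Proof.
move=> /andP [t0 t1]; rewrite /clamp; case: (lerP t 0) => [t0'|_]; first by apply/eqP; rewrite eq_le t0 t0'.
by case: (lerP 1 t) => // t1'; apply/eqP; rewrite eq_le t1 t1'.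
Qed.

Lemma uniform_square (G : R * R -> N) (U : set N) : contN G -> nbhs (1%g : N) U ->
  exists M0 : nat, forall M p q, (M0 <= M)%N -> 0 <= p.1 <= 1 -> 0 <= p.2 <= 1 ->
    `|p.1 - q.1| <= M.+1%:R^-1 -> `|p.2 - q.2| <= M.+1%:R^-1 -> U ((G p)^-1 * G q)%g.
Proof.
move=> cG nU; pose I := `[0, 1]%classic : set R.
have cI : compact (I `*` I) by apply: compact_setX; exact: segment_compact.
pose P (M : nat) (p : R * R) := forall q : R * R,
    `|p.1 - q.1| <= M.+1%:R^-1 -> `|p.2 - q.2| <= M.+1%:R^-1 -> U ((G p)^-1 * G q)%g.
have H : \forall M \near \oo, (I `*` I) `<=` P M.
  have NC := (compact_near_coveringP (I `*` I)).1 cI.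
  suff nearP : forall x, (I `*` I) x -> \forall x' \near x & M \near \oo, P M x'.
    exact: (NC nat \oo P _ nearP).
  move=> x _.
  have cF : contN (fun pq : (R * R) * (R * R) => ((G pq.1)^-1 * G pq.2)%g).
    apply: contMg; first apply: contVg.
      by move=> p; apply: (@cvg_comp _ _ _ (fun p : (R * R) * (R * R) => p.1) G); [exact: cvg_fst|exact: cG].
    by move=> p; apply: (@cvg_comp _ _ _ (fun p : (R * R) * (R * R) => p.2) G); [exact: cvg_snd|exact: cG].
  have /nbhs_ballP [d /= d0 dE] : nbhs (x, x) ((fun pq : (R * R) * (R * R) => ((G pq.1)^-1 * G pq.2)%g) @^-1` U).
    by apply: cF; rewrite /= mulVg.
  have [k kE] := large_nat (2 / d).
  exists ([set y | ball x (d / 2) y], [set M | (k <= M)%N]).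
    split=> /=; first by apply: nbhsx_ballx; rewrite divr_gt0.
    by exists k.
  move=> [y M] /= [[y1 y2] /kE kM] q q1 q2.
  have Md : M.+1%:R^-1 <= d / 2.
    by rewrite -[leRHS]invrK lef_pV2 ?posrE ?invr_gt0 ?divr_gt0//; rewrite invf_div.
  have yx1 : `|x.1 - y.1| < d / 2 := y1.
  have yx2 : `|x.2 - y.2| < d / 2 := y2.
  apply: (dE (y, q)); split; split=> /=; rewrite /ball /=.
  - by lra.
  - by lra.
  - apply: le_lt_trans (ler_distD y.1 _ _) _; rewrite [d]splitr; apply: ltr_leD yx1 _; exact: le_trans q1 Md.
  - apply: le_lt_trans (ler_distD y.2 _ _) _; rewrite [d]splitr; apply: ltr_leD yx2 _; exact: le_trans q2 Md.
case: H => k _ kE; exists k => M p q kM p1 p2 q1 q2.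
by apply: (kE M kM p) => //; split; rewrite /I /= in_itv.
Qed.

Section AbelianRetract.
Variables (T : set N) (r : N -> N).
Hypothesis rT : retract_subgroup T r.
Hypothesis T_abelian : forall x y, T x -> T y -> commute x y.

Definition lie_line v := forall s : R, T (ex (s *: v)).

Let sT : is_subgroup T. Proof. exact: rs_subgroup rT. Qed.

Lemma lie_line_ex v : lie_line v -> T (ex v).
Proof. by move=> /(_ 1); rewrite scale1r. Qed.

Lemma abelian_exD u v : lie_line u -> lie_line v -> ex (u + v) = (ex u * ex v)%g.
Proof. by move=> Tu Tv; apply: (ex_commute_add em) => k; apply: T_abelian. Qed.

Lemma lie_lineZ a v : lie_line v -> lie_line (a *: v).
Proof. by move=> Tv s; rewrite scalerA. Qed.

Lemma lie_lineD u v : lie_line u -> lie_line v -> lie_line (u + v).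
Proof.
move=> Tu Tv s; rewrite scalerDr abelian_exD; [|exact: lie_lineZ|exact: lie_lineZ].
by apply: subgroupM.
Qed.

Lemma lie_lineN v : lie_line v -> lie_line (- v).
Proof. by move=> Tv; rewrite -scaleN1r; apply: lie_lineZ. Qed.

Lemma lie_line0 : lie_line 0.
Proof. by move=> s; rewrite scaler0 (ex0 em); apply: subgroup1. Qed.

Lemma abelian_ex_surjective : connected [set: N] ->
  forall x, T x -> exists2 v, lie_line v & x = ex v.
Proof.
move=> cN; apply: (retract_ind cN rT); first by exists 0; [exact: lie_line0|rewrite (ex0 em)].
exists 1 => // x v Tx Tv _; split=> [[u Tu ->]|[u Tu uE]].
  by exists (u + v); [exact: lie_lineD|rewrite abelian_exD].
exists (u - v); first by apply: lie_lineD => //; apply: lie_lineN.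
by rewrite abelian_exD// -?uE ?(ex_opp em) ?mulgK//; apply: lie_lineN.
Qed.

(* A loop [ex (t v)] bounds a disc, and along a fine grid on the disc the
   logarithms of the increments have the same sum on all the rows. *)
Lemma abelian_ex_kernel : simply_connected R N -> forall v, lie_line v -> ex v = 1%g -> v = 0.
Proof.
move=> sc v Tv v1; pose I := `[0, 1]%classic : set R.
have [] := sc (fun t => ex (t *: v)).
- by apply: continuous_subspaceT; exact: ex_line_continuous em v.
- by rewrite scale0r scale1r v1 (ex0 em).
rewrite scale0r (ex0 em) => H [cH H0 H1 Hl Hr].
(* The contraction of the loop may leave [T]; the retraction brings it back, and [clamp] extends it
   continuously to the plane. *)
pose G p := r (H (clamp p.1, clamp p.2)).
have cG : contN G.
  apply: contNN (rs_cont rT) => p B nB.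
  have Ip : (I `*` I) (clamp p.1, clamp p.2) by split; apply: clamp_in.
  have nH : nbhs (clamp p.1, clamp p.2) [set y | (I `*` I) y -> B (H y)].
    exact: (subspace_continuousP (I `*` I) H).1 cH _ Ip B nB.
  move: nH => /nbhs_ballP [d /= d0 dE].
  apply/nbhs_ballP; exists d => //= q [q1 q2]; apply: dE; last by split; apply: clamp_in.
  by split; apply: le_lt_trans (clamp_lipschitz _ _) _; [exact: q1|exact: q2].
have [e ep eE] := rs_local rT.
(* With increments below [e0 / 2], the sum of two of them stays where [ex] is injective. *)
pose e' := Num.min (e0 / 2) e; have e'0 : 0 < e' by rewrite lt_min ep divr_gt0.
have [M0 M0E] := uniform_square cG (em_nbhs em e'0).
have [k kE] := large_nat (`|v| / e').
pose M := maxn M0 k; pose m := M.+1; have m0 : 0 < m%:R :> R by rewrite ltr0Sn.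
pose g (i j : nat) := G (i%:R / m%:R, j%:R / m%:R).
have gT i j : T (g i j) by exact: rs_in rT _.
have in01 (i : nat) : (i <= m)%N -> 0 <= (i%:R / m%:R : R) <= 1.
  by move=> im; rewrite divr_ge0//= ler_pdivrMr// mul1r ler_nat.
have inc (i j i' j' : nat) : (i <= m)%N -> (j <= m)%N -> (i' - i <= 1)%N -> (j' - j <= 1)%N ->
    (i <= i')%N -> (j <= j')%N ->
    exists w, [/\ lie_line w, `|w| < e' & (g i' j' = g i j * ex w)%g].
  move=> im jm i1 j1 ii jj.
  have close (a b : nat) : (a <= b)%N -> (b - a <= 1)%N -> `|a%:R / m%:R - b%:R / m%:R| <= M.+1%:R^-1 :> R.
    move=> ab ba; rewrite distrC -mulrBl -natrB// normrM ger0_norm// ger0_norm ?invr_ge0//.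
    by rewrite -[leRHS]mul1r; apply: ler_wpM2r; rewrite ?invr_ge0// -[leRHS]/(1%:R) ler_nat.
  have [w we wE] := M0E M (i%:R / m%:R, j%:R / m%:R) (i'%:R / m%:R, j'%:R / m%:R)
    (leq_maxl _ _) (in01 i im) (in01 j jm) (close _ _ ii i1) (close _ _ jj j1).
  move: we; rewrite /= lt_min => /andP [w1 w2]; exists w; split.
  - apply: eE => //; rewrite wE.
    by apply: subgroupM; [exact: sT|apply: subgroupV; [exact: sT|exact: gT]|exact: gT].
  - by rewrite lt_min w1.
  - by rewrite wE mulVKg.
have e'e : e' <= e0 / 2 by rewrite ge_min lexx.
have /choice [dh dhE] : forall ij : nat * nat, exists w, (ij.1 <= m)%N -> (ij.2 < m)%N ->
    [/\ lie_line w, `|w| < e' & (g ij.1 ij.2.+1 = g ij.1 ij.2 * ex w)%g].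
  move=> [i j] /=; have [im|_] := leqP i m; last by exists 0.
  have [jm|_] := ltnP j m; last by exists 0.
  have [||||||w wE] := inc i j i j.+1 => //; [exact: ltnW|by rewrite subnn|by rewrite subSn ?subnn|].
  by exists w.
have /choice [dv dvE] : forall ij : nat * nat, exists w, (ij.1 < m)%N -> (ij.2 <= m)%N ->
    [/\ lie_line w, `|w| < e' & (g ij.1.+1 ij.2 = g ij.1 ij.2 * ex w)%g].
  move=> [i j] /=; have [im|_] := ltnP i m; last by exists 0.
  have [jm|_] := leqP j m; last by exists 0.
  have [||||||w wE] := inc i j i.+1 j => //; [exact: ltnW|by rewrite subSn ?subnn|by rewrite subnn|].
  by exists w.
(* The two paths around a cell have the same product; [T] is abelian and the sums are small, so the
   logarithms agree as well. *)
have cell i j : (i < m)%N -> (j < m)%N -> dh (i, j) + dv (i, j.+1) = dv (i, j) + dh (i.+1, j).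
  move=> im jm.
  have [a1 a2 a3] := dhE (i, j) (ltnW im) jm; have [b1 b2 b3] := dvE (i, j.+1) im jm.
  have [c1 c2 c3] := dvE (i, j) im (ltnW jm); have [d1 d2 d3] := dhE (i.+1, j) im jm.
  rewrite /= in a3 b3 c3 d3.
  apply: (ex_inj em).
  - by apply: le_trans (ler_normD _ _) _; lra.
  - by apply: le_trans (ler_normD _ _) _; lra.
  - by rewrite !abelian_exD//; apply: (mulgI (g i j)); rewrite !mulgA -a3 -b3 -c3 -d3.
have zero_small w : `|w| < e' -> ex w = 1%g -> w = 0.
  move=> we w1; apply: (ex_inj em); rewrite ?(ex0 em) ?normr0 ?ltW//.
  by apply: lt_le_trans we _; lra.
have half0 : clamp 0 = 0 by rewrite clamp_id// lexx ler01.
have half1 : clamp 1 = 1 by rewrite clamp_id// lexx ler01.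
have mm : m%:R / m%:R = 1 :> R by rewrite divff// gt_eqF.
have r1 : r 1%g = 1%g by rewrite (rs_id rT)//; apply: subgroup1.
have Icl (i : nat) : I (clamp (i%:R / m%:R)) by exact: clamp_in.
have gl i : g i 0%N = 1%g by rewrite /g /G /= mul0r half0 Hl ?r1//; exact: Icl.
have gr i : g i m = 1%g by rewrite /g /G /= mm half1 Hr ?r1//; exact: Icl.
have gt j : g m j = 1%g by rewrite /g /G /= mm half1 H1 ?r1//; exact: Icl.
(* The vertical increments telescope along the row, and they are zero at its ends because the sides
   of the square are mapped to 1. *)
have row i : (i <= m)%N -> \sum_(j < m) dh (i, j : nat) = \sum_(j < m) dh (0%N, j : nat).
  elim: i => // i IH im; rewrite -IH; last exact: ltnW.
  have dv0 : dv (i, 0%N) = 0.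
    by have [_ a2 /= a3] := dvE (i, 0%N) im (leq0n m); apply: zero_small => //; move: a3; rewrite !gl mul1g.
  have dvm : dv (i, m) = 0.
    by have [_ a2 /= a3] := dvE (i, m) im (leqnn m); apply: zero_small => //; move: a3; rewrite !gr mul1g.
  have tel : \sum_(j < m) (dv (i, j.+1) - dv (i, j : nat)) = 0.
    by rewrite -(big_mkord predT (fun j => dv (i, j.+1) - dv (i, j))) telescope_sumr// dv0 dvm subr0.
  have E : \sum_(j < m) dh (i, j : nat) + \sum_(j < m) (dv (i, j.+1) - dv (i, j : nat)) =
      \sum_(j < m) dh (i.+1, j : nat).
    by rewrite -big_split /=; apply: eq_bigr => j _; rewrite addrA cell// addrC addKr.
  by rewrite -E tel addr0.
have top : \sum_(j < m) dh (m, j : nat) = 0.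
  apply: big1 => j _; have [_ a2 /= a3] := dhE (m, j : nat) (leqnn m) (ltn_ord j).
  by apply: zero_small => //; move: a3; rewrite !gt mul1g.
have bot : \sum_(j < m) dh (0%N, j : nat) = v.
  have -> : v = \sum_(j < m) (m%:R^-1 *: v).
    by rewrite sumr_const card_ord -scaler_nat scalerA divff ?scale1r// gt_eqF.
  apply: eq_bigr => j _; have [a1 a2 /= a3] := dhE (0%N, j : nat) (leq0n m) (ltn_ord j).
  have g0 (i : nat) : (i <= m)%N -> g 0%N i = ex ((i%:R / m%:R) *: v).
    move=> im; rewrite /g /G /= mul0r half0 H0; last exact: Icl.
    by rewrite clamp_id ?in01// (rs_id rT).
  apply: (ex_inj em).
  - by apply: ltW; apply: lt_le_trans a2 _; lra.
  - rewrite normrZ ger0_norm ?invr_ge0//.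
    have := kE M (leq_maxr _ _); rewrite ler_pdivrMr// -/m => h.
    rewrite mulrC ler_pdivrMr//; apply: le_trans h _; rewrite mulrC ler_pM2r//; lra.
  - move: a3; rewrite !g0//; last exact: ltnW.
    rewrite -natr1 mulrDl mul1r (exD em) => /mulgI; by [].
by rewrite -bot -(row m)// top.
Qed.

Lemma abelian_additive : connected [set: N] -> simply_connected R N ->
  (exists2 x, T x & x <> 1%g) ->
  exists f : N -> R, [/\ contR f, additive_on T f & exists2 s, T s & f s != 0].
Proof.
move=> cN sc [x0 Tx0 x01].
have /choice [L LE] : forall x, exists v, T x -> lie_line v /\ x = ex v.
  move=> x; have [Tx|nTx] := pselect (T x); last by exists 0.
  by have [v v1 v2] := abelian_ex_surjective cN Tx; exists v.
have Luniq x v : T x -> lie_line v -> x = ex v -> L x = v.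
  move=> Tx Tv xv; have [TL LE'] := LE x Tx; apply/eqP; rewrite -subr_eq0; apply/eqP.
  apply: (abelian_ex_kernel sc); first by apply: lie_lineD => //; apply: lie_lineN.
  by rewrite abelian_exD -?LE' ?(ex_opp em) -?xv ?mulgV//; apply: lie_lineN.
have LM x y : T x -> T y -> L (x * y)%g = L x + L y.
  move=> Tx Ty; have [Lx xE] := LE x Tx; have [Ly yE] := LE y Ty.
  apply: Luniq; [exact: subgroupM|exact: lie_lineD|].
  by rewrite abelian_exD// -xE -yE.
have [i iE] : exists i, L x0 0 i != 0.
  apply: contrapT => H; apply: x01; have [_ ->] := LE x0 Tx0.
  have -> : L x0 = 0; last exact: ex0 em.
  by apply/rowP => i; rewrite [RHS]mxE; apply: contrapT => iw; apply: H; exists i; apply/eqP.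
exists (fun x => L (r x) 0 i); split.
- move=> x; apply/cvgrPdist_lt => e ep; apply: filterS (retract_near rT ep x) => y [v [vd vT yE]].
  have TrX := rs_in rT x.
  have -> : L (r y) = L (r x) + v.
    by rewrite yE LM//; [congr (_ + _); apply: Luniq => //|]; apply: lie_line_ex.
  rewrite mxE opprD addrA subrr sub0r normrN; apply: le_lt_trans vd; exact: rV_coord_le.
- move=> x y Tx Ty; rewrite !(rs_id rT)//; last exact: subgroupM.
  by rewrite LM// mxE.
- by exists x0 => //; rewrite (rs_id rT).
Qed.

End AbelianRetract.

Lemma exists_additive T r : connected [set: N] -> simply_connected R N -> nilpotent_group N ->
  retract_subgroup T r -> (exists2 x, T x & x <> 1%g) ->
  exists f : N -> R, [/\ contR f, additive_on T f & exists2 s, T s & f s != 0].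
Proof.
move=> cN sc nil rT nT; have [Ad AdE] := exists_adjoint em.
have sT := rs_subgroup rT.
have [triv|//] := adjoint_additive em AdE nil sT.
(* With trivial adjoint action the elements of [T] commute with every [ex v], and the exponentials
   of the lines in [T] generate [T]. *)
apply: (abelian_additive rT _ cN sc nT) => x y Tx Ty.
suff : T `<=` [set y | (x * y)%g = (y * x)%g] by apply.
apply: (retract_generated cN rT).
  split; first by rewrite /= mulg1 mul1g.
  by split=> [a b ax bx|a ax]; [exact: commuteM|exact: commuteV].
move=> v vT /=; have := Ad_ex AdE x v; rewrite triv// => E.
by apply: (mulIg x^-1%g); rewrite E mulgK.
Qed.

End Retracts.

(** * Existence of Mal'cev coordinates *)

Lemma last_flag (nb : pred nat) i : nb 0%N ->
  exists s, [/\ (s <= i)%N, nb s & forall l, (s < l <= i)%N -> ~~ nb l].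
Proof.
move=> nb0; elim: i => [|i [s [si ns sl]]].
  by exists 0%N; split=> // l; case: l.
have [nbi|nbi] := boolP (nb i.+1); first by exists i.+1; split=> // l /andP [h1 h2]; lia.
exists s; split=> //; first exact: leqW.
move=> l /andP [h1]; rewrite leq_eqVlt => /orP [/eqP -> //|h2]; apply: sl; by rewrite h1 -ltnS.
Qed.

Lemma next_flag (nb : pred nat) i m : (i < m)%N -> nb m ->
  exists s, [/\ (i < s <= m)%N, nb s & forall l, (i < l < s)%N -> ~~ nb l].
Proof.
move=> im nbm; have exs : exists s, (i < s)%N && nb s by exists m; rewrite im.
case: (ex_minnP exs) => s /andP [is_ ns] smin; exists s; split=> //.
  by rewrite is_ smin// im.
move=> l /andP [il ls]; apply/negP => nl; have := smin l; rewrite il nl => /(_ isT); lia.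
Qed.

Section MalcevChainExistence.
Context {R : realType} {N : lieGroupType R} {n : nat}.
Local Notation V := 'rV[R]_n.
Variables (ex : V -> N) (e0 K : R).
Hypothesis em : exponential_map ex e0 K.
Hypotheses (cN : connected [set: N]) (sc : simply_connected R N) (nil : nilpotent_group N).
Implicit Types (u v w : V) (S T A : set N).

Let e00 : 0 < e0. Proof. exact: em_e0 em. Qed.

Definition in_lines T v := forall s : R, T (ex (s *: v)).

Lemma retract_closed T r : retract_subgroup ex T r -> closed T.
Proof.
move=> rT; have -> : T = [set x | r x = x].
  by apply/seteqP; split=> x /=; [exact: rs_id rT x|move=> <-; exact: rs_in rT x].
by apply: closed_eqN; [exact: rs_cont rT|exact: contN_id].
Qed.

Lemma tends_closed (A : set V) (u : nat -> V) l : closed A -> tends u l ->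
  (exists k0, forall k, (k0 <= k)%N -> A (u k)) -> A l.
Proof.
move=> cA ul [k0 kA]; apply: cA => B /nbhs_ballP [e /= ep eB].
have [k1 kE] := ul _ (divr_gt0 ep (ltr0Sn R 1)).
exists (u (maxn k0 k1)); split; first exact: kA (leq_maxl _ _).
apply: eB; rewrite -ball_normE /= distrC; have := kE _ (leq_maxr k0 k1).
by move=> h; apply: le_lt_trans h _; lra.
Qed.

(** [u + v] is the limit of scaled logarithms of [ex (u / k) ex (v / k)]; these span lines in [T] by
    [rs_local], a closed condition. *)
Lemma in_linesD T r u v : retract_subgroup ex T r -> in_lines T u -> in_lines T v -> in_lines T (u + v).
Proof.
move=> rT Tu Tv s; have [e ep eE] := rs_local rT.
have [z [[k0 kE] zl]] := tangentM em (tangent_exp ex u) (tangent_exp ex v).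
have e2 : 0 < e / 2 by rewrite divr_gt0.
have [k1 kE1] := tangent_small e2 zl.
have cl : closed [set w : V | T (ex (s *: w))].
  have -> : [set w : V | T (ex (s *: w))] = (fun w => ex (s *: w)) @^-1` T by [].
  apply: closed_comp; last exact: retract_closed rT.
  move=> w _ A nA; have := em_cont em nA; move=> /nbhs_ballP [d /= d0 dA].
  have s1 : 0 < `|s| + 1 by rewrite ltr_wpDl.
  apply/nbhs_ballP; exists (d / (`|s| + 1)) => /=; first exact: divr_gt0.
  move=> w'; rewrite -ball_normE /= ltr_pdivlMr// mulrDr mulr1 => ww.
  apply: dA; rewrite -ball_normE /= -scalerBr normrZ mulrC.
  by apply: le_lt_trans ww; rewrite lerDl.
apply: (tends_closed cl zl); exists (maxn k0 k1) => k; rewrite geq_max => /andP [/kE h /kE1 h1].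
rewrite /= scalerA; apply: eE; first lra.
by rewrite -h; apply: (subgroupM (rs_subgroup rT)); [exact: Tu|exact: Tv].
Qed.

Lemma in_linesZ T a v : in_lines T v -> in_lines T (a *: v).
Proof. by move=> Tv s; rewrite scalerA. Qed.

Lemma in_lines0 T : is_subgroup T -> in_lines T 0.
Proof. by move=> sT s; rewrite scaler0 (ex0 em); apply: subgroup1 sT. Qed.

Definition additive_functions A : set (N -> R) := [set f | contR f /\ additive_on A f].
Definition annihilated A T := forall f, additive_functions A f -> forall x, T x -> f x = 0.
Definition conj_stable T := forall g x, T x -> T (g * x * g^-1)%g.

Lemma additive_functions_comm S f g : is_subgroup S -> conj_stable S ->
  additive_functions S f -> additive_functions S (fun x => f (g * x * g^-1)%g - f x).
Proof.
move=> sS nS [cf af]; split.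
  have c1 : contR (fun x : N => f (g * x * g^-1)%g).
    apply: contNR cf; apply: contMg; last exact: contN_cst.
    by apply: contMg; [exact: contN_cst|exact: contN_id].
  by move=> x; apply: cvgB; [exact: c1|exact: cf].
move=> x y Sx Sy.
have -> : (g * (x * y) * g^-1)%g = ((g * x * g^-1) * (g * y * g^-1))%g by rewrite !mulgA mulgVK.
by rewrite (af _ _ (nS g x Sx) (nS g y Sy)) (af _ _ Sx Sy); ring.
Qed.

Lemma additive_comm S f g x : is_subgroup S -> conj_stable S -> additive_on S f -> S x ->
  f (commutator_gx g x) = f (g * x * g^-1)%g - f x.
Proof.
move=> sS nS af Sx; rewrite /commutator_gx af ?(additive_onV sS af)//; first exact: nS.
exact: subgroupV.
Qed.

Lemma commutators_in T gs x : is_subgroup T -> conj_stable T -> T x -> T (foldr commutator_gx x gs).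
Proof.
move=> sT nT Tx; elim: gs => //= g gs IH; apply: subgroupM => //; first exact: nT.
exact: subgroupV.
Qed.

(** As long as [f] is not invariant on [T], it is replaced by [f (g x g^-1) - f x], its value at a
    commutator. Nilpotency of [N] stops the process at an invariant function that is still non-zero
    on [T]. *)
Lemma invariant_additive S T : is_subgroup S -> is_subgroup T -> conj_stable S -> conj_stable T ->
  T `<=` S -> ~ annihilated S T -> exists f, [/\ additive_functions S f,
    forall g x, T x -> f (g * x * g^-1)%g = f x & exists2 x, T x & f x != 0].
Proof.
move=> sS sT nS nT TS nK; have [c Nc] := nil.
have gen m : forall f, additive_functions S f -> (exists2 x, T x & f x != 0) ->
    (forall gs x, size gs = m -> T x -> f (foldr commutator_gx x gs) = 0) ->
    exists f', [/\ additive_functions S f',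
      forall g x, T x -> f' (g * x * g^-1)%g = f' x & exists2 x, T x & f' x != 0].
  elim: m => [|m IH] f Sf [x0 Tx0 fx0] fm.
    by move: fx0; rewrite (fm [::])// eqxx.
  have [all|nall] := pselect (forall g x, T x -> f (g * x * g^-1)%g = f x).
    by exists f; split=> //; exists x0.
  have [g [x1 [Tx1 gx1]]] : exists g x, T x /\ f (g * x * g^-1)%g <> f x.
    apply: contrapT => H; apply: nall => g x Tx; apply: contrapT => gx; apply: H; by exists g, x.
  apply: (IH _ (additive_functions_comm g sS nS Sf)).
    by exists x1 => //; rewrite subr_eq0; apply/eqP.
  move=> gs x sz Tx; have Tc := commutators_in gs sT nT Tx.
  rewrite -(additive_comm g sS nS Sf.2 (TS _ Tc)); apply: (fm (g :: gs)) => //=; by rewrite sz.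
have [f [Sf [x Tx fx]]] : exists f, additive_functions S f /\ exists2 x, T x & f x <> 0.
  apply: contrapT => H; apply: nK => f Sf x Tx; apply: contrapT => fx; apply: H; exists f.
  by split=> //; exists x.
apply: (gen c f Sf); first by exists x => //; apply/eqP.
move=> gs y sz Ty; have := @lcs_iterated N 0 gs y I; rewrite addn0 sz Nc /= => ->.
exact: additive_on1 sS Sf.2.
Qed.

(** Lines generate [T], so [f] is non-zero on one of them; being continuous and additive there, it
    is linear, and rescaling the line normalises it. *)
Lemma exists_splitting S T r : is_subgroup S -> retract_subgroup ex T r -> conj_stable S ->
  conj_stable T -> T `<=` S -> ~ annihilated S T -> exists fe : (N -> R) * V,
   [/\ additive_functions S fe.1, forall g x, T x -> fe.1 (g * x * g^-1)%g = fe.1 x,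
       in_lines T fe.2 & forall s, fe.1 (ex (s *: fe.2)) = s].
Proof.
move=> sS rT nS nT TS nK; have sT := rs_subgroup rT.
have [f [[cf af] fN [x Tx fx]]] := invariant_additive sS sT nS nT TS nK.
have afT : additive_on T f by move=> y z Ty Tz; apply: af; apply: TS.
have [v [Tv fv]] : exists v, in_lines T v /\ f (ex v) <> 0.
  apply: contrapT => H; have : T `<=` [set y | T y /\ f y = 0].
    apply: (retract_generated em cN rT).
      split; first by split; [exact: subgroup1 sT|exact: additive_on1 sT afT].
      split=> [y z [Ty fy] [Tz fz]|y [Ty fy]]; split.
      - exact: subgroupM.
      - by rewrite afT// fy fz addr0.
      - exact: subgroupV.
      - by rewrite (additive_onV sT afT)// fy oppr0.
    move=> v Tv; split; first by have := Tv 1; rewrite scale1r.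
    by apply: contrapT => fv; apply: H; exists v.
  by move=> /(_ x Tx) [_ fx0]; rewrite fx0 eqxx in fx.
pose h s := f (ex (s *: v)).
have ch : contR h by apply: (contNR _ cf); exact: ex_line_continuous em v.
have hD s t : h (s + t) = h s + h t by rewrite /h (exD em) afT//; apply: Tv.
have hl s : h s = s * h 1 by exact: continuous_additive_linear.
have h1 : h 1 != 0 by rewrite /h scale1r; apply/eqP.
exists (f, (h 1)^-1 *: v); split=> //=; first exact: in_linesZ.
by move=> s; rewrite scalerA -/(h _) hl divfK.
Qed.

(** Moving along the line [e] until [f] vanishes retracts [T] onto the kernel of [f]. *)
Lemma retract_kernel T r f e : retract_subgroup ex T r -> contR f -> additive_on T f ->
  in_lines T e -> (forall s, f (ex (s *: e)) = s) ->
  retract_subgroup ex [set x | T x /\ f x = 0] (fun x => r x * ex (- f (r x) *: e))%g.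
Proof.
move=> rT cf af Te fe; have sT := rs_subgroup rT; split.
- split; first by split; [exact: subgroup1 sT|exact: additive_on1 sT af].
  split=> [y z [Ty fy] [Tz fz]|y [Ty fy]]; split.
  + exact: subgroupM.
  + by rewrite af// fy fz addr0.
  + exact: subgroupV.
  + by rewrite (additive_onV sT af)// fy oppr0.
- apply: contMg; first exact: rs_cont rT.
  apply: (contRN (f := fun x => - f (r x)) (g := fun s => ex (s *: e))); last exact: ex_line_continuous em e.
  have c1 : contR (fun x => f (r x)) by apply: contNR cf; exact: rs_cont rT.
  by move=> x; apply: cvgN; exact: c1.
- move=> x; have Tr := rs_in rT x; split; first by apply: subgroupM => //; apply: Te.
  by rewrite af ?fe ?subrr//; apply: Te.
- by move=> x [Tx fx]; rewrite (rs_id rT)// fx oppr0 scale0r (ex0 em) mulg1.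
have [d d0 dE] := rs_local rT; exists d => // v vd [Tv fv] s; have Tl := dE v vd Tv.
split; first exact: Tl.
pose h s := f (ex (s *: v)).
have ch : contR h by apply: (contNR _ cf); exact: ex_line_continuous em v.
have hD s' t : h (s' + t) = h s' + h t by rewrite /h (exD em) af//; apply: Tl.
have := continuous_additive_linear ch hD s; rewrite /h scale1r fv mulr0; exact.
Qed.

(** The start of the block under construction, and the current term of the chain. *)
Definition block_state : Type := (set N * set N)%type.
Definition good_state (P : block_state) := exists r, [/\ retract_subgroup ex P.2 r, is_subgroup P.1,
  conj_stable P.1, conj_stable P.2 & P.2 `<=` P.1].
(** A new block starts when all continuous homomorphisms of the old start vanish on the current
    term. *)
Definition current_block (P : block_state) := if `[< annihilated P.1 P.2 >] then P.2 else P.1.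

Lemma current_block_good P : good_state P -> good_state (current_block P, P.2).
Proof.
move=> [r [rT sS nS nT TS]]; exists r; rewrite /current_block; case: ifP => _ //=; split=> //.
exact: rs_subgroup rT.
Qed.

Lemma exists_state_splitting P : exists fe : (N -> R) * V, good_state P -> (exists2 x, P.2 x & x <> 1%g) ->
   [/\ additive_functions (current_block P) fe.1, forall g x, P.2 x -> fe.1 (g * x * g^-1)%g = fe.1 x,
       in_lines P.2 fe.2 & forall s, fe.1 (ex (s *: fe.2)) = s].
Proof.
have [[gP nP]|H] := pselect (good_state P /\ exists2 x, P.2 x & x <> 1%g); last first.
  by exists (fun=> 0, 0) => gP nP; exfalso; apply: H.
have [r [/= rT sS nS nT TS]] := current_block_good gP.
have [|fe feE] := exists_splitting sS rT nS nT TS; last by exists fe.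
rewrite /current_block; case: ifP => [_|/asboolP //] H.
have [f [cf af [x Tx fx]]] := exists_additive em cN sc nil rT nP.
by move: fx; rewrite (H f)// eqxx.
Qed.

Theorem exists_malcev_chain : exists m (T : nat -> set N) tau X st en,
  @malcev_chain R N m T tau X st en.
Proof.
have /choice [fe feE] := exists_state_splitting.
pose next (P : block_state) : block_state := (current_block P, [set x | P.2 x /\ (fe P).1 x = 0]).
pose P i : block_state := iter i next (setT, setT).
pose T i := (P i).2; pose B i := current_block (P i).
pose nt i := exists2 x, T i x & x <> 1%g.
have PS i : P i.+1 = (B i, [set x | T i x /\ (fe (P i)).1 x = 0]) by [].
have good0 : good_state (P 0%N).
  exists id; split=> //=; try by split.
  by constructor=> //; [exact: contN_id|exists 1].
have goodS i : good_state (P i) -> nt i -> good_state (P i.+1).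
  move=> gi ni; have [[cf af] fN Te fs] := feE _ gi ni.
  have [r [/= rT sS nS nT TS]] := current_block_good gi.
  exists (fun x => r x * ex (- (fe (P i)).1 (r x) *: (fe (P i)).2))%g.
  split=> //=.
  - by apply: retract_kernel => // x y Tx Ty; apply: af; apply: TS.
  - by move=> g x [Tx fx]; split; [exact: nT|rewrite fN].
  - by move=> x [Tx _]; exact: TS.
have good i : (forall j, (j < i)%N -> nt j) -> good_state (P i).
  elim: i => [//|i IH] nti; apply: goodS; last exact: nti.
  by apply: IH => j ji; apply: nti; exact: ltnW.
have Tmono i j : (i <= j)%N -> T j `<=` T i.
  elim: j => [|j IH]; first by rewrite leqn0 => /eqP ->.
  rewrite leq_eqVlt => /orP [/eqP -> //|ij] x [Tx _]; exact: IH.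
have stop : exists i, `[< ~ nt i >].
  apply: contrapT => H; have nti i : nt i.
    by apply: contrapT => ni; apply: H; exists i; apply/asboolP.
  have gi i := good i (fun j _ => nti j).
  pose e i := (fe (P i)).2.
  have Te i : in_lines (T i) (e i) by have [] := feE _ (gi i) (nti i).
  have fe1 i s : (fe (P i)).1 (ex (s *: e i)) = s by have [] := feE _ (gi i) (nti i).
  have rTi i : exists r, retract_subgroup ex (T i) r by have [r []] := gi i; exists r.
  pose M := \matrix_(i < n.+1) e i.
  have ker : kermx M != 0.
    by rewrite kermx_eq0 -row_leq_rank -ltnNge ltnS rank_leq_col.
  have [v /sub_kermxP vM v0] := rowV0Pn ker.
  have [j0 vj0] : exists j, v 0 j != 0.
    apply: contrapT => Hv; move: v0; have -> : v = 0; last by rewrite eqxx.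
    by apply/rowP => j; rewrite [RHS]mxE; apply: contrapT => vj; apply: Hv; exists j; apply/eqP.
  have ex1 : exists k : nat, `[< exists j : 'I_n.+1, j = k :> nat /\ v 0 j != 0 >].
    by exists (j0 : nat); apply/asboolP; exists j0.
  case: (ex_minnP ex1) => k /asboolP [j [jk vj]] kmin.
  have [r rT] := rTi j.+1.
  have lines l : l != j -> in_lines (T j.+1) (v 0 l *: e l).
    move=> lj; have [->|vl] := eqVneq (v 0 l) 0.
      by rewrite scale0r; apply: in_lines0; exact: rs_subgroup rT.
    apply: in_linesZ => s; apply: (Tmono j.+1 l _ _ (Te l s)).
    rewrite ltn_neqAle; apply/andP; split; first by rewrite eq_sym; exact: lj.
    by rewrite jk; apply: kmin; apply/asboolP; exists l.
  have sum0 : v 0 j *: e j = - \sum_(l | l != j) v 0 l *: e l.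
    move: vM; rewrite mulmx_sum_row (bigD1 j)//= => /eqP; rewrite addr_eq0 => /eqP.
    by rewrite rowK => ->; congr (- _); apply: eq_bigr => l _; rewrite rowK.
  have big : in_lines (T j.+1) (\sum_(l | l != j) v 0 l *: e l).
    apply: (big_ind (fun w => in_lines (T j.+1) w)); last by move=> l lj; exact: lines.
      by apply: in_lines0; exact: rs_subgroup rT.
    by move=> u w; exact: in_linesD rT.
  have ej : in_lines (T j.+1) (e j).
    have -> : e j = (- (v 0 j)^-1) *: \sum_(l | l != j) v 0 l *: e l.
      by rewrite scaleNr -scalerN -sum0 scalerA mulVf// scale1r.
    exact: in_linesZ.
  by have [_ /=] := ej 1; rewrite fe1 => /eqP; rewrite oner_eq0.
case: (ex_minnP stop) => m /asboolP Tm mmin.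
have nti j : (j < m)%N -> nt j.
  by move=> jm; apply: contrapT => nj; have := mmin j; rewrite leqNgt jm => H; move: (H (asboolT nj)).
have gm i : (i <= m)%N -> good_state (P i).
  by move=> im; apply: good => j ji; apply: nti; exact: leq_trans im.
have sub i : (i <= m)%N -> is_subgroup (T i).
  by move=> /gm [r [rT _ _ _ _]]; exact: rs_subgroup rT.
have Tm1 : T m = [set 1%g].
  apply/seteqP; split=> x /=; first by move=> Tx; apply: contrapT => x1; apply: Tm; exists x.
  by move=> ->; apply: subgroup1 (sub m (leqnn m)).
(* The indices at which a block begins; [st i] and [en i] are the nearest such indices at or before
   [i] and after [i]. *)
pose nb i := (i == 0%N) || `[< annihilated (P i).1 (T i) >].
have nbm : nb m.
  apply/orP; right; apply/asboolP => f [_ af] x; rewrite Tm1 /= => ->.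
  by have [r [_ sS _ _ _]] := gm m (leqnn m); exact: additive_on1 sS af.
have BE i : B i = if nb i then T i else (P i).1.
  by rewrite /B /current_block /nb; case: i => [|i] //=; rewrite if_same.
have /choice [st stE] := fun i => last_flag i (nb := nb) isT.
have /choice [en enE] : forall i, exists s, (i < m)%N ->
    [/\ (i < s <= m)%N, nb s & forall l, (i < l < s)%N -> ~~ nb l].
  move=> i; have [im|_] := ltnP i m; last by exists 0%N.
  by have [s sE] := next_flag im nbm; exists s.
have block i l : (st i <= l <= i)%N -> B l = T (st i).
  have [si ns nl] := stE i; elim: l => [|l IH] /andP [h1 h2].
    by move: h1; rewrite leqn0 => /eqP h1; rewrite BE h1.
  move: h1; rewrite leq_eqVlt => /orP [/eqP <-|h1]; first by rewrite BE ns.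
  by rewrite BE (negbTE (nl l.+1 _)) ?h1// PS /= IH// -ltnS h1 ltnW.
have Bst i : B i = T (st i) by have [si _ _] := stE i; apply: block; rewrite si leqnn.
have same i j : (i < m)%N -> (st i <= j < en i)%N -> st j = st i /\ en j = en i.
  move=> im /andP [ij ji]; have [si ns nl] := stE i; have [ei ne nel] := enE i im.
  have jm : (j < m)%N by move: ei => /andP [_ ei]; exact: leq_trans ji ei.
  have [sj nsj nlj] := stE j; have [ej nej nelj] := enE j jm.
  have mid l : (st i < l < en i)%N -> ~~ nb l.
    move=> /andP [h1 h2]; have [li|il] := leqP l i; first by apply: nl; rewrite h1.
    by apply: nel; rewrite il.
  split.
    have [h|h|//] := ltngtP (st j) (st i).
      by have := nlj (st i); rewrite h ij ns => /(_ isT).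
    by have := mid (st j); rewrite h nsj (leq_ltn_trans sj ji) => /(_ isT).
  move: ei ej => /andP [ei1 ei2] /andP [ej1 ej2]; have [h|h|//] := ltngtP (en j) (en i).
    by have := mid (en j); rewrite h nej (leq_ltn_trans ij ej1) => /(_ isT).
  by have := nelj (en i); rewrite h ne ji => /(_ isT).
pose tau i := (fe (P i)).1; pose X i s := ex (s *: (fe (P i)).2).
have step i : (i < m)%N -> [/\ additive_functions (B i) (tau i),
    forall g x, T i x -> tau i (g * x * g^-1)%g = tau i x,
    in_lines (T i) (fe (P i)).2 & forall s, tau i (X i s) = s].
  by move=> im; apply: feE; [exact: gm (ltnW im)|exact: nti].
have TB i : (i <= m)%N -> T i `<=` B i.
  by move=> /gm /current_block_good [r []].
exists m, T, tau, X, st, en; split=> //.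
- by move=> i im; exact: ex_one_parameter em _.
- by move=> i s /step [_ _ Te _]; exact: Te.
- by move=> i s /step [_ _ _].
- by move=> i im x y Tx Ty; have [[_ af] _ _ _] := step i im; apply: af; apply: (TB i (ltnW im)).
- by move=> i /step [[]].
- by move=> i g x /step [_ H _ _]; exact: H.
- by move=> i g x /gm [r [_ _ _ nT _]]; exact: nT.
- by move=> i im; have [-> _ _] := stE i; have [/andP [-> ->] _ _] := enE i im.
- by move=> i /step [[]]; rewrite Bst.
move=> i im; have [si _ _] := stE i; have [/andP [ei1 ei2] ne nel] := enE i im.
have se : (st i <= en i)%N by exact: leq_trans si (ltnW ei1).
(* For [mc_char]: at the index [en i] annihilation holds because a new block begins there.
   Conversely, an element killed by all homomorphisms is killed by every [tau l] of the block and
   descends to [T (en i)]. *)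
apply/seteqP; split=> x.
  move=> Tx; split; first exact: Tmono se _ Tx.
  move=> f cf af; move: ne ei1 Tx; rewrite /nb; case: (en i) (same i^~ im) => // k sameik /= /asboolP an ik Tx.
  apply: (an f) => //; split=> //; have [] := sameik k; first by rewrite ltnSn andbT; exact: leq_trans si ik.
  by move=> stk _; rewrite -/(B k) Bst stk.
move=> [Tx fx]; have : forall l, (st i <= l <= en i)%N -> T l x.
  elim=> [|l IH] /andP [h1 h2]; first by move: h1 Tx; rewrite leqn0 => /eqP ->.
  move: h1; rewrite leq_eqVlt => /orP [/eqP <- //|h1].
  have lm : (l < m)%N by exact: leq_trans h2 ei2.
  split; first by apply: IH; rewrite -ltnS h1 ltnW.
  have [[cf af] _ _ _] := step l lm; apply: fx => //.
  have [|<- _] := same i l im; first by rewrite -ltnS h1.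
  by rewrite -Bst.
by apply; rewrite se leqnn.
Qed.

End MalcevChainExistence.

(** * Affine actions in coordinates *)

Lemma lie_malcev_chain {R : realType} (N : lieGroupType R) : connected [set: N] ->
  simply_connected R N -> nilpotent_group N ->
  exists n (T : nat -> set N) tau X st en, @malcev_chain R N n T tau X st en.
Proof.
move=> cN sc nil; have [phi [m [r [C lc]]]] := @exists_local_chart R N.
have [ex [e0 [K em]]] := exists_exponential lc.
exact: exists_malcev_chain em cN sc nil.
Qed.

Module PolynomialEvaluation.
Import -(notations) mpoly.

Lemma polyfun_mpoly {R : realType} n (f : (nat -> R) -> R) : polyfun (fun l => (l < n)%N) f ->
  exists p : mpoly n R, forall x, f x = meval (fun i => x i) p.
Proof.
elim=> [c|i ni|g h _ [p pE] _ [q qE]|g h _ [p pE] _ [q qE]].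
- by exists (mpolyC n c) => x; rewrite mevalC.
- by exists (mpolyX R (mnm1 (Ordinal ni))) => x; rewrite mevalXU.
- by exists (p + q) => x; rewrite mevalD pE qE.
- by exists (p * q) => x; rewrite mevalM pE qE.
Qed.

End PolynomialEvaluation.

Section MalcevCoordinates.
Context {R : realType} {N : lieGroupType R}.
Local Notation S := (nat -> R).
Variables (n : nat) (T : nat -> set N) (tau : nat -> N -> R) (X : nat -> R -> N)
  (st en : nat -> nat).
Hypothesis mc : malcev_chain n T tau X st en.
Local Notation co := (co tau X).
Local Notation cv := (cv n tau X).
Local Notation pt := (pt X).

Definition row_seq (t : 'rV[R]_n) : S := fun l => if insub l is Some i then t 0 i else 0.

Lemma row_seqE t (i : 'I_n) : row_seq t i = t 0 i.
Proof. by rewrite /row_seq valK. Qed.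

Lemma malcev_coord_pt t : malcev_coord (fun i : 'I_n => X i) t = pt 0 n (row_seq t).
Proof. by rewrite /malcev_coord /pt big_mkord; apply: eq_bigr => i _; rewrite row_seqE. Qed.

Lemma pt_row x : pt 0 n x = malcev_coord (fun i : 'I_n => X i) (\row_i x i).
Proof.
rewrite malcev_coord_pt; apply: pt_dep => l /= ln.
by rewrite -[l]/(val (Ordinal ln)) row_seqE mxE.
Qed.

Lemma pt_tail k x : (k <= n)%N -> (forall l, (l < k)%N -> x l = 0) -> pt 0 n x = pt k n x.
Proof.
move=> kn x0; rewrite /pt (big_cat_nat _ (n := k))//= [X in (X * _)%g]big1_seq ?mul1g// => l.
rewrite mem_index_iota => /andP [_ lk]; rewrite x0// (X0 mc)//; exact: leq_trans lk kn.
Qed.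

Lemma malcev_chain_basis : malcev_basis (fun i : 'I_n => X i).
Proof.
split=> [i|g|k]; first exact: mc_one mc i (ltn_ord i).
  exists (\row_i cv g i); split; first by rewrite -pt_row (pt_cv mc).
  move=> t tE; apply/rowP => i; rewrite mxE -(row_seqE t i) -tE malcev_coord_pt.
  by rewrite (cv_pt mc).
pose k' := minn k n; have kn : (k' <= n)%N by exact: geq_minr.
have -> : [set malcev_coord (fun i : 'I_n => X i) t | t in
    [set t : 'rV[R]_n | forall i : 'I_n, (i < k)%N -> t 0 i = 0]] = T k'.
  apply/seteqP; split=> [_ [t t0 <-]|y Ty].
    rewrite malcev_coord_pt (pt_tail kn); first exact: (pt_in mc).
    move=> l; rewrite /k' leq_min => /andP [lk ln].
    by rewrite -[l]/(val (Ordinal ln)) row_seqE t0.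
  exists (\row_i cv y i); last by rewrite -pt_row (pt_cv mc).
  move=> i ik; rewrite mxE; apply: (cv_in_T mc kn Ty); rewrite /k' leq_min ik.
  exact: ltn_ord.
split=> //; first exact: mc_subgroup mc k' kn.
move=> x y Tx _; have := mc_norm mc (y^-1)%g kn Tx.
by rewrite invgK conjgE mulgA.
Qed.

Lemma pt_continuous : contN (fun t : 'rV[R]_n => pt 0 n (row_seq t)).
Proof.
have gen k : (k <= n)%N -> contN (fun t : 'rV[R]_n => pt 0 k (row_seq t)); last exact: gen.
elim: k => [|k IH] kn.
  have -> : (fun t : 'rV[R]_n => pt 0 0 (row_seq t)) = fun=> 1%g.
    by apply/funext => t; rewrite /pt big_geq.
  exact: contN_cst.
have -> : (fun t : 'rV[R]_n => pt 0 k.+1 (row_seq t)) =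
    fun t => (pt 0 k (row_seq t) * X k (t 0 (Ordinal kn)))%g.
  apply/funext => t; rewrite /pt big_nat_recr//=; congr (_ * X k _)%g.
  by rewrite -(row_seqE t (Ordinal kn)).
apply: contMg; first exact: IH (ltnW kn).
apply: (contRN (f := fun t : 'rV[R]_n => t 0 (Ordinal kn)) _ (X_continuous mc kn)).
exact: coord_continuous.
Qed.

Definition coordinate_map (f : N -> N) (s : S) : S :=
  fun i => if (i < n)%N then co i (f (pt 0 n s)) else s i.

Lemma pt_coordinate_map f s : pt 0 n (coordinate_map f s) = f (pt 0 n s).
Proof.
rewrite -[RHS](pt_cv mc); apply: pt_dep => l /= ln.
by rewrite /coordinate_map /cv ln.
Qed.

Section CoordinateActions.
Context {G : groupType}.
Variable rho : G -> N * (N -> N).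
Hypothesis aff : nil_affine_action rho.

Let automorphism g : {morph (rho g).2 : x y / (x * y)%g}.
Proof. by have [/(_ g) []] := aff. Qed.

Lemma automorphism_continuous g : contN (rho g).2.
Proof. by have [/(_ g) [_ [d' [_ _ [] ]]]] := aff. Qed.

Lemma aff_continuous g : contN (aff_act (rho g)).
Proof. by apply: contMg; [exact: contN_cst|exact: automorphism_continuous]. Qed.

Lemma aff_actM g h y : aff_act (rho (g * h)%g) y = aff_act (rho g) (aff_act (rho h) y).
Proof. by have [_ ->] := aff; rewrite /aff_act /aff_mul /= automorphism mulgA. Qed.

Lemma aff_act1 y : aff_act (rho 1%g) y = y.
Proof.
have [/(_ 1%g) [_ [d' [dK _ _ _]]] _] := aff.
have inj : injective (aff_act (rho 1%g)) by move=> u v /mulgI /(can_inj dK).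
by apply: inj; rewrite -aff_actM mulg1.
Qed.

Lemma coordinate_acts : acts [set: G] (fun g => coordinate_map (aff_act (rho g))).
Proof.
split=> [z|g h _ _ z]; apply/funext => i; rewrite /coordinate_map; case: ifP => // ni.
  by rewrite aff_act1 (co_pt mc).
by rewrite -/(coordinate_map (aff_act (rho h)) z) pt_coordinate_map aff_actM.
Qed.

Lemma coordinate_triangular : triangular [set: G] n st (fun g => coordinate_map (aff_act (rho g))).
Proof.
move=> g _; split=> [x i ni|i ni]; first by rewrite /coordinate_map ltnNge ni.
have [m [c [pc cE]]] := affine_coordinates mc (rho g).1 (automorphism g) (automorphism_continuous (g := g)) ni.
by exists m, c; split=> // x; rewrite /coordinate_map ni; exact: cE.
Qed.

Lemma coordinate_proper : properly_discontinuous (fun g => aff_act (rho g)) ->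
  proper_action [set: G] n (fun g => coordinate_map (aff_act (rho g))).
Proof.
move=> pd r; pose Kr := [set t : 'rV[R]_n | forall i, `[- r, r]%classic (t ord0 i)].
have cK : compact Kr := @rV_compact R n (fun=> `[- r, r]%classic) (fun i => @segment_compact R (- r) r).
have cI : compact ((fun t : 'rV[R]_n => pt 0 n (row_seq t)) @` Kr).
  by apply: continuous_compact cK; apply: continuous_subspaceT; exact: pt_continuous.
have inK x : box n r x -> ((fun t : 'rV[R]_n => pt 0 n (row_seq t)) @` Kr) (pt 0 n x).
  move=> bx; exists (\row_i x i); last by rewrite -malcev_coord_pt -pt_row.
  by move=> i; rewrite mxE /= in_itv /= -ler_norml; apply: bx.
apply: sub_finite_set (pd _ cI) => g /= [_ [x bx bgx]].
exists (aff_act (rho g) (pt 0 n x)); split; first by exists (pt 0 n x) => //; exact: inK.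
by rewrite -pt_coordinate_map; exact: inK.
Qed.

(** The images [U k] of the open coordinate boxes increase and cover the orbit space; they are open
    as their preimages are unions of translates. By compactness one of them is everything. *)
Lemma coordinate_cocompact : cocompact (fun g => aff_act (rho g)) ->
  cocompact_action [set: G] n (fun g => coordinate_map (aff_act (rho g))).
Proof.
pose act g := aff_act (rho g).
have orbit1 y : act_orbit act y y by exists 1%g => //; exact: aff_act1.
pose V k : set N := [set y | forall i : 'I_n, `|co i y| < k%:R].
have oV k : open (V k).
  rewrite openE => y Vy.
  have H : \forall z \near y, forall i : 'I_n, `|co i z| < k%:R; last exact: H.
  apply: (@filter_forall _ _ (fun (i : 'I_n) z => `|co i z| < k%:R) (nbhs y) _) => i.
  have nb : nbhs (co i y) [set s : R | `|s| < k%:R].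
    apply: open_nbhs_nbhs; split; last exact: Vy.
    have -> : [set s : R | `|s| < k%:R] = ball 0 k%:R.
      by apply/seteqP; split=> s; rewrite /ball /= sub0r normrN.
    exact: ball_open.
  have cc := co_continuous mc (ltn_ord i); exact: (cc y _ nb).
move=> cQ; pose pi : N -> orbit_space act := \pi_(orbit_space act)%qT.
pose U k : set (orbit_space act) := [set q | exists2 y, V k y & q = pi y].
have piE y z : pi y = pi z <-> act_orbit act y = act_orbit act z.
  split=> [/eqmodP /asboolP //|h]; apply/eqmodP; exact/asboolP.
have orbE y g : act_orbit act (act g y) = act_orbit act y.
  apply/seteqP; split=> _ [h _ <-].
    by exists (h * g)%g => //; rewrite /act aff_actM.
  by exists (h * g^-1)%g => //; rewrite /act -aff_actM mulgVK.
have oU k : open (U k).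
  have -> : open (U k) = open (pi @^-1` (U k)) by [].
  have -> : pi @^-1` (U k) = \bigcup_(g in [set: G]) (act g @^-1` (V k)).
    apply/seteqP; split=> y /=.
      move=> [z Vz /piE yz]; have : act_orbit act y z by rewrite yz.
      by move=> [g _ gy]; exists g => //=; rewrite gy.
    move=> [g _ Vg]; exists (act g y) => //; apply/piE; by rewrite orbE.
  apply: bigcup_open => g _; apply: open_comp => // y _; exact: aff_continuous.
have NC := (compact_near_coveringP [set: orbit_space act]).1 cQ.
have Um j k : (j <= k)%N -> U j `<=` U k.
  move=> jk q [y Vy ->]; exists y => // i; apply: lt_le_trans (Vy i) _; by rewrite ler_nat.
have nearU : forall q, [set: orbit_space act] q -> \forall q' \near q & k \near \oo, U k q'.
  move=> q _; have [y yE] : exists y, q = pi y.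
    by exists (repr q); rewrite /pi reprK.
  have [j jE] : exists j : nat, V j y.
    pose M := \sum_(i < n) `|co i y|; exists (Num.truncn M).+1 => i.
    by apply: le_lt_trans (truncnS_gt M); rewrite /M (bigD1 i)//= lerDl sumr_ge0.
  exists (U j, [set k | (j <= k)%N]); last by move=> [q' k] /= [Uq jk]; exact: Um jk _ Uq.
  split=> /=; last by exists j.
  by apply: (@open_nbhs_nbhs (orbit_space act) q (U j)); split; [exact: oU|exists y].
have := NC nat \oo (fun k q => U k q) _ nearU.
move=> [k _ kU]; exists k%:R => x.
have [y Vy /piE xy] := kU k (leqnn k) (pi (pt 0 n x)) I.
have : act_orbit act (pt 0 n x) y by rewrite xy.
move=> [g _ gx]; exists g => // i ni; rewrite /coordinate_map ni -/(act g) gx.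
by have := Vy (Ordinal ni); exact: ltW.
Qed.

End CoordinateActions.
End MalcevCoordinates.

Theorem corollary1p3 (R : realType) (G1 G2 : groupType)
    (phi : {multiplicative G1 -> G2})
    (vp1 : virtually_polycyclic G1) (vp2 : virtually_polycyclic G2)
    (N1 N2 : lieGroupType R)
    (conn1 : connected [set: N1]%classic) (conn2 : connected [set: N2]%classic)
    (sc1 : simply_connected R N1) (sc2 : simply_connected R N2)
    (nil1 : nilpotent_group N1) (nil2 : nilpotent_group N2)
    (rho1 : G1 -> N1 * (N1 -> N1)) (rho2 : G2 -> N2 * (N2 -> N2))
    (aff1 : nil_affine_action rho1) (aff2 : nil_affine_action rho2)
    (cryst1 : crystallographic (fun g => aff_act (rho1 g)))
    (cryst2 : crystallographic (fun g => aff_act (rho2 g))) :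
  exists p : N1 -> N2,
    polynomial_map p /\
    forall (g : G1) (x : N1),
      aff_act (rho2 (phi g)) (p x) = p (aff_act (rho1 g) x).
Proof.
have [n1 [T1 [tau1 [X1 [st1 [en1 mc1]]]]]] := lie_malcev_chain conn1 sc1 nil1.
have [n2 [T2 [tau2 [X2 [st2 [en2 mc2]]]]]] := lie_malcev_chain conn2 sc2 nil2.
have [H [h [Gam [t [st [en [gc fi]]]]]]] := virtually_polycyclic_chain vp1.
have phi1 : phi 1%g = 1%g by apply: (mulgI (phi 1%g)); rewrite -gmulfM !mulg1.
pose a1 g := coordinate_map n1 tau1 X1 (aff_act (rho1 g)).
pose a2 g := coordinate_map n2 tau2 X2 (aff_act (rho2 (phi g))).
(* Through [phi] the group [G1] acts triangularly on the coordinates of [N2], and equivariance for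
   this action is the required identity. *)
have acts2 : acts [set: G1] a2.
  have [c1 cM] := coordinate_acts mc2 aff2; split=> [z|g g' _ _ z].
    by rewrite /a2 phi1 c1.
  by rewrite /a2 gmulfM cM.
have tri2 : triangular [set: G1] n2 st2 a2.
  have tri := coordinate_triangular mc2 aff2; move=> g _; exact: (tri (phi g) I).
have [F [Fpoly F0 Feq]] := polynomial_equivariant_map gc fi (coordinate_acts mc1 aff1)
  (coordinate_triangular mc1 aff1) (coordinate_proper mc1 cryst1.1)
  (coordinate_cocompact mc1 aff1 cryst1.2) acts2 tri2.
pose cv1 := cv n1 tau1 X1.
exists (fun y => pt X2 0 n2 (F (cv1 y))); split; last first.
  move=> g y; rewrite -(pt_coordinate_map mc2) -/(a2 g) -Feq; congr (pt X2 0 n2 (F _)).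
  apply/funext => i; rewrite /coordinate_map /cv1 /cv; case: ifP => ni; last by rewrite ni.
  by rewrite (pt_cv mc1).
have /choice [P PE] : forall j : 'I_n2, exists p : mpoly.mpoly n1 R,
    forall x, F x j = mpoly.meval (fun i => x i) p.
  by move=> j; apply: PolynomialEvaluation.polyfun_mpoly; exact: Fpoly.
exists n1, n2, (fun i => X1 i), (fun i => X2 i), P; split.
- exact: malcev_chain_basis mc1.
- exact: malcev_chain_basis mc2.
move=> s; rewrite pt_row; congr malcev_coord; apply/rowP => j; rewrite !mxE PE.
congr (mpoly.meval _ _); apply/funext => i; rewrite /cv1 (malcev_coord_pt X1).
by rewrite (cv_pt mc1)// row_seqE.
Qed.
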